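(* Let $\{Q_n\}_{n\ge1}$ be a sequence of coupling matrices satisfying assumptions (A1)–(A4) of the context for some $C_w,\gamma\in(0,\infty)$ and some graphon $f$. Fix $\theta_0>1$ and set $R(\theta_0):=m^2(\theta_0)\sigma^2(\theta_0)$. Then: (a) The experiments $\{\mathbb{P}_{\theta_0+hn^{-1/2},Q_n}\}_{h\in\mathbb{R}}$ converge, in the sense of limits of experiments, to $\{N(h,R(\theta_0)^{-1})\}_{h\in\mathbb{R}}$ as $n\to\infty$. (b) If $\mathbf{X}\sim\mathbb{P}_{\theta_0,Q_n}$, then the maximum likelihood estimator $\hat\theta_n^{MLE}$ and the maximum pseudo-likelihood estimator $\hat\theta_n^{MPLE}$ exist with probability tending to $1$, and $$\sqrt n(\hat\theta_n^{MLE}-\theta_0)\stackrel{d}{\to}N(0,R(\theta_0)^{-1}),\qquad \sqrt n(\hat\theta_n^{MPLE}-\theta_0)\stackrel{d}{\to}N(0,R(\theta_0)^{-1}).$$ (c) Let $h>0$, $\theta_n=\theta_0+h/\sqrt n$ and $\alpha\in(0,1)$. Then the limiting powers $\beta_{NP},\beta_{PL},\beta_{MS}$ of the level-$\alpha$ NP-, PL- and MS-tests of $\theta=\theta_0$, against $\theta_n$, exist and satisfy $$\beta_{NP}=\beta_{PL}=\beta_{MS}=\mathbb{P}\big(N(0,1)>z_\alpha-h\sqrt{R(\theta_0)}\big),$$ where $z_\alpha$ is the $(1-\alpha)$-th quantile of $N(0,1)$.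
   Context: Ising model. For each $n$, $Q_n$ is a symmetric $n\times n$ matrix with non-negative entries and zero diagonal. For $\theta\in\mathbb{R}$, $\mathbb{P}_{\theta,Q_n}$ is the probability measure on $\{-1,1\}^n$ with $\mathbb{P}_{\theta,Q_n}(\mathbf{X}=\mathbf{x})=\exp\big(\frac{\theta}{2}\mathbf{x}^TQ_n\mathbf{x}-Z_n(\theta,Q_n)\big)$, where $Z_n(\theta,Q_n)$ is the log normalizing constant. Assumptions. (A1) $\sum_{j=1}^nQ_n(i,j)=1$ for all $i\in[n]$. (A2) $\max_{i,j}Q_n(i,j)<C_w/n$ with $C_w$ free of $n$. (A3) $\|Q_n\|_F=\sqrt{\sum_{i,j}Q_n^2(i,j)}\to\gamma$. (A4) $\delta_\square(f^{nQ_n},f)\to0$ for a graphon $f$ (a symmetric measurable function $[0,1]^2\to[0,C_w]$), and $\sup_{i\ge2}\lambda_i<\lambda_1$. Here $f^{A_n}(x,y):=A_n(\lceil nx\rceil,\lceil ny\rceil)$ for an $n\times n$ matrix $A_n$; $d_\square(f,g)=\sup_{S,T\subset[0,1]}|\int_{S\times T}(f-g)\,dx\,dy|$ (over measurable $S,T$); $\delta_\square(f,g)=\inf_{\iota_1,\iota_2}d_\square(f_{\iota_1},g_{\iota_2})$ over measure preserving maps $\iota_1,\iota_2$ of $[0,1]$, with $g_\iota(x,y)=g(\iota(x),\iota(y))$; and $\lambda_1,\lambda_2,\ldots$ are the eigenvalues (with multiplicity, padded with zeros if there are finitely many) of the Hilbert–Schmidt operator $T_fg(x)=\int_0^1f(x,y)g(y)\,dy$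 on $L_2[0,1]$, in decreasing order of absolute value. Under (A1) and (A4) the eigenvalue $1$ is the largest in absolute value and $\lambda_1=1$ (if $-1$ is also an eigenvalue, $1$ is listed first). For $\theta>1$, $m(\theta)$ is the unique positive root of $x=\tanh(\theta x)$, and $\sigma^2(\theta):=\frac{1-m^2(\theta)}{1-\theta(1-m^2(\theta))}$, which is well defined and positive. Limits of experiments. $\{\mathbb{P}_{h,n}\}_{h\in H}$ converges to $\{\mathbb{P}_{h,\infty}\}_{h\in H}$ if for every finite $I\subset H$ and every $h_0\in H$, the random vector $\big(\frac{d\mathbb{P}_{h,n}}{d\mathbb{P}_{h_0,n}}(\mathbf{X})\big)_{h\in I}$ with $\mathbf{X}\sim\mathbb{P}_{h_0,n}$ converges in distribution to $\big(\frac{d\mathbb{P}_{h,\infty}}{d\mathbb{P}_{h_0,\infty}}(Y)\big)_{h\in I}$ with $Y\sim\mathbb{P}_{h_0,\infty}$. Estimators. $\hat\theta_n^{MLE}$ is the maximizer over $\theta\in\mathbb{R}$ of $\frac\theta2\mathbf{X}^TQ_n\mathbf{X}-Z_n(\theta,Q_n)$; it exists if the supremum is attained uniquely. With $t_i=\sum_jQ_n(i,j)X_j$, $\hat\theta_n^{MPLE}$ is the maximizer over $\theta\in\mathbb{R}$ of $\theta\sum_iX_it_i-\sum_i\log\cosh(\theta t_i)$; it exists if the supremum is attained uniquely. On the event of non-existence an estimator is assigned an arbitrary value. Tests. Each test rejects when its statistic exceeds $K_n(\alpha)$: the MS-test uses $n\bar{\mathbf{X}}^2$ with $\bar{\mathbf{X}}=\frac1n\sum_iX_i$,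 the NP-test uses $\mathbf{X}^TQ_n\mathbf{X}$, the PL-test uses $\hat\theta_n^{MPLE}$. For each test, $K_n(\alpha)$ is chosen so that it has level $\alpha$: it is the smallest real $K$ such that the statistic exceeds $K$ with probability at most $\alpha$ under $\mathbb{P}_{\theta_0,Q_n}$. The limiting power is the limit as $n\to\infty$ of the rejection probability under $\mathbb{P}_{\theta_n,Q_n}$. *)

(* Defs.v *)
From HB Require Import structures.
From mathcomp Require Import all_boot all_order all_algebra.
From mathcomp Require Import all_classical all_reals all_analysis.

Set Implicit Arguments.
Unset Strict Implicit.
Unset Printing Implicit Defensive.

Import Order.TTheory GRing.Theory Num.Theory.
Import numFieldNormedType.Exports.

Local Open Scope classical_set_scope.
Local Open Scope ring_scope.

(* {-1,1}^n, with [true] encoding the spin 1 and [false] the spin -1 *)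
Definition config (n : nat) := {ffun 'I_n -> bool}.

HB.instance Definition _ n := Finite.on (config n).
HB.instance Definition _ n := isPointed.Build (config n) [ffun=> true].
HB.instance Definition _ n := @isMeasurable.Build default_measure_display
  (config n) discrete_measurable discrete_measurable0
  discrete_measurableC discrete_measurableU.

Section ising.
Context {R : realType} (n : nat).
Implicit Types (theta : R) (Q : 'M[R]_n) (x : config n).

Definition spins x : 'cV[R]_n := \col_i (if x i then 1 else -1).

Definition quad Q x : R := ((spins x)^T *m Q *m spins x) 0 0.

Definition log_partition theta Q : R :=
  ln (\sum_(x : config n) expR (theta / 2 * quad Q x)).

Definition ising_pmf theta Q x : R :=
  expR (theta / 2 * quad Q x - log_partition theta Q).

Definition ising theta Q (A : set (config n)) : \bar R :=
  (\esum_(x in A) (ising_pmf theta Q x)%:E)%E.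

End ising.

Section ising_probability.
Context {R : realType} (n : nat) (theta : R) (Q : 'M[R]_n).
Local Open Scope ereal_scope.

Let pmf_ge0 x : 0 <= (ising_pmf theta Q x)%:E.
Proof. by rewrite lee_fin expR_ge0. Qed.

Let ising0 : ising theta Q set0 = 0.
Proof. by rewrite /ising esum_set0. Qed.

Let ising_ge0 A : 0 <= ising theta Q A.
Proof. exact: esum_ge0. Qed.

Let ising_sigma_additive : semi_sigma_additive (ising theta Q).
Proof.
move=> F mF tF mUF; rewrite /ising.
apply: cvg_toP.
  apply: ereal_nondecreasing_is_cvgn => a b ab.
  by apply: lee_sum_nneg_natr => // k _ _; exact: esum_ge0.
by rewrite nneseries_sum_bigcup.
Qed.

HB.instance Definition _ := isMeasure.Build _ _ _ (ising theta Q)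
  ising0 ising_ge0 ising_sigma_additive.

Let ising_setT : ising theta Q [set: _] = 1.
Proof.
rewrite /ising esum_fset//; last exact: (@finite_finset (config n)).
rewrite (_ : [set: config n] = [set` index_enum (config n)]); last first.
  by apply/seteqP; split => x //= _; rewrite mem_index_enum.
rewrite -fsbig_seq ?index_enum_uniq//= sumEFin; congr EFin.
set S := (\sum_(x : config n) expR (theta / 2 * quad Q x))%R.
have S0 : (0 < S)%R.
  rewrite /S (bigD1 [ffun=> true])//= ltr_pwDl ?expR_gt0//.
  by apply: sumr_ge0 => x _; exact: expR_ge0.
have pmfE x : ising_pmf theta Q x = (expR (theta / 2 * quad Q x) / S)%R.
  by rewrite /ising_pmf /log_partition -/S expRD expRN lnK ?posrE.
under eq_bigr do rewrite pmfE.
by rewrite -mulr_suml divff// gt_eqF.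
Qed.

HB.instance Definition _ :=
  @Measure_isProbability.Build _ _ R (ising theta Q) ising_setT.

End ising_probability.

Section graphon.
Context {R : realType}.
Notation mu := (@lebesgue_measure R).
Notation I01 := (`[0%R, 1%R]%classic : set R).

Definition is_graphon (C : R) (f : R * R -> R) : Prop :=
  [/\ measurable_fun (I01 `*` I01) f,
      forall x y, I01 x -> I01 y -> f (x, y) = f (y, x) &
      forall x y, I01 x -> I01 y -> 0 <= f (x, y) <= C].

(* 0-based index of the cell ](i-1)/n, i/n] containing x, i = ceil(n x); the
   point x = 0 is sent to the first cell *)
Definition cell (n : nat) (x : R) : option 'I_n :=
  insub (absz (Num.ceil (n%:R * x))).-1.

Definition step_graphon (n : nat) (A : 'M[R]_n) (z : R * R) : R :=
  if (cell n z.1, cell n z.2) is (Some i, Some j) then A i j else 0.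

Definition cut_dist (f g : R * R -> R) : \bar R :=
  ereal_sup [set r | exists S T : set R,
    [/\ measurable S, measurable T, S `<=` I01, T `<=` I01 &
        r = `| \int[(mu \x mu)%E]_(z in S `*` T) (f z - g z) |%:E]].

Definition measure_preserving01 (iota : R -> R) : Prop :=
  [/\ measurable_fun I01 iota,
      forall x, I01 x -> I01 (iota x) &
      forall A : set R, measurable A -> A `<=` I01 ->
        mu (I01 `&` iota @^-1` A) = mu A].

Definition relabel (f : R * R -> R) (iota : R -> R) (z : R * R) : R :=
  f (iota z.1, iota z.2).

Definition delta_cut (f g : R * R -> R) : \bar R :=
  ereal_inf [set r | exists iota1 iota2 : R -> R,
    [/\ measure_preserving01 iota1, measure_preserving01 iota2 &
        r = cut_dist (relabel f iota1) (relabel g iota2)]].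

Definition L2_01 (g : R -> R) : Prop :=
  measurable_fun I01 g /\ mu.-integrable I01 (fun x => (g x ^+ 2)%:E).

Definition graphon_op (f : R * R -> R) (g : R -> R) (x : R) : R :=
  \int[mu]_(y in I01) (f (x, y) * g y).

Definition eigenspace01 (f : R * R -> R) (l : R) (g : R -> R) : Prop :=
  L2_01 g /\ ae_eq mu I01 (graphon_op f g) (fun x => l * g x).

(* dim Ker (T_f - l) = k, functions being identified when equal a.e. *)
Definition eigendim (f : R * R -> R) (l : R) (k : nat) : Prop :=
  exists phi : 'I_k -> R -> R,
    [/\ forall i, eigenspace01 f l (phi i),
        forall c : 'I_k -> R,
          ae_eq mu I01 (fun x => \sum_i c i * phi i x) (cst 0) ->
          forall i, c i = 0 &
        forall g, eigenspace01 f l g ->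
          exists c : 'I_k -> R,
            ae_eq mu I01 g (fun x => \sum_i c i * phi i x)].

(* [lam] lists the eigenvalues of T_f in decreasing order of absolute value
   ([lam 0] is lambda_1): each nonzero real occurs as many times as its
   multiplicity. Hence the other entries are 0, and by monotonicity they can
   only pad a finite list. If l and -l both have the largest absolute value,
   the positive one is listed first. *)
Definition eigenvalue_list (f : R * R -> R) (lam : nat -> R) : Prop :=
  [/\ forall i j, (i <= j)%N -> `|lam j| <= `|lam i|,
      forall i, `|lam i| = `|lam 0%N| -> lam i <= lam 0%N &
      forall l, l != 0 -> exists s : seq nat,
        [/\ uniq s, forall i, i \in s <-> lam i = l & eigendim f l (size s)]].

End graphon.

Section convergence.
Context {R : realType}.

Definition cvg_in_dist (V : topologicalType)
    (d : nat -> measure_display) (T : forall n, measurableType (d n))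
    (P : forall n, probability (T n) R) (X : forall n, T n -> V)
    (d' : measure_display) (T' : measurableType d')
    (P' : probability T' R) (Y : T' -> V) : Prop :=
  forall phi : V -> R, continuous phi ->
    (exists M : R, forall v, `|phi v| <= M) ->
    \int[P n]_x phi (X n x) @[n --> \oo] --> \int[P']_y phi (Y y).

Definition likelihood_ratio d (T : measurableType d) (P P0 : probability T R)
    (x : T) : R :=
  fine (Radon_Nikodym (charge_of_finite_measure P) P0 x).

(* A finite subset of H is given by an injective enumeration [t : 'I_k -> H]. *)
Definition experiments_cvg (H : Type)
    (d : nat -> measure_display) (T : forall n, measurableType (d n))
    (P : forall n, H -> probability (T n) R)
    (d' : measure_display) (T' : measurableType d')
    (P' : H -> probability T' R) : Prop :=
  forall (k : nat) (t : 'I_k -> H) (h0 : H), injective t ->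
    @cvg_in_dist 'rV[R]_k d T (fun n => P n h0)
      (fun n x => \row_i likelihood_ratio (P n (t i)) (P n h0) x)
      d' T' (P' h0)
      (fun y => \row_i likelihood_ratio (P' (t i)) (P' h0) y).

End convergence.

Section inference.
Context {R : realType}.

Definition cosh (x : R) : R := (expR x + expR (- x)) / 2.

Definition tanh (x : R) : R :=
  (expR x - expR (- x)) / (expR x + expR (- x)).

(* For theta > 1 the positive root exists and is unique, so that the choice
   and the default value of [xget] are immaterial. *)
Definition magnetization (theta : R) : R :=
  xget 0 [set x | 0 < x /\ x = tanh (theta * x)].

Definition sigma2 (theta : R) : R :=
  (1 - magnetization theta ^+ 2) /
  (1 - theta * (1 - magnetization theta ^+ 2)).

Definition unique_maximizer (L : R -> R) (t : R) : Prop :=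
  forall s, s != t -> L s < L t.

Definition log_lik n (Q : 'M[R]_n) (x : config n) (theta : R) : R :=
  theta / 2 * quad Q x - log_partition theta Q.

Definition local_field n (Q : 'M[R]_n) (x : config n) : 'cV[R]_n :=
  Q *m spins x.

Definition log_pseudolik n (Q : 'M[R]_n) (x : config n) (theta : R) : R :=
  theta * (\sum_i spins x i 0 * local_field Q x i 0)
  - \sum_i ln (cosh (theta * local_field Q x i 0)).

Definition estimator_exists n (L : config n -> R -> R) : set (config n) :=
  [set x | exists t, unique_maximizer (L x) t].

(* [est] is the maximizer of [L x] where it exists, and arbitrary elsewhere. *)
Definition is_estimator n (L : config n -> R -> R) (est : config n -> R) :=
  forall x t, unique_maximizer (L x) t -> est x = t.

Definition mean_spin n (x : config n) : R := n%:R^-1 * \sum_i spins x i 0.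

(* The default 0 is never used when 0 < alpha < 1: K |-> P (S > K) is
   right-continuous and nonincreasing from 1 to 0, so the least K exists. *)
Definition critical_value d (T : measurableType d) (P : probability T R)
    (S : T -> R) (alpha : R) : R :=
  xget 0 [set K : R | (P [set x | (K < S x)%R] <= alpha%:E)%E /\
    forall K' : R, (P [set x | (K' < S x)%R] <= alpha%:E)%E -> K <= K'].

Definition test_power d (T : measurableType d) (P0 P1 : probability T R)
    (S : T -> R) (alpha : R) : \bar R :=
  P1 [set x | critical_value P0 S alpha < S x].

Definition normal_quantile (p : R) : R :=
  inf [set x : R | (p%:E <= normal_prob 0 1 `]-oo, x])%E].

End inference.

(* Main.v *)
Require Import Defs.
From HB Require Import structures.
From mathcomp Require Import all_boot all_order all_algebra.
From mathcomp Require Import all_classical all_reals all_analysis.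
From mathcomp Require Import measurable_realfun.
From mathcomp Require Import ring lra.

Import Order.TTheory GRing.Theory Num.Theory.
Import numFieldNormedType.Exports.

Local Open Scope classical_set_scope.
Local Open Scope ring_scope.

(** The couplings enter only through two facts about [Q n] for large [n]: it is
    a symmetric doubly stochastic matrix with entries at most [Cw / n], and it has a
    spectral gap on vectors of mean zero that does not depend on [n].

    The gap ([spectral_gap_near]) is where the graphon is used. If it failed there
    would be mean-zero vectors [w] with [Q w] close to [w]. Spread over the cells of
    the unit interval and averaged against [f], they are bounded functions almost
    fixed by the operator of [f] ([approx_fixed]), because a small cut norm makes the
    difference of two operators small from [L^oo] to [L^1]. The operator is compact,
    so in the limit it has a fixed function orthogonal to the constant 1, which is
    also fixed. Thus 1 is a multiple eigenvalue; as the top eigenvalue is simple, it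
    exceeds 1, which is impossible for a kernel of degree 1.

    Given the gap, everything reduces to one scalar statistic. Let [M] be the mean
    spin, [V] the quadratic form, [m] the magnetization and [I = m ^+ 2 * sigma2].

    The spin at [i] has conditional mean [tanh (th * t i)], where [t = Q s] is the
    local field, and this gives the exact integration by parts [gibbs_ibp]. It bounds
    the residual [Q (s - tanh (th t))], so that [t] almost solves the mean-field
    equation. The free energy is [n * cw_pressure] up to a small error, hence an
    energy visibly below [n * m ^+ 2] is exponentially unlikely. For small residual
    and nearly maximal energy, the gap forces all the fields to be close to the same
    one of [m] and [- m] ([alignment]); on that event the fixed point map contracts.
    The outcome is [phase_moments]: [\sum_i (t i - M) ^+ 2] and
    [n * (M ^+ 2 - m ^+ 2) ^+ 2] have bounded expectation and [V] has expectation
    [n * m ^+ 2 + O(1)], locally uniformly in the inverse temperature.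

    Integrating by parts against a function of [U = sqrt n * (M ^+ 2 - m ^+ 2)]
    shows that [U] almost satisfies the Stein identity of a centred normal law
    ([stein_identity]), so [U] is asymptotically normal with variance [4 * I]. Since
    [d m ^+ 2 / d th = 2 * I] and [V - n * M ^+ 2] is negligible, the statistics
    [sqrt n * (M ^+ 2 - m0 ^+ 2) / 2] and [T = (V - n * m0 ^+ 2) / (2 * sqrt n)] have
    the limit law [N (h * I, I)] under the parameter [th0 + h / sqrt n]
    ([mean_stat_law], [energy_stat_law]).

    The conclusions follow. (a) Log-likelihood ratios are affine in [T], with slope
    [h - h0] and an intercept that converges because the derivative of the
    log-partition function is half the mean of [V] ([log_partition_local]). (b) Both
    objective functions are strictly concave as soon as their derivative takes both
    signs, so an estimator is at most [x] exactly when the derivative at [x] is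
    nonpositive; at [x = th0 + y / sqrt n] the derivative is asymptotically a
    positive multiple of [T - y * I] for the likelihood and for the pseudo-likelihood
    ([log_lik_score_law], [log_pseudolik_score_law]). (c) Up to increasing affine
    maps the three test statistics have the same normal limits, and this determines
    the power ([power_cvg]). *)

(** * Hyperbolic tangent and the Curie-Weiss fixed point *)

Section mvt.
Context {R : realType}.
Implicit Types (f g df : R -> R) (a b x : R).

Lemma is_derive_congr f g x (d d' : R) :
  is_derive x 1 f d -> f =1 g -> d = d' -> is_derive x 1 g d'.
Proof. by move=> fd /funext <- <-. Qed.

Lemma is_derive_continuous f df :
  (forall x : R, is_derive x 1 f (df x)) -> continuous f.
Proof.
move=> fd x; apply/differentiable_continuous.
by apply/derivable1_diffP; case: (fd x).
Qed.

Lemma mean_value_on f df a b : a <= b ->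
  (forall x : R, a <= x <= b -> is_derive x 1 f (df x)) ->
  exists2 c, a <= c <= b & f b - f a = df c * (b - a).
Proof.
move=> ab fd; have [x|x|c] := @MVT_segment R f df a b ab.
- by rewrite in_itv/= => /andP[ax xb]; apply: fd; rewrite !ltW.
- by apply: derivable_within_continuous => z; rewrite in_itv/= => /fd [].
- by rewrite in_itv/= => cab E; exists c.
Qed.

Lemma mean_value f df a b : a <= b ->
  (forall x : R, is_derive x 1 f (df x)) ->
  exists2 c, a <= c <= b & f b - f a = df c * (b - a).
Proof. by move=> ab fd; apply: mean_value_on => // x _; exact: fd. Qed.

End mvt.

Section tanh.
Context {R : realType}.
Implicit Types (a b c x u : R).

Lemma expRDN_gt0 x : 0 < expR x + expR (- x).
Proof. by rewrite addr_gt0// expR_gt0. Qed.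

Lemma is_derive_exprN x : is_derive x 1 (fun y : R => expR (- y)) (- expR (- x)).
Proof.
have h0 : is_derive x (1 : R) (- id) (- 1 : R) by apply: is_derive_eq.
have h := @is_derive1_comp _ expR (- id) x _ _ (is_derive_expR (- x)) h0.
by move: h; rewrite mulrN1.
Qed.

Lemma is_derive_tanh x : is_derive x 1 tanh (1 - tanh x ^+ 2).
Proof.
have d1 : is_derive x 1 (fun y : R => expR y - expR (- y)) (expR x + expR (- x)).
  have -> : (fun y : R => expR y - expR (- y)) = (expR - (fun y => expR (- y))).
    by [].
  have h := is_derive_exprN x.
  by apply: is_derive_eq; rewrite opprK.
have d2 : is_derive x 1 (fun y : R => expR y + expR (- y)) (expR x - expR (- x)).
  have -> : (fun y : R => expR y + expR (- y)) = (expR + (fun y => expR (- y))).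
    by [].
  have h := is_derive_exprN x.
  by apply: is_derive_eq.
have n0 : expR x + expR (- x) != 0 by rewrite gt_eqF// expRDN_gt0.
have d3 := is_deriveV (f := fun y : R => expR y + expR (- y)) n0 d2.
apply: (is_derive_congr _ _ _ _ _ (is_deriveM d1 d3)) => //.
rewrite /tanh /GRing.scale/=; field; exact: n0.
Qed.

Lemma tanh_lt1 x : tanh x < 1.
Proof.
by rewrite /tanh ltr_pdivrMr ?expRDN_gt0// mul1r; have := expR_gt0 (- x); lra.
Qed.

Lemma tanhN x : tanh (- x) = - tanh x.
Proof. by rewrite /tanh opprK addrC -mulNr opprB addrC [expR x + _]addrC. Qed.

Lemma tanh_gtN1 x : -1 < tanh x.
Proof. by have := tanh_lt1 (- x); rewrite tanhN; lra. Qed.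

Lemma tanh0 : tanh (0 : R) = 0.
Proof. by rewrite /tanh oppr0 subrr mul0r. Qed.

Lemma norm_tanh_le1 x : `|tanh x| <= 1.
Proof. by rewrite ler_norml !ltW ?tanh_lt1 ?tanh_gtN1. Qed.

Lemma tanh2_le1 x : tanh x ^+ 2 <= 1.
Proof. by rewrite -real_normK ?num_real// expr_le1// norm_tanh_le1. Qed.

Lemma tanh2_lt1 x : tanh x ^+ 2 < 1.
Proof. by have := tanh_lt1 x; have := tanh_gtN1 x; nra. Qed.

Lemma tanh_mvt a b : a <= b ->
  exists2 c, a <= c <= b & tanh b - tanh a = (1 - tanh c ^+ 2) * (b - a).
Proof. by move=> ab; exact: mean_value ab is_derive_tanh. Qed.

Lemma tanh_ltr a b : a < b -> tanh a < tanh b.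
Proof.
move=> ab; have [c _ E] := tanh_mvt _ _ (ltW ab).
by rewrite -subr_gt0 E mulr_gt0 ?subr_gt0// tanh2_lt1.
Qed.

Lemma tanh_ler a b : a <= b -> tanh a <= tanh b.
Proof. by rewrite le_eqVlt => /predU1P[->//|/tanh_ltr/ltW]. Qed.

Lemma tanh_ge0 a : 0 <= a -> 0 <= tanh a.
Proof. by move=> /tanh_ler; rewrite tanh0. Qed.

Lemma tanh_gt0 a : 0 < a -> 0 < tanh a.
Proof. by move=> /tanh_ltr; rewrite tanh0. Qed.

Lemma tanh_le_id a : 0 <= a -> tanh a <= a.
Proof.
move=> a0; have [c _] := tanh_mvt _ _ a0; rewrite tanh0 !subr0 => ->.
by rewrite ler_piMl// gerBl sqr_ge0.
Qed.

Lemma tanh_slope L a b :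
  (forall c, a <= c <= b \/ b <= c <= a -> 1 - tanh c ^+ 2 <= L) ->
  `|tanh a - tanh b| <= L * `|a - b|.
Proof.
wlog ab : a b / a <= b => [h|] H.
  have [/h|/ltW/h] := leP a b; first exact.
  rewrite distrC [`|a - b|]distrC; apply => c cab; apply: H.
  by case: cab; [right|left].
have [c cab E] := tanh_mvt _ _ ab.
rewrite distrC E normrM [`|a - b|]distrC ler_wpM2r//.
by rewrite ger0_norm ?subr_ge0 ?tanh2_le1//; apply: H; left.
Qed.

Lemma tanh_lip a b : `|tanh a - tanh b| <= `|a - b|.
Proof.
rewrite -[leRHS]mul1r; apply: tanh_slope => c _.
by rewrite gerBl sqr_ge0.
Qed.

Lemma sqr_tanh_lip a b : `|tanh a ^+ 2 - tanh b ^+ 2| <= 2 * `|a - b|.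
Proof.
rewrite subr_sqr normrM mulrC ler_pM//; last exact: tanh_lip.
by rewrite (le_trans (ler_normD _ _))// -[2]/(1 + 1) lerD// norm_tanh_le1.
Qed.

Lemma tanh_taylor a b :
  `|tanh b - tanh a - (1 - tanh a ^+ 2) * (b - a)| <= 2 * (b - a) ^+ 2.
Proof.
have key x y : x <= y -> exists2 c, x <= c <= y &
    tanh y - tanh x = (1 - tanh c ^+ 2) * (y - x) by exact: tanh_mvt.
have [c [cab E]] : exists c, `|c - a| <= `|b - a| /\
    tanh b - tanh a = (1 - tanh c ^+ 2) * (b - a).
  have [/key[c cab E]|/ltW/key[c cab E]] := leP a b; exists c; split=> //.
  - by rewrite !ger0_norm ?subr_ge0; lra.
  - by rewrite !ler0_norm ?subr_le0; lra.
  - by lra.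
have -> : 2 * (b - a) ^+ 2 = 2 * `|b - a| * `|b - a|.
  by rewrite -mulrA -normrM -expr2 ger0_norm// sqr_ge0.
rewrite E -mulrBl normrM ler_wpM2r//.
have -> : 1 - tanh c ^+ 2 - (1 - tanh a ^+ 2) = tanh a ^+ 2 - tanh c ^+ 2 by ring.
by rewrite (le_trans (sqr_tanh_lip _ _))// ler_wpM2l// distrC.
Qed.

Lemma tanh_concave a b : 0 <= a -> a <= b ->
  tanh b <= tanh a + (1 - tanh a ^+ 2) * (b - a).
Proof.
move=> a0 ab; have [c /andP[ac cb]] := tanh_mvt _ _ ab.
move=> /(canRL (subrK _)) ->; rewrite addrC lerD2l ler_wpM2r ?subr_ge0//.
rewrite lerD2l lerN2 ler_pXn2r ?nnegrE ?tanh_ge0 ?tanh_ler//.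
exact: le_trans ac.
Qed.

Lemma tanh_lt_id a : 0 < a -> tanh a < a.
Proof.
move=> a0; have a20 : 0 < a / 2 by rewrite divr_gt0.
have := @tanh_concave (a / 2) a (ltW a20); have := tanh_le_id _ (ltW a20).
have := mulr_gt0 (exprn_gt0 2 (tanh_gt0 _ a20)) a20; lra.
Qed.

(** By concavity the chord slope of [tanh] at 0 exceeds the tangent slope; at the
    fixed point this reads [th * (1 - m ^+ 2) < 1]. *)
Lemma tanh_gt_tangent a : 0 < a -> a * (1 - tanh a ^+ 2) < tanh a.
Proof.
move=> a0; have a20 : 0 < a / 2 by rewrite divr_gt0.
have a2a : a / 2 < a by lra.
have [c /andP[ac cb] E] := tanh_mvt _ _ (ltW a2a).
have [c' /andP[ac' cb'] E'] := tanh_mvt _ _ (ltW a20).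
have t2 x y : 0 <= x -> x <= y -> tanh x ^+ 2 <= tanh y ^+ 2.
  move=> x0 xy; rewrite ler_pXn2r ?nnegrE ?tanh_ge0 ?tanh_ler//.
  exact: le_trans xy.
have h1 : tanh c ^+ 2 <= tanh a ^+ 2 by apply: t2 => //; lra.
have h2 : tanh c' ^+ 2 <= tanh (a / 2) ^+ 2 by apply: t2 => //; lra.
have h3 : tanh (a / 2) ^+ 2 < tanh a ^+ 2.
  by rewrite ltr_pXn2r ?nnegrE ?tanh_ge0 ?tanh_ltr//; lra.
rewrite tanh0 !subr0 in E'.
have : tanh a - tanh (a / 2) >= (1 - tanh a ^+ 2) * (a - a / 2).
  by rewrite E ler_wpM2r; lra.
have : tanh (a / 2) > (1 - tanh a ^+ 2) * (a / 2).
  by rewrite E' ltr_pM2r//; lra.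
by lra.
Qed.

End tanh.

Section magnetization.
Context {R : realType}.
Implicit Types (th m x u : R).

Definition curie_weiss_root th m := 0 < m /\ m = tanh (th * m).

Lemma root_slope_lt1 th m : 0 < th -> curie_weiss_root th m ->
  th * (1 - m ^+ 2) < 1.
Proof.
move=> th0 [m0 mE]; have := @tanh_gt_tangent R (th * m) (mulr_gt0 th0 m0).
by rewrite -mE mulrAC gtr_pMl.
Qed.

Lemma root_lt1 th m : curie_weiss_root th m -> m < 1.
Proof. by case=> _ ->; exact: tanh_lt1. Qed.

(** At the smaller root the slope of [tanh (th * x)] is below 1, and by concavity it
    stays so beyond it: the graph cannot meet the diagonal again. *)
Lemma root_unique th m1 m2 : 0 < th ->
  curie_weiss_root th m1 -> curie_weiss_root th m2 -> m1 = m2.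
Proof.
move=> th0; wlog : m1 m2 / m1 < m2 => [h r1 r2|].
  by have [/h|/h/(_ r2 r1)|//] := ltgtP m1 m2; [exact|].
move=> m12 r1 [m20 m2E]; exfalso.
have [m10 m1E] := r1.
have := @tanh_concave R (th * m1) (th * m2) (ltW (mulr_gt0 th0 m10)).
rewrite ler_pM2l// -m1E -m2E => /(_ (ltW m12)).
have := root_slope_lt1 _ _ th0 r1.
have d0 : 0 < m2 - m1 by rewrite subr_gt0.
rewrite -(ltr_pM2r d0); nra.
Qed.

(** Just above 0 the curve [tanh (th * x)] is above the diagonal, since its slope
    there is [th], and at 1 it is below. *)
Lemma root_exists th : 1 < th -> exists m, curie_weiss_root th m.
Proof.
move=> th1; have th0 : 0 < th by lra.
pose x0 := (th - 1) / (4 * th ^+ 2).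
have x00 : 0 < x0 by rewrite divr_gt0 ?subr_gt0// mulr_gt0// exprn_gt0.
have x01 : x0 <= 1.
  by rewrite ler_pdivrMr ?mulr_gt0 ?exprn_gt0// mul1r; nra.
pose F x : R := tanh (th * x) - x.
have dF x : is_derive x 1 F ((1 - tanh (th * x) ^+ 2) * th - 1).
  have h0 : is_derive x 1 (fun y : R => th * y) th.
    have -> : (fun y : R => th * y) = (th \*: id) by [].
    by apply: is_derive_eq; rewrite /GRing.scale/= mulr1.
  have h1 := @is_derive1_comp _ tanh (fun y => th * y) x _ _ (is_derive_tanh _) h0.
  have -> : F = (@tanh R \o (fun y => th * y)) - id by [].
  by apply: is_derive_eq.
have F0 : 0 <= F x0.
  have := @tanh_taylor R 0 (th * x0); rewrite tanh0 !subr0 expr0n/= subr0 mul1r.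
  have E : 2 * (th * x0) ^+ 2 = (th - 1) * x0 / 2 by rewrite /x0; field; lra.
  rewrite E ler_norml => /andP[+ _]; rewrite /F.
  by have := mulr_gt0 (_ : 0 < th - 1) x00; lra.
have F1 : F 1 <= 0 by rewrite /F; have := tanh_lt1 (th * 1); lra.
have [||c] := @IVT R F x0 1 0 x01.
- by apply: continuous_subspaceT; exact: is_derive_continuous dF.
- by rewrite ge_min F1 orbT le_max F0.
rewrite in_itv/= => /andP[x0c _] /eqP; rewrite subr_eq0 => /eqP Fc.
by exists c; split; [exact: lt_le_trans x0c|].
Qed.

Lemma magnetizationP th : 1 < th -> curie_weiss_root th (magnetization th).
Proof.
move=> /root_exists[m mP]; rewrite /magnetization.
by apply: (@xgetPex _ 0 [set x | 0 < x /\ x = tanh (th * x)]); exists m.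
Qed.

Lemma magnetization_unique th m : 1 < th -> curie_weiss_root th m ->
  magnetization th = m.
Proof.
move=> th1 mP; apply: (@root_unique th) => //; first by lra.
exact: magnetizationP.
Qed.

Lemma magnetization_gt0 th : 1 < th -> 0 < magnetization th.
Proof. by move=> /magnetizationP[]. Qed.

Lemma magnetization_lt1 th : 1 < th -> magnetization th < 1.
Proof. by move=> /magnetizationP/root_lt1. Qed.

Lemma magnetizationE th : 1 < th -> magnetization th = tanh (th * magnetization th).
Proof. by move=> /magnetizationP[]. Qed.

(** The slope at the fixed point of the Curie-Weiss map [x |-> tanh (th * x)]; that
    it is below 1 is what makes the magnetized phases stable. *)
Definition cw_slope th := th * (1 - magnetization th ^+ 2).

Lemma cw_slope_lt1 th : 1 < th -> cw_slope th < 1.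
Proof. by move=> th1; apply: root_slope_lt1; [lra|exact: magnetizationP]. Qed.

(** The inverse of the strictly increasing map [u |-> u / tanh u] is
    [th |-> th * magnetization th]; this makes the magnetization smooth. *)
Lemma is_derive_magnetization th : 1 < th ->
  is_derive th 1 magnetization (magnetization th * sigma2 th).
Proof.
move=> th1; set m := magnetization th.
have m0 : 0 < m := magnetization_gt0 th th1.
have th0 : 0 < th by lra.
have mE : m = tanh (th * m) := magnetizationE th th1.
have r1 : 0 < 1 - th * (1 - m ^+ 2) by rewrite subr_gt0; exact: cw_slope_lt1.
pose f u : R := u * (tanh u)^-1.
pose g t : R := t * magnetization t.
have u0 : 0 < th * m by rewrite mulr_gt0.
have df u : 0 < u ->
    is_derive u 1 f ((tanh u - u * (1 - tanh u ^+ 2)) / tanh u ^+ 2).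
  move=> up; have tn0 : tanh u != 0 by rewrite gt_eqF// tanh_gt0.
  have h := is_deriveV (f := @tanh R) tn0 (is_derive_tanh u).
  have -> : f = id * (fun u => (tanh u)^-1) by [].
  by apply: is_derive_eq; rewrite /GRing.scale/=; field.
have fgt1 u : 0 < u -> 1 < f u.
  move=> up; rewrite /f ltr_pdivlMr ?tanh_gt0// mul1r.
  exact: tanh_lt_id.
have fK u : 0 < u -> g (f u) = u.
  move=> up; rewrite /g (@magnetization_unique _ (tanh u)) ?fgt1//.
    by rewrite /f divfK// gt_eqF// tanh_gt0.
  split; first exact: tanh_gt0.
  by rewrite /f divfK// gt_eqF// tanh_gt0.
have fth : f (th * m) = th by rewrite /f -mE mulfK// gt_eqF.
have near0 : \forall u \near th * m, 0 < u by exact: lt_nbhsr.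
have dg : is_derive (f (th * m)) 1 g
    ((tanh (th * m) - th * m * (1 - tanh (th * m) ^+ 2)) / tanh (th * m) ^+ 2)^-1.
  apply: is_derive_inverse.
  - by near=> u; apply: fK; near: u.
  - near=> u; apply/differentiable_continuous/derivable1_diffP.
    have u0' : 0 < u by near: u.
    by have [] := df u u0'.
  - exact: df.
  - rewrite -mE mulf_neq0 ?invr_eq0 ?sqrf_eq0 ?gt_eqF//.
    by rewrite (_ : _ - _ = m * (1 - th * (1 - m ^+ 2))); [rewrite mulr_gt0|ring].
rewrite fth -mE in dg.
have dt := @is_derive1_comp _ tanh g th _ _ (is_derive_tanh (g th)) dg.
have E : {near th, @tanh R \o g =1 magnetization}.
  have : \forall t \near th, 1 < t by exact: lt_nbhsr.
  by apply: filterS => t t1 /=; rewrite /g -magnetizationE.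
rewrite /sigma2 -/m.
have -> : m * ((1 - m ^+ 2) / (1 - th * (1 - m ^+ 2))) =
    (1 - tanh (g th) ^+ 2) * ((m - th * m * (1 - m ^+ 2)) / m ^+ 2)^-1.
  rewrite /g -/m -mE; field; rewrite !gt_eqF//=.
  by rewrite (_ : _ - _ = m * (1 - th * (1 - m ^+ 2))); [rewrite mulr_gt0|ring].
apply: near_eq_is_derive dt => //.
Unshelve. all: by end_near. Qed.

Lemma root_lt th1 th2 a b : 0 < th1 -> th1 < th2 ->
  curie_weiss_root th1 a -> curie_weiss_root th2 b -> a < b.
Proof.
move=> t1 t12 [a0 aE] rb; have t2 : 0 < th2 by exact: lt_trans t12.
have r2 := root_slope_lt1 _ _ t2 rb; have [b0 bE] := rb.
rewrite ltNge; apply/negP => ba.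
have h : tanh (th2 * a) <= b + (1 - b ^+ 2) * (th2 * a - th2 * b).
  rewrite {1 2}bE; apply: tanh_concave; last by rewrite ler_pM2l.
  by rewrite mulr_ge0// ltW.
have h2 : tanh (th1 * a) < tanh (th2 * a) by apply: tanh_ltr; rewrite ltr_pM2r.
move: h2; rewrite -aE => /lt_le_trans/(_ h).
have -> : (1 - b ^+ 2) * (th2 * a - th2 * b) = th2 * (1 - b ^+ 2) * (a - b) by ring.
rewrite -ltrBlDl ltNge => /negP; apply.
by rewrite ler_piMl ?subr_ge0// ltW.
Qed.

Lemma magnetization_lt th1 th2 : 1 < th1 -> th1 < th2 ->
  magnetization th1 < magnetization th2.
Proof.
move=> t1 t12; apply: (@root_lt th1 th2) => //; first exact: lt_trans t1.
  exact: magnetizationP.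
by apply: magnetizationP; exact: lt_trans t12.
Qed.

(** Concavity bounds [tanh (th u)] by its tangent at the fixed point. *)
Lemma tanh_root_le th m u : 0 < th -> 0 <= u -> curie_weiss_root th m ->
  tanh (th * u) <= m + th * (1 - m ^+ 2) * Num.max 0 (u - m).
Proof.
move=> th0 u0 [m0 mE]; have [mu|um] := leP m u.
  rewrite max_r ?subr_ge0//.
  have -> : th * (1 - m ^+ 2) * (u - m) =
      (1 - m ^+ 2) * (th * u - th * m) by ring.
  rewrite {1 2}mE; apply: tanh_concave; last by rewrite ler_pM2l.
  by rewrite mulr_ge0// ltW.
by rewrite max_l ?subr_le0 ?ltW// mulr0 addr0 {1}mE tanh_ltr// ltr_pM2l.
Qed.

(** The inverse parametrization [u |-> u / tanh u] reaches temperatures arbitrarily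
    close to 1 with root [tanh u] as small as desired. *)
Lemma magnetization_small (e : R) : 0 < e -> exists2 th, 1 < th & magnetization th < e.
Proof.
move=> e0.
pose u := Num.min (1 / 2) e.
have u0 : 0 < u by rewrite lt_min e0 divr_gt0.
have tu := tanh_gt0 _ u0.
exists (u / tanh u); first by rewrite ltr_pdivlMr// mul1r tanh_lt_id.
have th1 : 1 < u / tanh u by rewrite ltr_pdivlMr// mul1r tanh_lt_id.
rewrite (magnetization_unique _ (tanh u) th1).
  by apply: lt_le_trans (tanh_lt_id _ u0) _; rewrite ge_min lexx orbT.
by split=> //; rewrite divfK// gt_eqF.
Qed.

Definition log2cosh u : R := ln (expR u + expR (- u)).

Lemma is_derive_log2cosh u : is_derive u 1 log2cosh (tanh u).
Proof.
have d2 : is_derive u 1 (fun y : R => expR y + expR (- y)) (expR u - expR (- u)).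
  have -> : (fun y : R => expR y + expR (- y)) = (expR + (fun y => expR (- y))).
    by [].
  have h := is_derive_exprN u.
  by apply: is_derive_eq.
have d3 := @is_derive1_ln R _ (expRDN_gt0 u).
have d4 := @is_derive1_comp _ (@ln R) (fun y : R => expR y + expR (- y)) u _ _ d3 d2.
by apply: (is_derive_congr _ _ _ _ _ d4) => //; rewrite /tanh mulrC.
Qed.

(** The limiting log-partition function per spin; the derivative only sees the
    explicit dependence on [th] because the magnetization is a critical point. *)
Definition cw_pressure th :=
  log2cosh (th * magnetization th) - th / 2 * magnetization th ^+ 2.

Lemma is_derive_cw_pressure th : 1 < th ->
  is_derive th 1 cw_pressure (magnetization th ^+ 2 / 2).
Proof.
move=> th1; have dm := is_derive_magnetization _ th1.
have mE := magnetizationE _ th1.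
have d1 : is_derive th 1 (fun t => t * magnetization t)
    (magnetization th + th * (magnetization th * sigma2 th)).
  apply: (is_derive_congr _ _ _ _ _ (is_deriveM (is_derive_id th 1) dm)) => //=.
  by rewrite /GRing.scale/= mulr1 addrC.
have d2 := @is_derive1_comp _ log2cosh _ _ _ _ (is_derive_log2cosh _) d1.
have d3 : is_derive th 1 (fun t => t / 2 * magnetization t ^+ 2)
    (magnetization th ^+ 2 / 2 + th * magnetization th * (magnetization th * sigma2 th)).
  have d4 := is_deriveM d1 dm.
  apply: (is_derive_congr _ _ _ _ _ (is_deriveZ 2^-1 d4)) => [t|].
    by rewrite /= /GRing.scale/= expr2; change (2^-1 * (t * magnetization t * magnetization t) = t / 2 * (magnetization t * magnetization t)); ring.
  by rewrite /GRing.scale/=; field.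
apply: (is_derive_congr _ _ _ _ _ (is_deriveB d2 d3)) => [t|] //.
by rewrite -mE; field.
Qed.

Lemma log2cosh0 : log2cosh 0 = ln 2.
Proof. by rewrite /log2cosh oppr0 expR0. Qed.

(** [u |-> log2cosh u - u * tanh u / 2] increases on the positive axis. *)
Lemma cw_pressure_ge th : 1 < th -> ln 2 <= cw_pressure th.
Proof.
move=> th1; have mE := magnetizationE _ th1; have m0 := magnetization_gt0 _ th1.
have u0 : 0 <= th * magnetization th by rewrite mulr_ge0 ?ltW//; lra.
have -> : cw_pressure th = log2cosh (th * magnetization th) -
    th * magnetization th * tanh (th * magnetization th) / 2.
  by rewrite /cw_pressure -mE; field.
move: u0; set u := th * _ => u0.
pose F v : R := log2cosh v - v * tanh v / 2.
have dF (v : R) : is_derive v 1 F (tanh v - (tanh v + v * (1 - tanh v ^+ 2)) / 2).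
  have d1 := is_deriveM (is_derive_id v 1) (is_derive_tanh v).
  have d2 := is_deriveB (is_derive_log2cosh v) (is_deriveZ 2^-1 d1).
  apply: (is_derive_congr _ _ _ _ _ d2) => [t|].
    by change (log2cosh t - 2^-1 * (t * tanh t) = F t); rewrite /F; ring.
  by rewrite /GRing.scale/=; field.
have [c /andP[c0 cu]] := mean_value _ _ _ _ u0 dF.
rewrite subr0 {2}/F log2cosh0 mul0r mul0r subr0 => E.
rewrite -subr_ge0 -/(F u) E mulr_ge0//.
have [c00|] := ltP 0 c; last first.
  move=> c00; have -> : c = 0 by apply/eqP; rewrite eq_le c00.
  by rewrite tanh0 mul0r addr0 mul0r subr0.
by have := tanh_gt_tangent _ c00; move: (tanh c) => t; lra.
Qed.

End magnetization.

Set Implicit Arguments.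
Unset Strict Implicit.
Unset Printing Implicit Defensive.

(** * Gibbs expectations and integration by parts *)

Section gibbs.
Context {R : realType} {n : nat}.
Implicit Types (th : R) (Q : 'M[R]_n) (x : config n) (F G H : config n -> R).

Definition spin x i : R := if x i then 1 else -1.

Definition field_at Q x i : R := \sum_j Q i j * spin x j.

Definition set_spin x i b : config n := [ffun j => if j == i then b else x j].

(** The discrete derivative in the [i]-th spin. *)
Definition flip_diff i H x : R :=
  (H (set_spin x i true) - H (set_spin x i false)) / 2.

Definition gibbs th Q F : R := \sum_(x : config n) ising_pmf th Q x * F x.

Lemma spinsE x i : spins x i 0 = spin x i.
Proof. by rewrite mxE. Qed.

Lemma local_fieldE Q x i : local_field Q x i 0 = field_at Q x i.
Proof. by rewrite mxE; apply: eq_bigr => j _; rewrite spinsE. Qed.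

Lemma quadE Q x : quad Q x = \sum_i spin x i * field_at Q x i.
Proof.
rewrite /quad -mulmxA mxE; apply: eq_bigr => i _.
by rewrite mxE spinsE -/(local_field Q x) local_fieldE.
Qed.

Lemma mean_spinE x : mean_spin x = n%:R^-1 * \sum_i spin x i :> R.
Proof. by rewrite /mean_spin; congr (_ * _); apply: eq_bigr => i _; rewrite spinsE. Qed.

Lemma norm_spin x i : `|spin x i| = 1.
Proof. by rewrite /spin; case: ifP; rewrite ?normrN normr1. Qed.

Lemma spin_set x i b j :
  spin (set_spin x i b) j = if j == i then (if b then 1 else -1) else spin x j.
Proof. by rewrite /spin ffunE; case: eqP. Qed.

Lemma set_set x i b c : set_spin (set_spin x i b) i c = set_spin x i c.
Proof. by apply/ffunP => j; rewrite !ffunE; case: eqP. Qed.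

Lemma sum_flip i F : \sum_x F x =
  2^-1 * \sum_x (F (set_spin x i true) + F (set_spin x i false)).
Proof.
pose flip x := set_spin x i (~~ x i).
have flipK : involutive flip.
  by move=> x; apply/ffunP => j; rewrite !ffunE eqxx negbK; case: eqP => // ->.
have E : \sum_x F x = \sum_x F (flip x).
  by rewrite (reindex_inj (inv_inj flipK)).
have -> : \sum_x (F (set_spin x i true) + F (set_spin x i false)) =
    \sum_x (F x + F (flip x)).
  apply: eq_bigr => x _; have xi : x = set_spin x i (x i).
    by apply/ffunP => j; rewrite ffunE; case: eqP => // ->.
  rewrite [in F x]xi /flip; case: (x i) => //=.
  by rewrite addrC.
by rewrite big_split/= -E; lra.
Qed.

Lemma partition_gt0 th Q : 0 < \sum_x expR (th / 2 * quad Q x).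
Proof.
rewrite (bigD1 [ffun=> true])//= ltr_pwDl ?expR_gt0//.
by apply: sumr_ge0 => x _; exact: expR_ge0.
Qed.

Lemma ising_pmfE th Q x : ising_pmf th Q x =
  expR (th / 2 * quad Q x) / \sum_x expR (th / 2 * quad Q x).
Proof.
by rewrite /ising_pmf /log_partition expRD expRN lnK// posrE partition_gt0.
Qed.

Lemma ising_pmf_gt0 th Q x : 0 < ising_pmf th Q x.
Proof. exact: expR_gt0. Qed.

Lemma sum_ising_pmf th Q : \sum_x ising_pmf th Q x = 1.
Proof.
under eq_bigr do rewrite ising_pmfE.
by rewrite -mulr_suml divff// gt_eqF// partition_gt0.
Qed.

Lemma gibbs_ext th Q F G : F =1 G -> gibbs th Q F = gibbs th Q G.
Proof. by move=> FG; apply: eq_bigr => x _; rewrite FG. Qed.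

Lemma gibbs_cst th Q c : gibbs th Q (fun=> c) = c.
Proof. by rewrite /gibbs -mulr_suml sum_ising_pmf mul1r. Qed.

Lemma gibbsD th Q F G : gibbs th Q (fun x => F x + G x) = gibbs th Q F + gibbs th Q G.
Proof. by rewrite /gibbs -big_split/=; apply: eq_bigr => x _; rewrite mulrDr. Qed.

Lemma gibbsB th Q F G : gibbs th Q (fun x => F x - G x) = gibbs th Q F - gibbs th Q G.
Proof. by rewrite /gibbs -sumrB; apply: eq_bigr => x _; rewrite mulrBr. Qed.

Lemma gibbsZ th Q c F : gibbs th Q (fun x => c * F x) = c * gibbs th Q F.
Proof. by rewrite /gibbs mulr_sumr; apply: eq_bigr => x _; rewrite mulrCA. Qed.

Lemma gibbsN th Q F : gibbs th Q (fun x => - F x) = - gibbs th Q F.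
Proof. by rewrite /gibbs -sumrN; apply: eq_bigr => x _; rewrite mulrN. Qed.

Lemma gibbs_sum th Q (I : finType) (F : I -> config n -> R) :
  gibbs th Q (fun x => \sum_i F i x) = \sum_i gibbs th Q (F i).
Proof. by rewrite /gibbs exchange_big/=; apply: eq_bigr => x _; rewrite mulr_sumr. Qed.

Lemma gibbs_le th Q F G : (forall x, F x <= G x) -> gibbs th Q F <= gibbs th Q G.
Proof.
by move=> FG; apply: ler_sum => x _; rewrite ler_wpM2l// ltW ?ising_pmf_gt0.
Qed.

Lemma gibbs_ge0 th Q F : (forall x, 0 <= F x) -> 0 <= gibbs th Q F.
Proof. by move=> /(gibbs_le th Q); rewrite gibbs_cst. Qed.

Lemma gibbs_le_cst th Q F c : (forall x, F x <= c) -> gibbs th Q F <= c.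
Proof. by move=> /(gibbs_le th Q); rewrite gibbs_cst. Qed.

Lemma norm_gibbs th Q F : `|gibbs th Q F| <= gibbs th Q (fun x => `|F x|).
Proof.
rewrite ler_norml; apply/andP; split; last first.
  by apply: gibbs_le => x; rewrite ler_norm.
by rewrite -gibbsN; apply: gibbs_le => x; rewrite lerNl ler_normr lexx orbT.
Qed.

Lemma flip_diff_sum i (I : finType) (F : I -> config n -> R) x :
  flip_diff i (fun x => \sum_j F j x) x = \sum_j flip_diff i (F j) x.
Proof. by rewrite /flip_diff -sumrB mulr_suml. Qed.

Lemma flip_diffB i F G x :
  flip_diff i (fun x => F x - G x) x = flip_diff i F x - flip_diff i G x.
Proof. by rewrite /flip_diff; lra. Qed.

Lemma norm_flip_diff i F x c :
  `|F (set_spin x i true) - F (set_spin x i false)| <= 2 * c ->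
  `|flip_diff i F x| <= c.
Proof. move=> h; rewrite /flip_diff normrM [`|2^-1|]gtr0_norm ?invr_gt0//.
by rewrite ler_pdivrMr// mulrC. Qed.

Lemma flip_diff_mul_indep i F G x :
  F (set_spin x i true) = F x -> F (set_spin x i false) = F x ->
  flip_diff i (fun x => F x * G x) x = F x * flip_diff i G x.
Proof. by rewrite /flip_diff => -> ->; rewrite mulrA mulrBr. Qed.

End gibbs.

Section integration_by_parts.
Context {R : realType} {n : nat} (Q : 'M[R]_n).
Hypothesis Q_sym : forall i j, Q i j = Q j i.
Hypothesis Q_diag : forall i, Q i i = 0.
Implicit Types (th : R) (x : config n) (F G H : config n -> R).

Notation t := (field_at Q).

Lemma field_diff x i j :
  t (set_spin x i true) j - t (set_spin x i false) j = 2 * Q j i.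
Proof.
rewrite /field_at -sumrB (bigD1 i)//= !spin_set eqxx big1 ?addr0; first lra.
by move=> k ki; rewrite !spin_set (negbTE ki) subrr.
Qed.

Lemma field_set x i b : t (set_spin x i b) i = t x i.
Proof.
apply: eq_bigr => k _; rewrite spin_set; case: eqP => // ->.
by rewrite Q_diag !mul0r.
Qed.

Lemma quad_diff x i :
  quad Q (set_spin x i true) - quad Q (set_spin x i false) = 4 * t x i.
Proof.
rewrite !quadE -sumrB.
have -> : 4 * t x i = \sum_j ((j == i)%:R * (2 * t x i) + 2 * (Q i j * spin x j)).
  rewrite big_split/= -mulr_sumr -/(t x i) (bigD1 i)//= eqxx mul1r big1; first lra.
  by move=> k /negbTE ->; rewrite mul0r.
apply: eq_bigr => j _; rewrite !spin_set; have [->|ji] := eqVneq j i.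
  by rewrite !field_set Q_diag /= mulr1n; lra.
by rewrite /= mulr0n mul0r add0r -mulrBr field_diff Q_sym; lra.
Qed.

(** Conditionally on the other spins, [spin x i] has mean
    [tanh (th * field_at Q x i)] and variance [1 - tanh ^+ 2]. *)
Lemma gibbs_ibp th i H :
  gibbs th Q (fun x => (spin x i - tanh (th * t x i)) * H x) =
  gibbs th Q (fun x => (1 - tanh (th * t x i) ^+ 2) * flip_diff i H x).
Proof.
rewrite /gibbs (sum_flip i) [RHS](sum_flip i); congr (_ * _).
apply: eq_bigr => x _; rewrite !ising_pmfE.
set xp := set_spin x i true; set xm := set_spin x i false.
set Z := \sum_x _.
have Z0 : Z != 0 by rewrite gt_eqF// partition_gt0.
pose q := (quad Q xp + quad Q xm) / 2.
have qp : quad Q xp = q + 2 * t x i.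
  by have := quad_diff x i; rewrite -/xp -/xm /q; lra.
have qm : quad Q xm = q - 2 * t x i.
  by have := quad_diff x i; rewrite -/xp -/xm /q; lra.
rewrite qp qm; clearbody q.
rewrite /flip_diff !set_set -/xp -/xm !spin_set eqxx !field_set /tanh.
have -> : th / 2 * (q + 2 * t x i) = th / 2 * q + th * t x i by field.
have -> : th / 2 * (q - 2 * t x i) = th / 2 * q + (- (th * t x i)) by field.
rewrite !expRD; have := @expRDN_gt0 R (th * t x i).
move: (expR (th * t x i)) (expR (- (th * t x i))) (expR (th / 2 * q)) (H xp) (H xm).
move=> A B C a b AB; by field; rewrite Z0 (gt_eqF AB).
Qed.

(** The conditional variances are at most 1. *)
Lemma gibbs_ibp_le th (F : 'I_n -> config n -> R) :
  `|gibbs th Q (fun x => \sum_i (spin x i - tanh (th * t x i)) * F i x)| <=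
  gibbs th Q (fun x => \sum_i `|flip_diff i (F i) x|).
Proof.
rewrite !gibbs_sum (le_trans (ler_norm_sum _ _ _))//; apply: ler_sum => i _.
rewrite gibbs_ibp (le_trans (norm_gibbs _ _ _))//; apply: gibbs_le => x.
rewrite normrM ler_piMl// ger0_norm ?subr_ge0 ?tanh2_le1//.
by rewrite gerBl sqr_ge0.
Qed.

End integration_by_parts.

Section second_moments.
Context {R : realType} {n : nat} (Q : 'M[R]_n) (K : R).
Hypothesis Q_sym : forall i j, Q i j = Q j i.
Hypothesis Q_ge0 : forall i j, 0 <= Q i j.
Hypothesis Q_diag : forall i, Q i i = 0.
Hypothesis Q_row : forall i, \sum_j Q i j = 1.
Hypothesis Q_le : forall i j, Q i j <= K / n%:R.
Implicit Types (th : R) (x : config n) (F G H : config n -> R) (v w : 'I_n -> R).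

Notation t := (field_at Q).
Notation y th x i := (tanh (th * t x i)).

(** The error made by the local fields of [x] in the mean-field equation
    [t = Q tanh (th * t)]. *)
Definition residual th x i : R := \sum_j Q i j * (spin x j - y th x j).

(** This is at once the derivative of the log-pseudolikelihood and a centred
    approximation of the energy. *)
Definition score th x : R := \sum_i (spin x i - y th x i) * t x i.

Lemma Q_col j : \sum_i Q i j = 1.
Proof. by rewrite -(Q_row j); apply: eq_bigr => i _. Qed.

Lemma norm_field_le1 x i : `|t x i| <= 1.
Proof.
rewrite (le_trans (ler_norm_sum _ _ _))// -(Q_row i) ler_sum// => j _.
by rewrite normrM norm_spin mulr1 ger0_norm.
Qed.

(** Jensen's inequality for the doubly stochastic matrix [Q]. *)
Lemma Q_contract v : \sum_i (\sum_j Q i j * v j) ^+ 2 <= \sum_j v j ^+ 2.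
Proof.
have h i : (\sum_j Q i j * v j) ^+ 2 <= \sum_j Q i j * v j ^+ 2.
  have H c : 0 <= \sum_j Q i j * v j ^+ 2 - 2 * c * (\sum_j Q i j * v j) +
      c ^+ 2 * \sum_j Q i j.
    rewrite !mulr_sumr -sumrB -big_split/=; apply: sumr_ge0 => j _.
    have -> : Q i j * v j ^+ 2 - 2 * c * (Q i j * v j) + c ^+ 2 * Q i j =
      Q i j * (v j - c) ^+ 2 by ring.
    by rewrite mulr_ge0// sqr_ge0.
  by have := H (\sum_j Q i j * v j); rewrite Q_row; lra.
apply: le_trans (ler_sum _ (fun i _ => h i)) _.
rewrite exchange_big/=; apply: ler_sum => j _.
by rewrite -mulr_suml Q_col mul1r.
Qed.

Lemma Q_bilin v w : `|\sum_i \sum_j Q i j * (v i * w j)| <=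
  (\sum_i v i ^+ 2 + \sum_i w i ^+ 2) / 2.
Proof.
rewrite (le_trans (ler_norm_sum _ _ _))//.
apply: (@le_trans _ _ (\sum_i \sum_j Q i j * ((v i ^+ 2 + w j ^+ 2) / 2))).
  apply: ler_sum => i _; rewrite (le_trans (ler_norm_sum _ _ _))//.
  apply: ler_sum => j _; rewrite normrM ger0_norm// ler_wpM2l// normrM.
  rewrite -(@real_normK _ (v i)) ?num_real// -(@real_normK _ (w j)) ?num_real//.
  by have := sqr_ge0 (`|v i| - `|w j|); lra.
have E : \sum_i \sum_j Q i j * ((v i ^+ 2 + w j ^+ 2) / 2) =
   \sum_i \sum_j Q i j * (v i ^+ 2 / 2) + \sum_i \sum_j Q i j * (w j ^+ 2 / 2).
  rewrite -big_split/=; apply: eq_bigr => i _; rewrite -big_split/=.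
  by apply: eq_bigr => j _; ring.
rewrite E [X in _ + X]exchange_big/= mulrDl !mulr_suml lerD//.
  by apply: ler_sum => i _; rewrite -mulr_suml Q_row mul1r.
by apply: ler_sum => i _; rewrite -mulr_suml Q_col mul1r.
Qed.

Lemma flip_diff_tanh th x i j : 0 <= th ->
  `|flip_diff i (fun x => y th x j) x| <= th * Q j i.
Proof.
move=> th0; apply: norm_flip_diff; rewrite (le_trans (tanh_lip _ _))//.
rewrite -mulrBr field_diff normrM ger0_norm// [`|2 * _|]ger0_norm ?mulr_ge0//.
by rewrite mulrCA.
Qed.

Lemma flip_diff_spin x i j :
  flip_diff i (fun x => spin x j) x = (j == i)%:R :> R.
Proof. by rewrite /flip_diff !spin_set; case: eqP => _ /=; lra. Qed.

(** Integrating by parts against the statistic itself: changing spin [i] moves it by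
    [w i] directly, and through the conditional means by at most [th] times the
    bilinear form of [Q]. *)
Lemma linear_stat_sqr th w : 0 <= th ->
  gibbs th Q (fun x => (\sum_j w j * (spin x j - y th x j)) ^+ 2) <=
  (1 + th) * \sum_j w j ^+ 2.
Proof.
move=> th0; pose G x := \sum_j w j * (spin x j - y th x j).
have E x : G x ^+ 2 = \sum_i (spin x i - y th x i) * (w i * G x).
  rewrite expr2 {1}/G mulr_suml; apply: eq_bigr => i _; ring.
rewrite (gibbs_ext _ _ E).
apply: le_trans (ler_norm _) _; apply: le_trans (gibbs_ibp_le Q_sym Q_diag _ _) _.
apply: gibbs_le_cst => x.
have h i : `|flip_diff i (fun x => w i * G x) x| <=
    w i ^+ 2 + th * \sum_j Q i j * (`|w i| * `|w j|).
  rewrite (flip_diff_mul_indep (F := fun=> w i))// normrM.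
  have -> : w i ^+ 2 = `|w i| * `|w i| by rewrite -expr2 real_normK ?num_real.
  have -> : th * (\sum_j Q i j * (`|w i| * `|w j|)) =
      `|w i| * \sum_j `|w j| * (th * Q j i).
    by rewrite !mulr_sumr; apply: eq_bigr => j _; rewrite (Q_sym j i); ring.
  rewrite -mulrDr ler_wpM2l// /G flip_diff_sum.
  have -> : \sum_j flip_diff i (fun x0 => w j * (spin x0 j - y th x0 j)) x =
      w i - \sum_j w j * flip_diff i (fun x0 => y th x0 j) x.
    transitivity (\sum_j (w j * (j == i)%:R - w j * flip_diff i (fun x0 => y th x0 j) x)).
      apply: eq_bigr => j _; rewrite (flip_diff_mul_indep (F := fun=> w j))//.
      by rewrite flip_diffB flip_diff_spin mulrBr.
    rewrite sumrB (bigD1 i)//= eqxx mulr1 big1 ?addr0// => j /negbTE ->.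
    by rewrite mulr0.
  rewrite (le_trans (ler_normB _ _))// lerD2l (le_trans (ler_norm_sum _ _ _))//.
  by apply: ler_sum => j _; rewrite normrM ler_wpM2l// flip_diff_tanh.
apply: le_trans (ler_sum _ (fun i _ => h i)) _.
rewrite big_split/= -mulr_sumr mulrDl mul1r lerD2l ler_wpM2l//.
apply: le_trans (ler_norm _) _; apply: le_trans (Q_bilin _ _) _.
have -> : \sum_i `|w i| ^+ 2 = \sum_j w j ^+ 2.
  by apply: eq_bigr => i _; rewrite real_normK ?num_real.
lra.
Qed.

Lemma sum_sqr_Q_le : (0 < n)%N -> \sum_i \sum_j Q i j ^+ 2 <= K.
Proof.
move=> n0; have n0' : n%:R != 0 :> R by rewrite pnatr_eq0 -lt0n.
apply: (@le_trans _ _ (\sum_(i < n) \sum_(j < n) Q i j * (K / n%:R))).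
  by apply: ler_sum => i _; apply: ler_sum => j _; rewrite expr2 ler_wpM2l.
under eq_bigr do rewrite -mulr_suml Q_row mul1r.
by rewrite sumr_const card_ord -[_ *+ n]mulr_natr divfK.
Qed.

(** Each residual is a linear statistic with weights a row of [Q], whose squared norm
    is [O(1 / n)]. *)
Lemma residual_sqr th : (0 < n)%N -> 0 <= th ->
  gibbs th Q (fun x => \sum_i residual th x i ^+ 2) <= (1 + th) * K.
Proof.
move=> n0 th0; rewrite gibbs_sum.
apply: (@le_trans _ _ (\sum_i (1 + th) * \sum_j Q i j ^+ 2)).
  by apply: ler_sum => i _; exact: linear_stat_sqr.
by rewrite -mulr_sumr ler_wpM2l ?sum_sqr_Q_le// addr_ge0.
Qed.

Lemma scoreE th x : score th x = quad Q x - \sum_i t x i * y th x i.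
Proof. by rewrite /score quadE -sumrB; apply: eq_bigr => i _; ring. Qed.

Lemma flip_diff_quad x i : flip_diff i (quad Q) x = 2 * t x i.
Proof. by rewrite /flip_diff quad_diff//; lra. Qed.

Lemma flip_diff_field_tanh th x i j : 0 <= th ->
  `|flip_diff i (fun x => t x j * y th x j) x| <= (1 + th) * Q j i.
Proof.
move=> th0; apply: norm_flip_diff.
set xp := set_spin x i true; set xm := set_spin x i false.
have -> : t xp j * y th xp j - t xm j * y th xm j =
  (t xp j - t xm j) * y th xp j + t xm j * (y th xp j - y th xm j) by ring.
have tp := norm_tanh_le1 (th * t xp j).
have tm := norm_field_le1 xm j.
have d1 : `|t xp j - t xm j| <= 2 * Q j i.
  by rewrite field_diff ger0_norm ?mulr_ge0.
have d2 : `|y th xp j - y th xm j| <= th * (2 * Q j i).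
  by rewrite (le_trans (tanh_lip _ _))// -mulrBr normrM ger0_norm// ler_wpM2l.
rewrite (le_trans (ler_normD _ _))// [X in X + _]normrM [X in _ + X]normrM.
have -> : 2 * ((1 + th) * Q j i) = 2 * Q j i * 1 + 1 * (th * (2 * Q j i)) by ring.
by rewrite lerD// ler_pM.
Qed.

Lemma score_sqr th : 0 <= th ->
  gibbs th Q (fun x => score th x ^+ 2) <= (3 + th) * n%:R.
Proof.
move=> th0.
have E x : score th x ^+ 2 =
    \sum_i (spin x i - y th x i) * (t x i * score th x).
  rewrite expr2 {1}/score mulr_suml; apply: eq_bigr => i _; ring.
rewrite (gibbs_ext _ _ E).
apply: le_trans (ler_norm _) _; apply: le_trans (gibbs_ibp_le Q_sym Q_diag _ _) _.
apply: gibbs_le_cst => x.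
have -> : (3 + th) * n%:R = \sum_(i < n) (3 + th).
  by rewrite sumr_const card_ord mulr_natr.
apply: ler_sum => i _.
rewrite (flip_diff_mul_indep (F := t^~ i)) ?field_set// normrM.
have t1 := norm_field_le1 x i.
rewrite (le_trans (ler_wpM2r _ t1))// mul1r.
have -> : flip_diff i (score th) x = flip_diff i (fun x => quad Q x - \sum_i t x i * y th x i) x.
  by rewrite /flip_diff !scoreE.
rewrite flip_diffB flip_diff_quad flip_diff_sum (le_trans (ler_normB _ _))//.
have -> : 3 + th = 2 + (1 + th) by ring.
rewrite lerD//; first by rewrite normrM ger0_norm// -[leRHS]mulr1 ler_wpM2l.
apply: le_trans (ler_norm_sum _ _ _) _.
apply: le_trans (ler_sum _ (fun j _ => flip_diff_field_tanh x i j th0)) _.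
by rewrite -mulr_sumr Q_col mulr1.
Qed.

Lemma gibbs_score th : gibbs th Q (score th) = 0.
Proof.
rewrite gibbs_sum big1// => i _; rewrite gibbs_ibp//.
rewrite (gibbs_ext _ _ (G := fun=> 0)) ?gibbs_cst// => x.
by rewrite /flip_diff !field_set// subrr mul0r mulr0.
Qed.

End second_moments.

(** * The log-partition function and the energy *)

Section finite_sums.
Context {R : realType}.

Lemma is_derive_bigsum (I : Type) (r : seq I) (f : I -> R -> R) (df : I -> R) (x : R) :
  (forall i, is_derive x 1 (f i) (df i)) ->
  is_derive x 1 (fun y => \sum_(i <- r) f i y) (\sum_(i <- r) df i).
Proof.
move=> fd; elim: r => [|i r IH].
  apply: (is_derive_congr _ _ _ _ _ (is_derive_cst (0 : R) x 1)) => [y|]; by rewrite big_nil.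
apply: (is_derive_congr _ _ _ _ _ (is_deriveD (fd i) IH)) => [y|]; by rewrite big_cons.
Qed.

Lemma sum_abs_le (I : finType) (v : I -> R) (c : R) : 0 < c ->
  \sum_i `|v i| <= (\sum_i v i ^+ 2) / (2 * c) + c / 2 * #|I|%:R.
Proof.
move=> c0; have -> : c / 2 * #|I|%:R = \sum_(i : I) c / 2.
  by rewrite sumr_const mulr_natr.
rewrite mulr_suml -big_split/=; apply: ler_sum => i _.
rewrite -real_normK ?num_real// -subr_ge0.
have -> : `|v i| ^+ 2 / (2 * c) + c / 2 - `|v i| = (`|v i| - c) ^+ 2 / (2 * c).
  by field; rewrite gt_eqF.
by rewrite divr_ge0 ?sqr_ge0// mulr_ge0// ltW.
Qed.

End finite_sums.

(** The standing assumptions on the interaction, for one matrix. *)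
Record coupling {R : realType} (K : R) {n : nat} (Q : 'M[R]_n) : Prop := Coupling {
  coupling_n0 : (0 < n)%N;
  coupling_sym : forall i j, Q i j = Q j i;
  coupling_ge0 : forall i j, 0 <= Q i j;
  coupling_diag : forall i, Q i i = 0;
  coupling_row : forall i, \sum_j Q i j = 1;
  coupling_le : forall i j, Q i j <= K / n%:R }.

Section energy.
Context {R : realType} {n : nat} (Q : 'M[R]_n) (K : R).
Hypothesis QK : coupling K Q.
Implicit Types (th : R) (x : config n) (F G H : config n -> R) (v w : 'I_n -> R).

Notation t := (field_at Q).
Notation y th x i := (tanh (th * t x i)).
Let Q_sym := coupling_sym QK.
Let Q_ge0 := coupling_ge0 QK.
Let Q_diag := coupling_diag QK.
Let Q_row := coupling_row QK.
Let Q_le := coupling_le QK.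
Let n_gt0 := coupling_n0 QK.

Lemma K_ge0 : 0 <= K.
Proof.
have := Q_le (Ordinal n_gt0) (Ordinal n_gt0).
by rewrite Q_diag pmulr_lge0// invr_gt0 ltr0n.
Qed.

(** How far a local field exceeds, or falls short of, the magnetization in absolute
    value. *)
Definition excess m x i : R := Num.max 0 (`|t x i| - m).
Definition deficit m x i : R := Num.max 0 (m - `|t x i|).

Lemma excess_ge0 m x i : 0 <= excess m x i.
Proof. by rewrite /excess le_max lexx. Qed.

Lemma deficit_ge0 m x i : 0 <= deficit m x i.
Proof. by rewrite /deficit le_max lexx. Qed.

Lemma tanh_norm (u : R) : `|tanh u| = tanh `|u|.
Proof.
have [u0|/ltW u0] := leP 0 u; first by rewrite !ger0_norm ?tanh_ge0.
by rewrite [in RHS]ler0_norm// tanhN ler0_norm// -oppr_ge0 -tanhN tanh_ge0// oppr_ge0.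
Qed.

Lemma norm_y th x i : 0 <= th -> `|y th x i| = tanh (th * `|t x i|).
Proof. by move=> th0; rewrite tanh_norm normrM ger0_norm. Qed.

Section fixed_temperature.
Context (th m : R) (th_gt0 : 0 < th) (mP : curie_weiss_root th m).
Let rho := th * (1 - m ^+ 2).
Let m_gt0 : 0 < m := mP.1.
Let m_lt1 : m < 1 := root_lt1 _ _ mP.

Lemma slope_ge0 : 0 <= rho.
Proof. by rewrite /rho mulr_ge0 ?ltW// subr_gt0 expr_lt1// ltW. Qed.

Let rho_lt1 : rho < 1 := root_slope_lt1 _ _ th_gt0 mP.
Let rho_ge0 := slope_ge0.

Lemma norm_y_le x i : `|y th x i| <= m + rho * excess m x i.
Proof. by rewrite norm_y; [exact: tanh_root_le|exact: ltW]. Qed.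

Lemma excess_le1 x i : excess m x i <= 1.
Proof.
rewrite /excess ge_max ler01/=; have := @norm_field_le1 _ _ Q Q_ge0 Q_row x i.
by move=> h; rewrite (le_trans _ h)// gerBl ltW.
Qed.

(** A maximum principle: up to the residual, local fields solve the
    mean-field equation, whose solutions are bounded by [m]. *)
Lemma excess_sqr x :
  (1 - rho) ^+ 2 * \sum_i excess m x i ^+ 2 <= \sum_i residual Q th x i ^+ 2.
Proof.
pose a := excess m x; pose r := residual Q th x.
(* The tangent bound for tanh, averaged over the rows of Q. *)
have key i : a i <= `|r i| + rho * \sum_j Q i j * a j.
  have sQ : 0 <= \sum_j Q i j * a j.
    by apply: sumr_ge0 => j _; rewrite mulr_ge0// excess_ge0.
  have rQ := mulr_ge0 rho_ge0 sQ.
  rewrite /a {1}/excess ge_max (addr_ge0 (normr_ge0 _) rQ)/=.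
  have tE : t x i = \sum_j Q i j * y th x j + r i.
    rewrite /r /residual -big_split/=; apply: eq_bigr => j _; ring.
  rewrite lerBlDr {1}tE (le_trans (ler_normD _ _))// addrC -addrA lerD2l.
  rewrite (le_trans (ler_norm_sum _ _ _))//.
  have -> : rho * (\sum_j Q i j * a j) + m = \sum_j Q i j * (m + rho * a j).
    under [RHS]eq_bigr do rewrite mulrDr.
    rewrite big_split/= -mulr_suml Q_row mul1r addrC mulr_sumr; congr (_ + _).
    by apply: eq_bigr => j _; rewrite mulrCA.
  by apply: ler_sum => j _; rewrite normrM ger0_norm// ler_wpM2l// norm_y_le.
have ar : \sum_i a i ^+ 2 <= \sum_i a i * `|r i| + rho * \sum_i a i ^+ 2.
  apply: (@le_trans _ _ (\sum_i (a i * `|r i| + rho * \sum_j Q i j * (a i * a j)))).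
    apply: ler_sum => i _.
    have -> : a i * `|r i| + rho * (\sum_j Q i j * (a i * a j)) =
        a i * (`|r i| + rho * \sum_j Q i j * a j).
      rewrite mulrDr !mulr_sumr; congr (_ + _); apply: eq_bigr => j _; ring.
    by rewrite expr2 ler_wpM2l// excess_ge0.
  rewrite big_split/= lerD2l -mulr_sumr ler_wpM2l//.
  apply: le_trans (ler_norm _) _; apply: le_trans (Q_bilin Q_sym Q_ge0 Q_row _ _) _.
  by lra.
have ar2 : (1 - rho) * \sum_i a i * `|r i| <=
    ((1 - rho) ^+ 2 * \sum_i a i ^+ 2 + \sum_i r i ^+ 2) / 2.
  rewrite !mulr_sumr -big_split/= mulr_suml; apply: ler_sum => i _.
  rewrite -(@real_normK _ (r i)) ?num_real//.
  by have := sqr_ge0 ((1 - rho) * a i - `|r i|); lra.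
have c0 : 0 < 1 - rho by rewrite subr_gt0.
have : (1 - rho) * \sum_i a i ^+ 2 <= \sum_i a i * `|r i| by lra.
rewrite -(ler_pM2l c0) -/a -/r.
move: ar2; move: (\sum_i a i ^+ 2) (\sum_i a i * _) (\sum_i r i ^+ 2) => A B C.
move=> *; lra.
Qed.

(** Fields below [m] are penalized linearly by [m]; this is what forces nearly
    maximal energy to have few small fields. *)
Lemma field_tanh_ub x i :
  t x i * y th x i <= m ^+ 2 + 3 * excess m x i - m * deficit m x i.
Proof.
apply: le_trans (ler_norm _) _; rewrite normrM.
have h1 := norm_y_le x i; have a1 := excess_le1 x i; have a0 := excess_ge0 m x i.
have y0 : 0 <= `|y th x i| by [].
move: h1 y0; move: `|y th x i| => Y h1 Y0.
rewrite /deficit; have [tm|tm] := leP `|t x i| m.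
  rewrite max_r ?subr_ge0//.
  have a00 : excess m x i = 0 by rewrite /excess max_l// subr_le0.
  move: h1; rewrite a00 !mulr0 !addr0 => h1.
  have := ler_wpM2l (normr_ge0 (t x i)) h1; lra.
rewrite max_l; last by rewrite subr_le0 ltW.
rewrite mulr0 subr0.
have aE : `|t x i| = m + excess m x i by rewrite /excess max_r; [lra|rewrite subr_ge0 ltW].
rewrite aE; move: (excess m x i) a1 a0 h1 => a a1 a0 h1.
have := ler_wpM2l (addr_ge0 (ltW m_gt0) a0) h1.
have : rho * a <= a by rewrite ler_piMl// ltW.
have : m * a <= a by rewrite ler_piMl// ltW.
have : a * a <= a by rewrite ler_piMl.
have ra : rho * a <= a by rewrite ler_piMl// ltW.
have : m * (rho * a) <= a by apply: (le_trans (ler_wpM2l (ltW m_gt0) ra)); rewrite ler_piMl// ltW.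
have : a * (rho * a) <= a by apply: (le_trans (ler_wpM2l a0 ra)); rewrite ler_piMl.
lra.
Qed.

Lemma field_tanh_sum_ub (e : R) x : 0 < e ->
  \sum_i t x i * y th x i <=
  n%:R * (m ^+ 2 + e) + 9 / (4 * e) * (\sum_i residual Q th x i ^+ 2) / (1 - rho) ^+ 2.
Proof.
move=> e0; have c0 : 0 < (1 - rho) ^+ 2 by rewrite exprn_gt0// subr_gt0.
apply: (@le_trans _ _ (\sum_i (m ^+ 2 + e + 9 / (4 * e) * excess m x i ^+ 2))).
  apply: ler_sum => i _; apply: le_trans (field_tanh_ub x i) _.
  have : 0 <= m * deficit m x i by rewrite mulr_ge0 ?deficit_ge0// ltW.
  have : 3 * excess m x i <= e + 9 / (4 * e) * excess m x i ^+ 2.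
    rewrite -subr_ge0.
    have -> : e + 9 / (4 * e) * excess m x i ^+ 2 - 3 * excess m x i =
      (3 * excess m x i - 2 * e) ^+ 2 / (4 * e) by field; rewrite gt_eqF.
    by rewrite divr_ge0 ?sqr_ge0// mulr_ge0// ltW.
  lra.
rewrite big_split/= sumr_const card_ord -[_ *+ n]mulr_natl lerD2l -mulr_sumr.
have e4 : 0 <= 9 / (4 * e) by rewrite divr_ge0// mulr_ge0// ltW.
rewrite -[leRHS]mulrA ler_wpM2l//.
by rewrite ler_pdivlMr// mulrC excess_sqr.
Qed.

(** The energy has the same mean as [\sum_i t i * tanh (th * t i)], because the score is
    centred; the parameter [e] splits the excesses by Young's inequality. *)
Lemma gibbs_quad_ub (e : R) : 0 < e ->
  gibbs th Q (quad Q) <=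
  n%:R * (m ^+ 2 + e) + 9 / (4 * e) * ((1 + th) * K) / (1 - rho) ^+ 2.
Proof.
move=> e0.
have -> : gibbs th Q (quad Q) = gibbs th Q (fun x => \sum_i t x i * y th x i).
  apply/eqP; rewrite -subr_eq0 -gibbsB.
  rewrite (gibbs_ext _ _ (fun x => esym (scoreE Q th x))) gibbs_score//.
apply: le_trans (gibbs_le _ _ (fun x => field_tanh_sum_ub x e0)) _.
rewrite gibbsD gibbs_cst lerD2l.
rewrite (@gibbs_ext _ _ _ _ _ (fun x => (9 / (4 * e) / (1 - rho) ^+ 2) *
    \sum_i residual Q th x i ^+ 2)); last by move=> x; ring.
have e4 : 0 <= 9 / (4 * e) by rewrite divr_ge0// mulr_ge0// ltW.
rewrite gibbsZ mulrAC ler_wpM2r ?invr_ge0 ?sqr_ge0// ler_wpM2l//.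
by apply: residual_sqr => //; exact: ltW.
Qed.

End fixed_temperature.
End energy.

Section partition_function.
Context {R : realType} {n : nat} (Q : 'M[R]_n).
Implicit Types (th s : R) (x : config n) (F G H : config n -> R).

Lemma ising_pmf_shift th s x : ising_pmf (th + s) Q x =
  ising_pmf th Q x * expR (s / 2 * quad Q x) *
  expR (- (log_partition (th + s) Q - log_partition th Q)).
Proof.
by rewrite /ising_pmf -!expRD; congr expR; rewrite [(th + s) / 2]mulrDl; ring.
Qed.

Lemma gibbs_shift th s F : gibbs (th + s) Q F =
  gibbs th Q (fun x => F x * expR (s / 2 * quad Q x)) *
  expR (- (log_partition (th + s) Q - log_partition th Q)).
Proof.
by rewrite /gibbs mulr_suml; apply: eq_bigr => x _; rewrite ising_pmf_shift; ring.
Qed.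

Lemma gibbs_expR_quad th s : gibbs th Q (fun x => expR (s / 2 * quad Q x)) =
  expR (log_partition (th + s) Q - log_partition th Q).
Proof.
have := gibbs_shift th s (fun=> 1); rewrite gibbs_cst.
rewrite (@gibbs_ext _ _ _ _ _ (fun x => expR (s / 2 * quad Q x))); last first.
  by move=> x; rewrite mul1r.
rewrite expRN => /(congr1 ( *%R^~ (expR (log_partition (th + s) Q - log_partition th Q)))).
by rewrite mul1r divfK ?gt_eqF ?expR_gt0// => ->.
Qed.

Lemma log_partition0 : log_partition 0 Q = n%:R * ln 2.
Proof.
rewrite /log_partition; under eq_bigr do rewrite !mul0r expR0.
rewrite sumr_const card_ffun card_bool card_ord natrX lnXn// mulr_natl//.
Qed.

Lemma is_derive_log_partition th :
  is_derive th 1 (fun s => log_partition s Q) (gibbs th Q (quad Q) / 2).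
Proof.
have dl (c a : R) : is_derive a 1 (fun y : R => y / 2 * c) (c / 2).
  apply: (is_derive_congr _ _ _ _ _ (is_deriveZ (c / 2) (is_derive_id a 1))) => [y|].
    by rewrite /= /GRing.scale/=; change (c / 2 * y = y / 2 * c); ring.
  by rewrite /GRing.scale/= mulr1.
have de x (a : R) := @is_derive1_comp _ expR (fun y => y / 2 * quad Q x) a _ _
  (is_derive_expR _) (dl (quad Q x) a).
have ds := @is_derive_bigsum R _ (index_enum (config n))
  (fun x y => expR (y / 2 * quad Q x)) _ th (fun x => de x th).
have dln := @is_derive1_comp _ (@ln R) _ th _ _ (@is_derive1_ln R _ (partition_gt0 th Q)) ds.
apply: (is_derive_congr _ _ _ _ _ dln) => //.
rewrite /gibbs mulr_suml mulr_sumr; apply: eq_bigr => x _.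
by rewrite ising_pmfE; ring.
Qed.

(** Raising the inverse temperature tilts the measure by an increasing function of
    the energy, so Chebyshev's association inequality applies. *)
Lemma gibbs_quad_lt th s : 0 < s -> (exists x, quad Q x != gibbs th Q (quad Q)) ->
  gibbs th Q (quad Q) < gibbs (th + s) Q (quad Q).
Proof.
move=> s0 [x0 x0E]; set c := gibbs th Q (quad Q) in x0E *.
rewrite -subr_gt0 -{1}(gibbs_cst (th + s) Q c) -gibbsB gibbs_shift mulr_gt0 ?expR_gt0//.
have h : gibbs th Q (fun x => (quad Q x - c) * expR (s / 2 * c)) = 0.
  rewrite (@gibbs_ext _ _ _ _ _ (fun x => expR (s / 2 * c) * (quad Q x - c))).
    by rewrite gibbsZ gibbsB gibbs_cst subrr mulr0.
  by move=> x; rewrite mulrC.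
rewrite -[X in 0 < X]subr0 -[X in _ - X]h -gibbsB.
have pos x : 0 <= (quad Q x - c) * expR (s / 2 * quad Q x) -
    (quad Q x - c) * expR (s / 2 * c).
  rewrite -mulrBr; have [cx|cx] := leP c (quad Q x).
    by rewrite mulr_ge0 ?subr_ge0// ler_expR ler_wpM2l// divr_ge0// ltW.
  rewrite mulr_le0// ?subr_le0 1?ltW// ltr_expR ltr_pM2l// divr_gt0//.
rewrite /gibbs (bigD1 x0)//= ltr_pwDl//; last first.
  by apply: sumr_ge0 => x _; rewrite mulr_ge0// ltW// ising_pmf_gt0.
rewrite mulr_gt0 ?ising_pmf_gt0// lt0r pos andbT -mulrBr mulf_neq0 ?subr_eq0//.
apply: contra x0E => /eqP /expR_inj E; apply/eqP.
have s20 : s / 2 != 0 by rewrite gt_eqF// divr_gt0.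
exact: (mulfI s20 E).
Qed.

Lemma gibbs_quad_mono th th' : th <= th' ->
  gibbs th Q (quad Q) <= gibbs th' Q (quad Q).
Proof.
rewrite le_eqVlt => /predU1P[->//|tt'].
have [h|h] := pselect (exists x, quad Q x != gibbs th Q (quad Q)).
  apply: ltW; have := @gibbs_quad_lt th (th' - th) _ h.
  by rewrite subr_gt0 addrC subrK => ->.
have E x : quad Q x = gibbs th Q (quad Q).
  by apply/eqP; apply: contra_notT h => ?; exists x.
by rewrite (gibbs_ext th' _ E) gibbs_cst.
Qed.

End partition_function.

(** The Gibbs variational principle with the product measure of mean
    [tanh u]. *)
Section product_measure.
Context {R : realType} {n : nat} (Q : 'M[R]_n) (K : R).
Hypothesis QK : coupling K Q.
Variable u : R.

Let Q_sym := coupling_sym QK.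
Let Q_diag := coupling_diag QK.
Let Q_row := coupling_row QK.

Let w (x : config n) : R := expR (u * \sum_i spin x i - n%:R * log2cosh u).

Lemma product_mass : \sum_x w x = 1.
Proof.
rewrite /w; under eq_bigr do rewrite expRD.
rewrite -mulr_suml.
have -> : \sum_(x : config n) expR (u * \sum_i spin x i) =
    \prod_(i < n) \sum_(b : bool) expR (u * (if b then 1 else -1)).
  rewrite bigA_distr_bigA/=; apply: eq_bigr => x _.
  by rewrite mulr_sumr expR_sum.
under eq_bigr do rewrite big_bool/= mulr1 mulrN1.
rewrite prodr_const card_ord /log2cosh expRN expRM_natl lnK ?posrE ?expRDN_gt0//.
by rewrite divff// expf_neq0// gt_eqF// expRDN_gt0.
Qed.

Lemma product_ibp i F : F \in [set F : config n -> R | forall x b, F (set_spin x i b) = F x] ->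
  \sum_x w x * (spin x i * F x) = tanh u * \sum_x w x * F x.
Proof.
rewrite inE/= => FE; rewrite mulr_sumr (sum_flip i) [RHS](sum_flip i); congr (_ * _).
apply: eq_bigr => x _; rewrite !FE !spin_set eqxx /w.
have S b : \sum_j spin (set_spin x i b) j =
    (if b then 1 else -1) + \sum_(j | j != i) spin x j :> R.
  rewrite (bigD1 i)//= spin_set eqxx; congr (_ + _).
  by apply: eq_bigr => j ji; rewrite spin_set (negbTE ji).
rewrite !S; set T := \sum_(j | _) _; set N := n%:R * _.
have -> : u * (1 + T) - N = u + (u * T - N) by ring.
have -> : u * (-1 + T) - N = - u + (u * T - N) by ring.
rewrite (expRD u) (expRD (- u)) /tanh; have := @expRDN_gt0 R u.
move: (expR u) (expR (- u)) (expR _) => A B C AB.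
by field; rewrite gt_eqF.
Qed.

(** The variational principle is Jensen's inequality for the exponential, used as
    [1 + a <= expR a]. *)
Lemma log_partition_lb th :
  n%:R * (log2cosh u - u * tanh u + th / 2 * tanh u ^+ 2) <= log_partition th Q.
Proof.
set c := n%:R * _; pose A x := th / 2 * quad Q x - u * (\sum_i spin x i) + n%:R * log2cosh u.
have m1 i : \sum_x w x * spin x i = tanh u.
  have := @product_ibp i (fun=> 1); rewrite inE/= => /(_ (fun _ _ => erefl)).
  by under eq_bigr do rewrite mulr1; under [X in _ = _ * X]eq_bigr do rewrite mulr1;
    rewrite product_mass mulr1.
have mq : \sum_x w x * quad Q x = n%:R * tanh u ^+ 2.
  under eq_bigr do rewrite quadE mulr_sumr.
  have -> : n%:R * tanh u ^+ 2 = \sum_(i < n) tanh u ^+ 2.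
    by rewrite sumr_const card_ord mulr_natl.
  rewrite exchange_big/=.
  apply: eq_bigr => i _; rewrite product_ibp; last first.
    by rewrite inE/= => x b; rewrite field_set.
  rewrite expr2; congr (_ * _); under eq_bigr do rewrite /field_at mulr_sumr.
  rewrite exchange_big/= -[RHS]mul1r -(Q_row i) mulr_suml; apply: eq_bigr => j _.
  by rewrite -(m1 j) mulr_sumr; apply: eq_bigr => x _; ring.
have mA : \sum_x w x * A x = c.
  rewrite /A; under eq_bigr do rewrite mulrDr mulrBr.
  rewrite big_split/= sumrB -mulr_suml product_mass mul1r.
  have -> : \sum_x w x * (th / 2 * quad Q x) = th / 2 * (n%:R * tanh u ^+ 2).
    by rewrite -mq mulr_sumr; apply: eq_bigr => x _; ring.
  have -> : \sum_x w x * (u * \sum_i spin x i) = u * (n%:R * tanh u).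
    transitivity (\sum_i u * \sum_x w x * spin x i).
      under eq_bigr do rewrite mulrCA mulr_sumr mulr_sumr.
      by rewrite exchange_big/=; apply: eq_bigr => i _; rewrite mulr_sumr.
    by under eq_bigr do rewrite m1; rewrite sumr_const card_ord -[_ *+ n]mulr_natl; ring.
  by rewrite /c; ring.
rewrite -[c]expRK /log_partition ler_ln ?posrE ?expR_gt0 ?partition_gt0//.
have E x : expR (th / 2 * quad Q x) = w x * expR (A x).
  by rewrite /w -expRD; congr expR; rewrite /A; ring.
under eq_bigr do rewrite E.
have -> : expR c = \sum_x w x * (expR c * (1 + (A x - c))).
  transitivity (expR c * (\sum_x w x * A x + (1 - c) * \sum_x w x)).
    by rewrite mA product_mass; ring.
  by rewrite !mulr_sumr -big_split/= mulr_sumr; apply: eq_bigr => x _; ring.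
apply: ler_sum => x _; rewrite ler_wpM2l ?expR_ge0//.
have -> : expR (A x) = expR c * expR (A x - c) by rewrite -expRD addrC subrK.
by rewrite ler_wpM2l ?expR_ge0// expR_ge1Dx.
Qed.

End product_measure.

Section free_energy.
Context {R : realType} (K : R) (K_ge0 : 0 <= K).
Implicit Types (a b e s th : R).

(** The continuous function [cw_slope] attains its maximum on the compact interval. *)
Lemma cw_slope_gap a b : 1 < a -> a <= b ->
  exists2 r : R, 0 < r & forall s, a <= s <= b -> r <= 1 - cw_slope s.
Proof.
move=> a1 ab; have [|c] := @EVT_max R (@cw_slope R) a b ab.
  apply: derivable_within_continuous => s; rewrite in_itv/= => /andP[as_ _].
  have dm := is_derive_magnetization _ (lt_le_trans a1 as_).
  have d1 := is_deriveB (is_derive_cst (1 : R) s (1 : R)) (is_deriveM dm dm).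
  by have d2 := is_deriveM (is_derive_id s (1 : R)) d1; case: d2.
rewrite in_itv/= => /andP[ac cb] cmax; exists (1 - cw_slope c).
  by rewrite subr_gt0 cw_slope_lt1// (lt_le_trans a1).
by move=> s sab; rewrite lerD2l lerN2 cmax// in_itv.
Qed.

Lemma magnetization_sqr_lip a b : 1 < a -> a <= b ->
  exists2 L : R, 0 < L & forall s th, a <= s -> s <= th -> th <= b ->
    magnetization th ^+ 2 - magnetization s ^+ 2 <= L * (th - s).
Proof.
move=> a1 ab; have [r r0 rP] := cw_slope_gap a1 ab.
exists (2 / r) => [|s th as_ st tb]; first by rewrite divr_gt0.
have dm (x : R) : 1 < x -> is_derive x 1 (fun t => magnetization t ^+ 2 : R)
    (2 * magnetization x * (magnetization x * sigma2 x)).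
  move=> x1; have d := is_derive_magnetization _ x1.
  apply: (is_derive_congr _ _ _ _ _ (is_deriveM d d)) => [t|].
    by rewrite expr2.
  by rewrite /GRing.scale/=; ring.
have [c /andP[sc ct] ->] := @mean_value_on _ (fun t => magnetization t ^+ 2) _ _ _ st
  (fun x h => dm x (lt_le_trans (lt_le_trans a1 as_) (proj1 (andP h)))).
rewrite ler_wpM2r ?subr_ge0//.
have c1 : 1 < c by exact: lt_le_trans (lt_le_trans a1 as_) sc.
have := rP c; rewrite (le_trans as_ sc) (le_trans ct tb) => /(_ isT) rc.
have m0 := magnetization_gt0 _ c1; have m1 := magnetization_lt1 _ c1.
rewrite /sigma2 -/(cw_slope c) ler_pdivlMr//.
have -> : 2 * magnetization c * (magnetization c * ((1 - magnetization c ^+ 2) /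
    (1 - cw_slope c))) * r = 2 * (magnetization c ^+ 2 * (1 - magnetization c ^+ 2)) *
    (r / (1 - cw_slope c)) by ring.
have r1 : r / (1 - cw_slope c) <= 1.
  by rewrite ler_pdivrMr ?mul1r// (lt_le_trans r0).
have m21 : magnetization c ^+ 2 * (1 - magnetization c ^+ 2) <= 1.
  by move: (magnetization c) m0 m1 => m m0 m1; nra.
rewrite -mulrA -[leRHS]mulr1 ler_wpM2l//.
have m20 : 0 <= magnetization c ^+ 2 * (1 - magnetization c ^+ 2).
  by rewrite mulr_ge0 ?sqr_ge0// subr_ge0 expr_le1// ltW.
rewrite -[leRHS]mulr1 ler_pM// divr_ge0// ltW//; exact: lt_le_trans rc.
Qed.

Lemma log_partition_lb_pressure n (Q : 'M[R]_n) th : coupling K Q -> 1 < th ->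
  n%:R * cw_pressure th <= log_partition th Q.
Proof.
move=> QK th1; apply: le_trans (log_partition_lb QK (th * magnetization th) th).
rewrite ler_wpM2l ?ler0n// -magnetizationE// /cw_pressure.
by move: (log2cosh (th * magnetization th)) (magnetization th) => l m; lra.
Qed.

Lemma energy_integral_arith (N e1 Cb b t1 t X Y p1 p2 l : R) :
  0 <= N * e1 -> 0 <= Cb -> 0 <= t1 -> t1 <= b -> t <= b ->
  X - Y <= (N * e1 + Cb) / 2 * (t - t1) + (N * p1 - N * p2) ->
  Y <= N * l + t1 / 2 * (N * (e1 + e1) + Cb) -> N * l <= N * p2 ->
  X <= N * p1 + 2 * b * e1 * N + b * Cb.
Proof.
move=> q0 Cb0 t10 t1b tb h1 h2 h3.
have h4 := mulr_ge0 (_ : 0 <= b - t) (addr_ge0 q0 Cb0).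
have h5 := mulr_ge0 (_ : 0 <= b - t1) q0.
have h6 : 0 <= b - t by lra.
have h7 : 0 <= b - t1 by lra.
have h8 := mulr_ge0 (le_trans t10 t1b) q0.
have h9 := mulr_ge0 (le_trans t10 t1b) Cb0.
have {h4} := h4 h6; have {h5} := h5 h7; lra.
Qed.

Lemma chernoff_arith (N s e X Y C p1 p2 A B : R) :
  X <= N * p2 + s * e / 8 * N + C -> N * p1 <= Y ->
  N * (B / 2 * s) <= N * (p1 - p2) ->
  N * (s / 2) * (A - B) <= N * (s / 2) * (e / 2) ->
  X - Y + s / 2 * (N * A - e * N) <= C - s * e / 8 * N.
Proof. by move=> *; lra. Qed.

(** Integrating the energy bound in the inverse temperature, starting from the
    critical point where the magnetization is negligible. *)
Lemma log_partition_ub a b e : 1 < a -> a <= b -> 0 < e ->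
  exists2 C, 0 <= C & forall n (Q : 'M[R]_n), coupling K Q ->
    forall th, a <= th <= b ->
    log_partition th Q <= n%:R * cw_pressure th + e * n%:R + C.
Proof.
move=> a1 ab e0; have b0 : 0 < b by lra.
(* The interval is split at a temperature th1 close to the critical one: below it the
   energy is at most 2 * e1 per spin, above it the energy bound is integrated. *)
pose e1 := e / (2 * b); have e10 : 0 < e1 by rewrite divr_gt0// mulr_gt0.
have [th2 th21 m2] := magnetization_small _ e10.
pose th1 := Num.min th2 a.
have th11 : 1 < th1 by rewrite lt_min th21.
have th1a : th1 <= a by rewrite ge_min lexx orbT.
have m1 : magnetization th1 < e1.
  apply: le_lt_trans m2; have : th1 <= th2 by rewrite ge_min lexx.
  by rewrite le_eqVlt => /predU1P[->//|h]; rewrite ltW// magnetization_lt.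
have th1b : th1 <= b by exact: le_trans ab.
have [r r0 rP] := cw_slope_gap th11 th1b.
pose Cb := 9 / (4 * e1) * ((1 + b) * K) / r ^+ 2.
have e140 : 0 <= 9 / (4 * e1) by rewrite divr_ge0// mulr_ge0// ltW.
have Cb0 : 0 <= Cb.
  by rewrite !mulr_ge0 ?invr_ge0 ?sqr_ge0// ?addr_ge0// ltW// mulr_gt0.
have Vub n (Q : 'M[R]_n) s : coupling K Q -> th1 <= s <= b ->
    gibbs s Q (quad Q) <= n%:R * (magnetization s ^+ 2 + e1) + Cb.
  move=> QK /andP[s1 sb]; have s1' : 1 < s by exact: lt_le_trans s1.
  have s0 : 0 < s by exact: lt_trans s1'.
  apply: le_trans (gibbs_quad_ub QK s0 (magnetizationP _ s1') e10) _.
  rewrite lerD2l -/(cw_slope s).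
  have rs : r <= 1 - cw_slope s by apply: rP; rewrite s1 sb.
  apply: ler_pM.
  - by rewrite mulr_ge0// mulr_ge0// addr_ge0// ltW.
  - by rewrite invr_ge0 sqr_ge0.
  - by rewrite ler_wpM2l// ler_wpM2r// lerD2l.
  - rewrite lef_pV2 ?posrE ?exprn_gt0//; last exact: lt_le_trans rs.
    by rewrite ler_pXn2r// nnegrE ltW//; exact: lt_le_trans rs.
exists (b * Cb); first by rewrite mulr_ge0// ltW.
move=> n Q QK th /andP[ath thb]; have n0 : 0 <= n%:R :> R by [].
have th10 : 0 <= th1 by lra.
have [c /andP[c0 cth] E0] := mean_value _ _ _ _ th10 (@is_derive_log_partition _ _ Q).
have Z1 : log_partition th1 Q <= n%:R * ln 2 + th1 / 2 * (n%:R * (e1 + e1) + Cb).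
  rewrite log_partition0 subr0 in E0.
  have h1 := gibbs_quad_mono Q cth.
  have h2 := Vub n Q th1 QK; rewrite lexx th1b in h2.
  have m0 := magnetization_gt0 _ th11; have m1' := magnetization_lt1 _ th11.
  have h3 : magnetization th1 ^+ 2 + e1 <= e1 + e1.
    by rewrite lerD2r (le_trans _ (ltW m1))// expr2 ler_piMl// ltW.
  have h4 := le_trans (le_trans h1 (h2 isT)) (lerD (ler_wpM2l n0 h3) (lexx Cb)).
  have : gibbs c Q (quad Q) / 2 * th1 <= (n%:R * (e1 + e1) + Cb) / 2 * th1.
    by rewrite ler_wpM2r// ler_wpM2r// invr_ge0.
  by move: E0; move: (log_partition _ _) (ln 2) (gibbs c Q _); clear => X l g; lra.
have th1th : th1 <= th by exact: le_trans ath.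
pose F s := log_partition s Q - n%:R * cw_pressure s.
have dF s : th1 <= s <= th -> is_derive s 1 F
    (gibbs s Q (quad Q) / 2 - n%:R * (magnetization s ^+ 2 / 2)).
  move=> /andP[s1 _]; have s1' : 1 < s by exact: lt_le_trans s1.
  have d2 := is_deriveZ (n%:R : R) (is_derive_cw_pressure _ s1').
  exact: (is_derive_congr _ _ _ _ _ (is_deriveB (is_derive_log_partition Q s) d2)).
have [d /andP[d1 dth] EF] := mean_value_on _ _ _ _ th1th dF.
have hd := Vub n Q d QK; rewrite d1 (le_trans dth thb) in hd.
have FF : F th - F th1 <= (n%:R * e1 + Cb) / 2 * (th - th1).
  rewrite EF ler_wpM2r ?subr_ge0//; have := hd isT.
  by move: (gibbs d Q _) (magnetization d ^+ 2); clear => g mm; lra.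
have ne1 : 0 <= n%:R * e1 by rewrite mulr_ge0// ltW.
have -> : e * n%:R = 2 * b * e1 * n%:R by rewrite /e1; field; rewrite gt_eqF.
apply: (energy_integral_arith ne1 Cb0 th10 th1b thb _ Z1
  (ler_wpM2l n0 (cw_pressure_ge _ th11))).
by move: FF; rewrite /F; clear; lra.
Qed.

(** A Chernoff bound with tilt [- s]: the tilted free energy is controlled by
    [log_partition_ub], and [n * expR (- c * n)] is bounded. *)
Lemma low_energy_prob a b e : 1 < a -> a <= b -> 0 < e ->
  exists2 C, 0 <= C & forall n (Q : 'M[R]_n), coupling K Q ->
    forall th, a <= th <= b ->
    n%:R * gibbs th Q (fun x =>
      (quad Q x <= n%:R * magnetization th ^+ 2 - e * n%:R)%R%:R) <= C.
Proof.
move=> a1 ab e0; pose a' := (1 + a) / 2.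
have a'1 : 1 < a' by rewrite /a'; lra.
have a'a : a' < a by rewrite /a'; lra.
have a'b : a' <= b by lra.
have [L L0 LP] := magnetization_sqr_lip a'1 a'b.
(* Small enough for the quadratic error L * s in the expansion of the pressure to be
   beaten by the linear gain from the energy deficit. *)
pose s := Num.min (a - a') (e / (2 * L)).
have s0 : 0 < s by rewrite lt_min subr_gt0 a'a divr_gt0// mulr_gt0.
have sa : s <= a - a' by rewrite ge_min lexx.
have sL : L * s <= e / 2.
  have : s <= e / (2 * L) by rewrite ge_min lexx orbT.
  by rewrite ler_pdivlMr ?mulr_gt0//; lra.
have k0 : 0 < s * e / 8 by rewrite divr_gt0// mulr_gt0.
have [C C0 CP] := log_partition_ub a'1 a'b k0.
exists (expR C / (s * e / 8)) => [|n Q QK th /andP[ath thb]].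
  by rewrite divr_ge0 ?expR_ge0// ltW.
have th1 : 1 < th by lra.
have ths1 : 1 < th - s by lra.
set v := n%:R * _ - _.
have P1 : gibbs th Q (fun x => (quad Q x <= v)%R%:R) <=
    expR (log_partition (th - s) Q - log_partition th Q + s / 2 * v).
  rewrite expRD -gibbs_expR_quad mulrC -gibbsZ; apply: gibbs_le => x.
  rewrite -expRD; case: (boolP (quad Q x <= v)) => [h|_] /=; last exact: expR_ge0.
  rewrite (le_trans _ (expR_ge1Dx _))// lerDl.
  have -> : s / 2 * v + - s / 2 * quad Q x = s / 2 * (v - quad Q x) by ring.
  by rewrite mulr_ge0 ?subr_ge0// divr_ge0// ltW.
have n0 : 0 <= n%:R :> R by [].
have h1 := CP n Q QK (th - s); have h2 := log_partition_lb_pressure QK th1.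
have tss : th - s <= th by lra.
have [c /andP[sc ct] E] := mean_value_on _ _ _ _ tss
  (fun x h => is_derive_cw_pressure _ (lt_le_trans ths1 (proj1 (andP h)))).
have mc : magnetization (th - s) ^+ 2 <= magnetization c ^+ 2.
  have m0 := magnetization_gt0 _ ths1.
  move: sc; rewrite le_eqVlt => /predU1P[->//|sc].
  have := magnetization_lt _ _ ths1 sc => mm.
  by rewrite ler_pXn2r ?nnegrE ?ltW//; exact: lt_trans mm.
have h3 := LP (th - s) th.
have as_ : a' <= th - s by lra.
have {}h3 := h3 as_ tss thb.
rewrite as_/= in h1; have thsb : th - s <= b by lra.
have {}h1 := h1 thsb.
have ex : log_partition (th - s) Q - log_partition th Q + s / 2 * v <=
    C - s * e / 8 * n%:R.
  apply: (chernoff_arith h1 h2 (B := magnetization (th - s) ^+ 2)).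
    rewrite E ler_wpM2l//; have -> : th - (th - s) = s by ring.
    by rewrite ler_wpM2r ?(ltW s0)// ler_wpM2r// invr_ge0.
  have ns : 0 <= n%:R * (s / 2) by rewrite mulr_ge0// divr_ge0// ltW.
  rewrite ler_wpM2l// (le_trans h3)//.
  by have -> : th - (th - s) = s by ring.
apply: (@le_trans _ _ (n%:R * expR (C - s * e / 8 * n%:R))).
  by rewrite ler_wpM2l// (le_trans P1)// ler_expR.
rewrite expRD expRN ler_pdivlMr//.
have -> : n%:R * (expR C * (expR (s * e / 8 * n%:R))^-1) * (s * e / 8) =
  expR C * ((s * e / 8 * n%:R) / expR (s * e / 8 * n%:R)) by ring.
rewrite -[leRHS]mulr1 ler_wpM2l ?expR_ge0// ler_pdivrMr ?expR_gt0// mul1r.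
by apply: le_trans (expR_ge1Dx _); rewrite lerDr.
Qed.

End free_energy.

(** * Concentration around the two magnetized phases *)

(** A gap on the right only: eigenvalues near -1 do no harm, because the states of
    interest maximize the quadratic form. *)
Definition spectral_gap {R : realType} (d : R) {n : nat} (Q : 'M[R]_n) : Prop :=
  forall v : 'I_n -> R, \sum_i v i = 0 ->
  \sum_i \sum_j Q i j * (v i * v j) <= (1 - d) * \sum_i v i ^+ 2.

Section centered_sums.
Context {R : realType} {n : nat}.
Implicit Types (v w : 'I_n -> R).

Lemma sum_abs_le_sqr v c : 0 < c -> \sum_i v i ^+ 2 <= c ^+ 2 * n%:R ->
  \sum_i `|v i| <= c * n%:R.
Proof.
move=> c0 h; apply: le_trans (sum_abs_le v c0) _; rewrite card_ord.
have -> : c * n%:R = (c ^+ 2 * n%:R) / (2 * c) + c / 2 * n%:R.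
  by field; rewrite gt_eqF.
by rewrite lerD2r ler_wpM2r// invr_ge0 mulr_ge0// ltW.
Qed.

Lemma sum_cst (c : R) : \sum_(i < n) c = n%:R * c.
Proof. by rewrite sumr_const card_ord mulr_natl. Qed.

Lemma sum_center v : (0 < n)%N -> \sum_i (v i - n%:R^-1 * \sum_j v j) = 0.
Proof.
move=> n0; have n0' : n%:R != 0 :> R by rewrite pnatr_eq0 -lt0n.
by rewrite sumrB sum_cst mulrA mulfV// mul1r subrr.
Qed.

Lemma sum_sqr_center v : (0 < n)%N ->
  let c := n%:R^-1 * \sum_j v j in
  \sum_i v i ^+ 2 = n%:R * c ^+ 2 + \sum_i (v i - c) ^+ 2.
Proof.
move=> n0 c; have := sum_center v n0; rewrite -/c => h.
have -> : \sum_i v i ^+ 2 =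
    n%:R * c ^+ 2 + \sum_i (v i - c) ^+ 2 + 2 * c * \sum_i (v i - c).
  rewrite -sum_cst -big_split/= mulr_sumr -big_split/=.
  by apply: eq_bigr => i _; ring.
by rewrite h mulr0 addr0.
Qed.

Lemma sqr_add_le (a b : R) : (a + b) ^+ 2 <= 2 * a ^+ 2 + 2 * b ^+ 2.
Proof. by have := sqr_ge0 (a - b); lra. Qed.

End centered_sums.

Section alignment.
Context {R : realType} {n : nat} (Q : 'M[R]_n) (K d : R).
Hypothesis QK : coupling K Q.
Hypothesis d_gt0 : 0 < d.
Hypothesis Qd : spectral_gap d Q.
Implicit Types (x : config n) (v w : 'I_n -> R).

Notation t := (field_at Q).
Notation y th x i := (tanh (th * t x i)).
Notation r := (residual Q).
Let Q_sym := coupling_sym QK.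
Let Q_ge0 := coupling_ge0 QK.
Let Q_diag := coupling_diag QK.
Let Q_row := coupling_row QK.
Let Q_le := coupling_le QK.
Let n_gt0 := coupling_n0 QK.

Let nR0 : 0 < n%:R :> R. Proof. by rewrite ltr0n. Qed.
Let nN0 : n%:R != 0 :> R. Proof. by rewrite gt_eqF. Qed.

Lemma sum_Q v : \sum_i \sum_j Q i j * v j = \sum_j v j.
Proof.
rewrite exchange_big/=; apply: eq_bigr => j _.
by rewrite -mulr_suml (Q_col Q_sym Q_row) mul1r.
Qed.

Lemma sum_field x : \sum_i t x i = n%:R * mean_spin x.
Proof. by rewrite /field_at sum_Q mean_spinE mulrA mulfV// mul1r. Qed.

Lemma sum_spin x : \sum_i spin x i = n%:R * mean_spin x :> R.
Proof. by rewrite mean_spinE mulrA mulfV// mul1r. Qed.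

Lemma sum_field_center x : \sum_i (t x i - mean_spin x) = 0.
Proof. by rewrite sumrB sum_field sum_cst subrr. Qed.

Lemma norm_mean_le1 x : `|mean_spin x| <= 1 :> R.
Proof.
rewrite mean_spinE normrM ger0_norm ?invr_ge0// mulrC ler_pdivrMr// mul1r.
apply: le_trans (ler_norm_sum _ _ _) _.
by under eq_bigr do rewrite norm_spin; rewrite sum_cst mulr1.
Qed.

(** By the spectral gap the Dirichlet form of [Q] controls the variance. *)
Lemma dirichlet v (c := n%:R^-1 * \sum_j v j) :
  d * \sum_i (v i - c) ^+ 2 <=
  \sum_i v i ^+ 2 - \sum_i v i * (\sum_j Q i j * v j).
Proof.
have h := Qd (sum_center v n_gt0); rewrite -/c in h.
have E : \sum_i \sum_j Q i j * ((v i - c) * (v j - c)) =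
    \sum_i v i * (\sum_j Q i j * v j) - n%:R * c ^+ 2.
  have S : \sum_j v j = n%:R * c by rewrite /c mulrA mulfV// mul1r.
  transitivity (\sum_i (v i * (\sum_j Q i j * v j) - c * (\sum_j Q i j * v j) -
     (c * (v i - c)))).
    apply: eq_bigr => i _; rewrite !mulr_sumr -[c * (v i - c)]mulr1 -(Q_row i) mulr_sumr.
    by rewrite -!sumrB; apply: eq_bigr => j _; ring.
  rewrite !sumrB -mulr_sumr -mulr_sumr sum_Q sumrB S sum_cst; ring.
rewrite (sum_sqr_center v n_gt0) -/c; move: h; rewrite E; lra.
Qed.

Section fixed_temperature.
Context (th m : R) (th_gt0 : 0 < th) (mP : curie_weiss_root th m).
Let rho := th * (1 - m ^+ 2).
Let m_gt0 : 0 < m := mP.1.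
Let m_lt1 : m < 1 := root_lt1 _ _ mP.
Let mE : m = tanh (th * m) := mP.2.
Context (T m0 r0 : R).
Hypothesis (thT : th <= T) (m0_gt0 : 0 < m0) (m0m : m0 <= m).
Hypothesis (r0_gt0 : 0 < r0) (r0rho : r0 <= 1 - rho).

Let T_gt0 : 0 < T. Proof. exact: lt_le_trans thT. Qed.

Definition align_cst1 (T m0 r0 : R) := 1 / r0 + (1 + 3 / r0) / m0.
Definition align_cst2 (T m0 r0 : R) := (2 + 2 * T * align_cst1 T m0 r0) / d.
Definition align_cst (T m0 r0 : R) := 4 * align_cst2 T m0 r0 + 4 +
  2 * (align_cst2 T m0 r0 + 2 * T * align_cst1 T m0 r0).

(** Nearly maximal energy with small residual forces [`|t i|] close to [m] on average.
    Then both [\sum_i y i ^+ 2] and [\sum_i y i * (Q y) i], where [y = tanh (th * t)], are close to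
    [n * m ^+ 2], so the Dirichlet form of [y] is small and by the spectral gap [y] is nearly
    constant; the constant has absolute value close to [m], and its sign is [s]. *)
Lemma alignment x k : 0 < k -> k <= 1 ->
  \sum_i r th x i ^+ 2 <= k ^+ 2 * n%:R ->
  n%:R * m ^+ 2 - k * n%:R <= \sum_i t x i * y th x i ->
  exists2 s : R, s = 1 \/ s = -1 &
    \sum_i (t x i - s * m) ^+ 2 <= align_cst T m0 r0 * k * n%:R.
Proof.
move=> k0 k1 hr hty; pose N : R := n%:R; pose kn := k * N.
have kn0 : 0 < kn by rewrite mulr_gt0.
set C1 := align_cst1 T m0 r0; set C2 := align_cst2 T m0 r0.
have rho1 : 0 < 1 - rho by exact: lt_le_trans r0rho.
have sa : \sum_i excess Q m x i <= kn / r0.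
  have -> : \sum_i excess Q m x i = \sum_i `|excess Q m x i|.
    by apply: eq_bigr => i _; rewrite ger0_norm// excess_ge0.
  rewrite /kn mulrAC; apply: sum_abs_le_sqr; first by rewrite divr_gt0.
  have h := le_trans (excess_sqr QK th_gt0 mP x) hr.
  rewrite exprMn exprVn mulrAC ler_pdivlMr ?exprn_gt0// mulrC.
  apply: le_trans h; rewrite ler_wpM2r//; first by apply: sumr_ge0 => i _; rewrite sqr_ge0.
  by rewrite ler_pXn2r// nnegrE ltW.
have sb : \sum_i deficit Q m x i <= (1 + 3 / r0) / m0 * kn.
  have h : m * \sum_i deficit Q m x i <= kn + 3 * \sum_i excess Q m x i.
    have := ler_sum (index_enum 'I_n) (fun i (_ : true) => field_tanh_ub QK th_gt0 mP x i).
    rewrite sumrB big_split/= sum_cst -!mulr_sumr => /(le_trans hty).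
    by rewrite /kn /N; lra.
  have h2 : m0 * \sum_i deficit Q m x i <= (1 + 3 / r0) * kn.
    apply: (@le_trans _ _ (m * \sum_i deficit Q m x i)).
      by rewrite ler_wpM2r// sumr_ge0// => i _; exact: deficit_ge0.
    apply: (le_trans h); have -> : (1 + 3 / r0) * kn = kn + 3 * (kn / r0) by ring.
    by rewrite lerD2l ler_wpM2l.
  by rewrite mulrAC ler_pdivlMr// mulrC.
(* Excess and deficit are both O(k n): the fields have modulus close to m on average. *)
have sab : \sum_i `| `|t x i| - m | <= C1 * kn.
  have -> : C1 * kn = kn / r0 + (1 + 3 / r0) / m0 * kn.
    by rewrite /C1 /align_cst1; ring.
  apply: le_trans (lerD sa sb); rewrite -big_split/=; apply: ler_sum => i _.
  rewrite /excess /deficit; have [h|h] := leP m `|t x i|.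
    rewrite ger0_norm ?subr_ge0// max_r ?subr_ge0// lerDl.
    by rewrite le_max lexx.
  have -> : Num.max 0 (m - `|t x i|) = m - `|t x i|.
    by rewrite max_r// subr_ge0 ltW.
  by rewrite ltr0_norm ?subr_lt0// opprB lerDr le_max lexx.
have sy : \sum_i `|y th x i ^+ 2 - m ^+ 2| <= 2 * T * C1 * kn.
  apply: (@le_trans _ _ (\sum_i 2 * T * `| `|t x i| - m |)); last first.
    by rewrite -mulr_sumr -[leRHS]mulrA ler_wpM2l// mulr_ge0// ltW.
  apply: ler_sum => i _.
  have -> : y th x i ^+ 2 = tanh (th * `|t x i|) ^+ 2.
    by rewrite -norm_y ?(ltW th_gt0)// real_normK// num_real.
  rewrite {1}mE; apply: le_trans (sqr_tanh_lip _ _) _.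
  rewrite -mulrBr normrM (gtr0_norm th_gt0) -mulrA ler_wpM2l// ler_wpM2r//.
have sr : \sum_i `|r th x i| <= kn by exact: sum_abs_le_sqr.
pose c := n%:R^-1 * \sum_j y th x j.
have Qy i : \sum_j Q i j * y th x j = t x i - r th x i.
  rewrite /residual /field_at -sumrB; apply: eq_bigr => j _; ring.
(* The spectral gap, through the Dirichlet form of y. *)
have sv : \sum_i (y th x i - c) ^+ 2 <= C2 * kn.
  have := dirichlet (fun i => y th x i); rewrite -/c.
  under [X in _ - X]eq_bigr do rewrite Qy mulrBr.
  rewrite sumrB.
  have -> : \sum_i y th x i * t x i = \sum_i t x i * y th x i.
    by apply: eq_bigr => i _; rewrite mulrC.
  have h1 : \sum_i y th x i ^+ 2 <= N * m ^+ 2 + 2 * T * C1 * kn.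
    have -> : N * m ^+ 2 = \sum_(i < n) m ^+ 2 by rewrite sum_cst.
    rewrite -lerBlDl -sumrB; apply: le_trans sy.
    by apply: ler_sum => i _; exact: ler_norm.
  have h2 : \sum_i y th x i * r th x i <= kn.
    apply: le_trans sr; apply: ler_sum => i _; apply: le_trans (ler_norm _) _.
    by rewrite normrM ler_piMl// norm_tanh_le1.
  rewrite /C2 /align_cst2 -/C1 mulrAC ler_pdivlMr// mulrC => h.
  by apply: (le_trans h); move: h1 h2 hty; rewrite /kn -/N; lra.
have st : \sum_i (t x i - c) ^+ 2 <= (2 * C2 + 2) * kn.
  have E i : t x i - c = \sum_j Q i j * (y th x j - c) + r th x i.
    under eq_bigr do rewrite mulrBr.
    by rewrite sumrB Qy -mulr_suml Q_row mul1r; ring.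
  apply: (@le_trans _ _ (\sum_i (2 * (\sum_j Q i j * (y th x j - c)) ^+ 2 + 2 * r th x i ^+ 2))).
    by apply: ler_sum => i _; rewrite E; exact: sqr_add_le.
  rewrite big_split/= -!mulr_sumr.
  have h1 := le_trans (Q_contract Q_sym Q_ge0 Q_row (fun j => y th x j - c)) sv.
  have h2 : \sum_i r th x i ^+ 2 <= kn.
    apply: le_trans hr _; rewrite ler_wpM2r//.
    by rewrite expr2 ler_piMl// ltW.
  by move: h1 h2; lra.
(* The mean of the squares of y is close both to m ^+ 2 and to c ^+ 2. *)
have sc : `|N * (c ^+ 2 - m ^+ 2)| <= (C2 + 2 * T * C1) * kn.
  have -> : N * (c ^+ 2 - m ^+ 2) =
      \sum_i (y th x i ^+ 2 - m ^+ 2) - \sum_i (y th x i - c) ^+ 2.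
    by rewrite sumrB sum_cst (sum_sqr_center (fun i => y th x i) n_gt0) -/c -/N; ring.
  apply: le_trans (ler_normB _ _) _.
  rewrite addrC mulrDl lerD//.
    by rewrite ger0_norm// sumr_ge0// => i _; rewrite sqr_ge0.
  exact: le_trans (ler_norm_sum _ _ _) sy.
pose s : R := if 0 <= c then 1 else -1.
have ss : s * s = 1 by rewrite /s; case: ifP => _; ring.
have cs : c = s * `|c|.
  rewrite /s; case: leP => h; first by rewrite ger0_norm// mul1r.
  by rewrite ltr0_norm// mulrN mulN1r opprK.
exists s; first by rewrite /s; case: ifP; [left|right].
have sm : N * (c - s * m) ^+ 2 <= (C2 + 2 * T * C1) * kn.
  apply: le_trans sc; rewrite normrM gtr0_norm// ler_wpM2l//.
  rewrite cs -mulrBr exprMn (expr2 s) ss mul1r.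
  have -> : (s * `|c|) ^+ 2 - m ^+ 2 = (`|c| - m) * (`|c| + m).
    by rewrite exprMn (expr2 s) ss mul1r; ring.
  have -> : (`|c| - m) ^+ 2 = `| `|c| - m | * `| `|c| - m |.
    by rewrite -normrM -expr2 ger0_norm ?sqr_ge0.
  rewrite [X in _ <= X]normrM ler_wpM2l//.
  have c0 : 0 <= `|c| + m by rewrite addr_ge0// ltW.
  rewrite [X in _ <= X]ger0_norm//.
  by rewrite (le_trans (ler_normB _ _))// normr_id (gtr0_norm m_gt0).
apply: (@le_trans _ _ (\sum_i (2 * (t x i - c) ^+ 2 + 2 * (c - s * m) ^+ 2))).
  apply: ler_sum => i _; have -> : t x i - s * m = (t x i - c) + (c - s * m) by ring.
  exact: sqr_add_le.
rewrite big_split/= -mulr_sumr sum_cst -mulrA -/N -/kn /align_cst -/C1 -/C2.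
move: st sm; lra.
Qed.

Definition aligned (m e : R) x := exists2 s : R, s = 1 \/ s = -1 &
  `|mean_spin x - s * m| <= e /\ forall i, `|t x i - s * m| <= `|r th x i| + e.

(** One more application of [Q], whose entries are [O(1 / n)], turns closeness in mean
    square into closeness at every site, up to the residual of that site. *)
Lemma alignment_pointwise x s e z : s = 1 \/ s = -1 -> 0 < z -> z <= e ->
  K * T * z <= e -> \sum_i (t x i - s * m) ^+ 2 <= z ^+ 2 * n%:R ->
  `|mean_spin x - s * m| <= e /\ forall i, `|t x i - s * m| <= `|r th x i| + e.
Proof.
move=> s1 z0 ze Kz h; have h1 := sum_abs_le_sqr z0 h.
split.
  apply: le_trans ze; rewrite -(ler_pM2l nR0) [leRHS]mulrC.
  apply: le_trans h1; rewrite -(ger0_norm (ltW nR0)) -normrM.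
  by rewrite mulrBr -sum_field -sum_cst -sumrB ler_norm_sum.
move=> i; have sE : s * m = tanh (th * (s * m)).
  by case: s1 => ->; rewrite ?mul1r// mulN1r mulrN tanhN -mE.
have -> : t x i - s * m = r th x i + \sum_j Q i j * (y th x j - s * m).
  under [X in _ = _ + X]eq_bigr do rewrite mulrBr.
  rewrite sumrB -mulr_suml Q_row mul1r addrA; congr (_ - _).
  by rewrite /residual /field_at -big_split/=; apply: eq_bigr => j _; ring.
apply: le_trans (ler_normD _ _) _; rewrite lerD2l.
apply: le_trans (ler_norm_sum _ _ _) _; apply: le_trans Kz.
apply: (@le_trans _ _ (\sum_j K / n%:R * (T * `|t x j - s * m|))).
  apply: ler_sum => j _; rewrite normrM ger0_norm//.
  apply: ler_pM => //; rewrite sE; apply: le_trans (tanh_lip _ _) _.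
  by rewrite -sE -mulrBr normrM (gtr0_norm th_gt0) ler_wpM2r.
rewrite -!mulr_sumr -mulrA -mulrA ler_wpM2l ?(K_ge0 QK)//.
rewrite mulrCA ler_wpM2l ?(ltW T_gt0)// mulrC ler_pdivrMr//.
Qed.


Definition misaligned (e : R) x : R := (~~ `[< aligned m e x >])%:R.

Lemma misaligned_le1 e x : 0 <= misaligned e x <= 1.
Proof. by rewrite /misaligned; case: (~~ _) => /=; rewrite ?ler01 ?lexx. Qed.

(** Outside the event that [alignment] describes, one of three quantities is large:
    the residual, the score or the energy deficit. *)
Lemma misaligned_le x k z e : 0 < z -> z <= e -> K * T * z <= e ->
  0 < k -> k <= 1 -> align_cst T m0 r0 * k <= z ^+ 2 ->
  misaligned e x <= (k ^+ 2 * n%:R)^-1 * (\sum_i r th x i ^+ 2) +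
    4 / (k ^+ 2 * n%:R ^+ 2) * score Q th x ^+ 2 +
    (quad Q x <= n%:R * m ^+ 2 - k / 2 * n%:R)%R%:R.
Proof.
move=> z0 ze Kz k0 k1 kz; rewrite /misaligned.
have k2 : 0 < k ^+ 2 * n%:R by rewrite mulr_gt0// exprn_gt0.
have h1 : 0 <= (k ^+ 2 * n%:R)^-1 * (\sum_i r th x i ^+ 2).
  by rewrite mulr_ge0 ?invr_ge0 ?(ltW k2)// sumr_ge0// => i _; rewrite sqr_ge0.
have h2 : 0 <= 4 / (k ^+ 2 * n%:R ^+ 2) * score Q th x ^+ 2.
  by rewrite mulr_ge0 ?sqr_ge0// divr_ge0// mulr_ge0// sqr_ge0.
have h3 : 0 <= (quad Q x <= n%:R * m ^+ 2 - k / 2 * n%:R)%R%:R :> R by [].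
case: (boolP `[< aligned m e x >]) => /= [_|bad]; first by rewrite !addr_ge0.
rewrite leNgt; apply/negP => small; move/asboolP: bad; apply.
have low : n%:R * m ^+ 2 - k / 2 * n%:R < quad Q x.
  by rewrite ltNge; apply/negP => h; move: small; rewrite h/=; lra.
have sr : \sum_i r th x i ^+ 2 <= k ^+ 2 * n%:R.
  rewrite leNgt; apply/negP => h.
  have : 1 < (k ^+ 2 * n%:R)^-1 * (\sum_i r th x i ^+ 2).
    by rewrite mulrC ltr_pdivlMr// mul1r.
  by move=> ?; move: small; lra.
have ss : score Q th x <= k / 2 * n%:R.
  rewrite leNgt; apply/negP => h.
  have : 1 < 4 / (k ^+ 2 * n%:R ^+ 2) * score Q th x ^+ 2.
    rewrite mulrAC ltr_pdivlMr ?mulr_gt0 ?exprn_gt0// mul1r.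
    have kn0 : 0 < k / 2 * n%:R by rewrite mulr_gt0// divr_gt0.
    have -> : k ^+ 2 * n%:R ^+ 2 = 4 * (k / 2 * n%:R) ^+ 2 by field.
    by rewrite ltr_pM2l// ltr_pXn2r ?nnegrE// ltW// (lt_trans kn0).
  by move=> ?; move: small; lra.
have [|s s1 hs] := alignment k0 k1 sr.
  by move: ss low; rewrite (scoreE Q th x); lra.
exists s => //; apply: (alignment_pointwise s1 z0 ze Kz).
by apply: (le_trans hs); rewrite ler_wpM2r.
Qed.

Lemma misaligned_prob k z e C : 0 < z -> z <= e -> K * T * z <= e ->
  0 < k -> k <= 1 -> align_cst T m0 r0 * k <= z ^+ 2 ->
  n%:R * gibbs th Q (fun x =>
    (quad Q x <= n%:R * m ^+ 2 - k / 2 * n%:R)%R%:R) <= C ->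
  n%:R * gibbs th Q (misaligned e) <=
  (1 + T) * K / k ^+ 2 + 4 * (3 + T) / k ^+ 2 + C.
Proof.
move=> z0 ze Kz k0 k1 kz hC.
have := gibbs_le th Q (fun x => misaligned_le x z0 ze Kz k0 k1 kz).
rewrite !gibbsD !gibbsZ -(ler_pM2l nR0) => /le_trans; apply.
have k2 : 0 < k ^+ 2 by rewrite exprn_gt0.
have th0 := ltW th_gt0.
have e1 := le_trans (residual_sqr Q_sym Q_ge0 Q_diag Q_row Q_le n_gt0 th0)
  (ler_wpM2r (K_ge0 QK) (_ : 1 + th <= 1 + T)).
have e2 := le_trans (score_sqr Q_sym Q_ge0 Q_diag Q_row th0)
  (ler_wpM2r (ltW nR0) (_ : 3 + th <= 3 + T)).
rewrite 2!mulrDr; apply: lerD => //; apply: lerD.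
- have -> E : n%:R * ((k ^+ 2 * n%:R)^-1 * E) = E / k ^+ 2.
    by field; rewrite nN0 gt_eqF.
  by rewrite ler_wpM2r ?invr_ge0 ?(ltW k2)// e1// lerD2l.
- have -> E : n%:R * (4 / (k ^+ 2 * n%:R ^+ 2) * E) = 4 * (E / n%:R) / k ^+ 2.
    by field; rewrite nN0 gt_eqF.
  rewrite ler_wpM2r ?invr_ge0 ?(ltW k2)// ler_wpM2l//.
  by rewrite ler_pdivrMr// e2// lerD2l.
Qed.

(** The deviation of the local fields from the mean spin, which is also their mean. *)
Definition dispersion x : R := \sum_i (t x i - mean_spin x) ^+ 2.

Lemma dispersion_ge0 x : 0 <= dispersion x.
Proof. by apply: sumr_ge0 => i _; rewrite sqr_ge0. Qed.

Lemma dispersionE x : dispersion x =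
  \sum_i spin x i * (\sum_j Q i j * (t x j - mean_spin x)).
Proof.
have -> : \sum_i spin x i * (\sum_j Q i j * (t x j - mean_spin x)) =
   \sum_j t x j * (t x j - mean_spin x).
  under eq_bigr do rewrite mulr_sumr.
  rewrite exchange_big/=; apply: eq_bigr => j _.
  have -> : t x j * (t x j - mean_spin x) =
      (\sum_i Q j i * spin x i) * (t x j - mean_spin x) by [].
  by rewrite mulr_suml; apply: eq_bigr => i _; rewrite (Q_sym i j); ring.
have -> : \sum_j t x j * (t x j - mean_spin x) =
    dispersion x + mean_spin x * \sum_j (t x j - mean_spin x).
  by rewrite mulr_sumr -big_split/=; apply: eq_bigr => i _; ring.
by rewrite sum_field_center mulr0 addr0.
Qed.

Lemma mean_set x i b : mean_spin (set_spin x i b) =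
  mean_spin x + n%:R^-1 * ((if b then 1 else -1) - spin x i) :> R.
Proof.
rewrite !mean_spinE -mulrDr; congr (_ * _).
rewrite (bigD1 i)//= spin_set eqxx [in RHS](bigD1 i)//=.
have -> : \sum_(j < n | j != i) spin (set_spin x i b) j =
    \sum_(j < n | j != i) spin x j :> R.
  by apply: eq_bigr => j ji; rewrite spin_set (negbTE ji).
ring.
Qed.

Lemma mean_diff x i :
  mean_spin (set_spin x i true) - mean_spin (set_spin x i false) = 2 / n%:R :> R.
Proof. by rewrite !mean_set; ring. Qed.

(** Writing the dispersion as [\sum_i s i * (Q (t - M)) i], integration by parts replaces the spins by
    their conditional means at a bounded cost; subtracting [tanh (th * M)] is free
    because [t - M] has mean zero. *)
Lemma gibbs_dispersion_drift :
  gibbs th Q dispersion <= K + 1 + gibbs th Q (fun x =>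
    \sum_j (y th x j - tanh (th * mean_spin x)) *
      (\sum_k Q j k * (t x k - mean_spin x))).
Proof.
pose H j x := \sum_k Q j k * (t x k - mean_spin x).
have E x : dispersion x = \sum_j (spin x j - y th x j) * H j x +
    \sum_j (y th x j - tanh (th * mean_spin x)) * H j x.
  have : \sum_j tanh (th * mean_spin x) * H j x = 0.
    by rewrite -mulr_sumr /H sum_Q sum_field_center mulr0.
  move=> h; rewrite dispersionE.
  have -> : \sum_i spin x i * (\sum_j Q i j * (t x j - mean_spin x)) =
      \sum_j (spin x j - y th x j) * H j x +
      \sum_j (y th x j - tanh (th * mean_spin x)) * H j x +
      \sum_j tanh (th * mean_spin x) * H j x.
    rewrite -big_split/= -big_split/=.
    by apply: eq_bigr => j _; rewrite -/(H j x); ring.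
  by rewrite h addr0.
rewrite (gibbs_ext _ _ E) gibbsD lerD2r.
apply: le_trans (ler_norm _) _.
apply: le_trans (gibbs_ibp_le Q_sym Q_diag _ _) _; apply: gibbs_le_cst => x.
have hj i : `|flip_diff i (H i) x| <= \sum_j Q i j ^+ 2 + n%:R^-1.
  have -> : flip_diff i (H i) x = \sum_k Q i k ^+ 2 - n%:R^-1.
    have -> : n%:R^-1 = (\sum_k Q i k) * n%:R^-1 by rewrite Q_row mul1r.
    rewrite /H flip_diff_sum mulr_suml -sumrB.
    apply: eq_bigr => k _; rewrite (flip_diff_mul_indep (F := fun=> Q i k))//.
    rewrite flip_diffB /flip_diff field_diff mean_diff (Q_sym k i).
    by field.
  apply: le_trans (ler_normB _ _) _; rewrite !ger0_norm ?invr_ge0//.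
  by apply: sumr_ge0 => j _; rewrite sqr_ge0.
apply: le_trans (ler_sum _ (fun i _ => hj i)) _.
by rewrite big_split/= sum_cst mulfV// lerD2r (sum_sqr_Q_le Q_ge0 Q_row Q_le).
Qed.

Section contraction.
Context (e : R) (e_gt0 : 0 < e) (e_small : e <= r0 / (8 * T ^+ 2)).

(** Near either fixed point the slope of [tanh (th * u)] is close to [cw_slope]. *)
Lemma tanh_contract (s u w : R) : s = 1 \/ s = -1 ->
  `|u - s * m| <= 2 * e -> `|w - s * m| <= 2 * e ->
  `|tanh (th * u) - tanh (th * w)| <= (1 - r0 / 2) * `|u - w|.
Proof.
move=> s1 hu hw; have -> : (1 - r0 / 2) * `|u - w| =
    (1 - r0 / 2) / th * `|th * u - th * w|.
  by rewrite -mulrBr normrM gtr0_norm//; field; rewrite gt_eqF.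
apply: tanh_slope => c hc.
have [c1 c2] : - (th * (2 * e)) <= c - th * (s * m) /\ c - th * (s * m) <= th * (2 * e).
  move: hu hw; rewrite !ler_norml => /andP[u1 u2] /andP[w1 w2].
  have := ler_wpM2l (ltW th_gt0) u1; have := ler_wpM2l (ltW th_gt0) u2.
  have := ler_wpM2l (ltW th_gt0) w1; have := ler_wpM2l (ltW th_gt0) w2.
  rewrite !mulrBr !mulrN => *; case: hc => /andP[]; split; lra.
have cm : `|c - th * (s * m)| <= th * (2 * e) by rewrite ler_norml c1.
have := le_trans (sqr_tanh_lip c (th * (s * m))) (ler_wpM2l (ler0n R 2) cm).
have -> : tanh (th * (s * m)) ^+ 2 = m ^+ 2.
  by case: s1 => ->; rewrite ?mul1r ?mulN1r ?mulrN ?tanhN ?sqrrN -mE.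
rewrite ler_norml => /andP[h _].
rewrite ler_pdivlMr//.
have h1 : (1 - tanh c ^+ 2) * th <= (1 - m ^+ 2 + 2 * (th * (2 * e))) * th.
  by rewrite ler_wpM2r ?(ltW th_gt0)//; lra.
apply: (le_trans h1).
have h2 : th ^+ 2 * e <= r0 / 8.
  apply: (@le_trans _ _ (T ^+ 2 * e)).
    by rewrite ler_wpM2r ?(ltW e_gt0)// ler_pXn2r// nnegrE ltW.
  apply: (le_trans (ler_wpM2l (sqr_ge0 T) e_small)).
  by rewrite le_eqVlt; apply/orP; left; apply/eqP; field; rewrite gt_eqF.
by have := r0rho; rewrite /rho; lra.
Qed.

(** Sites with small residual have fields in the contracting region. At the others the
    trivial bound 2 is at most [2 / e] times the residual. *)
Lemma drift_aligned x : aligned m e x ->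
  \sum_j (y th x j - tanh (th * mean_spin x)) *
      (\sum_k Q j k * (t x k - mean_spin x)) <=
  (1 - r0 / 4) * dispersion x + 4 / (e ^+ 2 * r0) * \sum_i r th x i ^+ 2.
Proof.
case=> s s1 [hM hi]; set H := fun j => \sum_k Q j k * (t x k - mean_spin x).
(* Q is a contraction in mean square. *)
have hH : \sum_j H j ^+ 2 <= dispersion x.
  exact: (Q_contract Q_sym Q_ge0 Q_row (fun k => t x k - mean_spin x)).
have r01 : r0 <= 1.
  by apply: (le_trans r0rho); rewrite gerBl; apply: slope_ge0.
have hj j : (y th x j - tanh (th * mean_spin x)) * H j <=
   (1 - r0 / 2) / 2 * (t x j - mean_spin x) ^+ 2 + (1 - r0 / 2) / 2 * H j ^+ 2 +
   r0 / 4 * H j ^+ 2 + 4 / (e ^+ 2 * r0) * r th x j ^+ 2.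
  have h1 : `|y th x j - tanh (th * mean_spin x)| <=
     (1 - r0 / 2) * `|t x j - mean_spin x| + 2 / e * `|r th x j|.
    have p1 : 0 <= (1 - r0 / 2) * `|t x j - mean_spin x| by rewrite mulr_ge0//; lra.
    have p2 : 0 <= 2 / e * `|r th x j| by rewrite mulr_ge0// divr_ge0// ltW.
    have [re|re] := leP `|r th x j| e.
      apply: (@le_trans _ _ ((1 - r0 / 2) * `|t x j - mean_spin x|)); last by rewrite lerDl.
      have e2 : e <= 2 * e by rewrite ler_peMl ?ler1n// ltW.
      apply: (tanh_contract s1); last exact: le_trans hM e2.
      by apply: (le_trans (hi j)); rewrite mulr_natl mulr2n lerD2r.
    apply: (@le_trans _ _ (2 / e * `|r th x j|)); last by rewrite lerDr.
    apply: (le_trans (ler_normB _ _)); apply: (@le_trans _ _ 2).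
      by rewrite -[leRHS]/(1 + 1) lerD// norm_tanh_le1.
    by rewrite mulrAC ler_pdivlMr// ler_wpM2l// ltW.
  apply: (le_trans (ler_norm _)); rewrite normrM.
  apply: (le_trans (ler_wpM2r (normr_ge0 (H j)) h1)).
  rewrite -(@real_normK _ (H j)) ?num_real// -(@real_normK _ (r th x j)) ?num_real//.
  rewrite -(@real_normK _ (t x j - _)) ?num_real//.
  move: `|t x j - _| `|H j| `|r th x j| => A B C.
  have q1 : 0 <= (1 - r0 / 2) / 2 * (A - B) ^+ 2.
    by rewrite mulr_ge0 ?sqr_ge0//; lra.
  have q2 : 0 <= (r0 * e * B - 4 * C) ^+ 2 / (4 * e ^+ 2 * r0).
    by rewrite divr_ge0 ?sqr_ge0// mulr_ge0 ?(ltW r0_gt0)// mulr_ge0// sqr_ge0.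
  have E2 : (r0 * e * B - 4 * C) ^+ 2 / (4 * e ^+ 2 * r0) =
     r0 / 4 * B ^+ 2 + 4 / (e ^+ 2 * r0) * C ^+ 2 - 2 / e * C * B.
    by field; rewrite !gt_eqF.
  by move: q1 q2; rewrite E2; lra.
apply: (le_trans (ler_sum _ (fun j _ => hj j))).
rewrite !big_split/= -!mulr_sumr lerD2r.
have := ler_wpM2l (_ : 0 <= (1 - r0 / 2) / 2 + r0 / 4) hH.
have q : 0 <= (1 - r0 / 2) / 2 + r0 / 4 by lra.
by move=> /(_ q); rewrite -/(dispersion x); lra.
Qed.

Lemma drift_le x :
  \sum_j (y th x j - tanh (th * mean_spin x)) *
      (\sum_k Q j k * (t x k - mean_spin x)) <=
  (1 - r0 / 4) * dispersion x + 4 / (e ^+ 2 * r0) * \sum_i r th x i ^+ 2 +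
  4 * (n%:R * misaligned e x).
Proof.
rewrite /misaligned; case: (boolP `[< aligned m e x >]) => [/asboolP al|_] /=.
  by rewrite !mulr0 addr0 drift_aligned.
have r01 : r0 <= 1.
  by apply: (le_trans r0rho); rewrite gerBl; apply: slope_ge0.
rewrite -[leLHS]add0r mulr1 lerD//.
  rewrite addr_ge0// mulr_ge0 ?dispersion_ge0//; first lra.
    by rewrite divr_ge0// mulr_ge0 ?sqr_ge0// ltW.
  by apply: sumr_ge0 => i _; rewrite sqr_ge0.
have -> : 4 * n%:R = \sum_(j < n) 4 :> R by rewrite sum_cst mulrC.
apply: ler_sum => j _.
apply: (le_trans (ler_norm _)); rewrite normrM.
have -> : 4 = 2 * 2 :> R by ring.
have two (u v : R) : `|u| <= 1 -> `|v| <= 1 -> `|u - v| <= 2.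
  by move=> hu hv; rewrite (le_trans (ler_normB _ _))// -[2]/(1 + 1) lerD.
apply: ler_pM => //; first by rewrite two// norm_tanh_le1.
apply: (le_trans (ler_norm_sum _ _ _)).
apply: (@le_trans _ _ (\sum_k Q j k * 2)); last by rewrite -mulr_suml Q_row mul1r.
apply: ler_sum => k _; rewrite normrM ger0_norm// ler_wpM2l// two ?norm_mean_le1//.
exact: (norm_field_le1 Q_ge0 Q_row).
Qed.

(** The drift is at most a fraction of the dispersion up to bounded terms, so the
    dispersion can be absorbed. *)
Lemma gibbs_dispersion_le C : n%:R * gibbs th Q (misaligned e) <= C ->
  gibbs th Q dispersion <=
  4 / r0 * (K + 1 + 4 / (e ^+ 2 * r0) * ((1 + T) * K) + 4 * C).
Proof.
move=> hC; have h1 := gibbs_dispersion_drift.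
have := gibbs_le th Q drift_le; rewrite !gibbsD !gibbsZ => h2.
have e1 := le_trans (residual_sqr Q_sym Q_ge0 Q_diag Q_row Q_le n_gt0 (ltW th_gt0))
  (ler_wpM2r (K_ge0 QK) (_ : 1 + th <= 1 + T)).
have {}e1 := e1 (_ : 1 + th <= 1 + T).
have e2 : 0 <= 4 / (e ^+ 2 * r0) by rewrite divr_ge0// mulr_ge0 ?sqr_ge0// ltW.
have th1T : 1 + th <= 1 + T by rewrite lerD2l.
have := ler_wpM2l e2 (e1 th1T).
move: h1 h2 hC; move: (gibbs th Q dispersion) (gibbs _ _ _) (gibbs _ _ _) (gibbs _ _ _).
move: (4 / (e ^+ 2 * r0)) ((1 + T) * K) => c1 c2 A B D F h1 h2 hC h3.
rewrite mulrAC ler_pdivlMr//; lra.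
Qed.

End contraction.


Lemma mean_drift (phi : R -> R) (L : R) : 0 <= L ->
  (forall u v : R, `|u| <= 1 -> `|v| <= 1 -> `|phi u - phi v| <= L * `|u - v|) ->
  `|gibbs th Q (fun x => (n%:R * mean_spin x - \sum_i y th x i) * phi (mean_spin x))| <= L.
Proof.
move=> L0 hL.
have E x : (n%:R * mean_spin x - \sum_i y th x i) * phi (mean_spin x) =
    \sum_i (spin x i - y th x i) * phi (mean_spin x).
  by rewrite -sum_spin -sumrB mulr_suml.
rewrite (gibbs_ext _ _ E); apply: (le_trans (gibbs_ibp_le Q_sym Q_diag _ _)).
apply: gibbs_le_cst => x.
apply: (@le_trans _ _ (\sum_(i < n) L / n%:R)); last first.
  by rewrite sum_cst mulrC divfK.
apply: ler_sum => i _; apply: norm_flip_diff.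
apply: (le_trans (hL _ _ (norm_mean_le1 _) (norm_mean_le1 _))).
by rewrite mean_diff ger0_norm ?divr_ge0// mulrCA.
Qed.

(** The first-order terms cancel because the fields average to the mean spin. *)
Lemma sum_tanh_linear x :
  `|\sum_i y th x i - n%:R * tanh (th * mean_spin x)| <= 2 * th ^+ 2 * dispersion x.
Proof.
set c := tanh (th * mean_spin x).
have -> : \sum_i y th x i - n%:R * c =
    \sum_i (y th x i - c - (1 - c ^+ 2) * (th * t x i - th * mean_spin x)).
  rewrite sumrB -mulr_sumr sumrB sum_cst.
  have -> : \sum_i (th * t x i - th * mean_spin x) = 0.
    under eq_bigr do rewrite -mulrBr.
    by rewrite -mulr_sumr sum_field_center mulr0.
  by rewrite mulr0 subr0.
apply: (le_trans (ler_norm_sum _ _ _)); rewrite /dispersion mulr_sumr.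
apply: ler_sum => i _; apply: (le_trans (tanh_taylor _ _)).
by rewrite -mulrBr exprMn mulrA.
Qed.

(** The conditional drift of the squared mean spin. It is even in [u] and has a simple
    zero at [u = m]. *)
Definition drift (th u : R) : R := u * (u - tanh (th * u)).

(** The factor for [`|u| > 1] only serves to have a bound for all real [u]. *)
Lemma drift_expand (u : R) : `|drift th u - (1 - rho) / 2 * (u ^+ 2 - m ^+ 2)| <=
  (1 + 2 * T ^+ 2) / m0 ^+ 2 * (u ^+ 2 - m ^+ 2) ^+ 2 *
  (if `|u| <= 1 then 1 else 1 + `|u|).
Proof.
have -> : drift th u = drift th `|u|.
  have [u0|u0] := leP 0 u; first by rewrite ger0_norm.
  by rewrite ltr0_norm// /drift mulrN tanhN opprK; ring.
have -> : u ^+ 2 = `|u| ^+ 2 by rewrite real_normK ?num_real.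
set v := `|u|; have v0 : 0 <= v by exact: normr_ge0.
have h := tanh_taylor (th * m) (th * v); rewrite -mE -mulrBr exprMn in h.
have -> : drift th v - (1 - rho) / 2 * (v ^+ 2 - m ^+ 2) =
    (1 - rho) / 2 * (v - m) ^+ 2 -
    v * (tanh (th * v) - m - (1 - m ^+ 2) * (th * (v - m))).
  by rewrite /drift /rho; field.
have rho1 : 0 < 1 - rho by exact: lt_le_trans r0rho.
have rho0 := slope_ge0 th_gt0 mP.
have d2 : 0 <= (v - m) ^+ 2 := sqr_ge0 _.
have tT : th ^+ 2 <= T ^+ 2 by rewrite ler_pXn2r// nnegrE ltW.
have b1 : `|(1 - rho) / 2 * (v - m) ^+ 2 -
    v * (tanh (th * v) - m - (1 - m ^+ 2) * (th * (v - m)))| <=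
    (v - m) ^+ 2 + v * (2 * T ^+ 2 * (v - m) ^+ 2).
  apply: (le_trans (ler_normB _ _)); apply: lerD.
    rewrite ger0_norm; last by rewrite mulr_ge0// divr_ge0// ltW.
    by rewrite ler_piMl//; rewrite -/rho in rho0; lra.
  rewrite normrM (ger0_norm v0) ler_wpM2l//; apply: (le_trans h).
  by rewrite mulrA ler_wpM2r// ler_wpM2l.
have p2 : (v - m) ^+ 2 <= (v ^+ 2 - m ^+ 2) ^+ 2 / m0 ^+ 2.
  rewrite ler_pdivlMr ?exprn_gt0//.
  have -> : v ^+ 2 - m ^+ 2 = (v - m) * (v + m) by ring.
  have m00 := ltW m0_gt0; have mm00 := ltW m_gt0.
  have mv : m0 <= v + m by apply: (le_trans m0m); rewrite lerDr.
  have vm : 0 <= v + m by rewrite addr_ge0.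
  by rewrite exprMn ler_wpM2l// ler_pXn2r// ?nnegrE.
apply: (le_trans b1).
have -> : (1 + 2 * T ^+ 2) / m0 ^+ 2 * (v ^+ 2 - m ^+ 2) ^+ 2 =
  (1 + 2 * T ^+ 2) * ((v ^+ 2 - m ^+ 2) ^+ 2 / m0 ^+ 2) by ring.
set B := _ / m0 ^+ 2 in p2 *.
have T2 : 0 <= 2 * T ^+ 2 by rewrite mulr_ge0// sqr_ge0.
have B0 : 0 <= B by exact: le_trans p2.
have s1 : 2 * T ^+ 2 * (v - m) ^+ 2 <= 2 * T ^+ 2 * B by rewrite ler_wpM2l.
case: (leP v 1) => v1.
  have := ler_wpM2l v0 s1.
  have : v * (2 * T ^+ 2 * B) <= 2 * T ^+ 2 * B by rewrite ler_piMl// mulr_ge0.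
  lra.
have := ler_wpM2l v0 s1; have := mulr_ge0 v0 B0.
have := mulr_ge0 v0 (mulr_ge0 T2 B0); have := mulr_ge0 T2 B0.
lra.
Qed.

Section second_order.
Context (e D C : R) (e_gt0 : 0 < e) (e_small : e <= r0 * m0 ^+ 2 / (8 * (1 + 2 * T ^+ 2))).
Hypothesis dispD : gibbs th Q dispersion <= D.
Hypothesis misC : n%:R * gibbs th Q (misaligned e) <= C.

Let D_ge0 : 0 <= D. Proof. exact: le_trans (gibbs_ge0 _ _ dispersion_ge0) dispD. Qed.
Let C_ge0 : 0 <= C.
Proof.
by apply: le_trans misC; rewrite mulr_ge0// gibbs_ge0// => x;
  case/andP: (misaligned_le1 e x).
Qed.

Definition sqr_excess x : R := mean_spin x ^+ 2 - m ^+ 2.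

Lemma sqr_excess_le1 x : `|sqr_excess x| <= 1.
Proof.
have M1 : (mean_spin x : R) ^+ 2 <= 1 by rewrite -real_normK ?num_real// expr_le1// norm_mean_le1.
have m1 : m ^+ 2 <= 1 by rewrite expr_le1// ltW.
have M0 := sqr_ge0 (mean_spin x : R); have mm0 := sqr_ge0 m.
by rewrite ler_norml /sqr_excess; apply/andP; split; lra.
Qed.

Lemma drift_le2 (u : R) : `|u| <= 1 -> `|drift th u| <= 2.
Proof.
move=> u1; rewrite /drift normrM -[2]mul1r ler_pM//.
by rewrite (le_trans (ler_normB _ _))// -[2]/(1 + 1) lerD// norm_tanh_le1.
Qed.

(** Replacing the average of the conditional means by the conditional mean at
    the average only costs the dispersion. *)
Lemma gibbs_drift_le (psi : R -> R) (B L : R) : 0 <= L ->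
  (forall u : R, `|u| <= 1 -> `|psi u| <= B) ->
  (forall u v : R, `|u| <= 1 -> `|v| <= 1 ->
    `|u * psi u - v * psi v| <= L * `|u - v|) ->
  `|gibbs th Q (fun x => n%:R * drift th (mean_spin x) * psi (mean_spin x))| <=
  L + 2 * T ^+ 2 * B * D.
Proof.
move=> L0 hB hL.
have B0 : 0 <= B by apply: le_trans (hB 0 _); rewrite ?normr0.
have h1 := mean_drift L0 hL.
set F1 := fun x => _ in h1.
rewrite -[X in `|X|](subrK (gibbs th Q F1)) -gibbsB addrC.
apply: (le_trans (ler_normD _ _)); apply: lerD => //.
apply: (le_trans (norm_gibbs _ _ _)).
apply: (@le_trans _ _ (2 * T ^+ 2 * B * gibbs th Q dispersion)); last first.
  by rewrite ler_wpM2l// (mulr_ge0 (mulr_ge0 (ler0n R 2) (sqr_ge0 T)) B0).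
rewrite -gibbsZ; apply: gibbs_le => x; rewrite /F1 /drift.
have -> : n%:R * (mean_spin x * (mean_spin x - tanh (th * mean_spin x))) *
    psi (mean_spin x) - (n%:R * mean_spin x - \sum_i y th x i) *
    (mean_spin x * psi (mean_spin x)) =
  (\sum_i y th x i - n%:R * tanh (th * mean_spin x)) *
  (mean_spin x * psi (mean_spin x)) by ring.
have -> : 2 * T ^+ 2 * B * dispersion x = 2 * T ^+ 2 * dispersion x * B by ring.
rewrite normrM; apply: ler_pM => //.
  apply: (le_trans (sum_tanh_linear x)); rewrite ler_wpM2r ?dispersion_ge0//.
  by rewrite ler_wpM2l// ler_pXn2r// nnegrE ltW.
rewrite normrM -[leRHS]mul1r ler_pM// ?norm_mean_le1//.
by apply: hB; rewrite norm_mean_le1.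
Qed.

Let Cg := (1 + 2 * T ^+ 2) / m0 ^+ 2.
Let Cg_gt0 : 0 < Cg.
Proof. by rewrite divr_gt0 ?exprn_gt0// addr_gt0// mulr_gt0// exprn_gt0. Qed.

Lemma drift_mean_expand x : `|drift th (mean_spin x) - (1 - rho) / 2 * sqr_excess x| <=
  Cg * sqr_excess x ^+ 2.
Proof. by have := drift_expand (mean_spin x); rewrite norm_mean_le1 mulr1. Qed.

Lemma drift_coercive x : r0 / 4 * sqr_excess x ^+ 2 <=
  drift th (mean_spin x) * sqr_excess x + 3 * misaligned e x.
Proof.
have r01 : r0 <= 1 by apply: (le_trans r0rho); rewrite gerBl; apply: slope_ge0.
have p1 := sqr_excess_le1 x.
have p21 : sqr_excess x ^+ 2 <= 1 by rewrite -real_normK ?num_real// expr_le1.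
have p20 : 0 <= sqr_excess x ^+ 2 := sqr_ge0 _.
rewrite /misaligned; case: (boolP `[< aligned m e x >]) => [/asboolP[s s1 [hM _]]|_] /=.
  rewrite mulr0 addr0.
  have pe : `|sqr_excess x| <= 2 * e.
    have -> : sqr_excess x = (mean_spin x - s * m) * (mean_spin x + s * m).
      by rewrite /sqr_excess; case: s1 => ->; ring.
    rewrite normrM mulrC ler_pM//; apply: (le_trans (ler_normD _ _)).
    rewrite -[2]/(1 + 1) lerD ?norm_mean_le1//.
    by rewrite normrM; case: s1 => ->; rewrite ?normrN normr1 mul1r gtr0_norm// ltW.
  have h := drift_mean_expand x.
  set g := drift _ _ in h *; set p := sqr_excess x in h pe p1 p20 *.
  have h2 : `|(g - (1 - rho) / 2 * p) * p| <= r0 / 4 * p ^+ 2.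
    rewrite normrM; apply: (@le_trans _ _ (Cg * p ^+ 2 * (2 * e))).
      exact: ler_pM.
    rewrite mulrAC ler_wpM2r//.
    have := ler_wpM2l (ltW Cg_gt0) e_small.
    have -> : Cg * (r0 * m0 ^+ 2 / (8 * (1 + 2 * T ^+ 2))) = r0 / 8.
      rewrite /Cg; field; rewrite !gt_eqF//= addr_gt0// mulr_gt0// exprn_gt0//.
    lra.
  move: h2; rewrite ler_norml => /andP[h2 _].
  have -> : g * p = (g - (1 - rho) / 2 * p) * p + (1 - rho) / 2 * p ^+ 2 by ring.
  have : r0 / 2 * p ^+ 2 <= (1 - rho) / 2 * p ^+ 2.
    by rewrite ler_wpM2r// ler_wpM2r ?invr_ge0.
  lra.
have := drift_le2 (norm_mean_le1 x); set g := drift _ _ => g2.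
have : `|g * sqr_excess x| <= 2 by rewrite normrM -[2]mulr1 ler_pM.
rewrite ler_norml => /andP[h _].
have r40 : 0 <= r0 / 4 by rewrite divr_ge0// ltW.
have := ler_wpM2l r40 p21; lra.
Qed.

Definition sqr_excess_cst (T r0 D C : R) := 4 / r0 * (3 + 2 * T ^+ 2 * D + 3 * C).

(** Taking [u ^+ 2 - m ^+ 2] itself as test function: by coercivity the drift dominates
    the square of the excess. *)
Lemma gibbs_sqr_excess_sqr :
  n%:R * gibbs th Q (fun x => sqr_excess x ^+ 2) <= sqr_excess_cst T r0 D C.
Proof.
pose psi (u : R) := u ^+ 2 - m ^+ 2.
have m1 : m ^+ 2 <= 1 by rewrite expr_le1// ltW.
have mm0 := sqr_ge0 m.
have hB (u : R) : `|u| <= 1 -> `|psi u| <= 1.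
  move=> u1; have M1 : u ^+ 2 <= 1 by rewrite -real_normK ?num_real// expr_le1.
  by have := sqr_ge0 u; rewrite ler_norml /psi => ?; apply/andP; split; lra.
have hL (u v : R) : `|u| <= 1 -> `|v| <= 1 ->
    `|u * psi u - v * psi v| <= 3 * `|u - v|.
  move=> u1 v1.
  have -> : u * psi u - v * psi v = (u ^+ 2 + u * v + v ^+ 2 - m ^+ 2) * (u - v).
    by rewrite /psi; ring.
  rewrite normrM ler_wpM2r//.
  move: u1 v1; rewrite !ler_norml => /andP[u1 u2] /andP[v1 v2].
  by apply/andP; split; nra.
have h3 : 0 <= 3 :> R by [].
have := gibbs_drift_le h3 hB hL; rewrite mulr1 => h.
have := gibbs_le th Q drift_coercive; rewrite gibbsD !gibbsZ => h2.
have E : gibbs th Q (fun x => n%:R * drift th (mean_spin x) * psi (mean_spin x)) =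
    n%:R * gibbs th Q (fun x => drift th (mean_spin x) * sqr_excess x).
  by rewrite -gibbsZ; apply: gibbs_ext => x; rewrite mulrA.
rewrite E in h; have := ler_wpM2l (ltW nR0) h2; rewrite mulrDr.
move: h; rewrite ler_norml => /andP[_ h] h4.
rewrite /sqr_excess_cst mulrAC ler_pdivlMr//.
move: h h4 misC; move: (gibbs _ _ _) (gibbs _ _ _) (gibbs _ _ _) => X Y Z; lra.
Qed.

(** The constant test function, with [drift_expand] controlling the second-order term by
    [gibbs_sqr_excess_sqr]. *)
Lemma gibbs_sqr_excess : `|n%:R * gibbs th Q sqr_excess| <=
  2 / r0 * (1 + 2 * T ^+ 2 * D + Cg * sqr_excess_cst T r0 D C).
Proof.
have L0 : 0 <= 1 :> R by [].
have := @gibbs_drift_le (fun=> 1) 1 1 L0; rewrite normr1 => /(_ (fun _ _ => lexx _)).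
have hL (u v : R) : `|u| <= 1 -> `|v| <= 1 -> `|u * 1 - v * 1| <= 1 * `|u - v|.
  by rewrite !mulr1 mul1r.
move=> /(_ hL) h.
have h2 : `|gibbs th Q (fun x => n%:R * (drift th (mean_spin x) - (1 - rho) / 2 * sqr_excess x))| <=
    Cg * sqr_excess_cst T r0 D C.
  apply: (le_trans (norm_gibbs _ _ _)).
  apply: (@le_trans _ _ (gibbs th Q (fun x => (n%:R * Cg) * sqr_excess x ^+ 2))).
    apply: gibbs_le => x; rewrite normrM (gtr0_norm nR0).
    have -> : n%:R * Cg * sqr_excess x ^+ 2 = n%:R * (Cg * sqr_excess x ^+ 2) by ring.
    rewrite ler_wpM2l//.
    exact: drift_mean_expand.
  by rewrite gibbsZ mulrAC mulrC ler_wpM2l ?(ltW Cg_gt0)// gibbs_sqr_excess_sqr.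
have rr : 0 < (1 - rho) / 2 by rewrite divr_gt0// (lt_le_trans r0_gt0).
have E : (1 - rho) / 2 * (n%:R * gibbs th Q sqr_excess) =
  gibbs th Q (fun x => n%:R * drift th (mean_spin x) * 1) -
  gibbs th Q (fun x => n%:R * (drift th (mean_spin x) - (1 - rho) / 2 * sqr_excess x)).
  by rewrite -gibbsB mulrA -gibbsZ; apply: gibbs_ext => x; ring.
have : (1 - rho) / 2 * `|n%:R * gibbs th Q sqr_excess| <=
    1 + 2 * T ^+ 2 * D + Cg * sqr_excess_cst T r0 D C.
  rewrite -[X in X * _](gtr0_norm rr) -normrM E (le_trans (ler_normB _ _))//.
  by rewrite lerD//; move: h; rewrite mulr1.
have r2 : r0 / 2 * `|n%:R * gibbs th Q sqr_excess| <=
  (1 - rho) / 2 * `|n%:R * gibbs th Q sqr_excess|.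
  by rewrite ler_wpM2r// ler_wpM2r// invr_ge0.
move=> /(le_trans r2); move: `|_ * _| (_ + Cg * _) => X Y h5.
have -> : 2 / r0 * Y = Y / (r0 / 2) by field; rewrite gt_eqF.
by rewrite ler_pdivlMr ?divr_gt0// mulrC.
Qed.

Lemma gibbs_quad_mean : `|gibbs th Q (quad Q) - n%:R * m ^+ 2| <=
  (T + 2 * T ^+ 2) * D + (1 + 2 * T ^+ 2 * D) +
  2 / r0 * (1 + 2 * T ^+ 2 * D + Cg * sqr_excess_cst T r0 D C).
Proof.
have L0 : 0 <= 1 :> R by [].
have := @gibbs_drift_le (fun=> 1) 1 1 L0; rewrite normr1 => /(_ (fun _ _ => lexx _)).
have hL (u v : R) : `|u| <= 1 -> `|v| <= 1 -> `|u * 1 - v * 1| <= 1 * `|u - v|.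
  by rewrite !mulr1 mul1r.
move=> /(_ hL) h; rewrite mulr1 in h.
have EV : gibbs th Q (quad Q) = gibbs th Q (fun x => \sum_i t x i * y th x i).
  apply/eqP; rewrite -subr_eq0 -gibbsB.
  by rewrite (gibbs_ext _ _ (fun x => esym (scoreE Q th x))) gibbs_score.
pose F x := \sum_i t x i * y th x i - n%:R * mean_spin x * tanh (th * mean_spin x).
have F1 x : `|F x| <= (T + 2 * T ^+ 2) * dispersion x.
  set c := tanh (th * mean_spin x).
  have -> : F x = \sum_i (t x i - mean_spin x) * (y th x i - c) +
      mean_spin x * (\sum_i y th x i - n%:R * c).
    have -> : \sum_i (t x i - mean_spin x) * (y th x i - c) =
      \sum_i t x i * y th x i - mean_spin x * (\sum_i y th x i) -
      c * \sum_i (t x i - mean_spin x).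
      rewrite !mulr_sumr -!sumrB; apply: eq_bigr => i _; ring.
    by rewrite sum_field_center /F -/c; ring.
  apply: (le_trans (ler_normD _ _)); rewrite mulrDl; apply: lerD.
    apply: (le_trans (ler_norm_sum _ _ _)); rewrite /dispersion mulr_sumr.
    apply: ler_sum => i _; rewrite normrM.
    have -> : T * (t x i - mean_spin x) ^+ 2 =
      `|t x i - mean_spin x| * (T * `|t x i - mean_spin x|).
      by rewrite -real_normK ?num_real//; ring.
    rewrite ler_wpM2l//; apply: (le_trans (tanh_lip _ _)).
    by rewrite -mulrBr normrM (gtr0_norm th_gt0) ler_wpM2r.
  rewrite normrM -[leRHS]mul1r; apply: ler_pM => //; first exact: norm_mean_le1.
  apply: (le_trans (sum_tanh_linear x)); rewrite ler_wpM2r ?dispersion_ge0//.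
  by rewrite ler_wpM2l// ler_pXn2r// nnegrE ltW.
have E : gibbs th Q (quad Q) - n%:R * m ^+ 2 = gibbs th Q F +
   n%:R * gibbs th Q sqr_excess - gibbs th Q (fun x => n%:R * drift th (mean_spin x) * 1).
  rewrite EV -gibbsZ -gibbsD -gibbsB -[X in _ - X](gibbs_cst th Q) -gibbsB.
  by apply: gibbs_ext => x; rewrite /F /sqr_excess /drift; ring.
rewrite E (le_trans (ler_normB _ _))// addrAC lerD//.
rewrite (le_trans (ler_normD _ _))// lerD//; last exact: gibbs_sqr_excess.
apply: (le_trans (norm_gibbs _ _ _)); apply: (le_trans (gibbs_le _ _ F1)).
by rewrite gibbsZ ler_wpM2l// addr_ge0 ?(ltW T_gt0)// mulr_ge0// sqr_ge0.
Qed.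

End second_order.
End fixed_temperature.
End alignment.

Section uniform_moments.
Context {R : realType}.
Implicit Types (K d a b th : R).

Lemma magnetization_le th1 th2 : 1 < th1 -> th1 <= th2 ->
  magnetization th1 <= magnetization th2.
Proof.
by move=> h; rewrite le_eqVlt => /predU1P[->//|h2]; rewrite ltW// magnetization_lt.
Qed.

(** Uniformity over compact temperature ranges is needed along the local parameters
    and to integrate the mean energy. *)
Theorem phase_moments K d a b : 0 <= K -> 0 < d -> 1 < a -> a <= b ->
  exists2 C, 0 <= C & forall n (Q : 'M[R]_n), coupling K Q -> spectral_gap d Q ->
  forall th, a <= th <= b ->
  [/\ gibbs th Q (dispersion Q) <= C,
      n%:R * gibbs th Q (fun x => sqr_excess (magnetization th) x ^+ 2) <= C &
      `|gibbs th Q (quad Q) - n%:R * magnetization th ^+ 2| <= C].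
Proof.
move=> K0 d0 a1 ab.
have [r r0 rP] := cw_slope_gap a1 ab.
have b0 : 0 < b by lra.
pose m0 := magnetization a; have m00 : 0 < m0 := magnetization_gt0 _ a1.
pose e := Num.min (r / (8 * b ^+ 2)) (r * m0 ^+ 2 / (8 * (1 + 2 * b ^+ 2))).
have b20 : 0 < b ^+ 2 by rewrite exprn_gt0.
have b21 : 0 < 1 + 2 * b ^+ 2 by rewrite addr_gt0// mulr_gt0.
have m20 : 0 < m0 ^+ 2 by rewrite exprn_gt0.
have e0 : 0 < e.
  by rewrite lt_min; apply/andP; split; rewrite divr_gt0// mulr_gt0.
have e1 : e <= r / (8 * b ^+ 2) by rewrite ge_min lexx.
have e2 : e <= r * m0 ^+ 2 / (8 * (1 + 2 * b ^+ 2)) by rewrite ge_min lexx orbT.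
have Kb : 0 <= K * b by rewrite mulr_ge0// ltW.
have Kb1 : 0 < 1 + K * b by lra.
(* Constants are chosen in the order e, z, k: the size of the contracting region, the
   mean-square precision it needs, and the energy deficit this allows. *)
pose z := e / (1 + K * b); have z0 : 0 < z by rewrite divr_gt0.
have ze : z <= e by rewrite ler_pdivrMr// ler_peMr ?(ltW e0)// lerDl.
have Kz : K * b * z <= e.
  rewrite mulrA ler_pdivrMr// [leRHS]mulrC ler_wpM2r ?(ltW e0)//; lra.
pose ac := align_cst d b m0 r.
have ac1 : 0 <= align_cst1 b m0 r.
  by rewrite /align_cst1 addr_ge0// divr_ge0 ?(ltW r0) ?(ltW m00)// addr_ge0// divr_ge0// ltW.
have bac : 0 <= 2 * b * align_cst1 b m0 r by rewrite mulr_ge0// mulr_ge0// ltW.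
have ac2 : 0 <= align_cst2 d b m0 r by rewrite /align_cst2 divr_ge0 ?(ltW d0)// addr_ge0.
have ac0 : 0 <= ac.
  by rewrite /ac /align_cst addr_ge0 ?mulr_ge0 ?addr_ge0// mulr_ge0.
have ac3 : 0 < 1 + ac by lra.
pose k := Num.min 1 (z ^+ 2 / (1 + ac)).
have k0 : 0 < k by rewrite lt_min ltr01 divr_gt0// exprn_gt0.
have k1 : k <= 1 by rewrite ge_min lexx.
have kz : ac * k <= z ^+ 2.
  have : k <= z ^+ 2 / (1 + ac) by rewrite ge_min lexx orbT.
  rewrite ler_pdivlMr// => h; apply: le_trans h; rewrite mulrC ler_wpM2l ?(ltW k0)//; lra.
have k20 : 0 < k / 2 by rewrite divr_gt0.
have [Cl Cl0 ClP] := low_energy_prob K0 a1 ab k20.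
pose C1 := (1 + b) * K / k ^+ 2 + 4 * (3 + b) / k ^+ 2 + Cl.
pose D := 4 / r * (K + 1 + 4 / (e ^+ 2 * r) * ((1 + b) * K) + 4 * C1).
pose E := sqr_excess_cst b r D C1.
pose G := (b + 2 * b ^+ 2) * D + (1 + 2 * b ^+ 2 * D) +
  2 / r * (1 + 2 * b ^+ 2 * D + (1 + 2 * b ^+ 2) / m0 ^+ 2 * E).
exists (`|D| + `|E| + `|G|) => [|n Q QK Qd th /andP[ath thb]].
  by rewrite !addr_ge0.
have th1 : 1 < th by exact: lt_le_trans ath.
have th0 : 0 < th by lra.
have mP := magnetizationP _ th1.
have m0m : m0 <= magnetization th by exact: magnetization_le.
have rr : r <= 1 - th * (1 - magnetization th ^+ 2) by apply: rP; rewrite ath thb.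
have hl := ClP n Q QK th; rewrite ath thb in hl.
have mis := misaligned_prob QK d0 Qd th0 mP thb m00 m0m r0 rr z0 ze Kz k0 k1 kz (hl isT).
have disp := gibbs_dispersion_le QK th0 mP thb r0 rr e0 e1 mis.
have exc := gibbs_sqr_excess_sqr QK th0 mP thb m00 m0m r0 rr e2 disp mis.
have en := gibbs_quad_mean QK th0 mP thb m00 m0m r0 rr e2 disp mis.
have hD := ler_norm D; have hE := ler_norm E; have hG := ler_norm G.
have nD := normr_ge0 D; have nE := normr_ge0 E; have nG := normr_ge0 G.
split.
- by apply: (le_trans disp); rewrite -/D; lra.
- by apply: (le_trans exc); rewrite -/E; lra.
- by apply: (le_trans en); rewrite -/E -/G; lra.
Qed.

End uniform_moments.

(** * Stein's identity for the squared magnetization *)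

Section stein.
Context {R : realType} {n : nat} (Q : 'M[R]_n) (K : R).
Hypothesis QK : coupling K Q.
Implicit Types (x : config n).

Notation t := (field_at Q).
Notation y th x i := (tanh (th * t x i)).
Let Q_sym := coupling_sym QK.
Let Q_ge0 := coupling_ge0 QK.
Let Q_diag := coupling_diag QK.
Let Q_row := coupling_row QK.
Let Q_le := coupling_le QK.
Let n_gt0 := coupling_n0 QK.

Let nR0 : 0 < n%:R :> R. Proof. by rewrite ltr0n. Qed.
Let nN0 : n%:R != 0 :> R. Proof. by rewrite gt_eqF. Qed.
Let sn : R := Num.sqrt n%:R.
Let sn0 : 0 < sn. Proof. by rewrite sqrtr_gt0. Qed.
Let sn2 : sn * sn = n%:R. Proof. by rewrite -expr2 sqr_sqrtr// ltW. Qed.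
Let sn1 : 1 <= sn. Proof. by rewrite -sqrtr1 ler_wsqrtr// ler1n. Qed.

Lemma sum_field_dev x : \sum_i `|t x i - mean_spin x| <=
  sn * ((dispersion Q x + 1) / 2).
Proof.
have c0 : 0 < sn^-1 by rewrite invr_gt0.
apply: (le_trans (sum_abs_le _ c0)); rewrite card_ord -/(dispersion Q x) -sn2.
by rewrite le_eqVlt; apply/orP; left; apply/eqP; field; rewrite gt_eqF.
Qed.

(** The energy that is not explained by the mean spin. *)
Definition quad_gap x : R := quad Q x - n%:R * mean_spin x ^+ 2.

Lemma quad_gapE th x : quad_gap x =
  \sum_i (spin x i - y th x i) * (t x i - mean_spin x) +
  \sum_i (y th x i - tanh (th * mean_spin x)) * (t x i - mean_spin x).
Proof.
have h : \sum_i tanh (th * mean_spin x) * (t x i - mean_spin x) = 0.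
  by rewrite -mulr_sumr (sum_field_center QK) mulr0.
have -> : quad_gap x = \sum_i spin x i * (t x i - mean_spin x).
  rewrite /quad_gap quadE expr2 mulrA -(sum_spin QK) mulr_suml -sumrB.
  by apply: eq_bigr => i _; rewrite mulrBr.
have -> : \sum_i spin x i * (t x i - mean_spin x) =
    \sum_i (spin x i - y th x i) * (t x i - mean_spin x) +
    \sum_i (y th x i - tanh (th * mean_spin x)) * (t x i - mean_spin x) +
    \sum_i tanh (th * mean_spin x) * (t x i - mean_spin x).
  by rewrite -big_split/= -big_split/=; apply: eq_bigr => i _; ring.
by rewrite h addr0.
Qed.

Lemma sum_tanh_dev th T x : 0 <= th -> th <= T ->
  `|\sum_i (y th x i - tanh (th * mean_spin x)) * (t x i - mean_spin x)| <=
  T * dispersion Q x.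
Proof.
move=> th0 thT; apply: (le_trans (ler_norm_sum _ _ _)).
rewrite /dispersion mulr_sumr; apply: ler_sum => i _; rewrite normrM.
have -> : T * (t x i - mean_spin x) ^+ 2 =
    T * `|t x i - mean_spin x| * `|t x i - mean_spin x|.
  by rewrite -[in LHS]real_normK ?num_real// expr2 mulrA.
rewrite ler_wpM2r//; apply: (le_trans (tanh_lip _ _)).
by rewrite -mulrBr normrM (ger0_norm th0) ler_wpM2r.
Qed.

Lemma mean_set_dist x i b :
  `|mean_spin (set_spin x i b) - mean_spin x| <= 2 / n%:R :> R.
Proof.
rewrite mean_set addrAC subrr add0r normrM ger0_norm ?invr_ge0// mulrC.
rewrite ler_wpM2r ?invr_ge0// (le_trans (ler_normB _ _))// norm_spin.
by case: b; rewrite ?normrN normr1.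
Qed.

Lemma flip_diff_gap x i :
  `|quad_gap (set_spin x i true) - quad_gap (set_spin x i false)| <=
  4 * `|t x i - mean_spin x| + 8 / n%:R.
Proof.
set xp := set_spin x i true; set xm := set_spin x i false.
have -> : quad_gap xp - quad_gap xm =
    4 * (t x i - mean_spin x) -
    2 * ((mean_spin xp - mean_spin x) + (mean_spin xm - mean_spin x)).
  have -> : quad_gap xp - quad_gap xm = quad Q xp - quad Q xm -
     n%:R * (mean_spin xp - mean_spin xm) * (mean_spin xp + mean_spin xm).
    by rewrite /quad_gap; ring.
  rewrite quad_diff// mean_diff; field; exact: nN0.
apply: (le_trans (ler_normB _ _)); rewrite !normrM !(ger0_norm (ler0n _ _)).
rewrite lerD2l (_ : 8 / n%:R = 2 * ((2 + 2) / n%:R)) ?ler_wpM2l//; last by field.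
by rewrite (le_trans (ler_normD _ _))// mulrDl lerD// mean_set_dist.
Qed.

Section close.
Context (th T D : R) (th_ge0 : 0 <= th) (thT : th <= T).
Hypothesis dispD : gibbs th Q (dispersion Q) <= D.

(** Integrating by parts against a bounded increasing function of the gap itself: the
    flip derivatives of this function are of order [1 / sqrt n] times the field
    deviations. *)
Lemma gibbs_gap_tanh :
  gibbs th Q (fun x => quad_gap x * tanh (quad_gap x / sn)) <= (T + 4) * D + 4.
Proof.
pose Phi x := tanh (quad_gap x / sn).
have P1 x : `|Phi x| <= 1 by exact: norm_tanh_le1.
have dP x i : `|flip_diff i Phi x| <= (2 * `|t x i - mean_spin x| + 4 / n%:R) / sn.
  apply: norm_flip_diff; apply: (le_trans (tanh_lip _ _)).
  rewrite -mulrBl normrM [`|sn^-1|]gtr0_norm ?invr_gt0// mulrA ler_wpM2r//.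
    by rewrite invr_ge0 ltW.
  by apply: (le_trans (flip_diff_gap x i)); rewrite le_eqVlt; apply/orP; left; apply/eqP; ring.
have E x : quad_gap x * Phi x =
    \sum_i (spin x i - y th x i) * ((t x i - mean_spin x) * Phi x) +
    (\sum_i (y th x i - tanh (th * mean_spin x)) * (t x i - mean_spin x)) * Phi x.
  rewrite (quad_gapE th) mulrDl; congr (_ + _).
  by rewrite mulr_suml; apply: eq_bigr => i _; rewrite mulrA.
rewrite (gibbs_ext _ _ E) gibbsD.
have h2 : gibbs th Q (fun x => (\sum_i (y th x i - tanh (th * mean_spin x)) *
    (t x i - mean_spin x)) * Phi x) <= T * D.
  apply: (@le_trans _ _ (gibbs th Q (fun x => T * dispersion Q x))).
    apply: gibbs_le => x; apply: (le_trans (ler_norm _)); rewrite normrM.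
    rewrite -[leRHS]mulr1; apply: ler_pM => //; exact: sum_tanh_dev.
  by rewrite gibbsZ ler_wpM2l// (le_trans th_ge0).
have h1 : gibbs th Q (fun x => \sum_i (spin x i - y th x i) *
    ((t x i - mean_spin x) * Phi x)) <= 4 * D + 4.
  apply: (le_trans (ler_norm _)).
  apply: (le_trans (gibbs_ibp_le Q_sym Q_diag _ _)).
  apply: (@le_trans _ _ (gibbs th Q (fun x => 4 * dispersion Q x + 4))); last first.
    by rewrite gibbsD gibbsZ gibbs_cst lerD2r ler_wpM2l.
  apply: gibbs_le => x.
  have hi i : `|flip_diff i (fun x => (t x i - mean_spin x) * Phi x) x| <=
      `|t x i - mean_spin x| * `|flip_diff i Phi x| + 2 / n%:R.
    set xp := set_spin x i true; set xm := set_spin x i false.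
    have -> : flip_diff i (fun x => (t x i - mean_spin x) * Phi x) x =
       (t x i - mean_spin x) * flip_diff i Phi x -
       ((mean_spin xp - mean_spin x) * Phi xp - (mean_spin xm - mean_spin x) * Phi xm) / 2.
      by rewrite /flip_diff -/xp -/xm !(field_set Q_diag); field.
    apply: (le_trans (ler_normB _ _)); rewrite [X in X + _]normrM lerD2l.
    rewrite normrM [`|2^-1|]gtr0_norm ?invr_gt0// ler_pdivrMr//.
    apply: (le_trans (ler_normB _ _)); rewrite mulr_natr mulr2n.
    by apply: lerD; rewrite normrM -[leRHS]mulr1 ler_pM// mean_set_dist.
  apply: (le_trans (ler_sum _ (fun i _ => hi i))).
  rewrite big_split/= sum_cst.
  have -> : n%:R * (2 / n%:R) = 2 :> R by rewrite mulrC divfK.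
  have h3 : \sum_i `|t x i - mean_spin x| * `|flip_diff i Phi x| <=
      2 / sn * dispersion Q x + 4 / (n%:R * sn) * \sum_i `|t x i - mean_spin x|.
    rewrite /dispersion !mulr_sumr -big_split/=; apply: ler_sum => i _.
    apply: (le_trans (ler_wpM2l (normr_ge0 _) (dP x i))).
    rewrite -[X in _ <= _ * X + _](@real_normK _ (t x i - mean_spin x)) ?num_real//.
    by rewrite le_eqVlt; apply/orP; left; apply/eqP; field; rewrite gt_eqF.
  have d0 := @dispersion_ge0 _ _ Q x.
  have h4 : 2 / sn * dispersion Q x <= 2 * dispersion Q x.
    by rewrite ler_wpM2r// ler_pdivrMr// ler_peMr.
  have n1 : 1 <= n%:R :> R by rewrite ler1n.
  have h5 : 4 / (n%:R * sn) * (\sum_i `|t x i - mean_spin x|) <=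
      2 * (dispersion Q x + 1).
    have n4 : 0 <= 4 / (n%:R * sn) by rewrite divr_ge0// mulr_ge0// ltW.
    apply: (le_trans (ler_wpM2l n4 (sum_field_dev x))).
    have -> : 4 / (n%:R * sn) * (sn * ((dispersion Q x + 1) / 2)) =
      2 * (dispersion Q x + 1) / n%:R by field; rewrite nN0 gt_eqF.
    by rewrite ler_pdivrMr// ler_peMr// mulr_ge0// addr_ge0.
  by move: h3 h4 h5; lra.
rewrite addrC [leRHS](_ : _ = T * D + (4 * D + 4)); last by ring.
exact: lerD.
Qed.

(** [u * tanh (u / sqrt n)] is at least of order [sqrt n] when [`|u|] is. *)
Lemma gap_prob e : 0 < e ->
  gibbs th Q (fun x => (e * sn < `|quad_gap x|)%R%:R) <=
  ((T + 4) * D + 4) / (e * tanh e) / sn.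
Proof.
move=> e0; have te := tanh_gt0 _ e0.
have et : 0 < e * tanh e * sn by rewrite mulr_gt0// mulr_gt0.
rewrite -mulrA -invfM ler_pdivlMr// mulrC -gibbsZ.
apply: le_trans gibbs_gap_tanh; apply: gibbs_le => x.
have E : quad_gap x * tanh (quad_gap x / sn) = `|quad_gap x| * tanh (`|quad_gap x| / sn).
  have [h|h] := leP 0 (quad_gap x); first by rewrite ger0_norm.
  by rewrite ltr0_norm// (mulNr (quad_gap x) sn^-1) tanhN mulrNN.
rewrite E; case: (boolP (e * sn < _)) => [h|_] /=; last first.
  by rewrite mulr0 mulr_ge0// tanh_ge0// divr_ge0// ltW.
rewrite mulr1 mulrAC ler_pM//.
- by rewrite mulr_ge0// ltW.
- exact: ltW.
- exact: ltW.
- by rewrite tanh_ler// ler_pdivlMr// ltW.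
Qed.

End close.

Section identity.
Context (th m T m0 r0 D C : R) (th_gt0 : 0 < th) (mP : curie_weiss_root th m).
Let rho := th * (1 - m ^+ 2).
Let m_gt0 : 0 < m := mP.1.
Let m_lt1 : m < 1 := root_lt1 _ _ mP.
Let mE : m = tanh (th * m) := mP.2.
Hypothesis (thT : th <= T) (m0_gt0 : 0 < m0) (m0m : m0 <= m).
Hypothesis (r0_gt0 : 0 < r0) (r0rho : r0 <= 1 - rho).
Hypothesis dispD : gibbs th Q (dispersion Q) <= D.
Hypothesis excC : n%:R * gibbs th Q (fun x => sqr_excess m x ^+ 2) <= C.
Let T_gt0 : 0 < T. Proof. exact: lt_le_trans thT. Qed.

Context (phi dphi : R -> R) (B : R).
Hypothesis phi_der : forall u : R, is_derive u 1 phi (dphi u).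
Hypothesis phi_B : forall u, `|phi u| <= B.
Hypothesis dphi_B : forall u, `|dphi u| <= B.
Hypothesis dphi_lip : forall u v, `|dphi u - dphi v| <= B * (1 + `|u|) * `|u - v|.

Let B_ge0 : 0 <= B. Proof. exact: le_trans (phi_B 0). Qed.

(** Linearized at either [m] or [- m] this is [2 * m * sqrt n] times the deviation; using the
    square treats both phases at once. *)
Definition root_scale m (u : R) : R := sn * (u ^+ 2 - m ^+ 2).
Notation U x := (root_scale m (mean_spin x)).

Let k (u : R) := u * phi (root_scale m u).
Let dk (u : R) := phi (root_scale m u) + 2 * sn * u ^+ 2 * dphi (root_scale m u).

Lemma is_derive_k (u : R) : is_derive u 1 k (dk u).
Proof.
have d1 : is_derive u 1 (root_scale m) (sn * (2 * u)).
  have h1 := is_deriveM (is_derive_id u (1 : R)) (is_derive_id u (1 : R)).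
  have h2 := is_deriveZ sn (is_deriveB h1 (is_derive_cst (m ^+ 2) u (1 : R))).
  apply: (is_derive_congr _ _ _ _ _ h2) => [v|].
    by change (sn * (v * v - m ^+ 2) = root_scale m v); rewrite /root_scale expr2.
  by rewrite /GRing.scale/=; ring.
have d2 := @is_derive1_comp _ phi (root_scale m) _ _ _ (phi_der _) d1.
apply: (is_derive_congr _ _ _ _ _ (is_deriveM (is_derive_id u (1 : R)) d2)) => //=.
by rewrite /dk /GRing.scale/=; ring.
Qed.

Lemma root_scaleE x : U x = sn * sqr_excess m x.
Proof. by []. Qed.

Let M1 x : `|mean_spin x : R| <= 1 := norm_mean_le1 QK x.

(** The flip derivative of [M * phi U] is [(1 / n) * dk] at an intermediate point, which is
    then moved to [U x], and the conditional variance [1 - y ^+ 2] to [1 - m ^+ 2]. *)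
Lemma stein_term x i :
  `| (1 - y th x i ^+ 2) * flip_diff i (fun x => k (mean_spin x)) x -
     2 * sn / n%:R * ((1 - m ^+ 2) * m ^+ 2 * dphi (U x)) | <=
  B / n%:R + 2 * sn / n%:R * (B * (1 + `|U x|) * (4 / sn) +
    B * (`|sqr_excess m x| + 4 / n%:R +
         (2 * T * `|t x i - mean_spin x| + 2 * T * (`|sqr_excess m x| / m0)))).
Proof.
set Mp : R := mean_spin (set_spin x i true); set Mm : R := mean_spin (set_spin x i false).
have Mpm : Mp - Mm = 2 / n%:R by exact: mean_diff.
have Mle : Mm <= Mp by rewrite -subr_ge0 Mpm divr_ge0.
have [xi /andP[x1 x2] Ek] := mean_value _ _ _ _ Mle is_derive_k.
have -> : flip_diff i (fun x => k (mean_spin x)) x = dk xi / n%:R.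
  by rewrite /flip_diff -/Mp -/Mm Ek Mpm; field.
have dM b : `|mean_spin (set_spin x i b) - mean_spin x| <= 2 / n%:R :> R := mean_set_dist x i b.
have xiM : `|xi - mean_spin x| <= 2 / n%:R.
  have := dM true; have := dM false; rewrite -/Mp -/Mm !ler_norml.
  by move=> /andP[? ?] /andP[? ?]; apply/andP; split; lra.
have xi1 : `|xi| <= 1.
  have := norm_mean_le1 QK (set_spin x i true); have := norm_mean_le1 QK (set_spin x i false).
  rewrite -/Mp -/Mm !ler_norml => /andP[? ?] /andP[? ?]; apply/andP; split; lra.
have xi2 : xi ^+ 2 <= 1 by rewrite -real_normK ?num_real// expr_le1.
have xi20 := sqr_ge0 xi.
have xiM2 : `|xi ^+ 2 - mean_spin x ^+ 2| <= 4 / n%:R.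
  rewrite subr_sqr normrM.
  have -> : 4 / n%:R = 2 / n%:R * 2 :> R by field.
  apply: ler_pM => //; rewrite (le_trans (ler_normD _ _))// -[2]/(1 + 1).
  by rewrite lerD// M1.
have dU : `|U x - root_scale m xi| <= 4 / sn.
  have -> : U x - root_scale m xi = - (sn * (xi ^+ 2 - mean_spin x ^+ 2)).
    by rewrite /root_scale; ring.
  rewrite normrN normrM (gtr0_norm sn0).
  apply: (le_trans (ler_wpM2l (ltW sn0) xiM2)); rewrite -sn2.
  by rewrite le_eqVlt; apply/orP; left; apply/eqP; field; rewrite gt_eqF.
have y1 := tanh2_le1 (th * t x i); have y0 := sqr_ge0 (y th x i).
have a1 : `|1 - y th x i ^+ 2| <= 1 by rewrite ger0_norm ?subr_ge0// gerBl.
have -> : (1 - y th x i ^+ 2) * (dk xi / n%:R) -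
     2 * sn / n%:R * ((1 - m ^+ 2) * m ^+ 2 * dphi (U x)) =
  (1 - y th x i ^+ 2) * phi (root_scale m xi) / n%:R +
  2 * sn / n%:R * ((1 - y th x i ^+ 2) * xi ^+ 2 * (dphi (root_scale m xi) - dphi (U x)) +
    dphi (U x) * ((1 - y th x i ^+ 2) * xi ^+ 2 - (1 - m ^+ 2) * m ^+ 2)).
  by rewrite /dk; field.
apply: (le_trans (ler_normD _ _)); apply: lerD.
  rewrite normrM [`|n%:R^-1|]ger0_norm ?invr_ge0// ler_wpM2r ?invr_ge0//.
  by rewrite normrM -[leRHS]mul1r ler_pM.
have sn20 : 0 <= 2 * sn / n%:R by rewrite divr_ge0// mulr_ge0// ltW.
rewrite normrM (ger0_norm sn20) ler_wpM2l//.
apply: (le_trans (ler_normD _ _)); apply: lerD.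
  rewrite normrM -[leRHS]mul1r; apply: ler_pM => //.
    by rewrite normrM -[leRHS]mul1r ler_pM// ger0_norm.
  rewrite distrC; apply: (le_trans (dphi_lip _ _)); rewrite ler_wpM2l//.
  by rewrite mulr_ge0// addr_ge0.
rewrite normrM ler_pM//.
have -> : (1 - y th x i ^+ 2) * xi ^+ 2 - (1 - m ^+ 2) * m ^+ 2 =
  (1 - y th x i ^+ 2) * ((xi ^+ 2 - mean_spin x ^+ 2) + sqr_excess m x) -
  m ^+ 2 * ((y th x i ^+ 2 - tanh (th * mean_spin x) ^+ 2) +
            (tanh (th * mean_spin x) ^+ 2 - m ^+ 2)).
  by rewrite /sqr_excess; ring.
apply: (le_trans (ler_normB _ _)); apply: lerD.
  rewrite normrM -[leRHS]mul1r; apply: ler_pM => //.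
  by rewrite (le_trans (ler_normD _ _))// addrC lerD.
have m21 : `|m ^+ 2| <= 1 by rewrite ger0_norm ?sqr_ge0// expr_le1// ltW.
rewrite normrM -[leRHS]mul1r; apply: ler_pM => //.
apply: (le_trans (ler_normD _ _)); apply: lerD.
  apply: (le_trans (sqr_tanh_lip _ _)).
  rewrite -mulrBr normrM (gtr0_norm th_gt0) mulrA ler_wpM2r// ler_wpM2l//.
have -> : tanh (th * mean_spin x) ^+ 2 = tanh (th * `|mean_spin x|) ^+ 2.
  by rewrite -[in LHS]real_normK ?num_real// tanh_norm normrM (gtr0_norm th_gt0).
rewrite {1}mE; apply: (le_trans (sqr_tanh_lip _ _)).
rewrite -mulrBr normrM (gtr0_norm th_gt0) mulrA.
apply: ler_pM => //; first by rewrite mulr_ge0// ltW.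
  by rewrite ler_wpM2l.
rewrite ler_pdivlMr//.
have -> : sqr_excess m x = (`|mean_spin x| - m) * (`|mean_spin x| + m).
  by rewrite /sqr_excess -[in LHS]real_normK ?num_real//; ring.
rewrite [X in _ <= X]normrM ler_wpM2l// (le_trans m0m)//.
by rewrite ger0_norm ?addr_ge0 ?(ltW m_gt0)// lerDr.
Qed.

Lemma gibbs_norm_U : gibbs th Q (fun x => `|U x|) <= (1 + C) / 2.
Proof.
apply: (@le_trans _ _ (gibbs th Q (fun x => 2^-1 + n%:R / 2 * sqr_excess m x ^+ 2))).
  apply: gibbs_le => x; rewrite root_scaleE normrM (gtr0_norm sn0) -sn2.
  rewrite -[in leRHS]real_normK ?num_real//.
  by have := sqr_ge0 (sn * `|sqr_excess m x| - 1); lra.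
by rewrite gibbsD gibbs_cst gibbsZ; move: excC; lra.
Qed.

Definition stein_cst (T m0 D C : R) :=
  (17 + 2 * T * (D + 1)) + (10 + 4 * T / m0) * ((1 + C) / 2) +
  2 * T ^+ 2 * D + (1 + 2 * T ^+ 2) / m0 ^+ 2 * C.

(** Both sides compute the expectation of [\sum_i (s i - y i) * M * phi U]: directly, the drift gives
    the term in [U * phi U]; by parts, the flip derivative gives the term in [dphi U]. *)
Lemma stein_identity :
  `|(1 - rho) / 2 * gibbs th Q (fun x => U x * phi (U x)) -
    2 * (m ^+ 2 * (1 - m ^+ 2)) * gibbs th Q (fun x => dphi (U x))| <=
  B * stein_cst T m0 D C / sn.
Proof.
have d0 x := @dispersion_ge0 _ _ Q x.
pose F x := \sum_i (1 - y th x i ^+ 2) * flip_diff i (fun x => k (mean_spin x)) x.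
pose G x := (n%:R * mean_spin x - \sum_i y th x i) * k (mean_spin x).
(* Integration by parts turns G into F. *)
have GF : gibbs th Q G = gibbs th Q F.
  have E x : G x = \sum_i (spin x i - y th x i) * k (mean_spin x).
    by rewrite /G -(sum_spin QK) -sumrB mulr_suml.
  rewrite (gibbs_ext _ _ E) !gibbs_sum; apply: eq_bigr => i _.
  exact: gibbs_ibp.
(* Conditional variances and flip derivatives are replaced by their limits. *)
have s1 : `|gibbs th Q F - 2 * sn * (m ^+ 2 * (1 - m ^+ 2)) * gibbs th Q (fun x => dphi (U x))| <=
    B * ((17 + 2 * T * (D + 1)) + (10 + 4 * T / m0) * ((1 + C) / 2)).
  rewrite -gibbsZ -gibbsB; apply: (le_trans (norm_gibbs _ _ _)).
  apply: (@le_trans _ _ (gibbs th Q (fun x => B * ((17 + 2 * T) +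
      2 * T * dispersion Q x + (10 + 4 * T / m0) * `|U x|)))); last first.
    rewrite gibbsZ ler_wpM2l// 2!gibbsD gibbs_cst 2!gibbsZ.
    have := ler_wpM2l (_ : 0 <= 10 + 4 * T / m0) gibbs_norm_U.
    have q : 0 <= 10 + 4 * T / m0 by rewrite addr_ge0// divr_ge0 ?(ltW m0_gt0)// mulr_ge0// ltW.
    have q2 : 0 <= 2 * T by rewrite mulr_ge0// ltW.
    by move=> /(_ q); have := ler_wpM2l q2 dispD; lra.
  apply: gibbs_le => x.
  have -> : F x - 2 * sn * (m ^+ 2 * (1 - m ^+ 2)) * dphi (U x) =
    \sum_i ((1 - y th x i ^+ 2) * flip_diff i (fun x => k (mean_spin x)) x -
     2 * sn / n%:R * ((1 - m ^+ 2) * m ^+ 2 * dphi (U x))).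
    by rewrite sumrB sum_cst /F; congr (_ - _); field.
  apply: (le_trans (ler_norm_sum _ _ _)).
  apply: (le_trans (ler_sum _ (fun i _ => stein_term x i))).
  set p := `|sqr_excess m x|.
  have pU : p = `|U x| / sn.
    by rewrite root_scaleE normrM (gtr0_norm sn0) mulrC mulKf ?gt_eqF.
  have -> : \sum_(i < n) (B / n%:R + 2 * sn / n%:R * (B * (1 + `|U x|) * (4 / sn) +
    B * (p + 4 / n%:R + (2 * T * `|t x i - mean_spin x| + 2 * T * (p / m0))))) =
    B + 2 * sn * (B * (1 + `|U x|) * (4 / sn) + B * (p + 4 / n%:R + 2 * T * (p / m0))) +
    2 * sn / n%:R * B * (2 * T) * \sum_(i < n) `|t x i - mean_spin x|.
    rewrite mulr_sumr.
    have -> : B + 2 * sn * (B * (1 + `|U x|) * (4 / sn) +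
       B * (p + 4 / n%:R + 2 * T * (p / m0))) =
      \sum_(i < n) (B / n%:R + 2 * sn / n%:R * (B * (1 + `|U x|) * (4 / sn) +
       B * (p + 4 / n%:R + 2 * T * (p / m0)))).
      by rewrite sum_cst; field; rewrite nN0 !gt_eqF.
    by rewrite -big_split/=; apply: eq_bigr => i _; field; rewrite nN0 !gt_eqF.
  have h1 : 2 * sn / n%:R * B * (2 * T) * (\sum_(i < n) `|t x i - mean_spin x|) <=
     2 * B * T * (dispersion Q x + 1).
    have q : 0 <= 2 * sn / n%:R * B * (2 * T).
      by rewrite !mulr_ge0 ?invr_ge0// ltW.
    apply: (le_trans (ler_wpM2l q (sum_field_dev x))); rewrite -sn2.
    by rewrite le_eqVlt; apply/orP; left; apply/eqP; field; rewrite gt_eqF.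
  apply: (le_trans (lerD (lexx _) h1)); rewrite pU.
  have -> : B + 2 * sn * (B * (1 + `|U x|) * (4 / sn) + B * (`|U x| / sn + 4 / n%:R +
      2 * T * (`|U x| / sn / m0))) + 2 * B * T * (dispersion Q x + 1) =
    B * (9 + 10 * `|U x| + 8 / sn + 4 * T / m0 * `|U x| + 2 * T * (dispersion Q x + 1)).
    by rewrite -sn2; field; rewrite !gt_eqF.
  rewrite ler_wpM2l//.
  have : 8 / sn <= 8 by rewrite ler_pdivrMr// ler_peMr.
  by lra.
(* Averages of conditional means are replaced by the conditional mean at the average. *)
have s2 : `|gibbs th Q (fun x => n%:R * drift th (mean_spin x) * phi (U x)) - gibbs th Q G| <=
    B * (2 * T ^+ 2 * D).
  rewrite -gibbsB; apply: (le_trans (norm_gibbs _ _ _)).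
  apply: (@le_trans _ _ (gibbs th Q (fun x => B * (2 * T ^+ 2) * dispersion Q x))); last first.
    by rewrite gibbsZ -mulrA ler_wpM2l// ler_wpM2l// mulr_ge0// sqr_ge0.
  apply: gibbs_le => x; rewrite /G /drift /k.
  have -> : n%:R * (mean_spin x * (mean_spin x - tanh (th * mean_spin x))) * phi (U x) -
     (n%:R * mean_spin x - \sum_i y th x i) * (mean_spin x * phi (U x)) =
    (\sum_i y th x i - n%:R * tanh (th * mean_spin x)) * (mean_spin x * phi (U x)) by ring.
  have -> : B * (2 * T ^+ 2) * dispersion Q x = 2 * T ^+ 2 * dispersion Q x * B by ring.
  rewrite normrM; apply: ler_pM => //.
    apply: (le_trans (sum_tanh_linear QK th x)); rewrite ler_wpM2r ?d0//.
    by rewrite ler_wpM2l// ler_pXn2r// nnegrE ltW.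
  by rewrite normrM -[leRHS]mul1r ler_pM.
(* The drift is linearized. *)
have s3 : `|(1 - rho) / 2 * sn * gibbs th Q (fun x => U x * phi (U x)) -
    gibbs th Q (fun x => n%:R * drift th (mean_spin x) * phi (U x))| <=
    B * ((1 + 2 * T ^+ 2) / m0 ^+ 2 * C).
  rewrite -gibbsZ -gibbsB; apply: (le_trans (norm_gibbs _ _ _)).
  have cg : 0 <= (1 + 2 * T ^+ 2) / m0 ^+ 2.
    by rewrite divr_ge0 ?sqr_ge0// addr_ge0// mulr_ge0// sqr_ge0.
  apply: (@le_trans _ _ (gibbs th Q (fun x => B * ((1 + 2 * T ^+ 2) / m0 ^+ 2) * n%:R *
      sqr_excess m x ^+ 2))); last first.
    rewrite gibbsZ; have := ler_wpM2l B_ge0 (ler_wpM2l cg excC).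
    by rewrite !mulrA.
  apply: gibbs_le => x.
  have -> : (1 - rho) / 2 * sn * (U x * phi (U x)) -
      n%:R * drift th (mean_spin x) * phi (U x) =
    - (phi (U x) * (n%:R * (drift th (mean_spin x) - (1 - rho) / 2 * sqr_excess m x))).
    by rewrite root_scaleE -sn2; ring.
  rewrite normrN normrM.
  have -> : B * ((1 + 2 * T ^+ 2) / m0 ^+ 2) * n%:R * sqr_excess m x ^+ 2 =
     B * (n%:R * ((1 + 2 * T ^+ 2) / m0 ^+ 2 * sqr_excess m x ^+ 2)) by ring.
  apply: ler_pM => //; rewrite normrM (gtr0_norm nR0) ler_wpM2l//.
  have := drift_expand th_gt0 mP thT m0_gt0 m0m r0_gt0 r0rho (mean_spin x).
  by rewrite M1 mulr1.
rewrite ler_pdivlMr// -[X in _ * X](gtr0_norm sn0) -normrM.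
have -> : ((1 - rho) / 2 * gibbs th Q (fun x => U x * phi (U x)) -
    2 * (m ^+ 2 * (1 - m ^+ 2)) * gibbs th Q (fun x => dphi (U x))) * sn =
  ((1 - rho) / 2 * sn * gibbs th Q (fun x => U x * phi (U x)) -
    gibbs th Q (fun x => n%:R * drift th (mean_spin x) * phi (U x))) +
  (gibbs th Q (fun x => n%:R * drift th (mean_spin x) * phi (U x)) - gibbs th Q G) +
  (gibbs th Q F - 2 * sn * (m ^+ 2 * (1 - m ^+ 2)) * gibbs th Q (fun x => dphi (U x))).
  by rewrite GF; ring.
apply: (le_trans (ler_normD _ _)); rewrite /stein_cst.
have -> : B * (17 + 2 * T * (D + 1) + (10 + 4 * T / m0) * ((1 + C) / 2) +
    2 * T ^+ 2 * D + (1 + 2 * T ^+ 2) / m0 ^+ 2 * C) =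
  (B * ((1 + 2 * T ^+ 2) / m0 ^+ 2 * C) + B * (2 * T ^+ 2 * D)) +
  B * (17 + 2 * T * (D + 1) + (10 + 4 * T / m0) * ((1 + C) / 2)) by ring.
by apply: lerD => //; apply: (le_trans (ler_normD _ _)); apply: lerD.
Qed.

End identity.
End stein.

(** * Gaussian distribution functions *)

Section normal_cdf.
Context {R : realType}.
Notation mu := (@lebesgue_measure R).
Implicit Types (m s x u v : R).

Definition normal_cdf m s x : R := (\int[mu]_(t in `]-oo, x]) normal_pdf m s t)%R.

Lemma integrable_normal_pdfS m s (A : set R) : measurable A ->
  mu.-integrable A (EFin \o normal_pdf m s).
Proof.
by move=> mA; apply: integrableS (integrable_normal_pdf m s).
Qed.

Lemma normal_cdfE m s x : normal_prob m s `]-oo, x] = (normal_cdf m s x)%:E.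
Proof.
rewrite /normal_cdf /Rintegral fineK//; apply: integrable_fin_num => //.
exact: integrable_normal_pdfS.
Qed.

Lemma normal_cdf_ge0 m s x : 0 <= normal_cdf m s x.
Proof. by rewrite -lee_fin -normal_cdfE. Qed.

Lemma normal_cdf_le1 m s x : normal_cdf m s x <= 1.
Proof. by rewrite -lee_fin -normal_cdfE probability_le1. Qed.

Lemma normal_cdf_le m s x u : x <= u -> normal_cdf m s x <= normal_cdf m s u.
Proof.
move=> xu; rewrite -lee_fin -!normal_cdfE le_measure ?inE//.
by apply: subitvPr; rewrite bnd_simp.
Qed.

Lemma normal_prob_gt m s x : normal_prob m s `]x, +oo[ = (1 - normal_cdf m s x)%:E.
Proof.
have -> : `]x, +oo[%classic = ~` `]-oo, x]%classic :> set R.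
  by rewrite setCitvl.
by rewrite EFinB -normal_cdfE; apply: probability_setC.
Qed.

Lemma is_derive_normal_cdf m s x : s != 0 ->
  is_derive x 1 (normal_cdf m s) (normal_pdf m s x).
Proof.
move=> s0; have x1 : x < x + 1 by rewrite ltrDl.
have [d e] := @continuous_FTC1 _ _ -oo%O x (x + 1) x1
  (integrable_normal_pdfS m s (measurable_itv _)) (ltNyr x) (@continuous_normal_pdf R m s s0 x).
by split; [exact: d|rewrite -derive1E].
Qed.

Lemma normal_cdf_cvgy m s e : 0 < e ->
  exists A, forall x, A <= x -> 1 - e < normal_cdf m s x.
Proof.
move=> e0.
have h : normal_prob m s (\bigcup_n `]-oo, n%:R]%classic) = 1%E.
  rewrite -(probability_setT (normal_prob m s)); congr (normal_prob _ _ _).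
  rewrite -subTset => t _ /=.
  by exists (Num.truncn t).+1 => //=; rewrite in_itv/= ltW// truncnS_gt.
have c : normal_prob m s `]-oo, n%:R] @[n --> \oo] --> 1%E.
  rewrite -h; apply: nondecreasing_cvg_mu => //; first exact: bigcup_measurable.
  move=> n k nk; apply/subsetPset => z/=; rewrite !in_itv/= => /le_trans.
  by apply; rewrite ler_nat.
have : normal_cdf m s n%:R @[n --> \oo] --> (1 : R) by exact: (fine_cvg c).
move=> /cvgrPdist_lt/(_ _ e0)[n _ /(_ n (leqnn _))] /=.
rewrite ger0_norm ?subr_ge0 ?normal_cdf_le1// => hn.
by exists n%:R => x /(normal_cdf_le m s); lra.
Qed.

Lemma normal_cdf_cvgNy m s e : 0 < e ->
  exists A, forall x, x <= A -> normal_cdf m s x < e.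
Proof.
move=> e0.
have h : normal_prob m s (\bigcap_n `]-oo, - n%:R]%classic) = 0%E.
  rewrite -(measure0 (normal_prob m s)); congr (normal_prob _ _ _).
  rewrite -subset0 => t /(_ (Num.bound t) I) /=.
  by rewrite in_itv/= leNgt => /negP; apply; rewrite ltrNl unstable.ltrNbound.
have c : normal_prob m s `]-oo, - n%:R] @[n --> \oo] --> 0%E.
  rewrite -h; apply: nonincreasing_cvg_mu => //=.
  + by rewrite (le_lt_trans (probability_le1 _ _)) ?ltry.
  + exact: bigcap_measurable.
  + move=> n k nk; apply/subsetPset => x/=; rewrite !in_itv => /le_trans; apply.
    by rewrite lerN2 ler_nat.
have : normal_cdf m s (- n%:R) @[n --> \oo] --> (0 : R) by exact: (fine_cvg c).
move=> /cvgrPdist_lt/(_ _ e0)[n _ /(_ n (leqnn _))] /=.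
rewrite sub0r normrN ger0_norm ?normal_cdf_ge0// => hn.
by exists (- n%:R) => x /(normal_cdf_le m s); lra.
Qed.

Lemma normal_pdf_scale m s x : 0 < s ->
  normal_pdf 0 1 ((x - m) / s) / s = normal_pdf m s x.
Proof.
move=> s0; rewrite !normal_pdfE ?oner_eq0 ?gt_eqF// /normal_peak /normal_fun.
rewrite subr0 expr1n mul1r mulrAC.
rewrite -[s ^+ 2 * pi *+ 2]mulrnAr sqrtrM ?sqr_ge0// sqrtr_sqr gtr0_norm// invfM.
have -> : - ((x - m) / s) ^+ 2 / 2 = - (x - m) ^+ 2 / (s ^+ 2 *+ 2).
  by field; rewrite gt_eqF.
by ring.
Qed.

Lemma normal_cdf_scale m s x : 0 < s ->
  normal_cdf m s x = normal_cdf 0 1 ((x - m) / s).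
Proof.
move=> s0; have sn0 : s != 0 by rewrite gt_eqF.
pose G u : R := normal_cdf m s u - normal_cdf 0 1 ((u - m) / s).
have dG (u : R) : is_derive u 1 G 0.
  have d1 : is_derive u 1 (fun v : R => (v - m) / s) s^-1.
    have h := is_deriveZ s^-1 (is_deriveB (is_derive_id u (1 : R)) (is_derive_cst m u (1 : R))).
    apply: (is_derive_congr _ _ _ _ _ h) => [v|].
      by change (s^-1 * (v - m) = (v - m) / s); rewrite mulrC.
    by rewrite /GRing.scale/= subr0 mulr1.
  have d2 := is_derive_normal_cdf 0 ((u - m) / s) (oner_neq0 R).
  have d3 := @is_derive1_comp _ (normal_cdf 0 1) (fun v : R => (v - m) / s) u _ _ d2 d1.
  apply: (is_derive_congr _ _ _ _ _ (is_deriveB (is_derive_normal_cdf m u sn0) d3)) => //.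
  by rewrite normal_pdf_scale// subrr.
apply/eqP; rewrite -subr_eq0 -normr_eq0 -/(G x).
rewrite eq_le normr_ge0 andbT; apply/ler_addgt0Pl => e e0; rewrite addr0.
have [A hA] := normal_cdf_cvgNy m s e0; have [A' hA'] := normal_cdf_cvgNy 0 1 e0.
pose z := Num.min x (Num.min A (m + s * A')).
have zx : z <= x by rewrite ge_min lexx.
have [c _] := mean_value _ _ _ _ zx dG; rewrite mul0r => /eqP; rewrite subr_eq0 => /eqP ->.
have h1 : normal_cdf m s z < e by apply: hA; rewrite !ge_min lexx !orbT.
have h2 : normal_cdf 0 1 ((z - m) / s) < e.
  apply: hA'; rewrite ler_pdivrMr// lerBlDl [A' * s]mulrC.
  by rewrite !ge_min lexx !orbT.
have h3 := normal_cdf_ge0 m s z; have h4 := normal_cdf_ge0 0 1 ((z - m) / s).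
by rewrite /G ler_norml lerBDr lerBlDr; apply/andP; split;
  [rewrite (le_trans _ h3) // addrC subr_le0 ltW|rewrite (le_trans (ltW h1)) // lerDl].
Qed.

End normal_cdf.

Section mills.
Context {R : realType}.
Implicit Types (x u v : R).
Notation Phi := (normal_cdf 0 (1 : R)).
Notation p := (normal_pdf 0 (1 : R)).

Lemma std_pdfE x : p x = normal_peak 1 * expR (- (x ^+ 2 / 2)).
Proof.
rewrite normal_pdfE ?oner_neq0// /normal_fun subr0 expr1n; congr (_ * expR _).
by rewrite mulNr.
Qed.

Lemma std_pdf_gt0 x : 0 < p x.
Proof. by rewrite std_pdfE mulr_gt0 ?expR_gt0// normal_peak_gt0// oner_neq0. Qed.

Lemma is_derive_half_sqr x : is_derive x 1 (fun u : R => u ^+ 2 / 2) x.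
Proof.
have h := is_deriveZ (2^-1 : R) (is_deriveM (is_derive_id x (1 : R)) (is_derive_id x (1 : R))).
apply: (is_derive_congr _ _ _ _ _ h) => [v|].
  by change (2^-1 * (v * v) = v ^+ 2 / 2); rewrite mulrC expr2.
by rewrite /GRing.scale/=; field.
Qed.

(** The reciprocal of the standard density, in a form that is visibly smooth. *)
Definition inv_pdf x : R := (normal_peak 1)^-1 * expR (x ^+ 2 / 2).

Lemma inv_pdfE x : inv_pdf x = (p x)^-1.
Proof. by rewrite std_pdfE /inv_pdf invfM -expRN opprK. Qed.

Lemma inv_pdf_gt0 x : 0 < inv_pdf x.
Proof. by rewrite inv_pdfE invr_gt0 std_pdf_gt0. Qed.

Lemma pdf_inv_pdf x : p x * inv_pdf x = 1.
Proof. by rewrite inv_pdfE mulfV// gt_eqF// std_pdf_gt0. Qed.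

Lemma inv_pdf_le x u : `|x| <= `|u| -> inv_pdf x <= inv_pdf u.
Proof.
move=> xu; have pk : 0 < (normal_peak (1 : R))^-1 by rewrite invr_gt0 normal_peak_gt0 ?oner_neq0.
rewrite /inv_pdf ler_pM2l// ler_expR ler_wpM2r ?invr_ge0//.
by rewrite -(real_normK (num_real x)) -(real_normK (num_real u)) ler_pXn2r// nnegrE.
Qed.

Lemma is_derive_inv_pdf x : is_derive x 1 inv_pdf (x * inv_pdf x).
Proof.
have d := @is_derive1_comp _ expR _ x _ _ (is_derive_expR _) (is_derive_half_sqr x).
apply: (is_derive_congr _ _ _ _ _ (is_deriveZ (normal_peak 1)^-1 d)) => //.
by rewrite /inv_pdf /GRing.scale/=; ring.
Qed.

Lemma is_derive_std_pdf x : is_derive x 1 p (- x * p x).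
Proof.
have d0 := is_deriveN (is_derive_half_sqr x).
have d := @is_derive1_comp _ expR _ x _ _ (is_derive_expR _) d0.
apply: (is_derive_congr _ _ _ _ _ (is_deriveZ (normal_peak 1) d)) => [u|].
  by rewrite std_pdfE.
by rewrite std_pdfE /GRing.scale/=; change (normal_peak 1 * (expR (- (x ^+ 2 / 2)) * - x) = - x * (normal_peak 1 * expR (- (x ^+ 2 / 2)))); ring.
Qed.

(** The derivative has a sign, and [Phi u + p u / u] tends to 0 or 1 at infinity: this
    gives both Mills bounds. *)
Lemma is_derive_mills x : x != 0 ->
  is_derive x 1 (fun u => Phi u + p u / u) (- (p x / x ^+ 2)).
Proof.
move=> x0; have d1 := is_deriveV (f := id) x0 (is_derive_id x (1 : R)).
have d2 := is_deriveM (is_derive_std_pdf x) d1.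
apply: (is_derive_congr _ _ _ _ _ (is_deriveD (is_derive_normal_cdf 0 x (oner_neq0 R)) d2)) => //.
by rewrite /GRing.scale/=; field.
Qed.

Lemma mills_upper x : 0 < x -> 1 - Phi x <= p x / x.
Proof.
move=> x0; apply/ler_addgt0Pr => e e0; have [A hA] := normal_cdf_cvgy 0 1 e0.
pose z := Num.max x A.
have xz : x <= z by rewrite le_max lexx.
have z0 : 0 < z by exact: lt_le_trans xz.
have [c /andP[xc _] E] := mean_value_on _ _ _ _ xz (fun u h =>
  is_derive_mills (lt0r_neq0 (lt_le_trans x0 (proj1 (andP h))))).
have : Phi z + p z / z <= Phi x + p x / x.
  by rewrite -subr_le0 E mulr_le0_ge0 ?subr_ge0// oppr_le0 divr_ge0 ?sqr_ge0// ltW// std_pdf_gt0.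
have : 1 - e < Phi z by apply: hA; rewrite le_max lexx orbT.
have : 0 <= p z / z by rewrite divr_ge0 ?ltW// std_pdf_gt0.
lra.
Qed.

Lemma mills_lower x : x < 0 -> Phi x <= p x / `|x|.
Proof.
move=> x0; rewrite ltr0_norm// invrN mulrN.
apply/ler_addgt0Pr => e e0; have [A hA] := normal_cdf_cvgNy 0 1 e0.
pose z := Num.min x A.
have zx : z <= x by rewrite ge_min lexx.
have z0 : z < 0 by exact: le_lt_trans x0.
have [c /andP[xc _] E] := mean_value_on _ _ _ _ zx (fun u h =>
  is_derive_mills (ltr0_neq0 (le_lt_trans (proj2 (andP h)) x0))).
have : Phi x + p x / x <= Phi z + p z / z.
  by rewrite -subr_le0 E mulr_le0_ge0 ?subr_ge0// oppr_le0 divr_ge0 ?sqr_ge0// ltW// std_pdf_gt0.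
have : Phi z < e by apply: hA; rewrite ge_min lexx orbT.
have : p z / z <= 0 by rewrite mulr_ge0_le0 ?(ltW (std_pdf_gt0 _))// invr_le0 ltW.
lra.
Qed.

End mills.

(** Stein's method is applied to a step with Lipschitz derivative instead of an
    indicator, because the second-order errors of the couplings must be controlled. *)
Section smooth_step.
Context {R : realType}.
Implicit Types (s u v w a b : R).

Notation pos u := (Num.max 0 u).

Lemma is_derive_pos_sqr u : is_derive u 1 (fun v : R => pos v ^+ 2) (2 * pos u).
Proof.
have [u0|u0|->] := ltgtP u 0.
- rewrite mulr0.
  apply: near_eq_is_derive (is_derive_cst (0 : R) u (1 : R)).
  have : \forall v \near u, v < 0 by exact: lt_nbhsl.
  by apply: filterS => v v0; rewrite max_l ?ltW// expr0n.
- have d := is_deriveM (is_derive_id u (1 : R)) (is_derive_id u (1 : R)).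
  have -> : 2 * u = u *: 1 + u *: 1 by rewrite /GRing.scale/=; ring.
  apply: near_eq_is_derive d.
  have : \forall v \near u, 0 < v by exact: lt_nbhsr.
  by apply: filterS => v v0; rewrite max_r ?ltW// expr2.
rewrite mulr0; apply/is_derive1_caratheodory.
exists (fun v => pos v); split.
- move=> v; rewrite maxxx expr0n/= !subr0; have [v0|v0] := leP 0 v.
    by rewrite expr2.
  by rewrite expr0n mul0r.
- by apply: continuous_max; [exact: cvg_cst|exact: cvg_id].
- by rewrite maxxx.
Qed.

Definition step s : R := 1 - 2 * pos s ^+ 2 + 4 * pos (s - 2^-1) ^+ 2 - 2 * pos (s - 1) ^+ 2.
Definition dstep s : R := - 4 * pos s + 8 * pos (s - 2^-1) - 4 * pos (s - 1).

Lemma is_derive_step s : is_derive s 1 step (dstep s).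
Proof.
have sh c : is_derive s 1 (fun v : R => pos (v - c) ^+ 2) (2 * pos (s - c)).
  have h := is_deriveB (is_derive_id s (1 : R)) (is_derive_cst c s (1 : R)).
  have := @is_derive1_comp _ (fun v : R => pos v ^+ 2) _ s _ _ (is_derive_pos_sqr (s - c)) h.
  by rewrite subr0 mulr1.
have d := is_deriveB (is_deriveD (is_deriveB (is_derive_cst (1 : R) s (1 : R))
   (is_deriveZ (2 : R) (is_derive_pos_sqr s)))
   (is_deriveZ (4 : R) (sh 2^-1))) (is_deriveZ (2 : R) (sh 1)).
apply: (is_derive_congr _ _ _ _ _ d) => //.
by rewrite /dstep /GRing.scale/=; ring.
Qed.

Let posP s : (pos s = 0 /\ s <= 0) \/ (pos s = s /\ 0 <= s).
Proof.
by have [h|h] := leP 0 s; [right|left; split => //; exact: ltW].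
Qed.

Lemma step_le0 s : s <= 0 -> step s = 1 /\ dstep s = 0.
Proof.
move=> s0; rewrite /step /dstep !max_l; [|lra..].
by rewrite !expr0n/= !mulr0 !subr0 !addr0.
Qed.

Lemma step_ge1 s : 1 <= s -> step s = 0 /\ dstep s = 0.
Proof. by move=> s0; rewrite /step /dstep !max_r; [split; field|lra..]. Qed.

Lemma dstep_le0 s : dstep s <= 0.
Proof.
rewrite /dstep; have [[-> ?]|[-> ?]] := posP s;
have [[-> ?]|[-> ?]] := posP (s - 2^-1); have [[-> ?]|[-> ?]] := posP (s - 1); lra.
Qed.

Lemma step_itv s : 0 <= step s <= 1.
Proof.
have [s0|s0] := leP s 0; first by rewrite (step_le0 s0).1 ler01 lexx.
have [s1|s1] := leP 1 s; first by rewrite (step_ge1 s1).1 ler01 lexx.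
rewrite /step (max_r (ltW s0)) (@max_l _ _ 0 (s - 1)); last lra.
by have [[-> ?]|[-> ?]] := posP (s - 2^-1); apply/andP; split; nra.
Qed.

Lemma pos_lip u v : `|pos u - pos v| <= `|u - v|.
Proof.
have := ler_norm (u - v); have := lerNnormlW (lexx `|u - v|).
have [[-> ?]|[-> ?]] := posP u; have [[-> ?]|[-> ?]] := posP v => ? ?;
by rewrite ler_norml; apply/andP; split; lra.
Qed.

Lemma dstep_lip u v : `|dstep u - dstep v| <= 16 * `|u - v|.
Proof.
have h c : `|pos (u - c) - pos (v - c)| <= `|u - v|.
  by apply: (le_trans (pos_lip _ _)); rewrite opprB addrA subrK.
have h0 := pos_lip u v; have h1 := h 2^-1; have h2 := h 1.
move: h0 h1 h2; rewrite /dstep !ler_norml.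
by move=> /andP[? ?] /andP[? ?] /andP[? ?]; apply/andP; split; lra.
Qed.

Lemma norm_dstep_le s : `|dstep s| <= 16.
Proof.
have [s0|s0] := leP s 0; first by rewrite (step_le0 s0).2 normr0.
have [s1|s1] := leP 1 s; first by rewrite (step_ge1 s1).2 normr0.
have := dstep_lip s 0; rewrite (step_le0 (lexx 0)).2 !subr0 (gtr0_norm s0).
by move=> h; apply: (le_trans h); lra.
Qed.

End smooth_step.

(** * A bounded solution of Stein's equation *)

Section stein_solution.
Context {R : realType} (a b N : R).
Hypotheses (ab : a < b) (N01 : 0 <= N <= 1).
Implicit Types (x u v : R).
Notation Phi := (normal_cdf 0 (1 : R)).
Notation p := (normal_pdf 0 (1 : R)).

Let w := b - a.
Let w0 : 0 < w. Proof. by rewrite subr_gt0. Qed.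

Let iw0 : 0 <= (b - a)^-1. Proof. by rewrite invr_ge0 ltW. Qed.

Definition stein_step x : R := step ((x - a) / (b - a)).
Definition stein_dstep x : R := dstep ((x - a) / (b - a)) / (b - a).
Definition stein_rhs x : R :=
  stein_step x - N + stein_dstep x * ((Phi x - N) * inv_pdf x).
Definition stein_num x : R :=
  (1 - N) * (Phi x * stein_step x) + N * ((1 - Phi x) * (1 - stein_step x)).
(** With [f = stein_sol] one has [f' - x f = stein_step - N + stein_dstep * (Phi - N) / p]. For a sharp
    step and [N = Phi a] this is the classical solution of Stein's equation. Smoothing
    the step makes [f'] Lipschitz, and the extra term is not solved away: it has a
    constant sign when [N] is [Phi a] or [Phi b]. *)
Definition stein_sol x : R := stein_num x * inv_pdf x.
Definition stein_dsol x : R := x * stein_sol x + stein_rhs x.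

Lemma is_derive_stein_step x : is_derive x 1 stein_step (stein_dstep x).
Proof.
have d1 : is_derive x 1 (fun v : R => (v - a) / (b - a)) (b - a)^-1.
  have h := is_deriveZ (b - a)^-1 (is_deriveB (is_derive_id x (1 : R)) (is_derive_cst a x (1 : R))).
  apply: (is_derive_congr _ _ _ _ _ h) => [v|].
    by change ((b - a)^-1 * (v - a) = (v - a) / (b - a)); rewrite mulrC.
  by rewrite /GRing.scale/= subr0 mulr1.
exact: (@is_derive1_comp _ step (fun v : R => (v - a) / (b - a)) x _ _ (is_derive_step _) d1).
Qed.

Lemma is_derive_stein_num x :
  is_derive x 1 stein_num (p x * (stein_step x - N) + stein_dstep x * (Phi x - N)).
Proof.
have dP := is_derive_normal_cdf 0 x (oner_neq0 R).
have dS := is_derive_stein_step x.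
have d1 := is_deriveM dP dS.
have d2 := is_deriveM (is_deriveB (is_derive_cst (1 : R) x (1 : R)) dP)
                      (is_deriveB (is_derive_cst (1 : R) x (1 : R)) dS).
apply: (is_derive_congr _ _ _ _ _ (is_deriveD (is_deriveZ (1 - N) d1) (is_deriveZ N d2))) => //.
change ((1 - N) * (Phi x * stein_dstep x + stein_step x * p x) +
  N * ((1 - Phi x) * (0 - stein_dstep x) + (1 - stein_step x) * (0 - p x)) =
  p x * (stein_step x - N) + stein_dstep x * (Phi x - N)).
by move: (p x) (Phi x) => *; ring.
Qed.

Lemma is_derive_stein_sol x : is_derive x 1 stein_sol (stein_dsol x).
Proof.
have d := is_deriveM (is_derive_stein_num x) (is_derive_inv_pdf x).
apply: (is_derive_congr _ _ _ _ _ d) => //.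
rewrite /stein_dsol /stein_sol /stein_rhs /GRing.scale/=.
have := pdf_inv_pdf x; move: (p x) (inv_pdf x) => y z yz.
transitivity (stein_num x * (x * z) + (y * z) * (stein_step x - N)
  + stein_dstep x * ((Phi x - N) * z)); first by ring.
by rewrite yz; ring.
Qed.

Lemma stein_step_le x : x <= a -> stein_step x = 1 /\ stein_dstep x = 0.
Proof.
move=> xa; have [e1 e] : step ((x - a) / (b - a)) = 1 /\ dstep ((x - a) / (b - a)) = 0.
  by apply: step_le0; rewrite pmulr_lle0 ?invr_gt0// subr_le0.
by rewrite /stein_step /stein_dstep e mul0r e1.
Qed.

Lemma stein_step_ge x : b <= x -> stein_step x = 0 /\ stein_dstep x = 0.
Proof.
move=> xa; have [e1 e] : step ((x - a) / (b - a)) = 0 /\ dstep ((x - a) / (b - a)) = 0.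
  by apply: step_ge1; rewrite ler_pdivlMr// mul1r lerB.
by rewrite /stein_step /stein_dstep e mul0r e1.
Qed.

Lemma stein_step_itv x : 0 <= stein_step x <= 1.
Proof. exact: step_itv. Qed.

Lemma stein_dstep_le0 x : stein_dstep x <= 0.
Proof. by rewrite /stein_dstep pmulr_lle0 ?invr_gt0// dstep_le0. Qed.

Lemma norm_stein_dstep x : `|stein_dstep x| <= 16 / w.
Proof.
by rewrite /stein_dstep normrM [X in _ * X]ger0_norm// ler_wpM2r// norm_dstep_le.
Qed.

Lemma stein_step_lip u v : `|stein_step u - stein_step v| <= 16 / w * `|u - v|.
Proof.
wlog uv : u v / v <= u.
  move=> h; have [/h//|/ltW/h] := leP v u.
  by rewrite distrC [X in _ * X]distrC.
have [c _ ->] := mean_value _ _ _ _ uv is_derive_stein_step.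
by rewrite normrM ler_wpM2r// norm_stein_dstep.
Qed.

Lemma stein_dstep_lip u v : `|stein_dstep u - stein_dstep v| <= 16 / w ^+ 2 * `|u - v|.
Proof.
rewrite /stein_dstep -mulrBl normrM [X in _ * X]ger0_norm//.
have := dstep_lip ((u - a) / (b - a)) ((v - a) / (b - a)).
have -> : (u - a) / (b - a) - (v - a) / (b - a) = (u - v) / (b - a) by ring.
rewrite [X in _ <= 16 * X]normrM [X in _ * (_ * X)]ger0_norm//.
move=> h; have -> : 16 / w ^+ 2 * `|u - v| = 16 * (`|u - v| * (b - a)^-1) / (b - a).
  by rewrite /w; field; rewrite gt_eqF.
by rewrite ler_wpM2r.
Qed.

Let A := 1 + `|a| + `|b|.
Let I := inv_pdf A.

Let A1 : 1 <= A. Proof. by rewrite /A -addrA lerDl addr_ge0. Qed.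
Let A0 : 0 <= A. Proof. exact: le_trans A1. Qed.
Let I0 : 0 <= I. Proof. exact/ltW/inv_pdf_gt0. Qed.

Lemma stein_num_itv x : 0 <= stein_num x <= 1.
Proof.
have /andP[s0 s1] := stein_step_itv x; have /andP[N0 N1] := N01.
have P0 := normal_cdf_ge0 0 1 x; have P1 := normal_cdf_le1 0 1 x.
rewrite /stein_num; move: P0 P1 s0 s1; move: (stein_step x) (Phi x) => s P P0 P1 s0 s1.
have Ps : P * s <= 1 by rewrite mulr_ile1.
have Ps' : (1 - P) * (1 - s) <= 1 by rewrite mulr_ile1 ?subr_ge0// lerBlDr lerDl.
have Pp : 0 <= P * s by rewrite mulr_ge0.
have Pp' : 0 <= (1 - P) * (1 - s) by rewrite mulr_ge0 ?subr_ge0.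
apply/andP; split; first by rewrite addr_ge0 ?mulr_ge0 ?subr_ge0.
by rewrite -[leRHS](subrK N 1) lerD// ler_piMr// subr_ge0.
Qed.

Let aA : - A < a.
Proof. by rewrite /A; have := ler_norm (- a); rewrite normrN; have := normr_ge0 b; lra. Qed.
Let bA : b < A.
Proof. by rewrite /A; have := ler_norm b; have := normr_ge0 a; lra. Qed.

Lemma inv_pdf_bound x : - A <= x <= A -> 0 <= inv_pdf x <= I.
Proof.
move=> xA; rewrite ltW ?inv_pdf_gt0//= inv_pdf_le// (ger0_norm A0) ler_norml//.
Qed.

(** In the tails the numerator is a Gaussian tail, so Mills' inequality applies; the
    middle range is compact. *)
Lemma stein_sol_bound x : 0 <= (1 + `|x|) * stein_sol x <= 2 + (1 + A) * I.
Proof.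
have /andP[n0 n1] := stein_num_itv x; have /andP[N0 N1] := N01.
have x1 : 0 <= 1 + `|x| by rewrite addr_ge0.
have tail (y : R) : 1 <= `|x| -> y <= p x / `|x| -> 0 <= y -> (1 + `|x|) * (y * inv_pdf x) <= 2.
  move=> x1' yp y0.
  have xp : 0 < `|x| by exact: lt_le_trans x1'.
  have : y * inv_pdf x <= `|x|^-1.
    apply: (le_trans (ler_wpM2r (ltW (inv_pdf_gt0 _)) yp)).
    by rewrite mulrAC pdf_inv_pdf mul1r.
  move/(ler_wpM2l x1)/le_trans; apply.
  by rewrite ler_pdivrMr// mulrDl mul1r; lra.
apply/andP; split; first by rewrite mulr_ge0// mulr_ge0// ltW// inv_pdf_gt0.
have pos : 0 <= (1 + A) * I by rewrite mulr_ge0// addr_ge0.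
have [xA|xA] := leP `|x| A.
  rewrite -[leLHS]add0r lerD// ler_pM//.
    by rewrite mulr_ge0// ltW// inv_pdf_gt0.
    by rewrite lerD2l.
  have /andP[i0 iI] : 0 <= inv_pdf x <= I by apply: inv_pdf_bound; rewrite -ler_norml.
  by rewrite -[leRHS]mul1r ler_pM.
rewrite -[leLHS]addr0 lerD//.
have xx : 1 <= `|x| by exact: le_trans (ltW xA).
move: xA; rewrite lter_normr => /orP[xA|xA].
  have [e _] := stein_step_ge (ltW (lt_trans bA xA)).
  have x0 : 0 < x by exact: le_lt_trans xA.
  apply: tail => //; rewrite /stein_num e mulr0 mulr0 add0r subr0 mulr1.
  rewrite (gtr0_norm x0); apply: le_trans (mills_upper x0).
  by rewrite ler_piMl// subr_ge0 normal_cdf_le1.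
have xA' : x < - A by rewrite ltrNr.
have [e _] := stein_step_le (ltW (lt_trans xA' aA)).
have x0 : x < 0 by apply: (lt_le_trans xA'); rewrite oppr_le0.
apply: tail => //; rewrite /stein_num e subrr mulr0 mulr0 addr0 mulr1.
apply: le_trans (mills_lower x0).
by rewrite ler_piMl// ?normal_cdf_ge0// lerBlDr lerDl.
Qed.

Let r x := (Phi x - N) * inv_pdf x.

Let r_bound x : a <= x <= b -> `|r x| <= I.
Proof.
move=> /andP[xa xb]; have /andP[i0 iI] : 0 <= inv_pdf x <= I.
  by apply: inv_pdf_bound; rewrite (ltW (lt_le_trans aA xa)) (ltW (le_lt_trans xb bA)).
rewrite /r normrM (ger0_norm i0) -[leRHS]mul1r ler_pM//.
have := normal_cdf_ge0 0 1 x; have := normal_cdf_le1 0 1 x; have /andP[N0 N1] := N01.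
by rewrite ler_norml; move: (Phi x) => y *; apply/andP; split; lra.
Qed.

Let r_lip u v : a <= u <= b -> a <= v <= b -> `|r u - r v| <= (1 + A * I) * `|u - v|.
Proof.
wlog uv : u v / v <= u.
  move=> h hu hv; have [/h|/ltW/h] := leP v u; first exact.
  by move=> h'; rewrite distrC [X in _ * X]distrC; exact: h'.
move=> hu hv.
have dr (x : R) : is_derive x 1 r (1 + x * r x).
  have d := is_deriveM (is_deriveB (is_derive_normal_cdf 0 x (oner_neq0 R))
      (is_derive_cst N x (1 : R))) (is_derive_inv_pdf x).
  apply: (is_derive_congr _ _ _ _ _ d) => //.
  change ((Phi x - N) * (x * inv_pdf x) + inv_pdf x * (p x - 0) = 1 + x * r x).
  rewrite subr0 mulrC [inv_pdf x * p x]mulrC pdf_inv_pdf /r.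
  by move: (Phi x) => ?; ring.
have [c cuv ->] := mean_value _ _ _ _ uv dr.
rewrite normrM ler_wpM2r//.
have hc : a <= c <= b.
  move: hu hv cuv => /andP[? ?] /andP[? ?] /andP[? ?]; apply/andP; split; lra.
rewrite (le_trans (ler_normD _ _))// normr1 lerD2l normrM ler_pM// ?r_bound//.
by rewrite ler_norml; move: hc => /andP[h1 h2]; rewrite (ltW (lt_le_trans aA h1)) (ltW (le_lt_trans h2 bA)).
Qed.

Let q x := stein_dstep x * r x.
Let cl x := Num.max a (Num.min x b).

Let cl_itv x : a <= cl x <= b.
Proof. by rewrite /cl le_max lexx/= ge_max (ltW ab) ge_min lexx orbT. Qed.

Let q_cl x : q (cl x) = q x.
Proof.
rewrite /q /cl; have [xa|xa] := leP x a.
  rewrite min_l; last by rewrite (le_trans xa)// ltW.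
  by rewrite max_l// (stein_step_le xa).2 (stein_step_le (lexx a)).2 !mul0r.
have [xb|xb] := leP b x.
  by rewrite (max_r (ltW ab)) (stein_step_ge xb).2 (stein_step_ge (lexx b)).2 !mul0r.
by rewrite max_r// ltW.
Qed.

Let cl_lip u v : `|cl u - cl v| <= `|u - v|.
Proof.
have clP x : (cl x = a /\ x <= a) \/ (cl x = x /\ a <= x <= b) \/ (cl x = b /\ b <= x).
  rewrite /cl; have [xb|xb] := leP b x; first by rewrite (max_r (ltW ab)); right; right.
  have [xa|xa] := leP a x; first by right; left; rewrite (ltW xb).
  by left; rewrite ltW.
have := ler_norm (u - v); have := lerNnormlW (lexx `|u - v|).
have ab' := ab; have := clP u; have := clP v.
move: (cl u) (cl v) `|u - v| => U V D hV hU h1 h2.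
rewrite ler_norml.
have {}hU : (U = a /\ u <= a) \/ (U = u /\ (a <= u /\ u <= b)) \/ (U = b /\ b <= u).
  by case: hU => [|[[? /andP[]]|]]; tauto.
have {}hV : (V = a /\ v <= a) \/ (V = v /\ (a <= v /\ v <= b)) \/ (V = b /\ b <= v).
  by case: hV => [|[[? /andP[]]|]]; tauto.
case: hU => [[-> ?]|[[-> [? ?]]|[-> ?]]]; case: hV => [[-> ?]|[[-> [? ?]]|[-> ?]]];
by apply/andP; split; lra.
Qed.

Lemma stein_rhs_bound x : `|stein_rhs x| <= 1 + 16 / w * I.
Proof.
rewrite /stein_rhs (le_trans (ler_normD _ _))// lerD//.
  have /andP[? ?] := stein_step_itv x; have /andP[? ?] := N01.
  by rewrite ler_norml; apply/andP; split; lra.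
by rewrite -/(r x) -/(q x) -q_cl /q normrM ler_pM// ?norm_stein_dstep// r_bound// cl_itv.
Qed.

Lemma stein_rhs_lip u v :
  `|stein_rhs u - stein_rhs v| <=
  (16 / w + 16 / w * (1 + A * I) + 16 / w ^+ 2 * I) * `|u - v|.
Proof.
have -> : stein_rhs u - stein_rhs v = (stein_step u - stein_step v) + (q u - q v).
  by rewrite /stein_rhs -/(r u) -/(r v) -/(q u) -/(q v); ring.
rewrite (le_trans (ler_normD _ _))// -[16 / w + _ + _]addrA [X in _ <= X]mulrDl.
apply: lerD; first exact: stein_step_lip.
rewrite -(q_cl u) -(q_cl v).
apply: (@le_trans _ _ ((16 / w * (1 + A * I) + 16 / w ^+ 2 * I) * `|cl u - cl v|)); last first.
  by rewrite ler_wpM2l// addr_ge0// mulr_ge0// ?divr_ge0 ?sqr_ge0 ?(ltW w0)// addr_ge0// mulr_ge0.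
move: (cl u) (cl v) (cl_itv u) (cl_itv v) => U V hU hV.
have -> : q U - q V = stein_dstep U * (r U - r V) + (stein_dstep U - stein_dstep V) * r V.
  by rewrite /q; ring.
rewrite (le_trans (ler_normD _ _))// [X in _ <= X]mulrDl.
apply: lerD.
  rewrite normrM -[leRHS]mulrA ler_pM ?norm_stein_dstep//.
  exact: r_lip.
rewrite normrM [leRHS]mulrAC ler_pM ?stein_dstep_lip//.
exact: r_bound.
Qed.

(** Stein's equation [f' - x f = g] for a smoothed half-line has a solution with
    bounded derivatives, quantitatively enough for [stein_identity]. *)
Lemma stein_solution : exists B, [/\ 0 <= B, forall x, `|stein_sol x| <= B,
  forall x, `|stein_dsol x| <= B &
  forall u v, `|stein_dsol u - stein_dsol v| <= B * (1 + `|u|) * `|u - v|].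
Proof.
set K1 := 2 + (1 + A) * I; set K2 := K1 + (1 + 16 / w * I).
set L := 16 / w + 16 / w * (1 + A * I) + 16 / w ^+ 2 * I.
have wi : 0 <= 16 / w by rewrite divr_ge0// ltW.
have K10 : 0 <= K1 by rewrite addr_ge0// mulr_ge0// addr_ge0.
have K20 : 0 <= K2 by rewrite addr_ge0// addr_ge0// mulr_ge0.
have L0 : 0 <= L.
  have A' : 0 <= 1 + A * I by rewrite addr_ge0// mulr_ge0.
  have wi2 : 0 <= 16 / w ^+ 2 by rewrite divr_ge0// sqr_ge0.
  by rewrite /L; apply: addr_ge0; [apply: addr_ge0 => //|]; exact: mulr_ge0.
have fb x : `|stein_sol x| <= K1 /\ `|x * stein_sol x| <= K1.
  have /andP[h0 h1] := stein_sol_bound x.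
  have f0 : 0 <= stein_sol x.
    by rewrite mulr_ge0 ?(ltW (inv_pdf_gt0 _))//; case/andP: (stein_num_itv x).
  rewrite [X in _ /\ X <= _]normrM (ger0_norm f0); move: h1; rewrite mulrDl mul1r -/K1.
  have : 0 <= `|x| * stein_sol x by rewrite mulr_ge0.
  by move=> ? ?; split; lra.
have db x : `|stein_dsol x| <= K2.
  by rewrite (le_trans (ler_normD _ _))// lerD ?stein_rhs_bound// (fb x).2.
exists (K1 + K2 + L); split => [|x|x|u v].
- by apply: addr_ge0 => //; exact: addr_ge0.
- by apply: (le_trans (fb x).1); rewrite -addrA lerDl addr_ge0.
- by apply: (le_trans (db x)); rewrite addrAC lerDr addr_ge0.
have -> : stein_dsol u - stein_dsol v =
    u * (stein_sol u - stein_sol v) + ((u - v) * stein_sol v + (stein_rhs u - stein_rhs v)).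
  by rewrite /stein_dsol; ring.
have flip : `|stein_sol u - stein_sol v| <= K2 * `|u - v|.
  clear -db; wlog uv : u v / v <= u.
    move=> h; have [/h//|/ltW/h] := leP v u.
    by rewrite distrC [X in _ * X]distrC.
  have [c _ ->] := mean_value _ _ _ _ uv is_derive_stein_sol.
  by rewrite normrM ler_wpM2r.
have t1 : `|u * (stein_sol u - stein_sol v)| <= `|u| * (K2 * `|u - v|).
  by rewrite normrM ler_wpM2l.
have t2 : `|(u - v) * stein_sol v| <= K1 * `|u - v|.
  by rewrite normrM mulrC ler_wpM2r// (fb v).1.
have t3 := stein_rhs_lip u v; rewrite -/L in t3.
rewrite (le_trans (ler_normD _ _))//.
apply: (le_trans (lerD t1 (le_trans (ler_normD _ _) (lerD t2 t3)))).
move: (normr_ge0 u) (normr_ge0 (u - v)); move: `|u| `|u - v| => U W U0 W0.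
rewrite -subr_ge0.
have -> : (K1 + K2 + L) * (1 + U) * W - (U * (K2 * W) + (K1 * W + L * W)) =
  (K1 * U + L * U + K2) * W by ring.
by apply: mulr_ge0 => //; apply: addr_ge0 => //; apply: addr_ge0; exact: mulr_ge0.
Qed.

End stein_solution.

Section stein_sandwich.
Context {R : realType} (a b : R).
Hypothesis ab : a < b.
Notation Phi := (normal_cdf 0 (1 : R)).

(** The correction term is a product of two nonpositive factors on [[a, b]] for
    [N = Phi b], and has the opposite sign for [N = Phi a]. *)
Lemma stein_rhs_ge (x : R) : (x <= a)%R%:R <= stein_rhs a b (Phi b) x + Phi b.
Proof.
rewrite /stein_rhs addrAC subrK; apply: (@le_trans _ _ (stein_step a b x)).
  have [xa|_] := leP x a; first by rewrite (stein_step_le ab xa).1.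
  by case/andP: (stein_step_itv a b x).
rewrite lerDl; have [bx|xb] := leP b x; first by rewrite (stein_step_ge ab bx).2 mul0r.
rewrite mulr_le0// ?stein_dstep_le0// pmulr_lle0 ?inv_pdf_gt0//.
by rewrite subr_le0 normal_cdf_le// ltW.
Qed.

Lemma stein_rhs_le (x : R) : stein_rhs a b (Phi a) x + Phi a <= (x <= b)%R%:R.
Proof.
rewrite /stein_rhs addrAC subrK; apply: (@le_trans _ _ (stein_step a b x)).
  rewrite gerDl; have [bx|xb] := leP x a; first by rewrite (stein_step_le ab bx).2 mul0r.
  rewrite mulr_le0_ge0// ?stein_dstep_le0// mulr_ge0 ?(ltW (inv_pdf_gt0 _))//.
  by rewrite subr_ge0 normal_cdf_le// ltW.
have [xa|/ltW xa] := leP x b; last by rewrite (stein_step_ge ab xa).1.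
by case/andP: (stein_step_itv a b x).
Qed.

End stein_sandwich.

(** * The central limit theorem for the squared mean spin *)

Section information.
Context {R : realType}.
Implicit Types th : R.

(** The Fisher information of the limit experiment, in the local parameter. *)
Definition information th : R := magnetization th ^+ 2 * sigma2 th.

Lemma information_gt0 th : 1 < th -> 0 < information th.
Proof.
move=> th1; have m0 := magnetization_gt0 _ th1; have m1 := magnetization_lt1 _ th1.
rewrite mulr_gt0 ?exprn_gt0// divr_gt0 ?subr_gt0 ?exprn_ilt1//; first exact: ltW.
exact: cw_slope_lt1.
Qed.

(** The balance of drift and diffusion in the Stein identity: the limit variance of
    [sqrt n * (M ^+ 2 - m ^+ 2)] is [4 * information]. *)
Lemma informationE th : 1 < th ->
  (1 - cw_slope th) / 2 * (2 * Num.sqrt (information th)) ^+ 2 =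
  2 * (magnetization th ^+ 2 * (1 - magnetization th ^+ 2)).
Proof.
move=> th1; have h : 1 - cw_slope th != 0 by rewrite gt_eqF// subr_gt0 cw_slope_lt1.
rewrite exprMn sqr_sqrtr ?ltW ?information_gt0// /information /sigma2.
by rewrite -/(cw_slope th); field.
Qed.

Lemma is_derive_magnetization_sqr th : 1 < th ->
  is_derive th 1 (fun t => magnetization t ^+ 2) (2 * information th).
Proof.
move=> th1; have d := is_derive_magnetization _ th1.
apply: (is_derive_congr _ _ _ _ _ (is_deriveM d d)) => [t|].
  by rewrite expr2.
by rewrite /information /GRing.scale/=; ring.
Qed.

Lemma magnetization_continuous th : 1 < th -> {for th, continuous (@magnetization R)}.
Proof.
move=> th1; have [d _] := is_derive_magnetization _ th1.
exact/differentiable_continuous/derivable1_diffP.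
Qed.

End information.

Lemma normal_cdf_continuous {R : realType} (m sd x : R) (sd0 : sd != 0) : {for x, continuous (normal_cdf m sd)}.
Proof.
have [dd _] := is_derive_normal_cdf m x sd0.
exact/differentiable_continuous/derivable1_diffP.
Qed.

Lemma midpoint1 {R : realType} (t : R) : 1 < t ->
  [/\ 1 < (1 + t) / 2, (1 + t) / 2 <= t + 1 & 0 < (t - 1) / 2].
Proof. by move=> t1; split; lra. Qed.

Lemma near_midpoint {R : realType} (t u : R) : `|t - u| < (t - 1) / 2 -> `|t - u| < 1 ->
  (1 + t) / 2 <= u <= t + 1.
Proof.
by rewrite !ltr_norml => /andP[? ?] /andP[? ?]; apply/andP; split; lra.
Qed.

Lemma cube_bounds {R : realType} (z : R) : 0 < z ->
  [/\ 1 <= (1 + z) ^+ 3, z <= (1 + z) ^+ 3 & (1 + z) * z ^+ 2 <= (1 + z) ^+ 3].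
Proof.
move=> z0; have z2 := sqr_ge0 z; have z3 : 0 <= z ^+ 3 by rewrite exprn_ge0// ltW.
have E : (1 + z) ^+ 3 = 1 + 3 * z + 3 * z ^+ 2 + z ^+ 3 by ring.
have E' : (1 + z) * z ^+ 2 = z ^+ 2 + z ^+ 3 by ring.
by rewrite E E'; split; lra.
Qed.

Lemma sandwich {R : realType} (g h1 h2 p pu pl e : R) :
  - (e / 2) <= h1 <= e / 2 -> - (e / 2) <= h2 <= e / 2 ->
  g <= h1 + pu -> h2 + pl <= g ->
  - (e / 2) <= p - pu <= e / 2 -> - (e / 2) <= p - pl <= e / 2 ->
  - e <= p - g <= e.
Proof.
move=> /andP[? ?] /andP[? ?] ? ? /andP[? ?] /andP[? ?]; apply/andP; split; lra.
Qed.

Section near_regime.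
Context {R : realType} (Q : forall n, 'M[R]_n) (K d th0 : R) (th : nat -> R).
Hypotheses (K0 : 0 <= K) (d0 : 0 < d) (th01 : 1 < th0).
Hypothesis Qgood : \forall n \near \oo, coupling K (Q n) /\ spectral_gap d (Q n).
Hypothesis thth0 : th n @[n --> \oo] --> th0.

Lemma moments_near : exists C, 0 <= C /\ \forall n \near \oo,
  [/\ (1 + th0) / 2 <= th n <= th0 + 1, coupling K (Q n),
      gibbs (th n) (Q n) (dispersion (Q n)) <= C,
      n%:R * gibbs (th n) (Q n) (fun x => sqr_excess (magnetization (th n)) x ^+ 2) <= C &
      `|gibbs (th n) (Q n) (quad (Q n)) - n%:R * magnetization (th n) ^+ 2| <= C].
Proof.
have [a1 ab e1] := midpoint1 th01.
have [C C0 CP] := phase_moments K0 d0 a1 ab.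
exists C; split => //; near=> n.
have [QK Qd] : coupling K (Q n) /\ spectral_gap d (Q n) by near: n.
have hn : (1 + th0) / 2 <= th n <= th0 + 1.
  by apply: near_midpoint; near: n; move/cvgrPdist_lt: thth0; apply.
by have [? ? ?] := CP n (Q n) QK Qd _ hn.
Unshelve. all: by end_near. Qed.

Lemma magnetization_cvg : magnetization (th n) @[n --> \oo] --> magnetization th0.
Proof. exact: (cvg_comp _ _ thth0 (magnetization_continuous th01)). Qed.

Lemma inv_sqrt_cvg (c : R) : c / Num.sqrt n%:R @[n --> \oo] --> (0 : R).
Proof.
apply/cvgrPdist_lt => e e0; near=> n.
have n0 : 0 < n%:R :> R by rewrite ltr0n; near: n; exact: nbhs_infty_gt.
have s0 : 0 < Num.sqrt n%:R :> R by rewrite sqrtr_gt0.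
rewrite sub0r normrN normrM [`|_^-1|]gtr0_norm ?invr_gt0//.
rewrite ltr_pdivrMr// -ltr_pdivrMl//.
rewrite -(ltr_pXn2r (n := 2)) ?nnegrE ?(ltW s0)//; last first.
  by rewrite mulr_ge0// invr_ge0 ltW.
rewrite sqr_sqrtr ?(ltW n0)//.
by near: n; exact: nbhs_infty_gtr.
Unshelve. all: by end_near. Qed.

Let s : R := 2 * Num.sqrt (information th0).
Let s0 : 0 < s. Proof. by rewrite mulr_gt0// sqrtr_gt0 information_gt0. Qed.

Notation U n x := (root_scale (n := n) (magnetization (th n)) (mean_spin x)).

(** [stein_identity] applied to the Stein solution, rescaled by the limiting standard
    deviation; the remaining error comes from the variation of [m] along [th n]. *)
Lemma stein_rhs_cvg (a b N : R) : a < b -> 0 <= N <= 1 ->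
  gibbs (th n) (Q n) (fun x => stein_rhs a b N (U n x / s)) @[n --> \oo] --> (0 : R).
Proof.
move=> ab N01; have [B [B0 fB dfB dfL]] := stein_solution ab N01.
pose f := stein_sol a b N; pose df := stein_dsol a b N.
have f' (u : R) : is_derive u 1 f (df u) := is_derive_stein_sol a b N u.
pose z := s^-1; have z0 : 0 < z by rewrite invr_gt0.
pose B' := B * (1 + z) ^+ 3.
have B'0 : 0 <= B' by rewrite mulr_ge0// exprn_ge0// addr_ge0// ltW.
pose phi u := f (u / s); pose dphi u := df (u / s) / s.
have [zz1 zz2 zz3] := cube_bounds z0.
have phi_der (u : R) : is_derive u 1 phi (dphi u).
  have d1 : is_derive u 1 (fun v : R => v / s) s^-1.
    have h := is_deriveZ s^-1 (is_derive_id u (1 : R)).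
    apply: (is_derive_congr _ _ _ _ _ h) => [v|]; last by rewrite /GRing.scale/= mulr1.
    by change (s^-1 * v = v / s); rewrite mulrC.
  exact: (@is_derive1_comp _ f (fun v : R => v / s) u _ _ (f' _) d1).
have phi_B u : `|phi u| <= B' by rewrite (le_trans (fB _))// ler_peMr.
have dphi_B u : `|dphi u| <= B'.
  by rewrite normrM (gtr0_norm z0) ler_pM// ltW.
have dphi_L u v : `|dphi u - dphi v| <= B' * (1 + `|u|) * `|u - v|.
  rewrite /dphi -mulrBl normrM (gtr0_norm z0).
  apply: (@le_trans _ _ (B * (1 + `|u / s|) * `|u / s - v / s| / s)).
    by rewrite ler_wpM2r// ltW.
  rewrite -mulrBl !normrM (gtr0_norm z0) -/z.
  have -> : B * (1 + `|u| * z) * (`|u - v| * z) * z = B * (1 + `|u| * z) * z ^+ 2 * `|u - v| by ring.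
  rewrite ler_wpM2r//.
  apply: (@le_trans _ _ (B * ((1 + z) * z ^+ 2) * (1 + `|u|))).
    have -> : B * ((1 + z) * z ^+ 2) * (1 + `|u|) = B * ((1 + z) * (1 + `|u|)) * z ^+ 2 by ring.
    rewrite ler_wpM2r ?sqr_ge0// ler_wpM2l//.
    have -> : (1 + z) * (1 + `|u|) = 1 + `|u| * z + (`|u| + z) by ring.
    by rewrite lerDl addr_ge0// ltW.
  by rewrite ler_wpM2r ?addr_ge0// ler_wpM2l.
have [C [C0 CP]] := moments_near.
pose m0 := magnetization ((1 + th0) / 2).
have [a1 ab1 _] := midpoint1 th01.
have m00 : 0 < m0 := magnetization_gt0 _ a1.
have [r0 r00 rP] := cw_slope_gap (a := (1 + th0) / 2) (b := th0 + 1) a1 ab1.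
pose c t : R := (1 - cw_slope t) / 2.
pose v t : R := 2 * (magnetization t ^+ 2 * (1 - magnetization t ^+ 2)).
have c0 : 0 < c th0 by rewrite divr_gt0// subr_gt0 cw_slope_lt1.
(* The scale s is the standard deviation at which drift and diffusion balance. *)
have cs : c th0 * s = v th0 / s.
  by rewrite /v -(informationE th01) -/s -/(c th0); field; rewrite gt_eqF.
have mc := magnetization_cvg.
have m2c : magnetization (th n) ^+ 2 @[n --> \oo] --> magnetization th0 ^+ 2.
  by apply: cvg_trans (cvgM mc mc); apply: cvg_refl.
have cc : c (th n) @[n --> \oo] --> c th0.
  apply: cvgMl; apply: cvgB; first exact: cvg_cst.
  by apply: cvgM => //; apply: cvgB => //; exact: cvg_cst.
have vc : v (th n) @[n --> \oo] --> v th0.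
  by apply: cvgMr; apply: cvgM => //; apply: cvgB => //; exact: cvg_cst.
pose L := stein_cst (th0 + 1) m0 C C.
pose rem n := `|c (th n) - c th0| * (B * ((1 + C) / 2)) + `|v (th n) - v th0| * (B * z) +
  B' * L / Num.sqrt n%:R.
have rem0 : rem n @[n --> \oo] --> (0 : R).
  have t1 (g : R -> R) k : g (th n) @[n --> \oo] --> g th0 ->
      `|g (th n) - g th0| * k @[n --> \oo] --> (0 : R).
    move=> gc; rewrite -[X in _ --> X](mul0r k); apply: cvgMl.
    rewrite -(normr0 R) -(subrr (g th0)).
    by apply: cvg_norm; apply: cvgB => //; exact: cvg_cst.
  rewrite -[X in _ --> X]addr0 -[X in _ --> X + _]addr0.
  by apply: cvgD; [apply: cvgD; exact: t1|exact: inv_sqrt_cvg].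
have key : \forall n \near \oo, c th0 * s * `|gibbs (th n) (Q n)
    (fun x => stein_rhs a b N (U n x / s))| <= rem n.
  near=> n.
  have [thab QK disp exc _] : [/\ (1 + th0) / 2 <= th n <= th0 + 1, coupling K (Q n),
      gibbs (th n) (Q n) (dispersion (Q n)) <= C,
      n%:R * gibbs (th n) (Q n) (fun x => sqr_excess (magnetization (th n)) x ^+ 2) <= C &
      `|gibbs (th n) (Q n) (quad (Q n)) - n%:R * magnetization (th n) ^+ 2| <= C] by near: n.
  have /andP[tha thb] := thab.
  have th1 : 1 < th n by exact: lt_le_trans tha.
  have m0m : m0 <= magnetization (th n).
    move: tha; rewrite le_eqVlt => /predU1P[<-//|tha].
    exact/ltW/magnetization_lt.
  have thp : 0 < th n by lra.
  have r0rho := rP _ thab; rewrite /cw_slope in r0rho.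
  have r1 : r0 <= 1 - cw_slope (th n) by move: (rP _ thab); rewrite /cw_slope; lra.
  have SI := stein_identity QK thp (magnetizationP _ th1) thb m00 m0m r00 r1 disp exc
    phi_der phi_B dphi_B dphi_L.
  have NU := gibbs_norm_U QK exc.
  pose E1 := gibbs (th n) (Q n) (fun x => U n x * f (U n x / s)).
  pose E2 := gibbs (th n) (Q n) (fun x => df (U n x / s)).
  have E2E : gibbs (th n) (Q n) (fun x => dphi (U n x)) = E2 / s.
    by rewrite mulrC -gibbsZ; apply: gibbs_ext => x; rewrite mulrC.
  have E1b : `|E1| <= B * ((1 + C) / 2).
    apply: (le_trans (norm_gibbs _ _ _)).
    apply: (@le_trans _ _ (gibbs (th n) (Q n) (fun x => B * `|U n x|))).
      by apply: gibbs_le => x; rewrite normrM mulrC ler_wpM2r.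
    by rewrite gibbsZ ler_wpM2l.
  have E2b : `|E2| <= B.
    by apply: (le_trans (norm_gibbs _ _ _)); apply: gibbs_le_cst => x.
  have -> : gibbs (th n) (Q n) (fun x => stein_rhs a b N (U n x / s)) = E2 - E1 / s.
    rewrite /E1 [_ / s]mulrC -gibbsZ -gibbsB; apply: gibbs_ext => x.
    by rewrite /df /stein_dsol -/f; ring.
  have -> : c th0 * s * `|E2 - E1 / s| = `|c th0 * s * (E2 - E1 / s)|.
    by rewrite [RHS]normrM (gtr0_norm (mulr_gt0 c0 s0)).
  have -> : c th0 * s * (E2 - E1 / s) = (c (th n) - c th0) * E1 - (v (th n) - v th0) * (E2 / s)
      - (c (th n) * E1 - v (th n) * (E2 / s)).
    have -> : c th0 * s * (E2 - E1 / s) = c th0 * s * E2 - c th0 * E1 by field; rewrite gt_eqF.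
    by rewrite cs; field; rewrite gt_eqF.
  rewrite (le_trans (ler_normB _ _))// lerD//; last first.
    by move: SI; rewrite E2E /c /v /cw_slope.
  rewrite (le_trans (ler_normB _ _))// lerD//.
    by rewrite normrM ler_wpM2l.
  by rewrite normrM ler_wpM2l// normrM (gtr0_norm z0) ler_wpM2r// ltW.
apply/cvgrPdist_le => e e0; near=> n.
rewrite sub0r normrN -(ler_pM2l (mulr_gt0 c0 s0)).
apply: (@le_trans _ _ (rem n)); first by near: n.
have : `|0 - rem n| <= c th0 * s * e.
  by near: n; move/cvgrPdist_le: rem0; apply; exact: mulr_gt0 (mulr_gt0 c0 s0) e0.
by rewrite sub0r normrN => /(le_trans (ler_norm _)).
Unshelve. all: by end_near. Qed.

(** The indicator of a half-line lies between the smoothed right-hand sides of Stein's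
    equation attached to two nearby half-lines, whose Gaussian probabilities are close
    by continuity. *)
Theorem mean_spin_clt (x : R) :
  gibbs (th n) (Q n) (fun y => (U n y <= x * s)%R%:R) @[n --> \oo] --> normal_cdf 0 1 x.
Proof.
have E n : gibbs (th n) (Q n) (fun y => (U n y <= x * s)%R%:R) =
    gibbs (th n) (Q n) (fun y => (U n y / s <= x)%R%:R).
  by apply: gibbs_ext => y; rewrite ler_pdivrMr.
under eq_cvg do rewrite E.
apply/cvgrPdist_le => e e0.
have cx := @normal_cdf_continuous R 0 1 x (oner_neq0 R).
have [del /= del0 hdel] : exists2 del, 0 < del & forall y, `|x - y| < del ->
    `|normal_cdf 0 1 x - normal_cdf 0 1 y| <= e / 2.
  have /cvgrPdist_le/(_ (e / 2)) := cx; rewrite divr_gt0// => /(_ isT).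
  by move=> [del del0 h]; exists del.
have dP y : `|x - y| = del / 2 -> `|normal_cdf 0 1 x - normal_cdf 0 1 y| <= e / 2.
  by move=> h; apply: hdel; rewrite h; lra.
have P01 (y : R) : 0 <= normal_cdf 0 1 y <= 1 by rewrite normal_cdf_ge0 normal_cdf_le1.
have hu : x < x + del / 2 by lra.
have hl : x - del / 2 < x by lra.
have up : `|x - (x + del / 2)| = del / 2.
  by rewrite opprD addrA subrr sub0r normrN gtr0_norm ?divr_gt0.
have lo : `|x - (x - del / 2)| = del / 2.
  by rewrite opprB addrC subrK gtr0_norm ?divr_gt0.
have e2 : 0 < e / 2 by lra.
have /cvgrPdist_le/(_ _ e2) c1 := stein_rhs_cvg hu (P01 (x + del / 2)).
have /cvgrPdist_le/(_ _ e2) c2 := stein_rhs_cvg hl (P01 (x - del / 2)).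
near=> n.
have h1 : `|0 - gibbs (th n) (Q n) (fun y => stein_rhs x (x + del / 2)
    (normal_cdf 0 1 (x + del / 2)) (U n y / s))| <= e / 2 by near: n; exact: c1.
have h2 : `|0 - gibbs (th n) (Q n) (fun y => stein_rhs (x - del / 2) x
    (normal_cdf 0 1 (x - del / 2)) (U n y / s))| <= e / 2 by near: n; exact: c2.
have u1 := gibbs_le (th n) (Q n) (fun y => stein_rhs_ge hu (U n y / s)).
have u2 := gibbs_le (th n) (Q n) (fun y => stein_rhs_le hl (U n y / s)).
rewrite gibbsD gibbs_cst in u1; rewrite gibbsD gibbs_cst in u2.
move: h1 h2 u1 u2 (dP _ up) (dP _ lo).
rewrite !sub0r !normrN !ler_norml.
exact: sandwich.
Unshelve. all: by end_near. Qed.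

End near_regime.

(** * Averages and kernel operators on the unit interval *)

Section bounded_measurable.
Context {R : realType} {d : measure_display} {T : measurableType d}.
Implicit Types (g h : T -> R).

(** Bounded and measurable on the whole space, so that products and compositions need
    no integrability side conditions. *)
Definition bm h := measurable_fun setT h /\ exists B, forall x, `|h x| <= B.

Lemma bm_cst (c : R) : bm (cst c).
Proof. by split; [exact: measurable_cst|exists `|c|]. Qed.

Lemma bmD g h : bm g -> bm h -> bm (fun x => g x + h x).
Proof.
move=> [mg [A gA]] [mh [B hB]]; split; first exact: measurable_funD.
by exists (A + B) => x; rewrite (le_trans (ler_normD _ _))// lerD.
Qed.

Lemma bmM g h : bm g -> bm h -> bm (fun x => g x * h x).
Proof.
move=> [mg [A gA]] [mh [B hB]]; split; first exact: measurable_funM.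
by exists (A * B) => x; rewrite normrM ler_pM.
Qed.

Lemma bmN h : bm h -> bm (fun x => - h x).
Proof.
move=> [mh [B hB]]; split; last by exists B => x; rewrite normrN.
exact: measurableT_comp.
Qed.

Lemma bmB g h : bm g -> bm h -> bm (fun x => g x - h x).
Proof. by move=> bg bh; apply: bmD => //; exact: bmN. Qed.

Lemma bmZ (c : R) h : bm h -> bm (fun x => c * h x).
Proof. by move=> bh; apply: (bmM (bm_cst c) bh). Qed.

Lemma bm_norm h : bm h -> bm (fun x => `|h x|).
Proof.
move=> [mh [B hB]]; split; last by exists B => x; rewrite normr_id.
exact: measurableT_comp.
Qed.

Lemma bm_indic (A : set T) : measurable A -> bm (\1_A : T -> R).
Proof.
move=> mA; split; first exact: measurable_indic.
by exists 1 => x; rewrite indicE; case: (x \in A); rewrite ?normr1 ?normr0.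
Qed.

Lemma bm_sum (I : Type) (r : seq I) (F : I -> T -> R) :
  (forall i, bm (F i)) -> bm (fun x => \sum_(i <- r) F i x).
Proof.
move=> bF; elim: r => [|i r IH].
  by under eq_fun do rewrite big_nil; exact: bm_cst.
by under eq_fun do rewrite big_cons; exact: bmD.
Qed.

Lemma bm_comp d' (U : measurableType d') (phi : U -> T) h :
  measurable_fun setT phi -> bm h ->
  measurable_fun setT (h \o phi) /\ exists B, forall x, `|h (phi x)| <= B.
Proof. by move=> mphi [mh [B hB]]; split; [exact: measurableT_comp|exists B]. Qed.

End bounded_measurable.

Section averages.
Context {R : realType}.
Notation mu := (@lebesgue_measure R).
Notation I01 := (`[0%R, 1%R]%classic : set R).
Implicit Types (g h : R -> R) (k : R * R -> R).

Definition avg h : R := \int[mu]_(y in I01) h y.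

Lemma mu_I01 : mu I01 = 1%E.
Proof. by rewrite lebesgue_measure_itv/= lte_fin ltr01 oppr0 adde0. Qed.

Let mI : measurable I01. Proof. exact: measurable_itv. Qed.

Lemma bm_integrable h (D : set R) : bm h -> measurable D -> D `<=` I01 ->
  mu.-integrable D (EFin \o h).
Proof.
move=> [mh [B hB]] mD DI; apply: (@integrableS _ _ _ mu I01) => //.
apply: measurable_bounded_integrable => //.
- by rewrite [ltLHS]mu_I01 ltry.
- exact: measurable_funTS.
- by exists B; split; [exact: num_real|move=> M /ltW BM x _; exact: le_trans (hB x) BM].
Qed.

Let bmI h : bm h -> mu.-integrable I01 (EFin \o h).
Proof. by move=> bh; exact: bm_integrable. Qed.

Lemma eq_avg g h : (forall x, I01 x -> g x = h x) -> avg g = avg h.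
Proof. by move=> e; apply: eq_Rintegral => x; rewrite inE; exact: e. Qed.

Lemma avg_cst (c : R) : avg (fun=> c) = c.
Proof. by rewrite /avg Rintegral_cst// [X in fine X]mu_I01 mulr1. Qed.

Lemma avgD g h : bm g -> bm h -> avg (fun x => g x + h x) = avg g + avg h.
Proof. by move=> bg bh; apply: RintegralD => //; exact: bmI. Qed.

Lemma avgB g h : bm g -> bm h -> avg (fun x => g x - h x) = avg g - avg h.
Proof. by move=> bg bh; apply: RintegralB => //; exact: bmI. Qed.

Lemma avgZ (c : R) h : bm h -> avg (fun x => c * h x) = c * avg h.
Proof. by move=> bh; apply: RintegralZl => //; exact: bmI. Qed.

Lemma avg_sum (I : Type) (r : seq I) (F : I -> R -> R) :
  (forall i, bm (F i)) ->
  avg (fun x => \sum_(i <- r) F i x) = \sum_(i <- r) avg (F i).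
Proof.
move=> bF; elim: r => [|i r IH].
  by rewrite big_nil -[RHS](avg_cst 0); apply: eq_avg => x _; rewrite big_nil.
rewrite big_cons -IH -avgD//; last exact: bm_sum.
by apply: eq_avg => x _; rewrite big_cons.
Qed.

Lemma avg_le g h : bm g -> bm h -> (forall x, I01 x -> g x <= h x) -> avg g <= avg h.
Proof. by move=> bg bh gh; apply: le_Rintegral => //; exact: bmI. Qed.

Lemma avg_le_cst h (c : R) : bm h -> (forall x, I01 x -> h x <= c) -> avg h <= c.
Proof. by move=> bh hc; rewrite -[leRHS]avg_cst; apply: avg_le => //; exact: bm_cst. Qed.

Lemma avg_ge0 h : (forall x, I01 x -> 0 <= h x) -> 0 <= avg h.
Proof. by move=> h0; apply: Rintegral_ge0. Qed.

Lemma norm_avg h : bm h -> `|avg h| <= avg (fun x => `|h x|).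
Proof. by move=> bh; apply: le_normr_Rintegral => //; exact: bmI. Qed.

Lemma norm_avg_le h (c : R) : bm h -> (forall x, I01 x -> `|h x| <= c) -> `|avg h| <= c.
Proof.
by move=> bh hc; apply: (le_trans (norm_avg bh)); apply: avg_le_cst => //; exact: bm_norm.
Qed.

Lemma integral_avg h : bm h -> (\int[mu]_x (h x * \1_I01 x)%:E)%E = (avg h)%:E.
Proof.
move=> bh; rewrite /avg /Rintegral fineK; last exact/integrable_fin_num/bmI.
rewrite [RHS]integral_mkcond; apply: eq_integral => x _.
by rewrite patchE indicE; case: (x \in I01); rewrite ?mulr1 ?mulr0.
Qed.

Lemma bm_op k h : bm k -> bm h -> bm (graphon_op k h).
Proof.
move=> [mk [A kA]] [mh [B hB]].
have mkx x : measurable_fun setT (fun y => k (x, y)) by exact: measurable_fun_pair2.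
have bkh x : bm (fun y => k (x, y) * h y).
  by apply: bmM; [split; [exact: mkx|exists A]|split; [|exists B]].
have b x y : `|k (x, y) * h y| <= A * B by rewrite normrM ler_pM.
split; last by exists (A * B) => x; apply: norm_avg_le => // y _.
pose G (z : R * R) : \bar R := ((k z * h z.2 + A * B) * \1_I01 z.2)%:E.
have mG : measurable_fun setT G.
  apply/measurable_EFinP/measurable_funM.
    apply: measurable_funD; last exact: measurable_cst.
    by apply: measurable_funM => //; apply: measurableT_comp => //; exact: measurable_snd.
  by apply: measurableT_comp; [exact: measurable_indic|exact: measurable_snd].
have G0 z : (0 <= G z)%E.
  rewrite lee_fin mulr_ge0 ?indicE//.
  by case: z => x y; have := b x y; rewrite ler_norml /= => /andP[? _]; lra.
have E x : fubini_F mu G x = (graphon_op k h x + A * B)%:E.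
  have := integral_avg (bmD (bkh x) (bm_cst (A * B))).
  by rewrite avgD// ?avg_cst//; exact: bm_cst.
have mF := measurable_fun_fubini_tonelli_F G mG G0 (m2 := mu).
have -> : graphon_op k h = fun x => fine (fubini_F mu G x) - A * B.
  by apply/funext => x; rewrite E/= addrK.
apply: measurable_funB; last exact: measurable_cst.
exact: measurableT_comp.
Qed.

Definition swap_kernel k (z : R * R) : R := k (z.2, z.1).

Lemma bm_swap k : bm k -> bm (swap_kernel k).
Proof.
move=> bk; apply: (bm_comp (phi := fun z : R * R => (z.2, z.1))) bk.
by apply: measurable_fun_pair; [exact: measurable_snd|exact: measurable_fst].
Qed.

Section fubini.
Context (k : R * R -> R) (g h : R -> R) (bk : bm k) (bg : bm g) (bh : bm h).

Let K (z : R * R) : \bar R := (g z.1 * k z * h z.2 * (\1_I01 z.1 * \1_I01 z.2))%:E.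

Let bmK : bm (fun z : R * R => g z.1 * k z * h z.2 : R).
Proof.
apply: bmM; [apply: bmM => //|].
  exact: (bm_comp (phi := fst) measurable_fst bg).
exact: (bm_comp (phi := snd) measurable_snd bh).
Qed.

Let KI : (mu \x mu)%E.-integrable setT K.
Proof.
have mII : measurable (I01 `*` I01 : set (measurableTypeR R * measurableTypeR R)).
  exact: measurableX.
have -> : K = (EFin \o (fun z : R * R => g z.1 * k z * h z.2)) \_ (I01 `*` I01).
  apply/funext => -[x y]; rewrite patchE /K !indicE in_setX/=.
  by case: (x \in I01); case: (y \in I01); rewrite ?mulr1 ?mulr0.
rewrite -(integrable_mkcond _ mII).
have [mK [B hB]] := bmK.
apply: measurable_bounded_integrable => //.
- have := @product_measure1E _ _ _ _ R mu mu I01 I01 mI mI.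
  by rewrite ![X in (_ * X)%E]mu_I01 mule1 [X in _ = X]mu_I01 => e; rewrite [ltLHS]e ltry.
- exact: measurable_funTS.
- by exists B; split; [exact: num_real|move=> M /ltW BM x _; exact: le_trans (hB x) BM].
Qed.

Lemma fubini12 : (\int[mu \x mu]_z K z)%E = (avg (fun x => g x * graphon_op k h x))%:E.
Proof.
rewrite -(integral12_prod_meas1 KI) -integral_avg; last by apply: bmM => //; exact: bm_op.
apply: eq_integral => x _; rewrite /fubini_F /K/=.
have [mk [A kA]] := bk.
have bkx : bm (fun y => k (x, y) * h y).
  by apply: bmM => //; split; [exact: measurable_fun_pair2|exists A].
have := integral_avg (bmZ (g x * \1_I01 x) bkx); rewrite avgZ// => e.
transitivity ((g x * \1_I01 x * avg (fun y => k (x, y) * h y))%:E : \bar R).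
  by rewrite -e; apply: eq_integral => y _; congr EFin; ring.
by rewrite mulrAC.
Qed.

Lemma fubini21 : (\int[mu \x mu]_z K z)%E =
  (avg (fun y => h y * graphon_op (swap_kernel k) g y))%:E.
Proof.
rewrite -(integral21_prod_meas1 KI) -integral_avg; last first.
  by apply: bmM => //; apply: bm_op => //; exact: bm_swap.
apply: eq_integral => y _; rewrite /fubini_G /K/=.
have [mk [A kA]] := bk.
have bkx : bm (fun x => k (x, y) * g x).
  by apply: bmM => //; split; [exact: measurable_fun_pair1|exists A].
have := integral_avg (bmZ (h y * \1_I01 y) bkx); rewrite avgZ// => e.
transitivity ((h y * \1_I01 y * avg (fun x => k (x, y) * g x))%:E : \bar R).
  by rewrite -e; apply: eq_integral => x _; congr EFin; ring.
by rewrite mulrAC.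
Qed.

Lemma op_swap : avg (fun x => g x * graphon_op k h x) =
  avg (fun y => h y * graphon_op (swap_kernel k) g y).
Proof. by apply: EFin_inj; rewrite -fubini12 fubini21. Qed.

End fubini.

Lemma integral_rect k (S T : set R) : bm k -> measurable S -> measurable T ->
  S `<=` I01 -> T `<=` I01 ->
  \int[(mu \x mu)%E]_(z in S `*` T) k z = avg (fun x => \1_S x * graphon_op k \1_T x).
Proof.
move=> bk mS mT SI TI; apply: EFin_inj.
rewrite -(fubini12 bk (bm_indic mS) (bm_indic mT)) /Rintegral integral_mkcond.
set f1 := (fun z => _); set f2 := (fun z => _).
have -> : f1 = f2.
  apply/funext => -[x y]; rewrite /f1 /f2 patchE !indicE in_setX/=.
  have [xS|_] := boolP (x \in S); have [yT|_] := boolP (y \in T);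
    rewrite ?mul0r ?mulr0 ?mul0r//=.
  rewrite (_ : x \in I01); last by move: xS; rewrite !inE; exact: SI.
  rewrite (_ : y \in I01); last by move: yT; rewrite !inE; exact: TI.
  by rewrite mul1r !mulr1.
by rewrite (fubini12 bk (bm_indic mS) (bm_indic mT)).
Qed.

(** [S] and [T] are the sets where the function is nonnegative and negative. *)
Lemma norm_avg_split h : bm h -> exists S T : set R,
  [/\ measurable S, measurable T, S `<=` I01, T `<=` I01 &
   avg (fun x => `|h x|) = avg (fun x => \1_S x * h x) - avg (fun x => \1_T x * h x)].
Proof.
move=> bh; have [mh _] := bh.
pose S := I01 `&` h @^-1` `[0, +oo[%classic; pose T := I01 `&` h @^-1` `]-oo, 0[%classic.
have mS : measurable S by apply: measurableI => //; rewrite -[X in measurable X]setTI; exact: mh.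
have mT : measurable T by apply: measurableI => //; rewrite -[X in measurable X]setTI; exact: mh.
exists S, T; split => //; [exact: subIsetl|exact: subIsetl|].
rewrite -avgB; [|by apply: bmM => //; exact: bm_indic|by apply: bmM => //; exact: bm_indic].
apply: eq_avg => x xI; rewrite !indicE.
have [h0|h0] := leP 0 (h x).
  rewrite mem_set ?memNset ?mul1r ?mul0r ?subr0 ?ger0_norm//.
  - by move=> [_]; rewrite /= in_itv/= ltNge h0.
  - by split => //=; rewrite in_itv/= h0.
rewrite memNset ?mem_set ?mul1r ?mul0r ?sub0r ?ltr0_norm//.
- by move=> [_]; rewrite /= in_itv/= andbT leNgt h0.
Qed.

(** The cut norm controls the operator norm from [L^oo] to [L^1]: testing against
    signs reduces a bounded function to two indicators on each side. *)
Lemma cut_op_L1 k h (e B : R) : bm k -> bm h -> (forall x, I01 x -> `|h x| <= B) ->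
  (forall S T, measurable S -> measurable T -> S `<=` I01 -> T `<=` I01 ->
    `|\int[(mu \x mu)%E]_(z in S `*` T) k z| <= e) ->
  avg (fun x => `|graphon_op k h x|) <= 4 * B * e.
Proof.
move=> bk bh hB cut.
have B0 : 0 <= B by apply: le_trans (hB 0 _) => //; rewrite /= in_itv/= lexx ler01.
(* The bounded function is moved to the outer integral, where only its bound matters. *)
have c2 (S : set R) : measurable S -> S `<=` I01 ->
    `|avg (fun x => \1_S x * graphon_op k h x)| <= 2 * B * e.
  move=> mS SI; rewrite (op_swap bk (bm_indic mS) bh).
  have bE : bm (graphon_op (swap_kernel k) \1_S) by apply: bm_op; [exact: bm_swap|exact: bm_indic].
  have bhE : bm (fun y => h y * graphon_op (swap_kernel k) \1_S y) by exact: bmM.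
  apply: (le_trans (norm_avg bhE)).
  apply: (@le_trans _ _ (avg (fun y => B * `|graphon_op (swap_kernel k) \1_S y|))).
    apply: avg_le; [exact: bm_norm|by apply: bmZ; exact: bm_norm|move=> x xI].
    by rewrite normrM ler_wpM2r// hB.
  rewrite avgZ; last exact: bm_norm.
  have [S' [T' [mS' mT' SI' TI' ->]]] := norm_avg_split bE.
  rewrite -!(op_swap bk (bm_indic mS)); [|exact: bm_indic..].
  rewrite -!integral_rect//.
  have := cut S S' mS mS' SI SI'; have := cut S T' mS mT' SI TI'.
  rewrite !ler_norml => /andP[? ?] /andP[? ?].
  by rewrite [2 * B]mulrC -mulrA ler_wpM2l//; lra.
have [S [T [mS mT SI TI ->]]] := norm_avg_split (bm_op bk bh).
have := c2 S mS SI; have := c2 T mT TI.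
rewrite !ler_norml => /andP[? ?] /andP[? ?].
have -> : 4 * B * e = 2 * B * e + 2 * B * e by ring.
lra.
Qed.

End averages.

(** * Cells and measure-preserving maps *)

Section cells.
Context {R : realType} (n : nat) (n_gt0 : (0 < n)%N).
Notation mu := (@lebesgue_measure R).
Notation I01 := (`[0%R, 1%R]%classic : set R).
Implicit Types (y : R) (i : 'I_n).

Let nR0 : 0 < n%:R :> R. Proof. by rewrite ltr0n. Qed.

Definition cell_set i : set R := [set y | I01 y /\ cell n y = Some i].

(** The ceiling, seen through the inequalities that characterize it. *)
Lemma cell_index y : 0 <= y -> exists2 c : nat,
  forall m : nat, (c <= m)%N = (n%:R * y <= m%:R) & cell n y = insub c.-1.
Proof.
move=> y0; have ny0 : 0 <= n%:R * y by rewrite mulr_ge0// ltW.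
exists (absz (Num.ceil (n%:R * y))) => // m.
have c0 : (0 <= Num.ceil (n%:R * y))%R.
  by rewrite -(ceil0 R) ceil_le.
by rewrite -lez_nat gez0_abs// ceil_le_int.
Qed.

Lemma cell_some y : I01 y -> exists i, cell n y = Some i.
Proof.
rewrite /= in_itv/= => /andP[y0 y1]; have [c cP ->] := cell_index y0.
have cn : (c <= n)%N by rewrite cP ler_piMr// ltW.
have h : (c.-1 < n)%N by case: c cn {cP} => // c.
by exists (Ordinal h); rewrite insubT.
Qed.

(** The first cell also contains 0, whose ceiling is 0. *)
Lemma cell_setE i : cell_set i =
  (if nat_of_ord i is 0%N then `[0, n%:R^-1]%classic else `](nat_of_ord i)%:R / n%:R, (nat_of_ord i).+1%:R / n%:R]%classic).
Proof.
have some_eq (c : nat) : ((insub c : option 'I_n) = Some i) <-> c = nat_of_ord i.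
  split=> [|->]; last exact: valK.
  by case: insubP => // u _ <- [->].
have i1 : (nat_of_ord i).+1%:R / n%:R <= 1 :> R.
  by rewrite ler_pdivrMr// mul1r ler_nat; exact: ltn_ord.
apply/seteqP; split => y.
  rewrite /cell_set /= in_itv/= => -[/andP[y0 y1]]; have [c cP ->] := cell_index y0.
  move/some_eq; case: (nat_of_ord i) => [|m] ci.
    rewrite /= in_itv/= y0/= -[_^-1]mul1r ler_pdivlMr// mulrC.
    by rewrite -[1]/(1%:R) -cP; move: ci; case: (c) => [|[]].
  have {}ci : c = m.+2 by case: (c) ci => // c' /= ->.
  rewrite /= in_itv/= ltr_pdivrMr// ler_pdivlMr// [y * _]mulrC.
  by rewrite ltNge -!cP ci leqnn ltnn.
move=> h; have {h} [y0 y1 h] : [/\ 0 <= y, y <= 1 &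
    y <= (nat_of_ord i).+1%:R / n%:R /\ ((0 < nat_of_ord i)%N -> (nat_of_ord i)%:R / n%:R < y)].
  case: (nat_of_ord i) h i1 => [|m]; rewrite /= in_itv/= => /andP[h1 h2] i1.
    by rewrite mul1r in i1 *; split => //; exact: le_trans i1.
  split => //; [|exact: le_trans i1].
  by apply/ltW/(le_lt_trans _ h1); rewrite divr_ge0.
split; first by rewrite /= in_itv/= y0.
have [c cP ->] := cell_index y0; apply/some_eq.
case: h; rewrite ler_pdivlMr// mulrC -cP => h1 h2.
case: (nat_of_ord i) h1 h2 => [|m] h1 h2; first by case: (c) h1 => [|[]].
have := h2 isT; rewrite ltr_pdivrMr// [y * _]mulrC ltNge -cP -ltnNge => h3.
by apply/eqP; rewrite -(eqn_add2r 1) !addn1 prednK ?(leq_trans _ h3)// eqn_leq h1.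
Qed.

Lemma measurable_cell_set i : measurable (cell_set i).
Proof. by rewrite cell_setE; case: (nat_of_ord i) => [|m]; exact: measurable_itv. Qed.

Lemma avg_cell_set i : avg (\1_(cell_set i)) = n%:R^-1 :> R.
Proof.
have e : (\int[mu]_(y in I01) (\1_(cell_set i) y)%:E = mu (cell_set i))%E.
  rewrite (integral_indic mu (measurable_itv _) (measurable_cell_set i)).
  by congr (mu _); apply/setIidPl => y [].
rewrite /avg /Rintegral e cell_setE; case: (nat_of_ord i) => [|m].
  by rewrite lebesgue_measure_itv/= lte_fin invr_gt0 nR0/= oppr0 addr0.
rewrite lebesgue_measure_itv/= lte_fin ltr_pM2r ?invr_gt0// ltr_nat ltnSn/=.
by rewrite -mulrBl -natrB// subSnn mul1r.
Qed.

End cells.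

Section measure_preserving.
Context {R : realType}.
Notation mu := (@lebesgue_measure R).
Notation I01 := (`[0%R, 1%R]%classic : set R).
Implicit Types (iota h : R -> R).

(** Off the unit interval the extension takes a value outside of it, so that the
    unit interval is exactly the preimage of itself. *)
Definition extend01 iota x : R := if x \in I01 then iota x else 2.

Lemma extend01E iota x : I01 x -> extend01 iota x = iota x.
Proof. by move=> xI; rewrite /extend01 mem_set. Qed.

Lemma extend01_in iota x : measure_preserving01 iota -> I01 x -> I01 (extend01 iota x).
Proof. by move=> [_ h _] xI; rewrite extend01E//; exact: h. Qed.

Lemma measurable_extend01 iota : measure_preserving01 iota ->
  measurable_fun setT (extend01 iota).
Proof.
move=> [mi _ _]; apply: measurable_fun_if => //.
- apply: (@measurable_fun_bool _ _ setT _ true) => //.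
  rewrite setTI (_ : _ @^-1` _ = I01); first exact: measurable_itv.
  by apply/seteqP; split => x /= => [/set_mem|/mem_set].
- rewrite setTI (_ : _ @^-1` _ = I01) //.
  by apply/seteqP; split => x /= => [/set_mem|/mem_set].
Qed.

Lemma preimage_extend01 iota : measure_preserving01 iota ->
  extend01 iota @^-1` I01 = I01.
Proof.
move=> [_ h _]; apply/seteqP; split => x /=; rewrite /extend01.
  have [|_] := boolP (x \in I01); first by rewrite inE.
  by rewrite in_itv/= => /andP[_]; rewrite leNgt ltr1n.
by move=> xI; rewrite mem_set//; exact: h.
Qed.

Lemma avg_extend01 iota h : measure_preserving01 iota -> bm h ->
  avg (fun x => h (extend01 iota x)) = avg h.
Proof.
move=> mp bh; have mi := measurable_extend01 mp; have pI := preimage_extend01 mp.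
have [mh [B hB]] := bh.
have bhi : bm (fun x => h (extend01 iota x)).
  by split; [exact: measurableT_comp|exists B].
congr fine; symmetry.
have mi' : measurable_fun (T := measurableTypeR R) (U := measurableTypeR R) setT
  (extend01 iota) := mi.
pose nu := measure_function_pushforward__canonical__measure_function_Measure mu mi'.
have e : forall A : set (measurableTypeR R), measurable A -> A `<=` I01 -> mu A = nu A.
  move=> A mA AI; rewrite /nu /= /pushforward.
  case: mp => [_ _ mp]; rewrite -mp//; congr (mu _).
  apply/seteqP; split => x /=.
    by move=> [xI xA]; rewrite extend01E.
  move=> h1; have xI : I01 x by rewrite -pI; exact: AI.
  by split => //; rewrite extend01E in h1.
have -> : (\int[mu]_(x in I01) (h x)%:E = \int[nu]_(x in I01) (EFin \o h) x)%E.
  exact: (@eq_measure_integral _ (measurableTypeR R) R I01 nu mu (EFin \o h) e).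
have mh' : measurable_fun (T := measurableTypeR R) setT (EFin \o h) by exact/measurable_EFinP.
rewrite (@integral_pushforward _ _ _ _ R _ mi' mu I01 (EFin \o h) mh')//.
  by rewrite pI.
by rewrite pI; exact: (bm_integrable bhi).
Qed.

End measure_preserving.

(** * From matrices to graphons in cut distance *)

Section kernel.
Context {R : realType} (C : R) (f : R * R -> R) (fG : is_graphon C f).
Notation mu := (@lebesgue_measure R).
Notation I01 := (`[0%R, 1%R]%classic : set R).
Implicit Types (x y : R) (g h : R -> R).

(** The graphon extended by zero, so as to be bounded and measurable on the plane. *)
Definition zero_ext (z : R * R) : R := if z \in I01 `*` I01 then f z else 0.

Lemma in_square x y : ((x, y) \in I01 `*` I01) = (x \in I01) && (y \in I01).
Proof. by rewrite in_setX. Qed.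

Let x0 : I01 0. Proof. by rewrite /= in_itv/= lexx ler01. Qed.

Lemma graphon_bound_ge0 : 0 <= C.
Proof. by have [_ _ h] := fG; have /andP[] := h 0 0 x0 x0; exact: le_trans. Qed.

Lemma zero_ext_itv z : 0 <= zero_ext z <= C.
Proof.
case: z => x y; rewrite /zero_ext; case: ifPn => [|_]; last by rewrite lexx graphon_bound_ge0.
by rewrite in_square => /andP[/set_mem xI /set_mem yI]; have [_ _ h] := fG; exact: h.
Qed.

Lemma norm_zero_ext z : `|zero_ext z| <= C.
Proof. by have /andP[h0 h1] := zero_ext_itv z; rewrite ger0_norm. Qed.

Lemma zero_ext_sym x y : zero_ext (x, y) = zero_ext (y, x).
Proof.
rewrite /zero_ext !in_square andbC; case: ifPn => // /andP[/set_mem yI /set_mem xI].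
by have [_ h _] := fG; exact: h.
Qed.

Lemma zero_extE x y : I01 x -> I01 y -> zero_ext (x, y) = f (x, y).
Proof. by move=> xI yI; rewrite /zero_ext in_square !mem_set. Qed.

Lemma bm_zero_ext : bm zero_ext.
Proof.
have [mf _ _] := fG; split; last by exists C; exact: norm_zero_ext.
apply: measurable_fun_if => //.
- apply: (@measurable_fun_bool _ _ setT _ true) => //.
  rewrite setTI (_ : _ @^-1` _ = I01 `*` I01); first by apply: measurableX; exact: measurable_itv.
  by apply/seteqP; split => z /= => [/set_mem|/mem_set].
- rewrite setTI (_ : _ @^-1` _ = I01 `*` I01) //.
  by apply/seteqP; split => z /= => [/set_mem|/mem_set].
Qed.

Lemma op_zero_ext h x : I01 x -> graphon_op zero_ext h x = graphon_op f h x.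
Proof.
by move=> xI; apply: eq_Rintegral => y; rewrite inE => yI; rewrite zero_extE.
Qed.

Lemma bm_section (k : R * R -> R) x : bm k -> bm (fun y => k (x, y)).
Proof. by move=> [mk [B kB]]; split; [exact: measurable_fun_pair2|exists B]. Qed.

Lemma op_sub (k : R * R -> R) g h x : bm k -> bm g -> bm h ->
  graphon_op k (fun y => g y - h y) x = graphon_op k g x - graphon_op k h x.
Proof.
move=> bk bg bh; have bx := bm_section x bk.
rewrite -[RHS]avgB; [|exact: bmM..].
by apply: eq_avg => y _; rewrite mulrBr.
Qed.

Lemma norm_op_le (k : R * R -> R) h x (B : R) : bm k -> bm h -> 0 <= B ->
  (forall y, I01 y -> `|k (x, y)| <= B) ->
  `|graphon_op k h x| <= B * avg (fun y => `|h y|).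
Proof.
move=> bk bh B0 kB; rewrite -avgZ; last exact: bm_norm.
have bx := bm_section x bk.
apply: (le_trans (norm_avg (bmM bx bh))); apply: avg_le.
- exact/bm_norm/bmM.
- exact/bmZ/bm_norm.
- by move=> y yI; rewrite normrM ler_wpM2r// kB.
Qed.

End kernel.

Section cut_model.
Context {R : realType} (n : nat) (n_gt0 : (0 < n)%N) (A : 'M[R]_n).
Context (C : R) (f : R * R -> R) (fG : is_graphon C f).
Hypothesis A01 : forall i j, 0 <= A i j <= C.
Notation mu := (@lebesgue_measure R).
Notation I01 := (`[0%R, 1%R]%classic : set R).
Implicit Types (x y : R) (g h : R -> R) (w : 'I_n -> R).
Context (iota1 iota2 : R -> R) (e : R).
Hypotheses (mp1 : measure_preserving01 iota1) (mp2 : measure_preserving01 iota2).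
Hypothesis cut : forall S T, measurable S -> measurable T -> S `<=` I01 -> T `<=` I01 ->
  `|\int[(mu \x mu)%E]_(z in S `*` T)
     (relabel (step_graphon A) iota1 z - relabel f iota2 z)| <= e.

Let nR0 : 0 < n%:R :> R. Proof. by rewrite ltr0n. Qed.
Let C0 : 0 <= C := graphon_bound_ge0 fG.
Let j1 := extend01 iota1.
Let j2 := extend01 iota2.
Let bm1 h : bm h -> bm (fun x => h (j1 x)).
Proof. by move=> bh; apply: (bm_comp (phi := j1)) bh; exact: measurable_extend01. Qed.
Let bm2 h : bm h -> bm (fun x => h (j2 x)).
Proof. by move=> bh; apply: (bm_comp (phi := j2)) bh; exact: measurable_extend01. Qed.

Let a (i : 'I_n) x : R := \1_(cell_set i) (j1 x).

Let bm_a i : bm (a i).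
Proof. by apply: (bm1 (h := \1_(cell_set i))); apply: bm_indic; exact: measurable_cell_set. Qed.

Let avg_a i : avg (a i) = n%:R^-1.
Proof.
rewrite -(avg_cell_set n_gt0 i); apply: (avg_extend01 (h := \1_(cell_set i)) mp1).
by apply: bm_indic; exact: measurable_cell_set.
Qed.

Let a_mul i j x : a i x * a j x = (i == j)%:R * a i x.
Proof.
rewrite /a !indicE; have [->|ij] := eqVneq i j.
  by case: (_ \in _); rewrite ?mulr1 ?mulr0.
have [|_] := boolP (j1 x \in cell_set i); last by rewrite mul0r mulr0.
rewrite inE => -[_ ei]; rewrite memNset ?mulr0 ?mul0r//.
by move=> [_]; rewrite ei => -[E]; rewrite E eqxx in ij.
Qed.

Let cell_of x : I01 x -> {i | cell n (j1 x) = Some i}.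
Proof.
move=> xI; case E : (cell n (j1 x)) => [i|]; first by exists i.
exfalso; have [i] := cell_some n_gt0 (extend01_in mp1 xI).
by rewrite -/j1 E.
Qed.

Let a_cell x i : I01 x -> cell n (j1 x) = Some i -> forall j, a j x = (j == i)%:R.
Proof.
move=> xI xi j; rewrite /a indicE; have [->|ji] := eqVneq j i.
  by rewrite mem_set//; split => //; exact: extend01_in.
rewrite memNset// => -[_]; rewrite xi => -[E]; rewrite E eqxx in ji.
by [].
Qed.

Let sum_delta (u : 'I_n -> R) i : \sum_j u j * (j == i)%:R = u i.
Proof.
rewrite (bigD1 i)//= eqxx mulr1 big1 ?addr0// => j /negbTE ->.
by rewrite mulr0.
Qed.

Definition step_fun w x := \sum_i w i * a i x.

Let stepE w x i : I01 x -> cell n (j1 x) = Some i -> step_fun w x = w i.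
Proof.
move=> xI xi; rewrite /step_fun (eq_bigr (fun j => w j * (j == i)%:R)).
  exact: sum_delta.
by move=> j _; rewrite (a_cell xI xi).
Qed.

Lemma bm_step w : bm (step_fun w).
Proof. by apply: bm_sum => i; exact: bmZ. Qed.

Lemma avg_step w : avg (step_fun w) = n%:R^-1 * \sum_i w i.
Proof.
rewrite avg_sum => [|i]; last exact: bmZ.
by rewrite mulr_sumr; apply: eq_bigr => i _; rewrite avgZ// avg_a mulrC.
Qed.

Lemma norm_step_le w (B : R) x : (forall i, `|w i| <= B) -> I01 x -> `|step_fun w x| <= B.
Proof. by move=> wB xI; have [i xi] := cell_of xI; rewrite (stepE _ xI xi). Qed.

Let k1 (z : R * R) : R := \sum_i \sum_j A i j * (a i z.1 * a j z.2).
Let k2 (z : R * R) : R := zero_ext f (j2 z.1, j2 z.2).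

Let bm_k1 : bm k1.
Proof.
apply: bm_sum => i; apply: bm_sum => j; apply: bmZ; apply: bmM.
  exact: (bm_comp (phi := fst) measurable_fst (bm_a i)).
exact: (bm_comp (phi := snd) measurable_snd (bm_a j)).
Qed.

Let bm_k2 : bm k2.
Proof.
apply: (bm_comp (phi := fun z : R * R => (j2 z.1, j2 z.2))); last exact: bm_zero_ext fG.
have m2 : measurable_fun setT j2 by exact: measurable_extend01.
by apply: measurable_fun_pair; apply: (measurableT_comp m2);
  [exact: measurable_fst|exact: measurable_snd].
Qed.

Let k1E x y : I01 x -> I01 y -> k1 (x, y) = relabel (step_graphon A) iota1 (x, y).
Proof.
move=> xI yI; have [i xi] := cell_of xI; have [j yj] := cell_of yI.
rewrite /relabel /step_graphon /= -(extend01E iota1 xI) -(extend01E iota1 yI).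
rewrite -/j1 xi yj /k1 /=.
rewrite (eq_bigr (fun i' => A i' j * (i' == i)%:R)); first by rewrite sum_delta.
move=> i' _; rewrite (eq_bigr (fun j' => A i' j' * (i' == i)%:R * (j' == j)%:R)).
  by rewrite (sum_delta (fun j' => A i' j' * (i' == i)%:R)).
by move=> j' _; rewrite (a_cell xI xi) (a_cell yI yj) mulrA.
Qed.

Let k2E x y : I01 x -> I01 y -> k2 (x, y) = relabel f iota2 (x, y).
Proof.
move=> xI yI; rewrite /k2 /= zero_extE; [|exact: extend01_in..].
by rewrite /relabel/= -(extend01E iota2 xI) -(extend01E iota2 yI).
Qed.

Let bm_k : bm (fun z => k1 z - k2 z). Proof. exact: bmB bm_k1 bm_k2. Qed.

Let cut_k S T : measurable S -> measurable T -> S `<=` I01 -> T `<=` I01 ->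
  `|\int[(mu \x mu)%E]_(z in S `*` T) (k1 z - k2 z)| <= e.
Proof.
move=> mS mT SI TI; apply: le_trans (cut mS mT SI TI).
rewrite le_eqVlt; apply/orP; left; apply/eqP; congr `|_|; apply: eq_Rintegral.
move=> -[x y] /set_mem[/= /SI xI /TI yI].
by rewrite (k1E xI yI) (k2E xI yI).
Qed.

Let op_k1 h x : bm h -> graphon_op k1 h x =
  \sum_i (\sum_j A i j * avg (fun y => a j y * h y)) * a i x.
Proof.
move=> bh; transitivity (avg (fun y => \sum_i \sum_j A i j * a i x * (a j y * h y))).
  apply: eq_avg => y _; rewrite /k1 mulr_suml; apply: eq_bigr => i _.
  by rewrite mulr_suml; apply: eq_bigr => j _ /=; ring.
have bah j : bm (fun y => a j y * h y) by exact: bmM.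
rewrite avg_sum => [|i]; last by apply: bm_sum => j; exact: bmZ.
apply: eq_bigr => i _; rewrite avg_sum => [|j]; last exact: bmZ.
rewrite mulr_suml; apply: eq_bigr => j _; rewrite avgZ//.
by rewrite mulrAC.
Qed.

Let op_k2 h x : bm h -> graphon_op k2 (fun y => h (j2 y)) x = graphon_op (zero_ext f) h (j2 x).
Proof.
move=> bh; apply: (avg_extend01 (h := fun y => zero_ext f (j2 x, y) * h y) mp2).
by apply: bmM => //; apply: bm_section; exact: bm_zero_ext fG.
Qed.

Let op_k h x : bm h -> graphon_op (fun z => k1 z - k2 z) h x =
  graphon_op k1 h x - graphon_op k2 h x.
Proof.
move=> bh; rewrite -[RHS]avgB; [|by apply: bmM => //; exact: bm_section..].
by apply: eq_avg => y _; rewrite mulrBl.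
Qed.

(** Up to the cut distance, the image under the graphon operator is determined by
    finitely many averages: this is what makes the operator compact. *)
Lemma op_finite_rank g (B : R) : bm g -> (forall x, I01 x -> `|g x| <= B) ->
  avg (fun x => `|graphon_op (zero_ext f) g x|) <=
  4 * B * e + C * \sum_j `|avg (fun y => a j y * g (j2 y))|.
Proof.
move=> bg gB; have bz := bm_zero_ext fG.
have bg2 : bm (fun y => g (j2 y)) by exact: bm2.
rewrite -(avg_extend01 mp2 (bm_norm (bm_op bz bg))) -/j2.
have bd : bm (graphon_op (fun z => k1 z - k2 z) (fun y => g (j2 y))) by exact: bm_op.
set D := avg (fun x => _).
have -> : D = avg (fun x => `|graphon_op k2 (fun y => g (j2 y)) x|).
  by apply: eq_avg => x _; rewrite op_k2.
pose c := C * \sum_j `|avg (fun y => a j y * g (j2 y))|.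
apply: (@le_trans _ _ (avg (fun x =>
    `|graphon_op (fun z => k1 z - k2 z) (fun y => g (j2 y)) x| + c))).
  apply: avg_le; [exact/bm_norm/bm_op|apply: bmD; [exact: bm_norm|exact: bm_cst]|].
  move=> x xI; rewrite op_k//; set u := graphon_op k1 _ x; set v := graphon_op k2 _ x.
  have : `|u| <= c.
    have [i xi] := cell_of xI.
    have -> : u = \sum_j A i j * avg (fun y => a j y * g (j2 y)).
      by rewrite /u op_k1// -(stepE (fun i => \sum_j A i j * avg (fun y => a j y * g (j2 y))) xI xi).
    rewrite (le_trans (ler_norm_sum _ _ _))// /c mulr_sumr; apply: ler_sum => j _.
    have /andP[A0 AC] := A01 i j.
    by rewrite normrM (ger0_norm A0) ler_wpM2r.
  have := ler_normB u (u - v); rewrite opprB addrC subrK.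
  lra.
rewrite avgD; [|exact: bm_norm|exact: bm_cst].
rewrite avg_cst lerD2r; apply: (cut_op_L1 bm_k bg2 _ cut_k) => x xI; apply: gB.
exact: extend01_in.
Qed.

(** The function [F] averages [f] in its second variable against the step function of [w]. Only
    that variable is pulled back, so [F] lives on the space of [f], while in the cut
    distance its pullback is compared with a step function. The last clause records
    that [w = 1] yields the degree function of [f]. *)
Lemma approx_fixed w (B : R) : 0 <= B -> (forall i, `|w i| <= B) ->
  let kappa := 4 * B * e + n%:R^-1 * \sum_i `|n%:R^-1 * \sum_j A i j * w j - w i| in
  exists F : R -> R, [/\ bm F, forall x, `|F x| <= C * B,
    forall x, `|graphon_op (zero_ext f) F x - F x| <= C * kappa,
    forall (phi : R -> R) (L : R), (forall h, bm h -> bm (fun x : R => phi (h x))) -> 0 <= L ->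
      (forall u v, `|u| <= C * B -> `|v| <= B -> `|phi u - phi v| <= L * `|u - v|) ->
      `|avg (fun x => phi (F x)) - n%:R^-1 * \sum_i phi (w i)| <= L * kappa &
    (forall i, w i = 1) -> forall x, F x = graphon_op (zero_ext f) (cst 1) x].
Proof.
move=> B0 wB kappa; have bz := bm_zero_ext fG.
pose fz (z : R * R) := zero_ext f (z.1, j2 z.2).
have bfz : bm fz.
  apply: (bm_comp (phi := fun z : R * R => (z.1, j2 z.2))) bz.
  apply: measurable_fun_pair; first exact: measurable_fst.
  by apply: measurableT_comp; [exact: measurable_extend01|exact: measurable_snd].
pose F := graphon_op fz (step_fun w).
have bs := bm_step w.
have bF : bm F by exact: bm_op.
have bF2 : bm (fun x => F (j2 x)) by exact: bm2.
have stepB := norm_step_le wB.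
pose dF x := F (j2 x) - step_fun w x.
have bdF : bm dF by exact: bmB.
(* The pullback of F differs from the step function of w by the cut error and by the
   defect of w as a fixed vector. *)
have key : avg (fun x => `|dF x|) <= kappa.
  pose r i := n%:R^-1 * \sum_j A i j * w j - w i.
  have a_step j : avg (fun y => a j y * step_fun w y) = n%:R^-1 * w j.
    rewrite -(avg_a j) mulrC -avgZ//; apply: eq_avg => y yI.
    rewrite /step_fun mulr_sumr (bigD1 j)//= big1 => [|i ij].
      by rewrite addr0 mulrCA a_mul eqxx mul1r.
    by rewrite mulrCA a_mul eq_sym (negbTE ij) mul0r mulr0.
  have E x : I01 x -> dF x = step_fun r x - graphon_op (fun z => k1 z - k2 z) (step_fun w) x.
    move=> xI; have [i xi] := cell_of xI.
    rewrite op_k// /dF !(stepE _ xI xi) op_k1//.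
    have -> : \sum_i (\sum_j A i j * avg (fun y => a j y * step_fun w y)) * a i x =
        n%:R^-1 * \sum_j A i j * w j.
      rewrite -[LHS]/(step_fun (fun i => \sum_j A i j * avg (fun y => a j y * step_fun w y)) x).
      rewrite (stepE _ xI xi) mulr_sumr; apply: eq_bigr => j _.
      by rewrite a_step mulrCA.
    have -> : graphon_op k2 (step_fun w) x = F (j2 x) by [].
    by rewrite /r; ring.
  have bk : bm (graphon_op (fun z => k1 z - k2 z) (step_fun w)) by exact: bm_op.
  apply: (@le_trans _ _ (avg (fun x => `|graphon_op (fun z => k1 z - k2 z) (step_fun w) x| +
      step_fun (fun i => `|r i|) x))).
    apply: avg_le; [exact: bm_norm|by apply: bmD; [exact: bm_norm|exact: bm_step]|].
    move=> x xI; have [i xi] := cell_of xI.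
    by rewrite (E x xI) !(stepE _ xI xi) addrC (le_trans (ler_normD _ _))// normrN.
    rewrite avgD; [|exact: bm_norm|exact: bm_step].
  by rewrite avg_step /kappa lerD//; exact: (cut_op_L1 bm_k bs stepB cut_k).
exists F; split => //.
- move=> x; apply: (le_trans (norm_op_le bfz bs C0 _)).
    by move=> y _; exact: norm_zero_ext.
  rewrite ler_wpM2l//; apply: avg_le_cst; first exact: bm_norm.
  exact: stepB.
- move=> x.
  have -> : graphon_op (zero_ext f) F x = graphon_op fz (fun y => F (j2 y)) x.
    symmetry; apply: (avg_extend01 (h := fun y => zero_ext f (x, y) * F y) mp2).
    by apply: bmM => //; exact: bm_section.
  rewrite /F -op_sub//.
  apply: (le_trans (norm_op_le bfz _ C0 _)) => //.
    by move=> y _; exact: norm_zero_ext.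
  by rewrite ler_wpM2l.
- move=> phi L bphi L0 phiL.
  have -> : n%:R^-1 * \sum_i phi (w i) = avg (fun x => phi (step_fun w x)).
    rewrite -avg_step; apply: eq_avg => x xI; have [i xi] := cell_of xI.
    by rewrite !(stepE _ xI xi).
  have bphis : bm (fun x => phi (step_fun w x)) by exact: bphi.
  have bphiF : bm (fun x => phi (F x)) by exact: bphi.
  rewrite -(avg_extend01 mp2 bphiF) -avgB//; last exact: (bm2 bphiF).
  apply: (le_trans (norm_avg _)); first by apply: bmB => //; exact: (bm2 bphiF).
  apply: (@le_trans _ _ (avg (fun x => L * `|dF x|))).
    apply: avg_le; [apply: bm_norm; apply: bmB => //; exact: (bm2 bphiF)|exact/bmZ/bm_norm|].
    move=> x xI; apply: phiL; last exact: stepB.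
    apply: (le_trans (norm_op_le bfz bs C0 _)).
      by move=> y _; exact: norm_zero_ext.
    rewrite ler_wpM2l//; apply: avg_le_cst; first exact: bm_norm.
    exact: stepB.
  by rewrite avgZ; [rewrite ler_wpM2l|exact: bm_norm].
- move=> w1 x; rewrite /F.
  transitivity (graphon_op fz (fun=> 1) x).
    apply: eq_avg => y yI; have [i yi] := cell_of yI.
    by rewrite (stepE _ yI yi) w1.
  apply: (avg_extend01 (h := fun y => zero_ext f (x, y) * 1) mp2).
  by apply: bmM; [exact: bm_section|exact: bm_cst].
Qed.

End cut_model.

(** * Approximate eigenfunctions *)

(** Normalize a vector [v] violating the gap to mean square 1. Then [v] and [w = Q v] are
    close in mean square, and [w] is bounded entrywise because the entries of [Q] are [O(1 / n)]. *)
Lemma almost_fixed_vector {R : realType} (n : nat) (Q : 'M[R]_n) (C tau : R) :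
  coupling C Q -> 0 <= C -> 0 < tau -> ~ spectral_gap (tau ^+ 2) Q ->
  exists w : 'I_n -> R, [/\ forall i, `|w i| <= C, \sum_i w i = 0,
    n%:R^-1 * \sum_i `|\sum_j Q i j * w j - w i| <= 2 * tau &
    `|n%:R^-1 * \sum_i w i ^+ 2 - 1| <= 2 * tau ^+ 2].
Proof.
move=> QK C0 tau0 /existsNP[u] /not_implyP[u0 /negP]; rewrite -ltNge => hu.
have n0 := coupling_n0 QK; have nR0 : 0 < n%:R :> R by rewrite ltr0n.
have Qsym := coupling_sym QK; have Qrow := coupling_row QK; have Qge0 := coupling_ge0 QK.
have Qcol i : \sum_j Q j i = 1 by rewrite -(Qrow i); apply: eq_bigr => j _; exact: Qsym.
have N0 : 0 < \sum_i u i ^+ 2.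
  rewrite lt0r sumr_ge0 ?andbT => [|i _]; last exact: sqr_ge0.
  apply/eqP => N0; move: hu; rewrite N0 mulr0.
  have uz i : u i = 0.
    apply/eqP; rewrite -sqrf_eq0; apply/eqP; move: i (erefl true) => i _.
    by have /psumr_eq0P := N0; apply => // k _; exact: sqr_ge0.
  rewrite big1 ?ltxx// => i _; rewrite big1// => j _.
  by rewrite uz mul0r mulr0.
pose c := Num.sqrt (n%:R / \sum_i u i ^+ 2).
have c2 : c ^+ 2 = n%:R / \sum_i u i ^+ 2 by rewrite sqr_sqrtr// divr_ge0// ltW.
have c20 : 0 < c ^+ 2 by rewrite c2 divr_gt0.
pose v i := c * u i.
have v0 : \sum_i v i = 0 by rewrite -mulr_sumr u0 mulr0.
have v2 : \sum_i v i ^+ 2 = n%:R.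
  under eq_bigr do rewrite exprMn.
  by rewrite -mulr_sumr c2 divfK// gt_eqF.
pose w i := \sum_j Q i j * v j.
have hS : (1 - tau ^+ 2) * n%:R < \sum_i v i * w i.
  have -> : \sum_i v i * w i = c ^+ 2 * \sum_i \sum_j Q i j * (u i * u j).
    rewrite mulr_sumr; apply: eq_bigr => i _; rewrite !mulr_sumr.
    by apply: eq_bigr => j _; rewrite /v; ring.
  have -> : (1 - tau ^+ 2) * n%:R = c ^+ 2 * ((1 - tau ^+ 2) * \sum_i u i ^+ 2).
    by rewrite mulrCA c2 divfK// gt_eqF.
  by rewrite ltr_pM2l.
have w2 : \sum_i w i ^+ 2 <= n%:R by rewrite -v2; exact: Q_contract.
have wv : \sum_i (w i - v i) ^+ 2 = \sum_i w i ^+ 2 - 2 * \sum_i v i * w i + n%:R.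
  rewrite -v2 mulr_sumr -sumrB -big_split/=; apply: eq_bigr => i _; ring.
exists w; split.
- move=> i; rewrite /w (le_trans (ler_norm_sum _ _ _))//.
  apply: (@le_trans _ _ (\sum_j C / n%:R * `|v j|)).
    apply: ler_sum => j _; rewrite normrM ger0_norm// ler_wpM2r//.
    exact: (coupling_le QK).
  rewrite -mulr_sumr mulrAC ler_pdivrMr// ler_wpM2l// -[leRHS]mul1r.
  by apply: sum_abs_le_sqr => //; rewrite expr1n mul1r v2.
- rewrite /w exchange_big/= -[RHS]v0; apply: eq_bigr => j _.
  by rewrite -mulr_suml Qcol mul1r.
- have h : \sum_i (\sum_j Q i j * w j - w i) ^+ 2 <= (2 * tau) ^+ 2 * n%:R.
    have -> : \sum_i (\sum_j Q i j * w j - w i) ^+ 2 = \sum_i (\sum_j Q i j * (w j - v j)) ^+ 2.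
      apply: eq_bigr => i _; congr (_ ^+ 2); rewrite -sumrB.
      by apply: eq_bigr => j _; rewrite mulrBr.
    apply: (@le_trans _ _ (\sum_i (w i - v i) ^+ 2)); first exact: Q_contract.
    rewrite wv exprMn.
    have : 0 <= tau ^+ 2 * n%:R by rewrite mulr_ge0// sqr_ge0.
    by move: hS w2; rewrite mulrBl mul1r; lra.
  have t20 : 0 < 2 * tau by rewrite mulr_gt0.
  by rewrite [X in X <= _]mulrC ler_pdivrMr// sum_abs_le_sqr.
- have E : n%:R^-1 * \sum_i w i ^+ 2 - 1 = (\sum_i w i ^+ 2 - n%:R) / n%:R.
    by field; rewrite gt_eqF.
  rewrite E normrM [X in _ * X]gtr0_norm ?invr_gt0// ler_pdivrMr//.
  have : 0 <= \sum_i (w i - v i) ^+ 2 by apply: sumr_ge0 => i _; exact: sqr_ge0.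
  rewrite wv ler0_norm ?subr_le0// opprB.
  by move: hS w2; rewrite mulrBl mul1r; lra.
Qed.

(** Ultrafilters replace the extraction of subsequences. *)
Lemma ultra_bounded_cvg {R : realType} (U : set_system nat) (u : nat -> R) (B : R) :
  UltraFilter U -> (forall k, `|u k| <= B) ->
  exists l, forall e, 0 < e -> U [set k | `|u k - l| <= e].
Proof.
move=> UU uB; have UP := ultra_proper.
have : ((u k @[k --> U]) : set_system R) `[- B, B]%classic.
  by rewrite /fmap /=; apply: filterE => k /=; rewrite in_itv/= -ler_norml.
move/segment_compact => -[l [_ cl]]; exists l => e e0.
have [//|hC] := in_ultra_setVsetC [set k | `|u k - l| <= e] UU.
have [] := cl (u @` ~` [set k | `|u k - l| <= e]) (ball l e).
- rewrite /fmap/=; apply: filterS hC => k hk; by exists k.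
- exact: nbhsx_ballx.
- move=> x [[k /= hk <-]]; rewrite /ball/= distrC => /ltW hk'.
  by exfalso; apply: hk.
Qed.

Section limit.
Context {R : realType} (C : R) (f : R * R -> R) (fG : is_graphon C f).
Context (Q : forall n, 'M[R]_n).
Hypothesis Qcoup : \forall n \near \oo, coupling C (Q n).
Notation mu := (@lebesgue_measure R).
Notation I01 := (`[0%R, 1%R]%classic : set R).
Hypothesis Qf : delta_cut (step_graphon (n%:R *: Q n)) f @[n --> \oo] --> 0%E.
Implicit Types (x y : R) (g h : R -> R).

Let C0 : 0 <= C := graphon_bound_ge0 fG.
Notation T := (graphon_op (zero_ext f)).
Let bz : bm (zero_ext f) := bm_zero_ext fG.

Lemma cut_near (e : R) : 0 < e -> \forall n \near \oo, coupling C (Q n) /\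
  exists iota1 iota2, [/\ measure_preserving01 iota1, measure_preserving01 iota2 &
   forall S T, measurable S -> measurable T -> S `<=` I01 -> T `<=` I01 ->
   `|\int[(mu \x mu)%E]_(z in S `*` T)
     (relabel (step_graphon (n%:R *: Q n)) iota1 z - relabel f iota2 z)| <= e].
Proof.
move=> e0; near=> n; split; first by near: n.
have : (delta_cut (step_graphon (n%:R *: Q n)) f < e%:E)%E.
  near: n; have : nbhs (0%E : \bar R) [set y | (y < e%:E)%E].
    by apply: open_nbhs_nbhs; split; [exact: open_ereal_lt_ereal|rewrite /= lte_fin].
  by move/Qf.
move=> /ereal_inf_lt[_ [i1 [i2 [m1 m2 ->]]] h].
exists i1, i2; split => // S S' mS mS' SI SI'.
rewrite -lee_fin; apply: le_trans (ltW h); apply: ereal_sup_ubound.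
by exists S, S'.
Unshelve. all: by end_near. Qed.

Let scaled n i j : coupling C (Q n) -> 0 <= (n%:R *: Q n) i j <= C.
Proof.
move=> QK; rewrite mxE mulr_ge0 ?(coupling_ge0 QK)//=.
have n0 := coupling_n0 QK; rewrite mulrC -ler_pdivlMr ?ltr0n//.
exact: (coupling_le QK).
Qed.

(** The constant vector is exactly fixed by the couplings, and the degree function is
    its image in the limit. *)
Lemma degree_one : avg (fun x => `|T (cst 1) x - 1|) = 0.
Proof.
have bT : bm (T (cst 1)) by apply: bm_op => //; exact: bm_cst.
apply/eqP; rewrite eq_le avg_ge0 ?andbT//; apply/ler_addgt0Pl => e e0; rewrite addr0.
have e4 : 0 < e / 4 by rewrite divr_gt0.
have [n [QK [i1 [i2 [m1 m2 cut]]]]] := filter_ex (cut_near e4).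
have n0 := coupling_n0 QK; have nN : n%:R != 0 :> R by rewrite pnatr_eq0 -lt0n.
have w1 (i : 'I_n) : `|1 : R| <= 1 by rewrite normr1.
have [F [bF _ _ hF FE]] :=
  approx_fixed n0 fG m1 m2 cut ler01 w1.
have E x : F x = T (cst 1) x by exact: FE.
have := hF (fun u => `|u - 1|) 1 _ ler01 _.
rewrite (_ : avg (fun x => `|F x - 1|) = avg (fun x => `|T (cst 1) x - 1|)); last first.
  by apply: eq_avg => x _; rewrite E.
have z1 : \sum_(i < n) `|1 - 1| = 0 :> R by rewrite big1// => i _; rewrite subrr normr0.
have z2 : \sum_i `|n%:R^-1 * \sum_j (n%:R *: Q n) i j * 1 - 1| = 0 :> R.
  rewrite big1// => i _; under eq_bigr do rewrite mxE mulr1.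
  by rewrite -mulr_sumr (coupling_row QK) mulr1 mulVf// subrr normr0.
rewrite z1 z2 mulr0 subr0 addr0 mul1r !mulr1 => h.
have {h} h : `|avg (fun x => `|T (cst 1) x - 1|)| <= 4 * (e / 4).
  apply: h.
    by move=> h bh; apply: bm_norm; apply: bmB => //; exact: bm_cst.
  move=> u v _ _; rewrite mul1r (le_trans (ler_dist_dist _ _))//.
  by rewrite opprB addrA subrK.
apply: (le_trans (ler_norm _)); apply: (le_trans h).
by rewrite mulrC divfK.
Qed.

Definition approx_eigenfunction (eta : R) (F : R -> R) := [/\ bm F, forall x, `|F x| <= C * C,
  forall x, `|T F x - F x| <= eta, `|avg F| <= eta & `|avg (fun x => F x ^+ 2) - 1| <= eta].

Lemma approx_eigenfunction_exists :
  (forall d, 0 < d -> ~ \forall n \near \oo, spectral_gap d (Q n)) ->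
  forall eta, 0 < eta -> exists F, approx_eigenfunction eta F.
Proof.
move=> nogap eta eta0.
pose M := (C + 1 + (C * C + C)) * (4 * C + 2) + 2.
have CC : 0 <= C * C by rewrite mulr_ge0.
have M2 : 2 <= M by rewrite lerDr mulr_ge0// !addr_ge0// mulr_ge0.
have M0 : 0 < M by exact: lt_le_trans M2.
pose e := Num.min 1 (eta / M).
have e0 : 0 < e by rewrite lt_min ltr01 divr_gt0.
have e1 : e <= 1 by rewrite ge_min lexx.
have eM : e * M <= eta by rewrite -ler_pdivlMr// ge_min lexx orbT.
have [n [[QK [i1 [i2 [m1 m2 cut]]]] ng]] : exists n, (coupling C (Q n) /\
    exists iota1 iota2, [/\ measure_preserving01 iota1, measure_preserving01 iota2 &
      forall S T, measurable S -> measurable T -> S `<=` I01 -> T `<=` I01 ->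
      `|\int[(mu \x mu)%E]_(z in S `*` T)
        (relabel (step_graphon (n%:R *: Q n)) iota1 z - relabel f iota2 z)| <= e]) /\
    ~ spectral_gap (e ^+ 2) (Q n).
  apply/not_existsP => h; apply: (nogap (e ^+ 2)); first by rewrite exprn_gt0.
  near=> n; apply: contrapT => ng; apply: (h n); split => //.
  by near: n; exact: cut_near.
have [w [wC w0 wQ w2]] := almost_fixed_vector QK C0 e0 ng.
have n0 := coupling_n0 QK; have nN : n%:R != 0 :> R by rewrite pnatr_eq0 -lt0n.
have [F [bF FB TF hF _]] := approx_fixed n0 fG m1 m2 cut C0 wC.
move: TF hF; set kappa := _ + _ => TF hF.
have kE : kappa <= (4 * C + 2) * e.
  rewrite /kappa [X in _ <= X]mulrDl; apply: lerD => //; apply: le_trans wQ.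
  rewrite ler_wpM2l ?invr_ge0// ; apply: ler_sum => i _.
  rewrite le_eqVlt; apply/orP; left; apply/eqP; congr (`|_ - _|).
  rewrite mulr_sumr; apply: eq_bigr => j _.
  by rewrite mxE !mulrA mulVf// mul1r.
have k0 : 0 <= kappa.
  by rewrite addr_ge0 ?mulr_ge0 ?invr_ge0 ?sumr_ge0// ltW.
have hk L : 0 <= L -> L <= C + 1 + (C * C + C) -> L * kappa + 2 * e <= eta.
  move=> L0 LC; apply: le_trans eM.
  have -> : e * M = (C + 1 + (C * C + C)) * ((4 * C + 2) * e) + 2 * e by rewrite /M; ring.
  by rewrite lerD2r ler_pM.
have hk' L : 0 <= L -> L <= C + 1 + (C * C + C) -> L * kappa <= eta.
  by move=> L0 LC; apply: le_trans (hk L L0 LC); rewrite lerDl mulr_ge0// ltW.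
exists F; split => //.
- move=> x; apply: (le_trans (TF x)); apply: hk' => //.
  by rewrite -addrA lerDl addr_ge0// addr_ge0.
- have := hF id 1 (fun h bh => bh) ler01; rewrite w0 mulr0 subr0 => h.
  apply: (le_trans (h _)); first by move=> u v _ _; rewrite mul1r.
  by apply: hk' => //; rewrite addrAC lerDr addr_ge0// addr_ge0.
- have h := hF (fun u => u ^+ 2) (C * C + C).
  have {}h : `|avg (fun x => F x ^+ 2) - n%:R^-1 * \sum_i w i ^+ 2| <= (C * C + C) * kappa.
    apply: h; first by move=> g bg; under eq_fun do rewrite expr2; exact: bmM.
      by rewrite addr_ge0.
    move=> u v uB vB; rewrite subr_sqr mulrC normrM ler_wpM2r//.
    by rewrite (le_trans (ler_normD _ _))// lerD.
  have hh : (C * C + C) * kappa + 2 * e <= eta.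
    by apply: hk; [rewrite addr_ge0|rewrite lerDr addr_ge0].
  apply: le_trans hh.
  have -> : avg (fun x => F x ^+ 2) - 1 = (avg (fun x => F x ^+ 2) - n%:R^-1 * \sum_i w i ^+ 2)
     + (n%:R^-1 * \sum_i w i ^+ 2 - 1) by ring.
  rewrite (le_trans (ler_normD _ _))// lerD//; apply: (le_trans w2).
  by rewrite ler_pM2l// expr2 ler_piMl// ltW.
Unshelve. all: by end_near. Qed.

End limit.

(** * Compactness of the graphon operator *)

Section eigenfunction.
Context {R : realType} (C : R) (f : R * R -> R) (fG : is_graphon C f).
Context (Q : forall n, 'M[R]_n).
Hypothesis Qcoup : \forall n \near \oo, coupling C (Q n).
Notation mu := (@lebesgue_measure R).
Notation I01 := (`[0%R, 1%R]%classic : set R).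
Hypothesis Qf : delta_cut (step_graphon (n%:R *: Q n)) f @[n --> \oo] --> 0%E.
Implicit Types (x y : R) (g h : R -> R).

Let C0 : 0 <= C := graphon_bound_ge0 fG.
Notation T := (graphon_op (zero_ext f)).
Let bz : bm (zero_ext f) := bm_zero_ext fG.

(** The functionals [l] are the averages over the cells of one matrix close to [f]. *)
Lemma finite_rank_test (e : R) : 0 < e ->
  exists (n : nat) (l : 'I_n -> (R -> R) -> R),
  [/\ forall j g h, bm g -> bm h -> l j (fun x => g x - h x) = l j g - l j h,
      forall j g B, bm g -> (forall x, `|g x| <= B) -> `|l j g| <= B &
      forall g B, bm g -> (forall x, I01 x -> `|g x| <= B) ->
        avg (fun x => `|T g x|) <= 4 * B * e + C * \sum_j `|l j g|].
Proof.
move=> e0; have [n [QK [i1 [i2 [m1 m2 cut]]]]] := filter_ex (cut_near Qcoup Qf e0).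
have n0 := coupling_n0 QK.
have A01 i j : 0 <= (n%:R *: Q n) i j <= C.
  rewrite mxE mulr_ge0 ?(coupling_ge0 QK)//= mulrC -ler_pdivlMr ?ltr0n//.
  exact: (coupling_le QK).
pose a (j : 'I_n) x : R := \1_(cell_set j) (extend01 i1 x).
have ba j : bm (a j).
  apply: (bm_comp (phi := extend01 i1) (measurable_extend01 m1) (h := \1_(cell_set j))).
  by apply: bm_indic; exact: measurable_cell_set.
have b2 g : bm g -> bm (fun x => g (extend01 i2 x)).
  by move=> bg; exact: (bm_comp (phi := extend01 i2) (measurable_extend01 m2) bg).
exists n, (fun j g => avg (fun x => a j x * g (extend01 i2 x))); split.
- move=> j g h bg bh; rewrite -avgB; [|by apply: bmM => //; exact: b2..].
  by apply: eq_avg => x _; rewrite mulrBr.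
- move=> j g B bg gB; apply: norm_avg_le; first by apply: bmM => //; exact: b2.
  move=> x _; rewrite normrM -[leRHS]mul1r ler_pM//.
  by rewrite /a indicE; case: (_ \in _); rewrite ?normr1 ?normr0.
- move=> g B bg gB; exact: (op_finite_rank n0 fG A01 m1 m2 cut bg gB).
Qed.

Hypothesis approx : forall eta, 0 < eta -> exists F, approx_eigenfunction C f eta F.

(** Along an ultrafilter the finitely many averages of [finite_rank_test] converge, so
    the images, hence the almost fixed functions themselves, are uniformly Cauchy. *)
Lemma eigenfunction_exists : exists v : R -> R, [/\ bm v,
  forall x, I01 x -> T v x = v x, avg v = 0 & avg (fun x => v x ^+ 2) = 1].
Proof.
pose eta k : R := (k.+1%:R)^-1.
have eta0 k : 0 < eta k by rewrite invr_gt0 ltr0n.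
have [F FP] : {F : nat -> R -> R & forall k, approx_eigenfunction C f (eta k) (F k)}.
  by apply: (@choice _ _ (fun k F => approx_eigenfunction C f (eta k) F)) => k; exact: approx.
pose B := C * C; have B0 : 0 <= B by rewrite mulr_ge0.
have bF k : bm (F k) by have [] := FP k.
have FB k x : `|F k x| <= B by have [_ + _ _ _] := FP k.
have TF k x : `|T (F k) x - F k x| <= eta k by have [_ _ + _ _] := FP k.
have [U [UU FU]] := ultraFilterLemma (@eventually_filter).
have UP := ultra_proper.
have etaU e : 0 < e -> U [set k | eta k <= e].
  move=> e0; apply: FU; have [k0 _ h] := near_infty_natSinv_lt (PosNum e0).
  by exists k0 => // k /h /ltW.
(* When the averages of two almost fixed functions are close, so are their images,
   first in mean and then, by applying the operator once more, uniformly. *)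
have cauchy e : 0 < e -> exists2 A, U A & forall k l x, A k -> A l -> I01 x ->
    `|F k x - F l x| <= e.
  move=> e0; pose M := C * (8 * B + C + 2) + 2.
  have M2 : 2 <= M by rewrite lerDr mulr_ge0// !addr_ge0// mulr_ge0.
  have M0 : 0 < M by exact: lt_le_trans M2.
  pose s := e / M; have s0 : 0 < s by rewrite divr_gt0.
  have [n [l [lB lb lT]]] := finite_rank_test s0.
  pose s' := s / (2 * n.+1%:R).
  have n10 : 0 < n.+1%:R :> R by rewrite ltr0n.
  have s'0 : 0 < s' by rewrite divr_gt0// mulr_gt0.
  have hl (j : 'I_n) : exists L, forall e, 0 < e -> U [set k | `|l j (F k) - L| <= e].
    by apply: (ultra_bounded_cvg (B := B) (u := fun k => l j (F k))) => k; exact: lb.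
  have [L LP] := choice hl.
  exists [set k | (forall j, `|l j (F k) - L j| <= s') /\ eta k <= s].
    by apply: filterI; [apply: filter_forall => j; exact: LP|exact: etaU].
  move=> k m x [hk ek] [hm em] xI.
  pose g y := F k y - F m y.
  have bg : bm g by exact: bmB.
  have gB y : I01 y -> `|g y| <= 2 * B.
    by move=> _; rewrite (le_trans (ler_normB _ _))// mulrDl mul1r lerD.
  have near_T y : `|T g y - g y| <= 2 * s.
    rewrite /g (op_sub _ bz (bF k) (bF m)).
    have -> : T (F k) y - T (F m) y - (F k y - F m y) =
      (T (F k) y - F k y) - (T (F m) y - F m y) by ring.
    rewrite (le_trans (ler_normB _ _))// mulrDl mul1r lerD//.
      exact: le_trans (TF _ _) ek.
    exact: le_trans (TF _ _) em.
  have hT : avg (fun y => `|T g y|) <= (8 * B + C) * s.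
    apply: (le_trans (lT g _ bg gB)).
    have -> : (8 * B + C) * s = 4 * (2 * B) * s + C * s by ring.
    rewrite lerD2l ler_wpM2l//.
    apply: (@le_trans _ _ (\sum_(j < n) 2 * s')).
      apply: ler_sum => j _; rewrite /g lB//.
      have -> : l j (F k) - l j (F m) = (l j (F k) - L j) - (l j (F m) - L j) by ring.
      by rewrite (le_trans (ler_normB _ _))// mulrDl mul1r lerD.
    rewrite sumr_const card_ord -[X in X <= _]mulr_natr.
    have -> : 2 * s' * n%:R = s * (n%:R / n.+1%:R) by rewrite /s'; field; rewrite gt_eqF.
    by rewrite ler_piMr ?(ltW s0)// ler_pdivrMr// mul1r ler_nat.
  have bT : bm (T g) by exact: bm_op.
  have hg : avg (fun y => `|g y|) <= (8 * B + C + 2) * s.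
    apply: (@le_trans _ _ (avg (fun y => `|T g y| + 2 * s))).
      apply: avg_le; [exact: bm_norm|by apply: bmD; [exact: bm_norm|exact: bm_cst]|].
      move=> y _; rewrite -lerBlDl; apply: le_trans (near_T y).
      by rewrite (le_trans (lerB_dist _ _))// distrC.
    rewrite avgD; [|exact: bm_norm|exact: bm_cst].
    by rewrite avg_cst [X in _ <= X]mulrDl lerD2r.
  rewrite -/(g x).
  have h1 : `|T g x| <= C * ((8 * B + C + 2) * s).
    apply: (le_trans (norm_op_le bz bg C0 _)) => [y _|]; first exact: norm_zero_ext.
    by rewrite ler_wpM2l.
  have -> : e = C * ((8 * B + C + 2) * s) + 2 * s.
    have <- : M * s = e by rewrite /s mulrC divfK// gt_eqF.
    by rewrite /M; ring.
  have -> : g x = T g x - (T g x - g x) by ring.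
  by rewrite (le_trans (ler_normB _ _))// lerD.
have hv x : exists v, forall e, 0 < e -> U [set k | `|F k x - v| <= e].
  exact: (ultra_bounded_cvg (B := B) (u := fun k => F k x)).
have [v0 v0P] := choice hv.
pose v x := v0 x * \1_I01 x.
have unif e : 0 < e -> U [set k | forall x, I01 x -> `|F k x - v x| <= e].
  move=> e0; have e2 : 0 < e / 2 by rewrite divr_gt0.
  have [A UA AP] := cauchy _ e2.
  apply: (filterS _ UA) => k Ak x xI; rewrite /v indicE mem_set// mulr1.
  have [l [Al hl]] := filter_ex (filterI UA (v0P x _ e2)).
  have -> : F k x - v0 x = (F k x - F l x) + (F l x - v0 x) by ring.
  by rewrite (le_trans (ler_normD _ _))// [e]splitr lerD// AP.
have [G GP] : {G : nat -> nat & forall m, eta (G m) <= eta m /\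
    forall x, I01 x -> `|F (G m) x - v x| <= eta m}.
  apply: (@choice _ _ (fun m k => eta k <= eta m /\
    forall x, I01 x -> `|F k x - v x| <= eta m)) => m.
  by have [k hk] := filter_ex (filterI (etaU _ (eta0 m)) (unif _ (eta0 m))); exists k.
have vB x : `|v x| <= B.
  rewrite /v indicE; have [xI|_] := boolP (x \in I01); last by rewrite mulr0 normr0.
  rewrite mulr1; apply/ler_addgt0Pl => e e0.
  have [k hk] := filter_ex (v0P x _ e0).
  have -> : v0 x = F k x - (F k x - v0 x) by ring.
  by rewrite (le_trans (ler_normB _ _))// addrC lerD.
have mI : measurable I01 by exact: measurable_itv.
have bv : bm v.
  split; last by exists B.
  apply: (@measurable_fun_cvg _ _ _ _ (fun m x => F (G m) x * \1_I01 x)) => [m|x _].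
    by apply: measurable_funM; [case: (bF (G m))|exact: measurable_indic].
  rewrite /v; have [xI|xI] := boolP (x \in I01); last first.
    by rewrite indicE (negbTE xI) mulr0; under eq_cvg do rewrite mulr0; exact: cvg_cst.
  rewrite indicE xI mulr1; under eq_cvg do rewrite mulr1.
  apply/cvgrPdist_le => e e0; near=> m.
  have [_ h] := GP m; have := h x (set_mem xI); rewrite /v indicE xI mulr1 distrC.
  move/le_trans; apply; apply/ltW.
  by near: m; exact: (near_infty_natSinv_lt (PosNum e0)).
pose g m x := v x - F (G m) x.
have bg m : bm (g m) by exact: bmB.
have gB m x : I01 x -> `|g m x| <= eta m.
  by move=> xI; rewrite distrC; have [_ h] := GP m; exact: h.
have eta_lim (K a : R) : 0 <= K -> (forall m, `|a| <= K * eta m) -> a = 0.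
  move=> K0 h; apply/eqP; rewrite -normr_eq0 eq_le normr_ge0 andbT.
  apply/ler_addgt0Pl => e e0; rewrite addr0.
  have K1 : 0 < e / (K + 1) by rewrite divr_gt0// ltr_wpDl.
  have [m hm] := filter_ex (etaU _ K1).
  apply: (le_trans (h m)); apply: (le_trans (ler_wpM2l K0 hm)).
  rewrite mulrA ler_pdivrMr ?ltr_wpDl// mulrC ler_wpM2l// ?(ltW e0)//.
  by rewrite lerDl.
exists v; split => //.
- move=> x xI; apply/eqP; rewrite -subr_eq0; apply/eqP.
  apply: (eta_lim (C + 2)); first by rewrite addr_ge0.
  move=> m.
  have -> : T v x - v x = T (g m) x + (T (F (G m)) x - F (G m) x) - g m x.
    by rewrite /g (op_sub _ bz bv (bF _)); ring.
  have -> : (C + 2) * eta m = C * eta m + eta m + eta m by ring.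
  rewrite (le_trans (ler_normB _ _))// lerD ?gB// (le_trans (ler_normD _ _))// lerD//.
    apply: (le_trans (norm_op_le bz (bg m) C0 _)) => [y _|]; first exact: norm_zero_ext.
    rewrite ler_wpM2l//; apply: avg_le_cst; first exact: bm_norm.
    exact: gB.
  by apply: (le_trans (TF _ _)); have [] := GP m.
- apply: (eta_lim 2) => // m.
  have -> : avg v = avg (g m) + avg (F (G m)) by rewrite -avgD//; apply: eq_avg => x _; rewrite /g; ring.
  rewrite mulrDl mul1r (le_trans (ler_normD _ _))// lerD//.
    by apply: norm_avg_le => // x; exact: gB.
  by have [_ _ _ h _] := FP (G m); apply: (le_trans h); have [] := GP m.
- apply/eqP; rewrite -subr_eq0; apply/eqP.
  apply: (eta_lim (2 * B + 1)); first by rewrite addr_ge0// mulr_ge0.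
  move=> m.
  have bv2 : bm (fun x => v x ^+ 2) by under eq_fun do rewrite expr2; exact: bmM.
  have bF2 : bm (fun x => F (G m) x ^+ 2) by under eq_fun do rewrite expr2; exact: bmM.
  have -> : avg (fun x => v x ^+ 2) - 1 = avg (fun x => v x ^+ 2 - F (G m) x ^+ 2) +
      (avg (fun x => F (G m) x ^+ 2) - 1) by rewrite avgB//; ring.
  rewrite mulrDl mul1r (le_trans (ler_normD _ _))// lerD//.
    apply: norm_avg_le; first exact: bmB.
    move=> x xI; rewrite subr_sqr mulrC normrM ler_pM// ?gB//.
    by rewrite (le_trans (ler_normD _ _))// mulrDl mul1r lerD.
  by have [_ _ _ _ h] := FP (G m); apply: (le_trans h); have [] := GP m.
Unshelve. all: by end_near. Qed.

End eigenfunction.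

(** * The spectral gap of the couplings *)

Section almost_everywhere.
Context {R : realType}.
Notation mu := (@lebesgue_measure R).
Notation I01 := (`[0%R, 1%R]%classic : set R).
Implicit Types (g h : R -> R).

Let mI : measurable I01. Proof. exact: measurable_itv. Qed.

Lemma avg_ae g h : bm g -> bm h -> ae_eq mu I01 g h -> avg g = avg h.
Proof.
move=> [mg _] [mh _] gh; congr fine; apply: ae_eq_integral => //.
- exact/measurable_EFinP/measurable_funTS.
- exact/measurable_EFinP/measurable_funTS.
- by apply: filterS gh => x e /e ->.
Qed.

Lemma avg_norm_eq0 h : bm h -> avg (fun x => `|h x|) = 0 -> ae_eq mu I01 h (cst 0).
Proof.
move=> bh e0; have [mh _] := bh.
have mh' : measurable_fun I01 (EFin \o h) by exact/measurable_EFinP/measurable_funTS.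
have e : (\int[mu]_(x in I01) `|(EFin \o h) x| = 0)%E.
  transitivity ((avg (fun x => `|h x|))%:E); last by rewrite e0.
  rewrite /avg /Rintegral fineK//; apply: integrable_fin_num => //; exact: (bm_integrable (bm_norm bh)).
have := (ae_eq_integral_abs mu mI mh').1 e.
by apply: filterS => x h0 /h0 [].
Qed.

Lemma sqr_integrable_norm g : L2_01 g -> mu.-integrable I01 (EFin \o g).
Proof.
move=> [mg ig]; have i1 : mu.-integrable I01 (EFin \o (cst 1 : R -> R)).
  exact: (bm_integrable (bm_cst 1)).
have mg' : measurable_fun (T := measurableTypeR R) I01 (EFin \o g) by exact/measurable_EFinP.
have mI' : measurable (I01 : set (measurableTypeR R)) := mI.
apply: (le_integrable mI' mg' _ (integrableD mI' i1 ig)).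
move=> x _; rewrite /= lee_fin.
rewrite [X in _ <= X]ger0_norm ?addr_ge0 ?sqr_ge0//.
rewrite -(real_normK (num_real (g x))).
by have := sqr_ge0 (`|g x| - 2^-1); rewrite sqrrB; lra.
Qed.

End almost_everywhere.

Section contraction.
Context {R : realType} (C : R) (f : R * R -> R) (fG : is_graphon C f).
Notation mu := (@lebesgue_measure R).
Notation I01 := (`[0%R, 1%R]%classic : set R).
Notation T := (graphon_op (zero_ext f)).
Implicit Types (x y l : R) (g h : R -> R).
Hypothesis deg1 : avg (fun x => `|T (cst 1) x - 1|) = 0.

Let mI : measurable I01. Proof. exact: measurable_itv. Qed.
Let C0 : 0 <= C := graphon_bound_ge0 fG.
Let bz : bm (zero_ext f) := bm_zero_ext fG.

(** Symmetry and degree 1 make the operator doubly stochastic. *)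
Lemma op_contract h : bm h -> avg (fun x => `|T h x|) <= avg (fun x => `|h x|).
Proof.
move=> bh; have bn := bm_norm bh; have b1 : bm (cst 1 : R -> R) by exact: bm_cst.
have bT := bm_op bz bh; have bTn := bm_op bz bn; have bT1 := bm_op bz b1.
apply: (@le_trans _ _ (avg (fun x => 1 * T (fun y => `|h y|) x))).
  apply: avg_le; [exact: bm_norm|exact: bmM|move=> x _; rewrite mul1r].
  have bx := bm_section x bz; apply: (le_trans (norm_avg (bmM bx bh))).
  apply: avg_le; [exact/bm_norm/bmM|exact: bmM|move=> y _].
  by rewrite normrM ger0_norm//; case/andP: (zero_ext_itv fG (x, y)).
rewrite (op_swap bz b1 bn).
have -> : graphon_op (swap_kernel (zero_ext f)) (cst 1) = T (cst 1).
  apply/funext => x; apply: eq_avg => y _; congr (_ * _).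
  exact: (zero_ext_sym fG).
have [_ [B hB]] := bh; have B0 : 0 <= B by exact: le_trans (hB 0).
rewrite -subr_le0 -avgB//; last exact: bmM.
apply: (@le_trans _ _ (avg (fun x => B * `|T (cst 1) x - 1|))).
  have b' : bm (fun x => T (cst 1) x - 1) by apply: bmB => //; exact: bm_cst.
  apply: avg_le; [by apply: bmB => //; exact: bmM|exact/bmZ/bm_norm|move=> x _].
  have -> : `|h x| * T (cst 1) x - `|h x| = `|h x| * (T (cst 1) x - 1) by ring.
  by rewrite (le_trans (ler_norm _))// normrM normr_id ler_wpM2r.
rewrite avgZ; last by apply: bm_norm; apply: bmB => //; exact: bm_cst.
by rewrite deg1 mulr0.
Qed.

Lemma op_fext g x : I01 x -> graphon_op f g x = graphon_op (zero_ext f) g x.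
Proof. by move=> xI; rewrite op_zero_ext. Qed.

(** An eigenfunction is almost everywhere bounded, hence covered by the
    [L^1]-contraction. *)
Lemma eigenvalue_le1 l g : 1 < l -> eigenspace01 f l g -> ae_eq mu I01 g (cst 0).
Proof.
move=> l1 [L2g eig]; have l0 : 0 < l by exact: lt_trans l1.
have [mg _] := L2g; have ig := sqr_integrable_norm L2g.
(* The eigenvalue equation itself bounds g by this constant almost everywhere. *)
pose B := C * \int[mu]_(y in I01) `|g y| / l.
pose g0 x : R := if x \in I01 then g x else 0.
have mg0 : measurable_fun setT g0.
  apply: measurable_fun_if => //.
  - apply: (@measurable_fun_bool _ _ setT _ true) => //.
    rewrite setTI (_ : _ @^-1` _ = I01)//.
    by apply/seteqP; split => x /= => [/set_mem|/mem_set].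
  - rewrite setTI (_ : _ @^-1` _ = I01) //.
    by apply/seteqP; split => x /= => [/set_mem|/mem_set].
pose h x : R := if `|g0 x| <= B then g0 x else 0.
have bh : bm h.
  split.
    apply: measurable_fun_ifT => //; apply: measurable_fun_ler => //.
    exact: measurableT_comp.
  exists `|B| => x; rewrite /h; case: ifPn => [hx|_]; last by rewrite normr0.
  exact: le_trans (ler_norm _).
have gb x : I01 x -> graphon_op f g x = l * g x -> `|g x| <= B.
  move=> xI e.
  have ifg : mu.-integrable I01 (EFin \o (fun y => zero_ext f (x, y) * g y)).
    have icg : mu.-integrable I01 (EFin \o (fun y => C * g y)).
      rewrite (_ : EFin \o _ = (fun y => C%:E * (EFin \o g) y)%E); last exact/funext.
      exact: integrableZl.
    have mzg : measurable_fun (T := measurableTypeR R) I01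
        (EFin \o (fun y => zero_ext f (x, y) * g y)).
      apply/measurable_EFinP/measurable_funM => //.
      by apply: measurable_funTS; case: (bm_section x bz).
    have mI' : measurable (I01 : set (measurableTypeR R)) := mI.
    apply: (le_integrable mI' mzg _ icg).
    move=> y _; rewrite /= lee_fin !normrM ler_wpM2r// (ger0_norm C0).
    exact: norm_zero_ext.
  have iag : mu.-integrable I01 (EFin \o (fun y => `|g y|)) by exact: (integrable_norm ig).
  rewrite /B ler_pdivlMr// mulrC -(gtr0_norm l0) -normrM -e (op_fext _ xI).
  have mI' : measurable (I01 : set (measurableTypeR R)) := mI.
  apply: (le_trans (le_normr_Rintegral mI' ifg)).
  rewrite -RintegralZl//; apply: le_Rintegral => //.
  - exact: (integrable_norm ifg).
  - rewrite (_ : EFin \o _ = (fun y => C%:E * (`|g y|%R)%:E)%E); last exact/funext.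
    exact: integrableZl.
  - by move=> y _; rewrite normrM ler_wpM2r// norm_zero_ext.
have gh : ae_eq mu I01 g h.
  apply: filterS eig => x e xI; have := gb x xI (e xI).
  by rewrite /h /g0 mem_set// => ->.
have Th x : I01 x -> T h x = graphon_op f g x.
  move=> xI; rewrite (op_fext _ xI); congr fine; apply: ae_eq_integral => //.
  - by apply/measurable_EFinP/measurable_funTS; case: (bmM (bm_section x bz) bh).
  - apply/measurable_EFinP/measurable_funM => //.
    by apply: measurable_funTS; case: (bm_section x bz).
  - by apply: filterS gh => y e /e ->.
have Tlh : ae_eq mu I01 (T h) (fun x => l * h x).
  apply: filterS2 eig gh => x e1 e2 xI.
  by rewrite Th// e1// e2.
have bT := bm_op bz bh; have bn := bm_norm bh.
have hn0 : avg (fun x => `|h x|) = 0.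
  have E : avg (fun x => `|T h x|) = l * avg (fun x => `|h x|).
    rewrite -avgZ//; apply: avg_ae; [exact: bm_norm|exact: bmZ|].
    by apply: filterS Tlh => x e /e ->; rewrite normrM gtr0_norm.
  have a0 : 0 <= avg (fun x => `|h x|) by exact: avg_ge0.
  have := op_contract bh; rewrite E => a1; apply/eqP; rewrite eq_le a0 andbT.
  have l1' : 0 < l - 1 by rewrite subr_gt0.
  by rewrite -(pmulr_rle0 _ l1') mulrBl mul1r subr_le0.
have h0 := avg_norm_eq0 bh hn0.
by apply: filterS2 gh h0 => x e1 e2 xI; rewrite e1// e2.
Qed.

End contraction.

Section gap.
Context {R : realType} (C : R) (f : R * R -> R) (fG : is_graphon C f).
Context (Q : forall n, 'M[R]_n) (lam : nat -> R).
Hypothesis Qcoup : \forall n \near \oo, coupling C (Q n).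
Notation mu := (@lebesgue_measure R).
Notation I01 := (`[0%R, 1%R]%classic : set R).
Notation T := (graphon_op (zero_ext f)).
Hypothesis Qf : delta_cut (step_graphon (n%:R *: Q n)) f @[n --> \oo] --> 0%E.
Hypothesis lamP : eigenvalue_list f lam.
Hypothesis gap : sup [set lam i | i in [set i : nat | (1 <= i)%N]] < lam 0%N.

Let mI : measurable I01. Proof. exact: measurable_itv. Qed.
Let bz : bm (zero_ext f) := bm_zero_ext fG.

Lemma bm_eigenspace (l : R) (h : R -> R) : bm h -> ae_eq mu I01 (T h) (fun x => l * h x) ->
  eigenspace01 f l h.
Proof.
move=> bh e; split.
  split; first by apply: measurable_funTS; case: bh.
  have b2 : bm (fun x => h x ^+ 2) by under eq_fun do rewrite expr2; exact: bmM.
  exact: (bm_integrable b2).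
by apply: filterS e => x e xI; rewrite -op_zero_ext//; exact: e.
Qed.

(** If the top eigenvalue 1 had multiplicity at least two, the gap hypothesis
    would force an eigenvalue above 1, against the [L^1]-contraction. *)
Lemma no_second_fixed (v : R -> R) : bm v -> (forall x, I01 x -> T v x = v x) ->
  avg v = 0 -> avg (fun x => v x ^+ 2) = 1 -> False.
Proof.
move=> bv Tv v0 v2; have deg := degree_one fG Qcoup Qf.
have b1 : bm (cst 1 : R -> R) by exact: bm_cst.
have E1 : eigenspace01 f 1 (cst 1).
  apply: bm_eigenspace => //; have b' : bm (fun x => T (cst 1) x - 1).
    by apply: bmB => //; exact: bm_op.
  apply: filterS (avg_norm_eq0 b' deg) => x e /e /eqP.
  by rewrite subr_eq0 mulr1 => /eqP.
have Ev : eigenspace01 f 1 v.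
  by apply: bm_eigenspace => //; apply: aeW => x xI; rewrite mul1r; exact: Tv.
have [lamD lam0 /(_ 1 (oner_neq0 R)) [s [us sP [phi [phiE phiI phiS]]]]] := lamP.
have [c cP] := phiS _ E1; have [d dP] := phiS _ Ev.
have s2 : (1 < size s)%N.
  rewrite ltnNge; apply/negP; case: (size s) phi phiE phiI phiS c cP d dP => [|[|//]] phi phiE phiI phiS c cP d dP _.
    have : avg (cst 1 : R -> R) = avg (cst 0).
      apply: avg_ae => //; first exact: bm_cst.
      by apply: filterS cP => x e /e ->; rewrite big_ord0.
    by rewrite !avg_cst => /eqP; rewrite oner_eq0.
  have dc : ae_eq mu I01 (fun x => d ord0) (fun x => c ord0 * v x).
    apply: filterS2 cP dP => x e1 e2 xI.
    have := e1 xI; rewrite (e2 xI) !big_ord1 => e.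
    by rewrite mulrCA -e mulr1.
  have d0 : d ord0 = 0.
    have := avg_ae (bm_cst (d ord0)) (bmZ (c ord0) bv) dc.
    by rewrite avg_cst avgZ// v0 mulr0.
  have c0 : c ord0 = 0.
    have bv2 : bm (fun x => v x ^+ 2) by under eq_fun do rewrite expr2; exact: bmM.
    have : avg (fun x => c ord0 * v x ^+ 2) = avg (cst 0).
      apply: avg_ae; [exact: bmZ|exact: bm_cst|].
      apply: filterS dc => x e xI; rewrite expr2 mulrA -(e xI) d0.
      by rewrite mul0r.
    by rewrite avgZ// v2 mulr1 avg_cst.
  have : avg (cst 1 : R -> R) = avg (cst 0).
    apply: avg_ae => //; first exact: bm_cst.
    by apply: filterS cP => x e /e ->; rewrite big_ord1 c0 mul0r.
  by rewrite !avg_cst => /eqP; rewrite oner_eq0.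
(* Two indices carry the eigenvalue 1, so one of them is not the first. *)
have [i [si i1]] : exists i, i \in s /\ (1 <= i)%N.
  apply: contrapT => h.
  have : {subset s <= [:: 0%N]}.
    move=> i si; rewrite inE; case: i si => // i si.
    by exfalso; apply: h; exists i.+1.
  by move/(uniq_leq_size us); rewrite leqNgt s2.
have lam1 : lam i = 1 by apply/sP.
have l01 : 1 < lam 0%N.
  apply: le_lt_trans gap; rewrite -lam1; apply: ub_le_sup; last by exists i.
  exists `|lam 0%N| => _ [j _ <-]; exact: le_trans (ler_norm _) (lamD 0%N j isT).
have l0n : lam 0%N != 0 by rewrite gt_eqF// (lt_trans ltr01).
have [_ _ /(_ _ l0n) [s' [us' s'P [psi [psiE psiI _]]]]] := lamP.
have s'0 : (0 < size s')%N.
  by rewrite lt0n size_eq0; apply/eqP => e; have := (s'P 0%N).2 erefl; rewrite e.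
have z := eigenvalue_le1 fG deg l01 (psiE (Ordinal s'0)).
have := psiI (fun j => (j == Ordinal s'0)%:R) _ (Ordinal s'0).
rewrite eqxx => h; have /eqP : (1 : R) = 0; last by rewrite oner_eq0.
apply: h; apply: filterS z => x e xI.
rewrite (bigD1 (Ordinal s'0))// eqxx mul1r big1 ?addr0; last first.
  by move=> j /negbTE ->; rewrite mul0r.
by rewrite /= addr0; exact: e.
Qed.

Theorem spectral_gap_near : exists2 d, 0 < d &
  \forall n \near \oo, coupling C (Q n) /\ spectral_gap d (Q n).
Proof.
apply: contrapT => h.
have nogap d : 0 < d -> ~ \forall n \near \oo, spectral_gap d (Q n).
  by move=> d0 hn; apply: h; exists d => //; exact: filterS2 Qcoup hn.
have [v [bv Tv v0 v2]] := eigenfunction_exists fG Qcoup Qf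
  (approx_eigenfunction_exists fG Qcoup Qf nogap).
exact: no_second_fixed bv Tv v0 v2.
Qed.

End gap.

(** * Convergence in law under Gibbs measures *)

Section probability_of_events.
Context {R : realType} {n : nat} (th : R) (Q : 'M[R]_n).
Implicit Types (a b c : config n -> bool).

Definition pr b : R := gibbs th Q (fun x => (b x)%:R).

Lemma pr_ge0 b : 0 <= pr b.
Proof. by apply: gibbs_ge0 => x; rewrite ler0n. Qed.

Lemma pr_le1 b : pr b <= 1.
Proof. by apply: gibbs_le_cst => x; rewrite -[leRHS]/(true%:R) ler_nat leq_b1. Qed.

Lemma eq_pr a b : a =1 b -> pr a = pr b.
Proof. by move=> ab; apply: gibbs_ext => x; rewrite ab. Qed.

Lemma prC b : pr (fun x => ~~ b x) = 1 - pr b.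
Proof.
rewrite -(gibbs_cst th Q 1) -gibbsB; apply: gibbs_ext => x.
by case: (b x); rewrite ?subrr ?subr0.
Qed.

Lemma pr_cover a b c : (forall x, a x -> b x || c x) -> pr a <= pr b + pr c.
Proof.
move=> h; rewrite -gibbsD; apply: gibbs_le => x; have := h x.
case: (a x) => [/(_ isT)/orP[->|->]|_]; rewrite ?lerDl ?lerDr ?addr_ge0 ?ler0n//.
Qed.

Lemma pr_le a b : (forall x, a x -> b x) -> pr a <= pr b.
Proof.
move=> h; apply: gibbs_le => x; have := h x.
by case: (a x); case: (b x) => //= /(_ isT).
Qed.

End probability_of_events.

Section gibbs_measure.
Context {R : realType} {n : nat} (th : R) (Q : 'M[R]_n).

Lemma ising_gibbs (A : set (config n)) :
  ising th Q A = (gibbs th Q (fun x => (x \in A)%:R))%:E.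
Proof.
have p0 x : (0 <= (if x \in A then (ising_pmf th Q x)%:E else 0))%E.
  by case: ifP => // _; rewrite lee_fin ltW// ising_pmf_gt0.
rewrite /ising esum_mkcond esum_fset//; last exact: (@finite_finset (config n)).
rewrite (_ : [set: config n] = [set` index_enum (config n)]); last first.
  by apply/seteqP; split => x //= _; rewrite mem_index_enum.
rewrite -fsbig_seq ?index_enum_uniq//= /gibbs -sumEFin; apply: eq_bigr => x _.
by case: ifP => _; rewrite ?mulr1 ?mulr0.
Qed.

Lemma ising_pr (b : config n -> bool) (A : set (config n)) :
  (forall x, A x <-> b x) -> ising th Q A = (pr th Q b)%:E.
Proof.
move=> h; rewrite ising_gibbs; congr EFin; apply: gibbs_ext => x.
suff -> : (x \in A) = b x by [].
by apply/idP/idP => [/set_mem/h|/h/mem_set].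
Qed.

Lemma ising_set1 x : ising th Q [set x] = (ising_pmf th Q x)%:E.
Proof.
rewrite ising_gibbs; congr EFin; rewrite /gibbs (bigD1 x)//= big1 => [|y yx].
  by rewrite addr0 mem_set ?mulr1.
by rewrite memNset ?mulr0// => /= e; rewrite e eqxx in yx.
Qed.

Lemma integral_gibbs (phi : config n -> R) : \int[ising th Q]_x phi x = gibbs th Q phi.
Proof.
have iphi (psi : config n -> R) : (ising th Q).-integrable setT (EFin \o psi).
  apply: measurable_bounded_integrable => //.
    by rewrite (le_lt_trans (probability_le1 _ _))// ltry.
  exists (\sum_x `|psi x|); split; first exact: num_real.
  move=> M /ltW hM x _; apply: le_trans hM.
  by rewrite (bigD1 x)//= lerDl sumr_ge0.
have E x : phi x = \sum_y phi y * \1_[set y] x.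
  rewrite (bigD1 x)//= big1 => [|y yx]; rewrite indicE.
    by rewrite addr0 mem_set ?mulr1.
  by rewrite memNset ?mulr0// => /= e; rewrite e eqxx in yx.
rewrite /Rintegral; under eq_integral => x _ do rewrite E -sumEFin.
rewrite integral_sum//; last by move=> y; exact: (iphi (fun x => phi y * \1_[set y] x)).
rewrite /gibbs (_ : (\sum_y _)%E = (\sum_x ising_pmf th Q x * phi x)%:E)//.
rewrite -sumEFin; apply: eq_bigr => y _.
under eq_integral do rewrite EFinM.
rewrite integralZl//; last exact: (iphi (\1_[set y])).
have -> : (\int[ising th Q]_x (\1_[set y] x)%:E = (ising_pmf th Q y)%:E)%E.
  by rewrite integral_indic// setIT; exact: ising_set1.
by rewrite mulrC.
Qed.

End gibbs_measure.

Section convergence_in_law.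
Context {R : realType} (Q : forall n, 'M[R]_n) (th : nat -> R).
Implicit Types (S : forall n, config n -> R) (m s c : R).

(** Convergence of distribution functions to a normal one, the form that Stein's method
    delivers. *)
Definition law_cvg S m s := forall x,
  pr (th n) (Q n) (fun y => S n y <= x) @[n --> \oo] --> normal_cdf m s x.

Definition negligible_diff S S' c := forall e, 0 < e ->
  pr (th n) (Q n) (fun y => e < `|S' n y - S n y - c|) @[n --> \oo] --> (0 : R).

Lemma normal_cdf_near m s x e : 0 < s -> 0 < e -> exists2 d, 0 < d &
  forall y, `|x - y| <= d -> `|normal_cdf m s x - normal_cdf m s y| <= e.
Proof.
move=> s0 e0; have sn : s != 0 by rewrite gt_eqF.
have /cvgrPdist_le/(_ _ e0) := @normal_cdf_continuous R m s x sn.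
move=> [d /= d0 h]; exists (d / 2); first by rewrite divr_gt0.
by move=> y xy; apply: h; rewrite /ball/=; lra.
Qed.

Lemma normal_cdf_shift m s c x : 0 < s -> normal_cdf m s (x - c) = normal_cdf (m + c) s x.
Proof.
by move=> s0; rewrite !(normal_cdf_scale _ _ s0); congr normal_cdf; field; rewrite gt_eqF.
Qed.

Lemma slutsky S S' m s c : 0 < s -> law_cvg S m s -> negligible_diff S S' c ->
  law_cvg S' (m + c) s.
Proof.
move=> s0 hS hd x; rewrite -normal_cdf_shift//; apply/cvgrPdist_le => e e0.
have e3 : 0 < e / 3 by rewrite divr_gt0.
have [d d0 dP] := normal_cdf_near m (x - c) s0 e3.
have hu := dP (x - c + d); have hl := dP (x - c - d).
have {}hu : `|normal_cdf m s (x - c) - normal_cdf m s (x - c + d)| <= e / 3.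
  by apply: hu; rewrite opprD addrA subrr sub0r normrN gtr0_norm.
have {}hl : `|normal_cdf m s (x - c) - normal_cdf m s (x - c - d)| <= e / 3.
  by apply: hl; rewrite opprB addrCA subrr addr0 gtr0_norm.
have /cvgrPdist_le/(_ _ e3) c1 := hS (x - c + d).
have /cvgrPdist_le/(_ _ e3) c2 := hS (x - c - d).
have /cvgrPdist_le/(_ _ e3) c3 := hd d d0.
near=> n.
have h1 : `|normal_cdf m s (x - c + d) - pr (th n) (Q n) (fun y => S n y <= x - c + d)| <= e / 3.
  by near: n; exact: c1.
have h2 : `|normal_cdf m s (x - c - d) - pr (th n) (Q n) (fun y => S n y <= x - c - d)| <= e / 3.
  by near: n; exact: c2.
have h3 : `|0 - pr (th n) (Q n) (fun y => d < `|S' n y - S n y - c|)| <= e / 3.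
  by near: n; exact: c3.
have u1 : pr (th n) (Q n) (fun y => S' n y <= x) <=
    pr (th n) (Q n) (fun y => S n y <= x - c + d) +
    pr (th n) (Q n) (fun y => d < `|S' n y - S n y - c|).
  apply: pr_cover => y hy; have [_|h] := leP (S n y) (x - c + d) => //=.
  by rewrite lter_normr; apply/orP; right; lra.
have u2 : pr (th n) (Q n) (fun y => S n y <= x - c - d) <=
    pr (th n) (Q n) (fun y => S' n y <= x) +
    pr (th n) (Q n) (fun y => d < `|S' n y - S n y - c|).
  apply: pr_cover => y hy; have [_|h] := leP (S' n y) x => //=.
  by rewrite lter_normr; apply/orP; left; lra.
move: hu hl h1 h2 h3 u1 u2; rewrite sub0r normrN.
move: (normal_cdf _ _ _) (normal_cdf _ _ _) (normal_cdf _ _ _) => g1 g2 g3.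
move: (pr _ _ _) (pr _ _ _) (pr _ _ _) (pr _ _ _) => p1 p2 p3 p4.
rewrite !ler_norml => /andP[? ?] /andP[? ?] /andP[? ?] /andP[? ?] /andP[? ?] ? ?.
by apply/andP; split; lra.
Unshelve. all: by end_near. Qed.

Lemma law_scale S m s a : 0 < s -> 0 < a -> law_cvg S m s ->
  law_cvg (fun n y => a * S n y) (a * m) (a * s).
Proof.
move=> s0 a0 hS x; have as0 : 0 < a * s by rewrite mulr_gt0.
have -> : normal_cdf (a * m) (a * s) x = normal_cdf m s (x / a).
  rewrite (normal_cdf_scale _ _ as0) (normal_cdf_scale _ _ s0); congr normal_cdf.
  by field; rewrite !gt_eqF.
have E n : pr (th n) (Q n) (fun y => a * S n y <= x) = pr (th n) (Q n) (fun y => S n y <= x / a).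
  by apply: eq_pr => y; rewrite ler_pdivlMr// mulrC.
by under eq_cvg do rewrite E; exact: hS.
Qed.

Lemma law_gt S m s x : law_cvg S m s ->
  pr (th n) (Q n) (fun y => x < S n y) @[n --> \oo] --> 1 - normal_cdf m s x.
Proof.
move=> hS; have E n : pr (th n) (Q n) (fun y => x < S n y) =
    1 - pr (th n) (Q n) (fun y => S n y <= x).
  by rewrite -prC; apply: eq_pr => y; rewrite ltNge.
under eq_cvg do rewrite E.
by apply: cvgB; [exact: cvg_cst|exact: hS].
Qed.

Lemma law_lt S m s x : 0 < s -> law_cvg S m s ->
  pr (th n) (Q n) (fun y => S n y < x) @[n --> \oo] --> normal_cdf m s x.
Proof.
move=> s0 hS; apply/cvgrPdist_le => e e0.
have e2 : 0 < e / 2 by rewrite divr_gt0.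
have [d d0 dP] := normal_cdf_near m x s0 e2.
have {dP} hl : `|normal_cdf m s x - normal_cdf m s (x - d)| <= e / 2.
  by apply: dP; rewrite opprB addrCA subrr addr0 gtr0_norm.
have /cvgrPdist_le/(_ _ e2) c1 := hS x.
have /cvgrPdist_le/(_ _ e2) c2 := hS (x - d).
near=> n.
have h1 : `|normal_cdf m s x - pr (th n) (Q n) (fun y => S n y <= x)| <= e / 2.
  by near: n; exact: c1.
have h2 : `|normal_cdf m s (x - d) - pr (th n) (Q n) (fun y => S n y <= x - d)| <= e / 2.
  by near: n; exact: c2.
have u1 : pr (th n) (Q n) (fun y => S n y < x) <= pr (th n) (Q n) (fun y => S n y <= x).
  by apply: pr_le => y /ltW.
have u2 : pr (th n) (Q n) (fun y => S n y <= x - d) <= pr (th n) (Q n) (fun y => S n y < x).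
  by apply: pr_le => y hy; lra.
move: hl h1 h2 u1 u2.
move: (normal_cdf _ _ _) (normal_cdf _ _ _) => g1 g2.
move: (pr _ _ _) (pr _ _ _) (pr _ _ _) => p1 p2 p3.
rewrite !ler_norml => /andP[? ?] /andP[? ?] /andP[? ?] ? ?.
by apply/andP; split; lra.
Unshelve. all: by end_near. Qed.

End convergence_in_law.

Section arithmetic.
Context {R : realFieldType}.
Implicit Types (M e a b p q x y z sg sn : R).

Lemma tail_arith M e1 e a b : 0 <= M -> 1 - e1 < a -> b < e1 -> M * e1 <= e / 16 ->
  e / 8 + M * (1 - (a - b)) <= e / 4.
Proof.
move=> M0 ha hb Me.
have h : M * (1 - (a - b)) <= M * (2 * e1) by rewrite ler_wpM2l//; lra.
by move: h; rewrite mulrCA; lra.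
Qed.

Lemma tail_arith' e1 a b p q : 1 - e1 < a -> b < e1 -> `|a - p| <= e1 -> `|b - q| <= e1 ->
  1 - (p - q) <= 4 * e1.
Proof. by rewrite !ler_norml => ? ? /andP[? ?] /andP[? ?]; lra. Qed.

Lemma chain_arith M e1 e x y sg sn : M * e1 <= e / 16 -> `|x - sg| <= e / 4 ->
  `|sg - sn| <= e / 8 -> `|y - sn| <= e / 4 + M * (4 * e1) -> `|x - y| <= e.
Proof.
rewrite [M * (4 * _)]mulrCA => Me h1 h2 h3.
have -> : x - y = (x - sg) + (sg - sn) - (y - sn) by ring.
have h0 : 0 <= e by have := normr_ge0 (x - sg); lra.
rewrite (le_trans (ler_normB _ _))//.
have := ler_normD (x - sg) (sg - sn); lra.
Qed.

End arithmetic.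

Section weak_convergence.
Context {R : realType}.
Implicit Types (F : R -> R) (A e M : R).

Definition grid A (k j : nat) : R := - A + 2 * A * (j%:R / k%:R).

(** Outside the grid the step function vanishes and the error is at most [M]. *)
Lemma step_approx F (a : nat -> R) (c : nat -> R) (k : nat) e M :
  {homo a : i j / (i <= j)%N >-> i <= j} -> 0 <= e -> (forall u, `|F u| <= M) ->
  (forall j u, (j < k)%N -> a j < u <= a j.+1 -> `|F u - c j| <= e) -> forall u,
  `|F u - \sum_(j < k) c j * ((u <= a j.+1)%R%:R - (u <= a j)%R%:R)| <=
  e + M * (1 - ((u <= a k)%R%:R - (u <= a 0%N)%R%:R)).
Proof.
move=> ah e0 FM Fc u; have M0 : 0 <= M by exact: le_trans (FM u).
have [u0|u0] := leP u (a 0%N).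
  have ui i : u <= a i by apply: (le_trans u0); exact: ah.
  rewrite big1 => [|j _]; last by rewrite !ui subrr mulr0.
  by rewrite subr0 ui subrr subr0 mulr1 (le_trans (FM u))// lerDr.
have [uk|uk] := leP u (a k); last first.
  have ui i : (i <= k)%N -> (u <= a i) = false.
    by move=> ik; apply/negbTE; rewrite -ltNge (le_lt_trans _ uk)//; exact: ah.
  rewrite big1 => [|j _]; last by rewrite !ui ?subrr ?mulr0// ltnW.
  by rewrite !subr0 mulr1 (le_trans (FM u))// lerDr.
have ex : exists i, u <= a i by exists k.
case: (ex_minnP ex) => i ui imin.
case: i ui imin => [|j] ui imin; first by rewrite leNgt u0 in ui.
have jk : (j < k)%N by exact: imin.
have uj : a j < u by rewrite ltNge; apply/negP => /imin; rewrite ltnn.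
rewrite (bigD1 (Ordinal jk))//= big1 => [|i /eqP ij].
  rewrite ui [u <= a j]leNgt uj/= !subr0 mulr1 addr0 subrr mulr0 addr0.
  by apply: Fc => //; rewrite uj.
have [ilt|igt|e'] := ltngtP i j; last by exfalso; apply: ij; exact: val_inj.
- have f1 : (u <= a i.+1) = false.
    by apply/negbTE; rewrite -ltNge; apply: le_lt_trans uj; exact: ah.
  have f2 : (u <= a i) = false.
    by apply/negbTE; rewrite -ltNge; apply: le_lt_trans uj; apply: ah; exact: ltnW.
  by rewrite f1 f2 subrr mulr0.
- have f1 : (u <= a i.+1) = true by apply: (le_trans ui); apply: ah; exact: leqW.
  have f2 : (u <= a i) = true by apply: (le_trans ui); exact: ah.
  by rewrite f1 f2 subrr mulr0.
Qed.

(** Compactness: finitely many of the neighbourhoods given by the hypothesis cover the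
    segment. *)
Lemma uniform_on_segment (Fn : nat -> R -> R) F A e : 0 < e -> continuous F ->
  (forall u0 e, 0 < e -> \forall u \near u0 & n \near \oo, `|Fn n u - F u0| <= e) ->
  \forall n \near \oo, forall u, - A <= u <= A -> `|Fn n u - F u| <= e.
Proof.
move=> e0 cF hF; have /compact_near_coveringP cov := @segment_compact R (- A) A.
have := cov _ \oo (fun n u => `|Fn n u - F u| <= e) _ _.
apply=> u0 _; have e2 : 0 < e / 2 by rewrite divr_gt0.
have h1 := hF u0 _ e2.
have h2 : \forall u \near u0 & n \near \oo, `|F u0 - F u| <= e / 2.
  have /cvgrPdist_le/(_ _ e2) h := cF u0.
  exists ([set u | `|F u0 - F u| <= e / 2], setT) => /=; first by split => //; exact: filterT.
  by move=> [u n] [].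
apply: filterS2 h1 h2 => -[u n] /= a b.
have -> : Fn n u - F u = (Fn n u - F u0) + (F u0 - F u) by ring.
by rewrite (le_trans (ler_normD _ _))// [e]splitr lerD.
Qed.

Lemma grid_fine F A e : 0 < A -> 0 < e -> continuous F -> exists2 k : nat, (0 < k)%N &
  forall j u, (j < k)%N -> grid A k j < u <= grid A k j.+1 -> `|F u - F (grid A k j)| <= e.
Proof.
move=> A0 e0 cF; have /compact_near_coveringP cov := @segment_compact R (- A) A.
have h : \forall k \near \oo, `[- A, A]%classic `<=`
    [set u | forall v, `|u - v| <= 2 * A / k%:R -> `|F v - F u| <= e].
  apply: (cov _ \oo (fun k u => forall v, `|u - v| <= 2 * A / k%:R -> `|F v - F u| <= e)).
  move=> u0 _; have e2 : 0 < e / 2 by rewrite divr_gt0.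
  have /cvgrPdist_le/(_ _ e2)[d /= d0 hd] := cF u0.
  have d2 : 0 < d / 2 by rewrite divr_gt0.
  exists (ball u0 (d / 2), [set k : nat | 2 * A / k%:R < d / 2]).
    split => /=; first exact: nbhsx_ballx.
    near=> k; have k0 : 0 < k%:R :> R by rewrite ltr0n; near: k; exact: nbhs_infty_gt.
    rewrite /= ltr_pdivrMr// -ltr_pdivrMl//.
    by near: k; exact: nbhs_infty_gtr.
  move=> [u k] /= [hu hk] v uv.
  have h1 : `|F u0 - F u| <= e / 2 by apply: hd; rewrite /ball/= (lt_trans hu)//; lra.
  have h2 : `|F u0 - F v| <= e / 2.
    apply: hd; rewrite /ball/=; have -> : u0 - v = (u0 - u) + (u - v) by ring.
    rewrite (le_lt_trans (ler_normD _ _))// [d]splitr ltrD//.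
    exact: le_lt_trans uv hk.
  have -> : F v - F u = (F u0 - F u) - (F u0 - F v) by ring.
  by rewrite (le_trans (ler_normB _ _))// [e]splitr lerD.
have [k [hk k0]] := filter_ex (filterI h (nbhs_infty_gt 0)).
exists k => // j u jk /andP[ju uj].
have kR : 0 < k%:R :> R by rewrite ltr0n.
have jk1 : j%:R / k%:R <= 1 :> R by rewrite ler_pdivrMr// mul1r ler_nat ltnW.
apply: hk.
  have A2 : 0 <= 2 * A by rewrite mulr_ge0// ltW.
  rewrite /= in_itv/= /grid lerDl (mulr_ge0 A2 (divr_ge0 _ _))//=.
  have := ler_wpM2l A2 jk1; rewrite mulr1 addrC lerBlDr => /le_trans; apply.
  by rewrite mulrDl mul1r.
rewrite distrC gtr0_norm ?subr_gt0// lerBlDl (le_trans uj)// /grid -addrA lerD2l.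
have -> : j.+1%:R / k%:R = j%:R / k%:R + k%:R^-1 :> R by rewrite -natr1 mulrDl mul1r.
by rewrite [X in X <= _]mulrDr.
Unshelve. all: by end_near. Qed.

Lemma grid_homo A k : 0 < A -> {homo grid A k : i j / (i <= j)%N >-> i <= j}.
Proof.
move=> A0 i j ij; have A2 : 0 <= 2 * A by rewrite mulr_ge0// ltW.
rewrite /grid lerD2l ler_wpM2l//.
by rewrite ler_wpM2r ?invr_ge0// ler_nat.
Qed.

Lemma normal_step F (a c : nat -> R) (k : nat) e M m s : s != 0 -> continuous F ->
  {homo a : i j / (i <= j)%N >-> i <= j} -> 0 <= e -> (forall u, `|F u| <= M) ->
  (forall j u, (j < k)%N -> a j < u <= a j.+1 -> `|F u - c j| <= e) ->
  `|\int[normal_prob m s]_y F y -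
    \sum_(j < k) c j * (normal_cdf m s (a j.+1) - normal_cdf m s (a j))| <=
  e + M * (1 - (normal_cdf m s (a k) - normal_cdf m s (a 0%N))).
Proof.
move=> s0 cF ah e0 FM Fc; pose P := normal_prob m s.
have bmP h : bm h -> P.-integrable setT (EFin \o h).
  move=> [mh [B hB]]; apply: measurable_bounded_integrable => //.
    by rewrite (le_lt_trans (probability_le1 _ _))// ltry.
  by exists B; split; [exact: num_real|move=> C /ltW BC x _; exact: le_trans (hB x) BC].
have bF : bm F by split; [exact: continuous_measurable_fun|exists M].
pose I (b : R) : R -> R := \1_(`]-oo, b]%classic).
have bI b : bm (I b) by apply: bm_indic; exact: measurable_itv.
have IE b u : I b u = (u <= b)%R%:R.
  by rewrite /I indicE mem_setE in_itv.
have intI b : \int[P]_y I b y = normal_cdf m s b.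
  rewrite /Rintegral (_ : (\int[P]_y (I b y)%:E)%E = P `]-oo, b]%classic).
    by rewrite /P normal_cdfE.
  by rewrite (integral_indic P measurableT (measurable_itv _)) setIT.
pose St u := \sum_(j < k) c j * (I (a j.+1) u - I (a j) u).
have bS : bm St by apply: bm_sum => j; apply: bmZ; exact: bmB.
have PD (g h : R -> R) : bm g -> bm h -> \int[P]_y (g y + h y) = \int[P]_y g y + \int[P]_y h y.
  by move=> bg bh; apply: RintegralD => //; exact: bmP.
have PB (g h : R -> R) : bm g -> bm h -> \int[P]_y (g y - h y) = \int[P]_y g y - \int[P]_y h y.
  by move=> bg bh; apply: RintegralB => //; exact: bmP.
have PZ (r : R) (h : R -> R) : bm h -> \int[P]_y (r * h y) = r * \int[P]_y h y.
  by move=> bh; apply: RintegralZl => //; exact: bmP.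
have P1 (r : R) : \int[P]_y (cst r y) = r.
  by rewrite Rintegral_cst// [X in fine X]probability_setT mulr1.
have intS : \int[P]_y St y = \sum_(j < k) c j * (normal_cdf m s (a j.+1) - normal_cdf m s (a j)).
  have bj j : bm (fun u => c j * (I (a j.+1) u - I (a j) u)) by apply: bmZ; exact: bmB.
  rewrite /St; elim: (k) => [|l IH].
    rewrite big_ord0 -[RHS](P1 0); apply: eq_Rintegral => y _.
    by rewrite big_ord0.
  rewrite big_ord_recr/= -IH -!intI -PB// -PZ//; last exact: bmB.
  rewrite -PD//; last by apply: bm_sum => j; exact: bj.
  by apply: eq_Rintegral => y _; rewrite big_ord_recr.
rewrite -intS -PB//.
have bFS : bm (fun y => F y - St y) by exact: bmB.
pose G y := e + M * (1 - (I (a k) y - I (a 0%N) y)).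
have b1 : bm (fun y => 1 - (I (a k) y - I (a 0%N) y)).
  by apply: bmB; [exact: bm_cst|exact: bmB].
have bG : bm G by apply: bmD; [exact: bm_cst|exact: bmZ].
have <- : \int[P]_y G y = e + M * (1 - (normal_cdf m s (a k) - normal_cdf m s (a 0%N))).
  rewrite PD ?P1 ?PZ//; [|exact: bm_cst|exact: bmZ].
  rewrite PB; [|exact: bm_cst|exact: bmB].
  by rewrite P1 PB// !intI.
apply: (le_trans (le_normr_Rintegral _ (bmP _ bFS))) => //.
apply: le_Rintegral => //; [exact: (bmP _ (bm_norm bFS))|exact: bmP|].
move=> u _; have := step_approx ah e0 FM Fc u.
by rewrite /G /St !IE; under eq_bigr do rewrite -!IE.
Qed.

Lemma gibbs_step n (th : R) (Q : 'M[R]_n) (X : config n -> R) F (a c : nat -> R) (k : nat) e M :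
  {homo a : i j / (i <= j)%N >-> i <= j} -> 0 <= e -> (forall u, `|F u| <= M) ->
  (forall j u, (j < k)%N -> a j < u <= a j.+1 -> `|F u - c j| <= e) ->
  `|gibbs th Q (fun x => F (X x)) - \sum_(j < k) c j *
     (pr th Q (fun x => X x <= a j.+1) - pr th Q (fun x => X x <= a j))| <=
  e + M * (1 - (pr th Q (fun x => X x <= a k) - pr th Q (fun x => X x <= a 0%N))).
Proof.
move=> ah e0 FM Fc.
have -> : \sum_(j < k) c j *
     (pr th Q (fun x => X x <= a j.+1) - pr th Q (fun x => X x <= a j)) =
   gibbs th Q (fun x => \sum_(j < k) c j * ((X x <= a j.+1)%R%:R - (X x <= a j)%R%:R)).
  by rewrite gibbs_sum; apply: eq_bigr => j _; rewrite gibbsZ gibbsB.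
rewrite -gibbsB.
have -> : e + M * (1 - (pr th Q (fun x => X x <= a k) - pr th Q (fun x => X x <= a 0%N))) =
    gibbs th Q (fun x => e + M * (1 - ((X x <= a k)%R%:R - (X x <= a 0%N)%R%:R))).
  by rewrite gibbsD gibbs_cst gibbsZ gibbsB gibbs_cst gibbsB.
apply: (le_trans (norm_gibbs _ _ _)); apply: gibbs_le => x.
exact: step_approx.
Qed.

Context (Q : forall n, 'M[R]_n) (th : nat -> R).

(** Approximation by step functions on a fine grid of a large segment. The test
    functions vary with [n] because the likelihood ratios are functions of the limiting
    statistic that contain the normalizing constants of size [n]. *)
Theorem law_cvg_integral (S : forall n, config n -> R) (m s : R) F (Fn : nat -> R -> R) M :
  0 < s -> law_cvg Q th S m s -> continuous F ->
  (forall u, `|F u| <= M) -> (forall n u, `|Fn n u| <= M) ->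
  (forall u0 e, 0 < e -> \forall u \near u0 & n \near \oo, `|Fn n u - F u0| <= e) ->
  gibbs (th n) (Q n) (fun x => Fn n (S n x)) @[n --> \oo] --> \int[normal_prob m s]_y F y.
Proof.
move=> s0 hS cF FM FnM hF; have sn : s != 0 by rewrite gt_eqF.
have M0 : 0 <= M by exact: le_trans (FM 0).
apply/cvgrPdist_le => e e0.
pose e1 := e / (16 * (M + 1)).
have M1 : 0 < M + 1 by rewrite ltr_wpDl.
have e10 : 0 < e1 by rewrite divr_gt0// mulr_gt0.
have e8 : 0 < e / 8 by rewrite divr_gt0.
have Me1 : M * e1 <= e / 16.
  have -> : M * e1 = e / 16 * (M / (M + 1)) by rewrite /e1; field; rewrite gt_eqF.
  by rewrite ler_piMr ?divr_ge0 ?(ltW e0)// ler_pdivrMr// mul1r lerDl.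
have [A1 hA1] := normal_cdf_cvgy m s e10; have [A2 hA2] := normal_cdf_cvgNy m s e10.
pose A := Num.max 1 (Num.max A1 (- A2)).
have A0 : 0 < A by rewrite lt_max ltr01.
have gA : 1 - e1 < normal_cdf m s A by apply: hA1; rewrite !le_max lexx orbT.
have gNA : normal_cdf m s (- A) < e1 by apply: hA2; rewrite lerNl !le_max lexx !orbT.
have [k kp hk] := grid_fine A0 e8 cF.
have gm : {homo grid A k : i j / (i <= j)%N >-> i <= j} := @grid_homo A k A0.
have g0 : grid A k 0 = - A by rewrite /grid mul0r mulr0 addr0.
have gk : grid A k k = A.
  by rewrite /grid divff ?pnatr_eq0 -?lt0n// mulr1; ring.
have inA j u : (j < k)%N -> grid A k j < u <= grid A k j.+1 -> - A <= u <= A.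
  move=> jk /andP[ju uj]; apply/andP; split.
    by rewrite -g0; exact: (le_trans (gm 0%N j (leq0n j)) (ltW ju)).
  by rewrite -[leRHS]gk; exact: (le_trans uj (gm _ _ jk)).
pose p n u := pr (th n) (Q n) (fun x => S n x <= u).
pose sig n := \sum_(j < k) F (grid A k j) * (p n (grid A k j.+1) - p n (grid A k j)).
pose sg := \sum_(j < k) F (grid A k j) *
  (normal_cdf m s (grid A k j.+1) - normal_cdf m s (grid A k j)).
have sigc : sig n @[n --> \oo] --> sg.
  rewrite /sig /sg; elim: (k) (grid A k) => [|l IH] a.
    by under eq_cvg do rewrite big_ord0; rewrite big_ord0; exact: cvg_cst.
  under eq_cvg do rewrite big_ord_recr; rewrite big_ord_recr.
  apply: cvgD; first exact: IH.
  by apply: cvgM; [exact: cvg_cst|apply: cvgB; exact: hS].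
have step1 : `|\int[normal_prob m s]_y F y - sg| <= e / 4.
  have h := @normal_step F (grid A k) (fun j => F (grid A k j)) k (e / 8) M m s
    sn cF gm (ltW e8) FM hk.
  apply: (le_trans h).
  rewrite gk g0; exact: tail_arith M0 gA gNA Me1.
have /cvgrPdist_le/(_ _ e8) c1 := sigc.
have /cvgrPdist_le/(_ _ e10) c2 := hS A.
have /cvgrPdist_le/(_ _ e10) c3 := hS (- A).
have c4 := uniform_on_segment A e8 cF hF.
near=> n.
have h1 : `|sg - sig n| <= e / 8 by near: n; exact: c1.
have h2 : `|normal_cdf m s A - p n A| <= e1 by near: n; exact: c2.
have h3 : `|normal_cdf m s (- A) - p n (- A)| <= e1 by near: n; exact: c3.
have h4 : forall u, - A <= u <= A -> `|Fn n u - F u| <= e / 8 by near: n; exact: c4.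
have step2 : `|gibbs (th n) (Q n) (fun x => Fn n (S n x)) - sig n| <= e / 4 + M * (4 * e1).
  have hFn j u : (j < k)%N -> grid A k j < u <= grid A k j.+1 ->
      `|Fn n u - F (grid A k j)| <= e / 4.
    move=> jk hu; have -> : Fn n u - F (grid A k j) = (Fn n u - F u) + (F u - F (grid A k j)) by ring.
    have e48 : e / 4 = e / 8 + e / 8 by field.
    by rewrite e48 (le_trans (ler_normD _ _))// lerD ?h4 ?(inA j)// hk.
  have e4 : 0 <= e / 4 by rewrite divr_ge0// ltW.
  have := gibbs_step (th n) (Q n) (S n) (c := fun j => F (grid A k j)) gm e4 (FnM n) hFn.
  move=> /le_trans; apply; rewrite gk g0 lerD2l ler_wpM2l//.
  exact: tail_arith' gA gNA h2 h3.
exact: chain_arith Me1 step1 h1 step2.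
Unshelve. all: by end_near. Qed.

End weak_convergence.

(** * Asymptotic normality along local parameters *)

Section local_expansion.
Context {R : realType}.
Implicit Types (f : R -> R) (a h x D : R).

Lemma derive_linear_approx f a (D e : R) : is_derive a 1 f D -> 0 < e ->
  exists2 d, 0 < d & forall t, `|t| < d -> `|f (a + t) - f a - D * t| <= e * `|t|.
Proof.
move=> /is_derive1_caratheodory[g [gE gc ga]] e0.
have /cvgrPdist_le/(_ _ e0)[d /= d0 hd] := gc.
exists d => // t td; rewrite gE.
have -> : g (a + t) * (a + t - a) - D * t = - (D - g (a + t)) * t by ring.
rewrite normrM normrN ler_wpM2r// -ga; apply: hd.
by rewrite /ball/= opprD addrA subrr sub0r normrN.
Qed.

Definition local_param (th0 : R) h n : R := th0 + h / Num.sqrt n%:R.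

Lemma local_param_cvg (th0 : R) h : local_param th0 h n @[n --> \oo] --> th0.
Proof.
rewrite -[X in _ --> X]addr0; apply: cvgD; first exact: cvg_cst.
exact: inv_sqrt_cvg.
Qed.

Lemma sqrt_nat_gt0 n : (0 < n)%N -> 0 < Num.sqrt n%:R :> R.
Proof. by move=> n0; rewrite sqrtr_gt0 ltr0n. Qed.

(** The delta method for a deterministic sequence. *)
Lemma local_derive f (th0 : R) h D : is_derive th0 1 f D ->
  Num.sqrt n%:R * (f (local_param th0 h n) - f th0) @[n --> \oo] --> D * h.
Proof.
move=> fD; apply/cvgrPdist_le => e e0.
have h1 : 0 < `|h| + 1 by rewrite ltr_wpDl.
have e1 : 0 < e / (`|h| + 1) by rewrite divr_gt0.
have [d d0 dP] := derive_linear_approx fD e1.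
have /cvgrPdist_lt/(_ _ d0) hc := inv_sqrt_cvg h.
near=> n; have n0 : (0 < n)%N by near: n; exact: nbhs_infty_gt.
have s0 := sqrt_nat_gt0 n0.
have td : `|h / Num.sqrt n%:R| < d.
  by have : `|0 - h / Num.sqrt n%:R| < d; [near: n; exact: hc|rewrite sub0r normrN].
have := dP _ td; rewrite -/(local_param th0 h n).
set y := f _ - f th0; move=> hy.
have -> : D * h - Num.sqrt n%:R * y = - (Num.sqrt n%:R * (y - D * (h / Num.sqrt n%:R))).
  by field; rewrite gt_eqF.
rewrite normrN normrM (gtr0_norm s0); apply: (le_trans (ler_wpM2l (ltW s0) hy)).
rewrite normrM normfV (gtr0_norm s0).
have -> : Num.sqrt n%:R * (e / (`|h| + 1) * (`|h| / Num.sqrt n%:R)) = e * (`|h| / (`|h| + 1)).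
  by field; rewrite !gt_eqF.
by rewrite ler_piMr ?(ltW e0)// ler_pdivrMr// mul1r lerDl.
Unshelve. all: by end_near. Qed.

End local_expansion.

Section slutsky_variants.
Context {R : realType} (Q : forall n, 'M[R]_n) (th : nat -> R).
Implicit Types (S X : forall n, config n -> R) (m s c : R) (a : nat -> R).

Lemma markov n (t : R) (A : 'M[R]_n) (X : config n -> R) e : 0 < e ->
  pr t A (fun y => e < `|X y|) <= gibbs t A (fun y => `|X y|) / e.
Proof.
move=> e0; rewrite ler_pdivlMr// mulrC -gibbsZ; apply: gibbs_le => x.
by have [h|_] := ltP e `|X x|; rewrite ?mulr1 ?mulr0// ltW.
Qed.

Lemma slutsky_shift S m s a c : 0 < s -> law_cvg Q th S m s -> a n @[n --> \oo] --> c ->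
  law_cvg Q th (fun n y => S n y + a n) (m + c) s.
Proof.
move=> s0 hS ac; apply: slutsky hS _ => // e e0.
apply/cvgrPdist_le => e' e'0; near=> n.
rewrite sub0r normrN (eq_pr _ _ (b := fun=> false)); last first.
  move=> y; apply/negbTE; rewrite -leNgt.
  have -> : S n y + a n - S n y - c = a n - c by ring.
  rewrite distrC; near: n; by move/cvgrPdist_le: ac; apply.
by rewrite /pr gibbs_cst normr0 ltW.
Unshelve. all: by end_near. Qed.

Lemma slutsky_prob S X m s : 0 < s -> law_cvg Q th S m s ->
  (forall e, 0 < e -> pr (th n) (Q n) (fun y => e < `|X n y|) @[n --> \oo] --> (0 : R)) ->
  law_cvg Q th (fun n y => S n y + X n y) m s.
Proof.
move=> s0 hS hX; rewrite -[m]addr0; apply: slutsky hS _ => // e e0.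
have E n : pr (th n) (Q n) (fun y => e < `|S n y + X n y - S n y - 0|) =
    pr (th n) (Q n) (fun y => e < `|X n y|).
  by apply: eq_pr => y; congr (_ < `|_|); ring.
by under eq_cvg do rewrite E; exact: hX.
Qed.

Lemma slutsky_mean S X m s : 0 < s -> law_cvg Q th S m s ->
  gibbs (th n) (Q n) (fun y => `|X n y|) @[n --> \oo] --> (0 : R) ->
  law_cvg Q th (fun n y => S n y + X n y) m s.
Proof.
move=> s0 hS hX; apply: slutsky_prob => // e e0.
apply/cvgrPdist_le => e' e'0; have ee : 0 < e' * e by rewrite mulr_gt0.
move/cvgrPdist_le/(_ _ ee): hX; apply: filterS => n.
rewrite !sub0r !normrN => h; rewrite ger0_norm ?pr_ge0//.
apply: (le_trans (markov _ _ _ e0)); rewrite ler_pdivrMr//.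
exact: (le_trans (ler_norm _) h).
Qed.

Lemma eq_law S S' m s : (\forall n \near \oo, forall y, S n y = S' n y) ->
  law_cvg Q th S m s -> law_cvg Q th S' m s.
Proof.
move=> e hS x; apply: cvg_trans (hS x); apply: near_eq_cvg.
by apply: filterS e => n e; apply: eq_pr => y; rewrite e.
Qed.

End slutsky_variants.

Section local_laws.
Context {R : realType} (Q : forall n, 'M[R]_n) (K d th0 : R) (h : R).
Hypotheses (K0 : 0 <= K) (d0 : 0 < d) (th01 : 1 < th0).
Hypothesis Qgood : \forall n \near \oo, coupling K (Q n) /\ spectral_gap d (Q n).

Let thn := local_param th0 h.
Let thc : thn n @[n --> \oo] --> th0 := @local_param_cvg R th0 h.
Let I := information th0.
Let m0 := magnetization th0.
Let I0 : 0 < I := information_gt0 th01.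
Let s0 : 0 < Num.sqrt I. Proof. by rewrite sqrtr_gt0. Qed.

(** Half the rescaled deviation of [M ^+ 2] from its value at the null parameter: the
    factor makes both mean shift and variance equal to the information. *)
Definition mean_stat n (y : config n) : R :=
  Num.sqrt n%:R * (mean_spin y ^+ 2 - magnetization th0 ^+ 2) / 2.

Definition energy_stat n (y : config n) : R :=
  (quad (Q n) y - n%:R * magnetization th0 ^+ 2) / (2 * Num.sqrt n%:R).

(** The shift is the derivative [2 * information] of the squared magnetization. *)
Lemma mean_stat_law : law_cvg Q thn mean_stat (h * I) (Num.sqrt I).
Proof.
have base : law_cvg Q thn (fun n y => root_scale (n := n) (magnetization (thn n)) (mean_spin y) / 2)
    0 (Num.sqrt I).
  move=> x; rewrite (normal_cdf_scale _ _ s0) subr0.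
  have c := mean_spin_clt K0 d0 th01 Qgood thc (x := x / Num.sqrt I).
  apply: cvg_trans c; apply: near_eq_cvg; apply: nearW => n.
  apply: eq_pr => y; rewrite ler_pdivrMr//; congr (_ <= _).
  by rewrite -/I; field; rewrite gt_eqF.
have sh : Num.sqrt n%:R * (magnetization (thn n) ^+ 2 - m0 ^+ 2) / 2 @[n --> \oo] --> h * I.
  have -> : h * I = (2 * I * h) / 2 by field.
  apply: cvgMl; exact: (local_derive (h := h) (is_derive_magnetization_sqr th01)).
have := slutsky_shift s0 base sh; rewrite add0r; apply: eq_law; apply: nearW => n y.
by rewrite /mean_stat /root_scale -/m0; field.
Qed.

Lemma gap_negligible (c : nat -> R) (r e : R) : 0 < r -> 0 < e ->
  (\forall n \near \oo, r <= c n) ->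
  pr (thn n) (Q n) (fun y => e < `|quad_gap (Q n) y / (c n * Num.sqrt n%:R)|)
    @[n --> \oo] --> (0 : R).
Proof.
move=> r0 e0 rc; have [C [C0 CP]] := moments_near K0 d0 th01 Qgood thc.
have re : 0 < e * r by rewrite mulr_gt0.
have lim := inv_sqrt_cvg ((((th0 + 1) + 4) * C + 4) / (e * r * tanh (e * r))).
apply/cvgrPdist_le => e' e'0; have /cvgrPdist_le/(_ _ e'0) lim' := lim.
near=> n.
have [/andP[tha thb] QK disp _ _] : [/\ (1 + th0) / 2 <= thn n <= th0 + 1, coupling K (Q n),
      gibbs (thn n) (Q n) (dispersion (Q n)) <= C,
      n%:R * gibbs (thn n) (Q n) (fun x => sqr_excess (magnetization (thn n)) x ^+ 2) <= C &
      `|gibbs (thn n) (Q n) (quad (Q n)) - n%:R * magnetization (thn n) ^+ 2| <= C] by near: n.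
have sn0 : 0 < Num.sqrt n%:R :> R by exact: sqrt_nat_gt0 (coupling_n0 QK).
have th_ge0 : 0 <= thn n by have := th01; lra.
have rcn : r <= c n by near: n.
have cn0 : 0 < c n by exact: lt_le_trans rcn.
have cs0 : 0 < c n * Num.sqrt n%:R by rewrite mulr_gt0.
rewrite sub0r normrN ger0_norm ?pr_ge0//.
apply: (@le_trans _ _ (pr (thn n) (Q n) (fun y => e * r * Num.sqrt n%:R < `|quad_gap (Q n) y|))).
  apply: pr_le => y; rewrite normrM normfV (gtr0_norm cs0) ltr_pdivlMr//.
  by apply: le_lt_trans; rewrite mulrA ler_wpM2r ?(ltW sn0)// ler_wpM2l// ltW.
apply: (le_trans (gap_prob QK th_ge0 thb disp re)).
apply: (le_trans (ler_norm _)); rewrite -normrN -sub0r.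
by near: n; exact: lim'.
Unshelve. all: by end_near. Qed.

Lemma energy_stat_law : law_cvg Q thn energy_stat (h * I) (Num.sqrt I).
Proof.
have r0 : (0 : R) < 2 by [].
have h2 : \forall n \near \oo, (2 : R) <= (fun=> 2) n by apply: nearW => n /=.
have := slutsky_prob s0 mean_stat_law (fun e e0 => gap_negligible r0 e0 h2).
apply: eq_law; near=> n => y.
have n0 : (0 < n)%N by near: n; exact: nbhs_infty_gt.
have sn0 := @sqrt_nat_gt0 R n n0.
have sn2 : n%:R = Num.sqrt n%:R ^+ 2 :> R by rewrite sqr_sqrtr.
rewrite /mean_stat /energy_stat /quad_gap.
move: sn2 sn0; move: (Num.sqrt n%:R) => sq -> sq0.
by field; rewrite gt_eqF.
Unshelve. all: by end_near. Qed.

(** Relative to the mean spin, the score is the energy gap plus the drift, up to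
    the dispersion. *)
Lemma score_expand n (t T : R) (x : config n) : coupling K (Q n) -> 0 <= t -> t <= T ->
  `|score (Q n) t x - (quad_gap (Q n) x + n%:R * drift t (mean_spin x))| <=
  (T + 2 * t ^+ 2) * dispersion (Q n) x.
Proof.
move=> QK t0 tT; set M := mean_spin x.
pose y i := tanh (t * field_at (Q n) x i).
have E : \sum_i field_at (Q n) x i * y i =
   \sum_i (y i - tanh (t * M)) * (field_at (Q n) x i - M) +
   M * (\sum_i y i - n%:R * tanh (t * M)) + n%:R * M * tanh (t * M).
  have c0 : \sum_i tanh (t * M) * (field_at (Q n) x i - M) = 0.
    by rewrite -mulr_sumr (sum_field_center QK) mulr0.
  transitivity (\sum_i ((y i - tanh (t * M)) * (field_at (Q n) x i - M) + M * y i +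
      tanh (t * M) * (field_at (Q n) x i - M))).
    by apply: eq_bigr => i _; ring.
  rewrite !big_split/= c0 addr0 -mulr_sumr -addrA; congr (_ + _).
  by move: (\sum_i y i) (tanh (t * M)) => *; ring.
have -> : score (Q n) t x - (quad_gap (Q n) x + n%:R * drift t M) =
   - (\sum_i (y i - tanh (t * M)) * (field_at (Q n) x i - M) +
      M * (\sum_i y i - n%:R * tanh (t * M))).
  rewrite scoreE -/y E /quad_gap /drift -/M expr2.
  move: (\sum_i (y i - tanh (t * M)) * (field_at (Q n) x i - M)) (\sum_i y i).
  by move: (quad (Q n) x) (tanh (t * M)) => *; ring.
rewrite normrN (le_trans (ler_normD _ _))// mulrDl lerD//.
  exact: sum_tanh_dev.
rewrite normrM -[leRHS]mul1r ler_pM// ?(norm_mean_le1 QK)//.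
exact: (sum_tanh_linear QK).
Qed.

(** The slope [1 - cw_slope] comes from linearizing the drift at the fixed point. *)
Definition score_scale y n : R := (1 - cw_slope (local_param th0 y n)) * Num.sqrt n%:R.

(** By [score_expand] and [drift_expand], at [t = th0 + y / sqrt n] the score is
    [(1 - cw_slope) * n * (M ^+ 2 - m t ^+ 2) / 2] up to terms negligible against [sqrt n]. *)
Lemma score_law y : law_cvg Q thn
  (fun n x => score (Q n) (local_param th0 y n) x / score_scale y n)
  ((h - y) * I) (Num.sqrt I).
Proof.
have [C [C0 CP]] := moments_near K0 d0 th01 Qgood thc.
have yc : local_param th0 y n @[n --> \oo] --> th0 := @local_param_cvg R th0 y.
have [a1 ab _] := midpoint1 th01.
pose ml := magnetization ((1 + th0) / 2); have ml0 : 0 < ml := magnetization_gt0 _ a1.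
have [r r0 rP] := cw_slope_gap (a := (1 + th0) / 2) (b := th0 + 1) a1 ab.
have ynear : \forall n \near \oo, (1 + th0) / 2 <= local_param th0 y n <= th0 + 1.
  have e1 : 0 < (th0 - 1) / 2 by have [] := midpoint1 th01.
  near=> n; apply: near_midpoint; near: n.
    by move/cvgrPdist_lt: yc; apply.
  by move/cvgrPdist_lt: yc; apply.
pose my n := magnetization (local_param th0 y n) ^+ 2.
have shy : - (Num.sqrt n%:R * (my n - m0 ^+ 2) / 2) @[n --> \oo] --> - (y * I).
  apply: cvgN; have -> : y * I = (2 * I * y) / 2 by field.
  apply: cvgMl; exact: (local_derive (h := y) (is_derive_magnetization_sqr th01)).
have shyh : Num.sqrt n%:R * (my n - magnetization (thn n) ^+ 2) @[n --> \oo] --> 2 * I * y - 2 * I * h.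
  have c1 := local_derive (h := y) (is_derive_magnetization_sqr th01).
  have c2 := local_derive (h := h) (is_derive_magnetization_sqr th01).
  apply: cvg_trans (cvgB c1 c2); apply: near_eq_cvg; apply: nearW => n.
  change (Num.sqrt n%:R * (my n - magnetization th0 ^+ 2) -
    Num.sqrt n%:R * (magnetization (thn n) ^+ 2 - magnetization th0 ^+ 2) =
    Num.sqrt n%:R * (my n - magnetization (thn n) ^+ 2)).
  by ring.
pose T := th0 + 1.
pose K1 := (1 + 2 * T ^+ 2) / ml ^+ 2.
pose B := `|2 * I * y - 2 * I * h| + 1.
have T0 : 0 < T by rewrite /T; have := th01; lra.
have K10 : 0 <= K1 by rewrite divr_ge0 ?sqr_ge0// addr_ge0// mulr_ge0// sqr_ge0.
(* The linearization is at the magnetization of th0 + y / sqrt n, while the moments are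
   those of th0 + h / sqrt n; the two differ by O(1 / sqrt n). *)
pose err n x := score (Q n) (local_param th0 y n) x -
  (quad_gap (Q n) x + n%:R * ((1 - cw_slope (local_param th0 y n)) / 2 * (mean_spin x ^+ 2 - my n))).
pose L := (T + 2 * T ^+ 2) * C + K1 * (2 * C + 2 * B ^+ 2).
have errL : \forall n \near \oo, gibbs (thn n) (Q n) (fun x => `|err n x|) <= L.
  near=> n.
  have [_ QK disp exc _] : [/\ (1 + th0) / 2 <= thn n <= th0 + 1, coupling K (Q n),
      gibbs (thn n) (Q n) (dispersion (Q n)) <= C,
      n%:R * gibbs (thn n) (Q n) (fun x => sqr_excess (magnetization (thn n)) x ^+ 2) <= C &
      `|gibbs (thn n) (Q n) (quad (Q n)) - n%:R * magnetization (thn n) ^+ 2| <= C] by near: n.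
  have tab : (1 + th0) / 2 <= local_param th0 y n <= th0 + 1 by near: n.
  have /andP[ta tb] := tab.
  have t1 : 1 < local_param th0 y n by exact: lt_le_trans ta.
  have t0 : 0 < local_param th0 y n by exact: lt_trans t1.
  have hB : `|Num.sqrt n%:R * (my n - magnetization (thn n) ^+ 2)| <= B.
    have : `|2 * I * y - 2 * I * h - Num.sqrt n%:R * (my n - magnetization (thn n) ^+ 2)| <= 1.
      by near: n; move/cvgrPdist_le: shyh; apply.
    move=> hh; have := lerB_dist (Num.sqrt n%:R * (my n - magnetization (thn n) ^+ 2)) (2 * I * y - 2 * I * h).
    rewrite distrC => h2; rewrite /B -lerBlDl; exact: le_trans h2 hh.
  have mlm : ml <= magnetization (local_param th0 y n) by apply: magnetization_le.
  have rr := rP _ tab; rewrite /cw_slope in rr.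
  have ptw x : `|err n x| <= (T + 2 * T ^+ 2) * dispersion (Q n) x +
      K1 * (2 * (n%:R * sqr_excess (magnetization (thn n)) x ^+ 2) + 2 * B ^+ 2).
    have -> : err n x = (score (Q n) (local_param th0 y n) x -
         (quad_gap (Q n) x + n%:R * drift (local_param th0 y n) (mean_spin x))) +
       n%:R * (drift (local_param th0 y n) (mean_spin x) -
         (1 - cw_slope (local_param th0 y n)) / 2 * (mean_spin x ^+ 2 - my n)).
      by rewrite /err; move: (score _ _ _) (drift _ _) (quad_gap _ _) => *; ring.
    rewrite (le_trans (ler_normD _ _))// lerD//.
      apply: (le_trans (score_expand x QK (ltW t0) tb)).
      rewrite ler_wpM2r ?dispersion_ge0// lerD2l ler_wpM2l//.
      by rewrite ler_pXn2r// nnegrE// ltW.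
    have := drift_expand t0 (magnetizationP _ t1) tb ml0 mlm r0 rr (mean_spin x).
    rewrite (norm_mean_le1 QK) mulr1 -/(cw_slope _) -/(my n) -/T -/K1 => hd.
    rewrite normrM (ger0_norm (ler0n _ _)).
    apply: (le_trans (ler_wpM2l (ler0n _ n) hd)).
    have sn2 : n%:R = Num.sqrt n%:R ^+ 2 :> R by rewrite sqr_sqrtr.
    have -> : n%:R * (K1 * (mean_spin x ^+ 2 - my n) ^+ 2) =
        K1 * (n%:R * (mean_spin x ^+ 2 - my n) ^+ 2) by rewrite mulrCA.
    rewrite ler_wpM2l// /sqr_excess.
    have hB2 : (Num.sqrt n%:R * (my n - magnetization (thn n) ^+ 2)) ^+ 2 <= B ^+ 2.
      by rewrite -real_normK ?num_real// ler_pXn2r// nnegrE// addr_ge0.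
    move: hB2; rewrite exprMn -sn2; set N := n%:R.
    move: (mean_spin x ^+ 2) (my n) (magnetization (thn n) ^+ 2) => a b c hB2.
    have : 0 <= N * ((a - c) + (b - c)) ^+ 2 by rewrite mulr_ge0 ?sqr_ge0// ler0n.
    rewrite sqrrD.
    have -> : (a - b) ^+ 2 = (a - c) ^+ 2 - (a - c) * (b - c) *+ 2 + (b - c) ^+ 2 by ring.
    by rewrite !mulrDr !mulrN; lra.
  apply: (le_trans (gibbs_le _ _ ptw)).
  rewrite gibbsD gibbsZ gibbsZ gibbsD gibbsZ gibbsZ gibbs_cst.
  have T2 : 0 <= T + 2 * T ^+ 2 by rewrite addr_ge0 ?(ltW T0)// mulr_ge0// sqr_ge0.
  rewrite /L lerD// ler_wpM2l// lerD2r ler_wpM2l//.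
pose c2 n := 1 - cw_slope (local_param th0 y n).
have rc : \forall n \near \oo, r <= c2 n.
  by apply: filterS ynear => n /rP.
have l1 := slutsky_shift s0 mean_stat_law shy.
have l2 := slutsky_prob s0 l1 (fun e e0 => gap_negligible r0 e0 rc).
have e0 : gibbs (thn n) (Q n) (fun x => `|err n x / (c2 n * Num.sqrt n%:R)|) @[n --> \oo] --> (0 : R).
  have /cvgrPdist_le lim := inv_sqrt_cvg (L / r).
  apply/cvgrPdist_le => e e0; near=> n.
  have n0 : (0 < n)%N by near: n; exact: nbhs_infty_gt.
  have sn0 := @sqrt_nat_gt0 R n n0.
  have rcn : r <= c2 n by near: n.
  have cn0 : 0 < c2 n by exact: lt_le_trans rcn.
  have cs : 0 < c2 n * Num.sqrt n%:R by rewrite mulr_gt0.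
  have Ln : gibbs (thn n) (Q n) (fun x => `|err n x|) <= L by near: n.
  have L0 : 0 <= L by apply: le_trans Ln; apply: gibbs_ge0.
  have -> : gibbs (thn n) (Q n) (fun x => `|err n x / (c2 n * Num.sqrt n%:R)|) =
      gibbs (thn n) (Q n) (fun x => `|err n x|) / (c2 n * Num.sqrt n%:R).
    rewrite [RHS]mulrC -gibbsZ; apply: gibbs_ext => x.
    by rewrite normrM normfV (gtr0_norm cs) mulrC.
  rewrite sub0r normrN ger0_norm; last by rewrite divr_ge0 ?(ltW cs)// gibbs_ge0.
  apply: (@le_trans _ _ (L / r / Num.sqrt n%:R)).
    rewrite -mulrA -invfM ler_pM// ?gibbs_ge0// ?invr_ge0 ?(ltW cs)//.
    by rewrite lef_pV2 ?posrE// ?mulr_gt0// ler_wpM2r// ltW.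
  apply: (le_trans (ler_norm _)); rewrite -normrN -sub0r; near: n; exact: lim.
have := slutsky_mean s0 l2 e0; rewrite -mulrBl; apply: eq_law.
near=> n => x.
have n0 : (0 < n)%N by near: n; exact: nbhs_infty_gt.
have sn0 := @sqrt_nat_gt0 R n n0.
have rcn : r <= c2 n by near: n.
have cn0 : 0 < c2 n by exact: lt_le_trans rcn.
rewrite /mean_stat /score_scale /err -/m0 -/(c2 n).
have sn2 : n%:R = Num.sqrt n%:R ^+ 2 :> R by rewrite sqr_sqrtr.
move: cn0 sn2 sn0; rewrite /c2.
move: (score _ _ _) (quad_gap _ _) (cw_slope _) (my n) (mean_spin x ^+ 2) (Num.sqrt n%:R).
move=> s q k b a sq cn0 -> sq0; field.
by rewrite !gt_eqF.
Unshelve. all: by end_near. Qed.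

End local_laws.

(** * Estimators as zeros of a decreasing score *)

Section concave_maximizer.
Context {R : realType} (L D : R -> R).
Hypothesis LD : forall t : R, is_derive t 1 L (D t).
Hypothesis D_decr : forall u v, u < v -> D v < D u.
Implicit Types (a b s t x z : R).

Lemma concave_incr s z : 0 <= D z -> s < z -> L s < L z.
Proof.
move=> Dz sz; pose w := (s + z) / 2.
have sw : s < w by rewrite /w; lra.
have wz : w < z by rewrite /w; lra.
have D_ge c : c <= z -> 0 <= D c.
  by rewrite le_eqVlt => /predU1P[->//|/D_decr/ltW]; exact: le_trans.
have [c1 /andP[_ c1w] E1] := mean_value _ _ _ _ (ltW sw) LD.
have [c2 /andP[_ c2z] E2] := mean_value _ _ _ _ (ltW wz) LD.
have p1 : 0 < L w - L s.
  rewrite E1 mulr_gt0 ?subr_gt0// (le_lt_trans Dz)//; apply: D_decr.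
  exact: le_lt_trans wz.
have p2 : 0 <= L z - L w by rewrite E2 mulr_ge0 ?D_ge// subr_ge0 ltW.
by move: p1 p2; lra.
Qed.

Lemma concave_decr z t : D z <= 0 -> z < t -> L t < L z.
Proof.
move=> Dz zt; pose w := (z + t) / 2.
have zw : z < w by rewrite /w; lra.
have wt : w < t by rewrite /w; lra.
have D_le c : z <= c -> D c <= 0.
  by rewrite le_eqVlt => /predU1P[<-//|/D_decr/ltW h]; exact: le_trans h Dz.
have [c1 /andP[zc1 _] E1] := mean_value _ _ _ _ (ltW zw) LD.
have [c2 /andP[wc2 _] E2] := mean_value _ _ _ _ (ltW wt) LD.
have p1 : L w - L z <= 0 by rewrite E1 mulr_le0_ge0 ?D_le// subr_ge0 ltW.
have p2 : L t - L w < 0.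
  rewrite E2 nmulr_rlt0 ?subr_gt0// (lt_le_trans _ Dz)//; apply: D_decr.
  exact: lt_le_trans wc2.
by move: p1 p2; lra.
Qed.

Lemma concave_maximizer a b : a <= b -> 0 < D a -> D b < 0 ->
  exists t, unique_maximizer L t.
Proof.
move=> ab Da Db.
have cL : {within `[a, b], continuous L}.
  by apply: continuous_subspaceT => x; exact: (@is_derive_continuous R L D LD).
have [c cab cmax] := EVT_max ab cL.
have {}cmax x : a <= x <= b -> L x <= L c by move=> h; apply: cmax; rewrite in_itv.
have {}cab : a <= c <= b by move: cab; rewrite in_itv.
have /andP[ac cb] := cab.
exists c => s sc.
have [sa|sa] := ltP s a.
  by apply: (lt_le_trans (concave_incr (ltW Da) sa)); apply: cmax; rewrite lexx.
have [bs|bs] := ltP b s.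
  by apply: (lt_le_trans (concave_decr (ltW Db) bs)); apply: cmax; rewrite lexx ab.
pose w := (s + c) / 2.
have wab : a <= w <= b by rewrite /w; apply/andP; split; lra.
have hw := cmax w wab.
move: sc; rewrite neq_lt => /orP[sc|cs].
  have [Dw|Dw] := leP 0 (D w).
    by apply: lt_le_trans hw; apply: concave_incr => //; rewrite /w; lra.
  have : L c < L w by apply: concave_decr (ltW Dw) _; rewrite /w; lra.
  by rewrite ltNge hw.
have [Dw|Dw] := leP (D w) 0.
  by apply: lt_le_trans hw; apply: concave_decr => //; rewrite /w; lra.
have : L c < L w by apply: concave_incr (ltW Dw) _; rewrite /w; lra.
by rewrite ltNge hw.
Qed.

(** The derivative is decreasing, and it vanishes at an interior maximum. *)
Lemma maximizer_sign t x : unique_maximizer L t -> (t <= x) = (D x <= 0).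
Proof.
move=> tmax; apply/idP/idP => [tx|Dx].
  rewrite leNgt; apply/negP => Dx.
  move: tx; rewrite le_eqVlt => /predU1P[e|tx].
    have D2 : 0 < D x / 2 by rewrite divr_gt0.
    have [d d0 dP] := derive_linear_approx (LD x) D2.
    have d2 : 0 < d / 2 by rewrite divr_gt0.
    have := dP (d / 2); rewrite (gtr0_norm d2) => /(_ ltac:(lra)).
    have : L (x + d / 2) < L x.
      by rewrite -e; apply: tmax; rewrite e -subr_eq0 addrAC subrr add0r gt_eqF.
    rewrite ler_norml => h /andP[h1 _].
    have : 0 < D x * (d / 2) by rewrite mulr_gt0.
    by move: h h1; rewrite [D x / 2 * _]mulrAC; lra.
  have := concave_incr (ltW Dx) tx; have := tmax x; rewrite gt_eqF// => /(_ isT).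
  by move=> /lt_trans h /h; rewrite ltxx.
rewrite leNgt; apply/negP => xt.
have := concave_decr Dx xt; have := tmax x; rewrite lt_eqF// => /(_ isT).
by move=> /lt_trans h /h; rewrite ltxx.
Qed.

End concave_maximizer.

Section z_estimator.
Context {R : realType} (Q : forall n, 'M[R]_n) (th0 h I : R) (I0 : 0 < I).
Let thn := local_param th0 h.
Context (L D : forall n, config n -> R -> R) (est : forall n, config n -> R).
Hypothesis LD : forall n (x : config n) (t : R), is_derive t 1 (L x) (D x t).
Hypothesis D_decr : forall n (x : config n) a b, 0 < D x a -> D x b < 0 ->
  forall u v, u < v -> D x v < D x u.
Hypothesis estP : forall n, is_estimator (@L n) (@est n).
Hypothesis D_law : forall y, exists S : forall n, config n -> R,
  law_cvg Q thn S ((h - y) * I) (Num.sqrt I) /\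
  \forall n \near \oo, exists2 c, 0 < c & forall x : config n, D x (local_param th0 y n) = c * S n x.

Let s0 : 0 < Num.sqrt I. Proof. by rewrite sqrtr_gt0. Qed.
Let si0 : 0 < Num.sqrt I^-1. Proof. by rewrite sqrtr_gt0 invr_gt0. Qed.

Let cdfE y : normal_cdf ((h - y) * I) (Num.sqrt I) 0 = normal_cdf h (Num.sqrt I^-1) y.
Proof.
rewrite (normal_cdf_scale _ _ s0) (normal_cdf_scale _ _ si0); congr normal_cdf.
rewrite sqrtrV ?ltW// invrK sub0r.
have E : I = Num.sqrt I * Num.sqrt I by rewrite -expr2 sqr_sqrtr// ltW.
have q0 := gt_eqF s0.
transitivity (- ((h - y) * (Num.sqrt I * Num.sqrt I)) / Num.sqrt I); first by rewrite -E.
by rewrite -mulNr opprB mulrA mulfK ?q0.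
Qed.

Let D_le y : pr (thn n) (Q n) (fun x => D x (local_param th0 y n) <= 0) @[n --> \oo] -->
  normal_cdf h (Num.sqrt I^-1) y.
Proof.
have [S [SL SE]] := D_law y; rewrite -cdfE; apply: cvg_trans (SL 0); apply: near_eq_cvg.
apply: filterS SE => n [c c0 cE]; apply: eq_pr => x.
by rewrite cE pmulr_rle0.
Qed.

Let D_lt y : pr (thn n) (Q n) (fun x => D x (local_param th0 y n) < 0) @[n --> \oo] -->
  normal_cdf h (Num.sqrt I^-1) y.
Proof.
have [S [SL SE]] := D_law y; rewrite -cdfE; apply: cvg_trans; last exact: (@law_lt R Q thn _ _ _ 0 s0 SL).
apply: near_eq_cvg; apply: filterS SE => n [c c0 cE]; apply: eq_pr => x.
by rewrite cE pmulr_rlt0.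
Qed.

Let good A n (x : config n) := (0 < D x (local_param th0 (- A) n)) && (D x (local_param th0 A n) < 0).

Let good_near e : 0 < e -> exists2 A, 0 < A &
  \forall n \near \oo, pr (thn n) (Q n) (fun x => ~~ good A x) <= e.
Proof.
move=> e0; have e4 : 0 < e / 4 by rewrite divr_gt0.
have [A1 hA1] := normal_cdf_cvgy h (Num.sqrt I^-1) e4.
have [A2 hA2] := normal_cdf_cvgNy h (Num.sqrt I^-1) e4.
pose A := Num.max 1 (Num.max A1 (- A2)).
have A0 : 0 < A by rewrite lt_max ltr01.
have gA : 1 - e / 4 < normal_cdf h (Num.sqrt I^-1) A.
  by apply: hA1; rewrite !le_max lexx orbT.
have gNA : normal_cdf h (Num.sqrt I^-1) (- A) < e / 4.
  by apply: hA2; rewrite lerNl !le_max lexx !orbT.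
exists A => //.
have /cvgrPdist_le/(_ _ e4) c1 := @D_le (- A).
have /cvgrPdist_le/(_ _ e4) c2 := @D_lt A.
near=> n.
have h1 : `|normal_cdf h (Num.sqrt I^-1) (- A) -
  pr (thn n) (Q n) (fun x => D x (local_param th0 (- A) n) <= 0)| <= e / 4 by near: n; exact: c1.
have h2 : `|normal_cdf h (Num.sqrt I^-1) A -
  pr (thn n) (Q n) (fun x => D x (local_param th0 A n) < 0)| <= e / 4 by near: n; exact: c2.
have u : pr (thn n) (Q n) (fun x => ~~ good A x) <=
    pr (thn n) (Q n) (fun x => D x (local_param th0 (- A) n) <= 0) +
    pr (thn n) (Q n) (fun x => ~~ (D x (local_param th0 A n) < 0)).
  by apply: pr_cover => x; rewrite /good negb_and -leNgt.
rewrite [X in _ <= _ + X]prC in u; move: gA gNA h1 h2 u.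
move: (normal_cdf _ _ _) (normal_cdf _ _ _) (pr _ _ _) (pr _ _ _) (pr _ _ _) => a b p q r.
by rewrite !ler_norml => ? ? /andP[? ?] /andP[? ?] ?; lra.
Unshelve. all: by end_near. Qed.

Let good_max A n (x : config n) : 0 < A -> good A x -> exists t, unique_maximizer (L x) t.
Proof.
move=> A0 /andP[Da Db]; have dec := D_decr Da Db.
apply: (concave_maximizer (@LD n x) dec _ Da Db).
rewrite lerD2l ler_wpM2r ?invr_ge0 ?sqrtr_ge0//.
by rewrite (@le_trans _ _ 0)// ?oppr_le0 ltW.
Qed.

(** With [A] large the derivative is positive at [th0 - A / sqrt n] and negative at
    [th0 + A / sqrt n] outside an event of small probability. *)
Lemma estimator_exists_cvg :
  ising (thn n) (Q n) (estimator_exists (@L n)) @[n --> \oo] --> 1%E.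
Proof.
have E n : ising (thn n) (Q n) (estimator_exists (@L n)) =
    (pr (thn n) (Q n) (fun x => `[< estimator_exists (@L n) x >]))%:E.
  by apply: ising_pr => x; split => [/asboolP|/asboolP].
under eq_cvg do rewrite E.
apply: cvg_EFin; first exact: nearW.
apply/cvgrPdist_le => e e0; have [A A0] := good_near e0.
apply: filterS => n hn; rewrite /= ger0_norm ?subr_ge0 ?pr_le1//.
rewrite -prC; apply: le_trans hn; apply: pr_le => x; apply: contra => g.
by apply/asboolP; exact: good_max g.
Qed.

(** The event that the rescaled estimator is at most [y] is the event that the derivative
    at [th0 + y / sqrt n] is nonpositive. *)
Lemma estimator_law :
  law_cvg Q thn (fun n x => Num.sqrt n%:R * (est x - th0)) h (Num.sqrt I^-1).
Proof.
move=> y; apply/cvgrPdist_le => e e0; have e2 : 0 < e / 2 by rewrite divr_gt0.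
have [A A0 gn] := good_near e2.
have /cvgrPdist_le/(_ _ e2) c1 := @D_le y.
near=> n.
have n0 : (0 < n)%N by near: n; exact: nbhs_infty_gt.
have sn0 := @sqrt_nat_gt0 R n n0.
have h1 : `|normal_cdf h (Num.sqrt I^-1) y -
  pr (thn n) (Q n) (fun x => D x (local_param th0 y n) <= 0)| <= e / 2 by near: n; exact: c1.
have h2 : pr (thn n) (Q n) (fun x => ~~ good A x) <= e / 2 by near: n; exact: gn.
have key (x : config n) : good A x ->
    (Num.sqrt n%:R * (est x - th0) <= y) = (D x (local_param th0 y n) <= 0).
  move=> g; have [t tmax] := good_max A0 g; rewrite (estP tmax).
  have /andP[Da Db] := g.
  rewrite -(maximizer_sign (@LD n x) (D_decr Da Db) _ tmax) /local_param.
  by rewrite -lerBlDl ler_pdivlMr// mulrC.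
have u1 : pr (thn n) (Q n) (fun x => Num.sqrt n%:R * (est x - th0) <= y) <=
    pr (thn n) (Q n) (fun x => D x (local_param th0 y n) <= 0) +
    pr (thn n) (Q n) (fun x => ~~ good A x).
  apply: pr_cover => x hx; have [g|//] := boolP (good A x); last by rewrite orbT.
  by rewrite -key// hx.
have u2 : pr (thn n) (Q n) (fun x => D x (local_param th0 y n) <= 0) <=
    pr (thn n) (Q n) (fun x => Num.sqrt n%:R * (est x - th0) <= y) +
    pr (thn n) (Q n) (fun x => ~~ good A x).
  apply: pr_cover => x hx; have [g|//] := boolP (good A x); last by rewrite orbT.
  by rewrite key// hx.
move: h1 h2 u1 u2.
move: (normal_cdf _ _ _) (pr _ _ _) (pr _ _ _) (pr _ _ _) => a p q r.
by rewrite !ler_norml => /andP[? ?] ? ? ?; apply/andP; split; lra.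
Unshelve. all: by end_near. Qed.

End z_estimator.

Lemma half_sub_gt0 {R : realFieldType} (x y : R) : 0 < (x - y) / 2 -> y < x.
Proof. by lra. Qed.

Lemma half_sub_lt0 {R : realFieldType} (x y : R) : (x - y) / 2 < 0 -> x < y.
Proof. by lra. Qed.

Section likelihoods.
Context {R : realType} {n : nat} (Q : 'M[R]_n).
Implicit Types (x : config n) (t : R).

Lemma is_derive_log_lik x t :
  is_derive t 1 (log_lik Q x) ((quad Q x - gibbs t Q (quad Q)) / 2).
Proof.
have d1 := is_deriveZ (quad Q x / 2) (is_derive_id t (1 : R)).
apply: (is_derive_congr _ _ _ _ _ (is_deriveB d1 (is_derive_log_partition Q t))) => [u|].
  by change (quad Q x / 2 * u - log_partition u Q = u / 2 * quad Q x - log_partition u Q); field.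
by rewrite /GRing.scale/= mulr1 -mulrBl.
Qed.

(** The mean energy is strictly increasing unless the energy is constant, which the
    two sign conditions exclude. *)
Lemma log_lik_strict x (a b : R) : 0 < (quad Q x - gibbs a Q (quad Q)) / 2 ->
  (quad Q x - gibbs b Q (quad Q)) / 2 < 0 -> forall u v, u < v ->
  (quad Q x - gibbs v Q (quad Q)) / 2 < (quad Q x - gibbs u Q (quad Q)) / 2.
Proof.
move=> /half_sub_gt0 ha /half_sub_lt0 hb u v uv.
rewrite ltr_pM2r ?invr_gt0// ltrD2l ltrN2.
have := @gibbs_quad_lt R n Q u (v - u); rewrite subr_gt0 addrC subrK => h; apply: h => //.
apply: contrapT => /forallNP h.
have e y : quad Q y = gibbs u Q (quad Q) by apply/eqP/negPn/negP; exact: h.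
have ga : gibbs a Q (quad Q) = gibbs u Q (quad Q).
  by rewrite (gibbs_ext _ _ e) gibbs_cst.
by move: ha hb; rewrite ga -(e x) ltxx.
Qed.

Lemma is_derive_log_pseudolik x t : is_derive t 1 (log_pseudolik Q x) (score Q t x).
Proof.
pose f i := field_at Q x i.
have dl (i : 'I_n) : is_derive t 1 (fun u : R => ln (cosh (u * f i))) (f i * tanh (t * f i)).
  have d1 : is_derive t 1 (fun u : R => u * f i) (f i).
    have dd := is_deriveZ (f i) (is_derive_id t (1 : R)).
    apply: (is_derive_congr _ _ _ _ _ dd) => [u|]; last by rewrite /GRing.scale/= mulr1.
    by change (f i * u = u * f i); rewrite mulrC.
  have d2 := @is_derive1_comp _ log2cosh (fun u : R => u * f i) t _ _ (is_derive_log2cosh _) d1.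
  have d3 := is_deriveB d2 (is_derive_cst (ln 2 : R) t (1 : R)).
  apply: (is_derive_congr _ _ _ _ _ d3) => [u|]; last by rewrite subr0 mulrC.
  change (log2cosh (u * f i) - ln 2 = ln (cosh (u * f i))).
  have e0 : expR (u * f i) + expR (- (u * f i)) \is Num.pos by rewrite posrE expRDN_gt0.
by rewrite /log2cosh /cosh ln_div//; rewrite posrE.
have d0 := is_deriveZ (quad Q x) (is_derive_id t (1 : R)).
have ds := is_derive_bigsum (index_enum _) dl.
apply: (is_derive_congr _ _ _ _ _ (is_deriveB d0 ds)) => [u|].
  change (quad Q x * u - \sum_i ln (cosh (u * f i)) = log_pseudolik Q x u).
  rewrite /log_pseudolik mulrC quadE; congr (_ * _ - _); apply: eq_bigr => i _;
    by rewrite ?spinsE local_fieldE.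
by rewrite /GRing.scale/= mulr1 scoreE.
Qed.

(** If all the fields vanished the score would be zero. *)
Lemma score_strict x (a b : R) : 0 < score Q a x -> score Q b x < 0 ->
  forall u v, u < v -> score Q v x < score Q u x.
Proof.
move=> ha hb u v uv; rewrite !scoreE ltrD2l ltrN2.
have mono i : field_at Q x i * tanh (u * field_at Q x i) <=
    field_at Q x i * tanh (v * field_at Q x i).
  have [f0|f0] := leP 0 (field_at Q x i).
    by rewrite ler_wpM2l// tanh_ler// ler_wpM2r// ltW.
  by rewrite ler_wnM2l ?(ltW f0)// tanh_ler// ler_wnM2r ?(ltW f0)// ltW.
have [i fi] : exists i, field_at Q x i != 0.
  apply: contrapT => /forallNP h.
  have e t : score Q t x = 0.
    rewrite /score big1// => i _.
    by have /negP/negPn/eqP -> := h i; rewrite mulr0.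
  by move: ha; rewrite e ltxx.
rewrite (bigD1 i)//= [ltRHS](bigD1 i)//= ltr_leD//; last by apply: ler_sum.
have [f0|f0|f0] := ltgtP (field_at Q x i) 0; last by rewrite f0 eqxx in fi.
  by rewrite ltr_nM2l// tanh_ltr// ltr_nM2r.
by rewrite ltr_pM2l// tanh_ltr// ltr_pM2r.
Qed.

End likelihoods.

(** * Local expansion of the likelihoods *)

Lemma norm_mean_value {R : realType} (f df : R -> R) (B a b x y : R) :
  a <= x <= b -> a <= y <= b ->
  (forall t, a <= t <= b -> is_derive t 1 f (df t)) ->
  (forall t, a <= t <= b -> `|df t| <= B) -> `|f y - f x| <= B * `|y - x|.
Proof.
wlog xy : x y / x <= y.
  move=> hw hx hy fd dB; have [xy|/ltW yx] := leP x y; first exact: hw.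
  by rewrite distrC [`|y - x|]distrC; apply: hw.
move=> /andP[ax xb] /andP[ay yb] fd dfB.
have inab t : x <= t <= y -> a <= t <= b.
  by move=> /andP[xt ty]; rewrite (le_trans ax xt) (le_trans ty yb).
have [c cxy ->] := mean_value_on _ _ _ _ xy (fun t h => fd t (inab t h)).
by rewrite normrM ler_wpM2r// dfB// inab.
Qed.

Lemma free_energy_arith {R : realFieldType} (n s t g G c1 c0 p m I : R) : s != 0 -> n = s ^+ 2 ->
  p = g - n * c1 - (G - n * c0) ->
  g - G - t * s * m / 2 - I * t ^+ 2 / 2 =
  p + n * (c1 - m / 2 * (t / s) - I * (t / s) ^+ 2 / 2 - (c0 - m / 2 * 0 - I * 0 ^+ 2 / 2)).
Proof. by move=> s0 -> ->; field. Qed.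

Section local_likelihoods.
Context {R : realType} (Q : forall n, 'M[R]_n) (K d th0 : R) (h : R).
Hypotheses (K0 : 0 <= K) (d0 : 0 < d) (th01 : 1 < th0).
Hypothesis Qgood : \forall n \near \oo, coupling K (Q n) /\ spectral_gap d (Q n).

Let thn := local_param th0 h.
Let I := information th0.
Let I0 : 0 < I := information_gt0 th01.
Let s0 : 0 < Num.sqrt I. Proof. by rewrite sqrtr_gt0. Qed.

(** The mean energy is [n * m ^+ 2 + O(1)], and [m ^+ 2] has derivative [2 * information]. *)
Lemma energy_mean_cvg y :
  (gibbs (local_param th0 y n) (Q n) (quad (Q n)) - n%:R * magnetization th0 ^+ 2) /
    (2 * Num.sqrt n%:R) @[n --> \oo] --> y * I.
Proof.
have yc : local_param th0 y n @[n --> \oo] --> th0 := @local_param_cvg R th0 y.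
have [C [C0 CP]] := moments_near K0 d0 th01 Qgood yc.
pose r n := gibbs (local_param th0 y n) (Q n) (quad (Q n)) - n%:R * magnetization (local_param th0 y n) ^+ 2.
have c1 : r n / (2 * Num.sqrt n%:R) @[n --> \oo] --> (0 : R).
  apply/cvgrPdist_le => e e0.
  have /cvgrPdist_le/(_ _ e0) lim := inv_sqrt_cvg (C / 2).
  near=> n.
  have [_ QK _ _ hr] : [/\ (1 + th0) / 2 <= local_param th0 y n <= th0 + 1, coupling K (Q n),
      gibbs (local_param th0 y n) (Q n) (dispersion (Q n)) <= C,
      n%:R * gibbs (local_param th0 y n) (Q n) (fun x => sqr_excess (magnetization (local_param th0 y n)) x ^+ 2) <= C &
      `|r n| <= C] by near: n.
  have sn0 : 0 < Num.sqrt n%:R :> R by exact: sqrt_nat_gt0 (coupling_n0 QK).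
  have : `|0 - C / 2 / Num.sqrt n%:R| <= e by near: n; exact: lim.
  rewrite !sub0r !normrN; apply: le_trans.
  rewrite invfM mulrA !normrM !normfV (gtr0_norm sn0) (gtr0_norm (ltr0n R 2)).
  by rewrite ler_wpM2r ?invr_ge0 ?(ltW sn0)// ler_wpM2r ?invr_ge0// (le_trans hr)// ler_norm.
have c2 := local_derive (h := y) (is_derive_magnetization_sqr th01).
have c2' : Num.sqrt n%:R * (magnetization (local_param th0 y n) ^+ 2 - magnetization th0 ^+ 2) / 2
    @[n --> \oo] --> 2 * information th0 * y / 2 by exact: cvgMl.
have c3 : r n / (2 * Num.sqrt n%:R) +
    Num.sqrt n%:R * (magnetization (local_param th0 y n) ^+ 2 - magnetization th0 ^+ 2) / 2
    @[n --> \oo] --> 0 + 2 * information th0 * y / 2 by exact: cvgD.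
rewrite add0r in c3.
have -> : y * I = 2 * information th0 * y * 2^-1 by rewrite /I; move: (information th0) => ?; field.
apply: cvg_trans c3; apply: near_eq_cvg; near=> n.
have n0 : (0 < n)%N by near: n; exact: nbhs_infty_gt.
have sn0 := @sqrt_nat_gt0 R n n0.
have sn2 : n%:R = Num.sqrt n%:R ^+ 2 :> R by rewrite sqr_sqrtr.
rewrite /r.
move: sn2 sn0; move: (Num.sqrt n%:R) (gibbs _ _ _) (magnetization _) (magnetization _) => sq g u v -> sq0.
by field; rewrite gt_eqF.
Unshelve. all: by end_near. Qed.

Lemma log_lik_score_law y : exists S : forall n, config n -> R,
  law_cvg Q thn S ((h - y) * I) (Num.sqrt I) /\
  \forall n \near \oo, exists2 c, 0 < c & forall x : config n,
    (quad (Q n) x - gibbs (local_param th0 y n) (Q n) (quad (Q n))) / 2 = c * S n x.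
Proof.
pose a n := - ((gibbs (local_param th0 y n) (Q n) (quad (Q n)) - n%:R * magnetization th0 ^+ 2) /
    (2 * Num.sqrt n%:R)).
have ac : a n @[n --> \oo] --> - (y * I) by apply: cvgN; exact: energy_mean_cvg.
have := slutsky_shift s0 (energy_stat_law (h := h) K0 d0 th01 Qgood) ac.
rewrite -mulrBl => SL; exists (fun n x => energy_stat Q th0 x + a n); split => //.
near=> n; have n0 : (0 < n)%N by near: n; exact: nbhs_infty_gt.
have sn0 := @sqrt_nat_gt0 R n n0.
exists (Num.sqrt n%:R) => // x; rewrite /a /energy_stat.
move: sn0; move: (Num.sqrt n%:R) (gibbs _ _ _) (magnetization _) (quad _ _) => sq g u v sq0.
by field; rewrite gt_eqF.
Unshelve. all: by end_near. Qed.

Lemma log_pseudolik_score_law y : exists S : forall n, config n -> R,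
  law_cvg Q thn S ((h - y) * I) (Num.sqrt I) /\
  \forall n \near \oo, exists2 c, 0 < c & forall x : config n,
    score (Q n) (local_param th0 y n) x = c * S n x.
Proof.
exists (fun n x => score (Q n) (local_param th0 y n) x / score_scale th0 y n); split.
  exact: score_law K0 d0 th01 Qgood y.
have yc : local_param th0 y n @[n --> \oo] --> th0 := @local_param_cvg R th0 y.
near=> n; have n0 : (0 < n)%N by near: n; exact: nbhs_infty_gt.
have sn0 := @sqrt_nat_gt0 R n n0.
have y1 : 1 < local_param th0 y n by near: n; exact: (cvgr_gt _ yc).
have c0 : 0 < score_scale th0 y n.
  by rewrite mulr_gt0// subr_gt0 cw_slope_lt1.
by exists (score_scale th0 y n) => // x; rewrite mulrC divfK// gt_eqF.
Unshelve. all: by end_near. Qed.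

(** The difference from [n * cw_pressure] has bounded derivative, so over a distance of
    order [1 / sqrt n] it is negligible; the explicit part is expanded to second order. *)
Lemma log_partition_local t :
  log_partition (local_param th0 t n) (Q n) - log_partition th0 (Q n) -
    t * Num.sqrt n%:R * magnetization th0 ^+ 2 / 2 @[n --> \oo] --> I * t ^+ 2 / 2.
Proof.
apply/cvgrPdist_le => e e0; have e2 : 0 < e / 2 by rewrite divr_gt0.
have [a1 ab _] := midpoint1 th01.
have [C C0 CP] := phase_moments K0 d0 a1 ab.
have t21 : 0 < t ^+ 2 + 1 by rewrite ltr_wpDl ?sqr_ge0.
have e3 : 0 < e / (t ^+ 2 + 1) by rewrite divr_gt0.
have [dd dd0 ddP] := derive_linear_approx (is_derive_magnetization_sqr th01) e3.
have /cvgrPdist_le/(_ _ e2) lim := inv_sqrt_cvg (C / 2 * `|t|).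
have /cvgrPdist_lt/(_ _ dd0) lim2 := inv_sqrt_cvg t.
have [_ _ h0] := midpoint1 th01.
have /cvgrPdist_lt/(_ _ h0) lim3 := inv_sqrt_cvg t.
have yc : local_param th0 t n @[n --> \oo] --> th0 := @local_param_cvg R th0 t.
near=> n.
have [QK Qd] : coupling K (Q n) /\ spectral_gap d (Q n) by near: n.
have n0 := coupling_n0 QK; have sn0 := @sqrt_nat_gt0 R n n0.
have sn2 : n%:R = Num.sqrt n%:R ^+ 2 :> R by rewrite sqr_sqrtr.
have tn : (1 + th0) / 2 <= local_param th0 t n <= th0 + 1.
  by apply: near_midpoint; near: n; move/cvgrPdist_lt: yc; apply; have [] := midpoint1 th01.
have t0n : (1 + th0) / 2 <= th0 <= th0 + 1 by apply/andP; split; have := th01; lra.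
have le1 : `|C / 2 * `|t| / Num.sqrt n%:R| <= e / 2.
  by have : `|0 - C / 2 * `|t| / Num.sqrt n%:R| <= e / 2; [near: n; exact: lim|rewrite sub0r normrN].
have u_d : `|t / Num.sqrt n%:R| < dd.
  by have : `|0 - t / Num.sqrt n%:R| < dd; [near: n; exact: lim2|rewrite sub0r normrN].
have u_h : `|t / Num.sqrt n%:R| < (th0 - 1) / 2.
  by have : `|0 - t / Num.sqrt n%:R| < (th0 - 1) / 2; [near: n; exact: lim3|rewrite sub0r normrN].
set u := t / Num.sqrt n%:R in u_d u_h.
pose G v := log_partition v (Q n) - n%:R * cw_pressure v.
(* The mean energy is n * m ^+ 2 + O(1) uniformly near th0, so G is Lipschitz uniformly in n. *)
have GB : `|G (local_param th0 t n) - G th0| <= e / 2.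
  have GD v : (1 + th0) / 2 <= v <= th0 + 1 -> is_derive v 1 G
      ((gibbs v (Q n) (quad (Q n)) - n%:R * magnetization v ^+ 2) / 2).
    move=> /andP[va _]; have v1 : 1 < v by exact: lt_le_trans va.
    have dd1 := is_deriveB (is_derive_log_partition (Q n) v)
      (is_deriveZ (n%:R : R) (is_derive_cw_pressure _ v1)).
    apply: (is_derive_congr _ _ _ _ _ dd1) => //.
    rewrite /GRing.scale/= -[RHS]/((_ + - _) / 2).
    by move: (gibbs _ _ _) (n%:R) (magnetization v ^+ 2) => *; field.
  have B v : (1 + th0) / 2 <= v <= th0 + 1 ->
      `|(gibbs v (Q n) (quad (Q n)) - n%:R * magnetization v ^+ 2) / 2| <= C / 2.
    move=> vab; have [_ _ hv] := CP n (Q n) QK Qd _ vab.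
    by rewrite normrM normfV (gtr0_norm (ltr0n R 2)) ler_wpM2r// invr_ge0.
  apply: (le_trans (norm_mean_value t0n tn GD B)).
  rewrite /local_param addrC addKr; apply: le_trans le1.
  by rewrite normrM normfV (gtr0_norm sn0) [leRHS]normrM normfV (gtr0_norm sn0) normrM normr_id
    (ger0_norm (_ : 0 <= C / 2)) ?divr_ge0// mulrA.
pose P v := cw_pressure (th0 + v) - magnetization th0 ^+ 2 / 2 * v - I * v ^+ 2 / 2.
(* P is the second-order Taylor remainder of the pressure; its derivative is the
   first-order remainder of m ^+ 2 / 2. *)
have PB : `|P u - P 0| <= e / (t ^+ 2 + 1) / 2 * `|u| * `|u - 0|.
  have au : - `|u| <= u <= `|u| by rewrite -ler_norml.
  have a0 : - `|u| <= 0 <= `|u| by rewrite oppr_le0 !normr_ge0.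
  have v1 v : - `|u| <= v <= `|u| -> 1 < th0 + v.
    by move=> /andP[vu _]; move: u_h vu; have := th01; lra.
  have PD v : - `|u| <= v <= `|u| -> is_derive v 1 P
      ((magnetization (th0 + v) ^+ 2 - magnetization th0 ^+ 2 - 2 * information th0 * v) / 2).
    move=> /v1 tv1.
    have d1 : is_derive v 1 (fun w : R => th0 + w) 1.
      have dd1 := is_deriveD (is_derive_cst th0 v (1 : R)) (is_derive_id v (1 : R)).
      by apply: (is_derive_congr _ _ _ _ _ dd1) => //; rewrite add0r.
    have d2 := @is_derive1_comp _ cw_pressure (fun w : R => th0 + w) v _ _
      (is_derive_cw_pressure _ tv1) d1.
    have d3 := is_deriveB d2 (is_deriveZ (magnetization th0 ^+ 2 / 2) (is_derive_id v (1 : R))).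
    have d4 := is_deriveB d3 (is_deriveZ (I / 2)
      (is_deriveM (is_derive_id v (1 : R)) (is_derive_id v (1 : R)))).
    apply: (is_derive_congr _ _ _ _ _ d4) => [w|].
      change (cw_pressure (th0 + w) - magnetization th0 ^+ 2 / 2 * w - I / 2 * (w * w) = P w).
      by rewrite /P expr2 [I * _ / 2]mulrAC.
    rewrite /GRing.scale/= -/I; move: (magnetization _) (magnetization _) I => *.
    by field.
  have B v : - `|u| <= v <= `|u| ->
      `|(magnetization (th0 + v) ^+ 2 - magnetization th0 ^+ 2 - 2 * information th0 * v) / 2| <=
      e / (t ^+ 2 + 1) / 2 * `|u|.
    rewrite -ler_norml => vu.
    rewrite normrM normfV (gtr0_norm (ltr0n R 2)) [leRHS]mulrAC ler_wpM2r ?invr_ge0//.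
    apply: (le_trans (ddP v (le_lt_trans vu u_d))).
    by rewrite ler_wpM2l// ltW.
  exact: (norm_mean_value a0 au PD B).
rewrite distrC (@free_energy_arith R n%:R _ t _ _ (cw_pressure (local_param th0 t n))
  (cw_pressure th0) (G (local_param th0 t n) - G th0) _ I (lt0r_neq0 sn0) sn2 erefl).
have -> : cw_pressure th0 = cw_pressure (th0 + 0) by rewrite addr0.
rewrite -/u -/(P 0) -[cw_pressure (local_param _ _ _) - _ - _]/(P u).
apply: (le_trans (ler_normD _ _)).
have -> : e = e / 2 + e / 2 by field.
apply: lerD; first exact: GB.
rewrite normrM (ger0_norm (ler0n R n)).
apply: (le_trans (ler_wpM2l (ler0n R n) PB)).
have uu : `|u| * `|u| = t ^+ 2 / n%:R.
  by rewrite -normrM -expr2 ger0_norm ?sqr_ge0// /u expr_div_n -sn2.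
rewrite subr0 -[_ * `|u| * `|u|]mulrA uu.
have n1 : 0 < n%:R :> R by rewrite ltr0n.
have -> : n%:R * (e / (t ^+ 2 + 1) / 2 * (t ^+ 2 / n%:R)) = e / 2 * (t ^+ 2 / (t ^+ 2 + 1)).
  by field; rewrite !gt_eqF.
by rewrite ler_piMr ?(ltW e2)// ler_pdivrMr// mul1r lerDl.
Unshelve. all: by end_near. Qed.

End local_likelihoods.

(** * Asymptotic power *)

Section standard_quantile.
Context {R : realType}.
Implicit Types (p x y m s : R).

Lemma normal_cdf_lt m s x y : 0 < s -> x < y -> normal_cdf m s x < normal_cdf m s y.
Proof.
move=> s0 xy; rewrite (normal_cdf_scale _ _ s0) [ltRHS](normal_cdf_scale _ _ s0).
have uv : (x - m) / s < (y - m) / s by rewrite ltr_pM2r ?invr_gt0// ltrD2r.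
have [c _] := mean_value _ _ _ _ (ltW uv) (fun t => is_derive_normal_cdf 0 t (oner_neq0 R)).
move=> E; rewrite -subr_gt0 E mulr_gt0 ?subr_gt0//; exact: std_pdf_gt0.
Qed.

Lemma normal_cdf_onto p : 0 < p < 1 -> exists z, normal_cdf 0 1 z = p.
Proof.
move=> /andP[p0 p1]; have q0 : 0 < 1 - p by rewrite subr_gt0.
have [A hA] := normal_cdf_cvgy 0 (1 : R) q0.
have [B hB] := normal_cdf_cvgNy 0 (1 : R) p0.
pose a := Num.min A B; pose b := Num.max A B.
have ab : a <= b by rewrite /a /b; case: (ltP A B) => // /ltW.
have cF : {within `[a, b], continuous (normal_cdf (0 : R) 1)}.
  by apply: continuous_subspaceT => x; exact: (@normal_cdf_continuous R 0 1 x (oner_neq0 R)).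
have fa : normal_cdf 0 1 a < p by apply: hB; rewrite /a ge_min lexx orbT.
have fb : p < normal_cdf 0 1 b.
  have : 1 - (1 - p) < normal_cdf 0 1 b by apply: hA; rewrite /b le_max lexx.
  by rewrite subKr.
have [|c _ <-] := @IVT R (normal_cdf 0 1) a b p ab cF; last by exists c.
by rewrite ge_min le_max (ltW fa) (ltW fb) orbT.
Qed.

(** By strict monotonicity the set in the definition of the quantile is a closed
    half-line. *)
Lemma normal_cdf_quantile p : 0 < p < 1 -> normal_cdf 0 1 (normal_quantile p) = p.
Proof.
move=> p01; have [z zE] := normal_cdf_onto p01.
rewrite /normal_quantile -[RHS]zE; congr normal_cdf.
have -> : [set x : R | (p%:E <= normal_prob 0 1 `]-oo, x])%E] = [set` `[z, +oo[ ].
  apply/seteqP; split => x /=; rewrite normal_cdfE lee_fin -zE in_itv/= andbT => h.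
    by rewrite leNgt; apply/negP => /(normal_cdf_lt 0 ltr01); rewrite ltNge h.
  exact: normal_cdf_le.
by rewrite inf_itv// bnd_simp.
Qed.

End standard_quantile.

(** The statistic takes finitely many values, and the least admissible one among them is
    the least admissible real number. *)
Lemma critical_valueP {R : realType} n (th : R) (Q : 'M[R]_n) (S : config n -> R) (alpha : R) :
  0 < alpha < 1 -> let K := critical_value (ising th Q) S alpha in
  pr th Q (fun x => K < S x) <= alpha /\
  forall K', pr th Q (fun x => K' < S x) <= alpha -> K <= K'.
Proof.
move=> /andP[a0 a1] K.
have prE K' : ising th Q [set x | (K' < S x)%R] = (pr th Q (fun x => K' < S x))%:E.
  exact: ising_pr.
pose ok x := pr th Q (fun y => S x < S y) <= alpha.
pose x1 : config n := [arg max_(x > [ffun=> true] | true) S x]%O.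
have x1P : ok x1.
  rewrite /ok /x1; case: arg_maxP => // x _ hx.
  rewrite (_ : pr _ _ _ = 0) ?(ltW a0)//.
  rewrite -(gibbs_cst th Q 0); apply: gibbs_ext => y.
  rewrite ltNge; by have /= -> := hx y isT.
pose x0 := [arg min_(x < x1 | ok x) S x]%O.
have x0P : [set K | (ising th Q [set x | (K < S x)%R] <= alpha%:E)%E /\
    forall K' : R, (ising th Q [set x | (K' < S x)%R] <= alpha%:E)%E -> K <= K'] (S x0).
  rewrite /= /x0; case: arg_minP => // x okx xmin; split; first by rewrite prE lee_fin.
  move=> K'; rewrite prE lee_fin => hK'; rewrite leNgt; apply/negP => K'x.
  (* Otherwise the level would be 1. *)
  have [y yK'] : exists y, S y <= K'.
    apply: contrapT => /forallNP h; move: hK'; rewrite leNgt.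
    suff -> : pr th Q (fun x => K' < S x) = 1 by rewrite a1.
    rewrite -(gibbs_cst th Q 1); apply: gibbs_ext => y.
    by rewrite ltNge; have /negP -> := h y.
  pose w := [arg max_(z > y | S z <= K') S z]%O.
  have [wK' wmax] : S w <= K' /\ forall z, S z <= K' -> S z <= S w.
    by rewrite /w; case: arg_maxP => // z hz hm; split.
  have okw : ok w.
    rewrite /ok; apply: le_trans hK'; apply: pr_le => z hz.
    by rewrite ltNge; apply/negP => /wmax; rewrite leNgt hz.
  by have := xmin _ okw; rewrite leNgt (le_lt_trans wK' K'x).
have := xgetI 0 x0P; rewrite -/(critical_value _ _ _) -/K => -[h1 h2].
split; first by move: h1; rewrite prE lee_fin.
by move=> K' hK'; apply: h2; rewrite prE lee_fin.
Qed.

(** In the affine coordinate the critical value is squeezed around the quantile by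
    the limit law under the null, and continuity of the limit law under the
    alternative does the rest. *)
Lemma power_cvg {R : realType} (Q : forall n, 'M[R]_n) (th0 : R) (thn : nat -> R)
    (S Z : forall n, config n -> R) (a b : nat -> R) (alpha m s : R) :
  0 < s -> 0 < alpha < 1 ->
  law_cvg Q (fun=> th0) Z 0 s -> law_cvg Q thn Z m s ->
  (\forall n \near \oo, 0 < b n /\ forall x : config n, S n x = a n + b n * Z n x) ->
  test_power (ising th0 (Q n)) (ising (thn n) (Q n)) (S n) alpha @[n --> \oo] -->
  normal_prob 0 1 [set y | normal_quantile (1 - alpha) - m / s < y].
Proof.
move=> s0 a01 Z0 Z1 SZ; set z := normal_quantile (1 - alpha).
have zE : normal_cdf 0 1 z = 1 - alpha.
  by apply: normal_cdf_quantile; move: a01 => /andP[? ?]; apply/andP; split; lra.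
pose q := s * z.
have qE : normal_cdf 0 s q = 1 - alpha.
  by rewrite (normal_cdf_scale _ _ s0) subr0 /q mulrAC divff ?mul1r// gt_eqF.
have limE : normal_prob 0 1 [set y | z - m / s < y] = (1 - normal_cdf m s q)%:E.
  rewrite -set_itvoy normal_prob_gt (normal_cdf_scale _ _ s0); congr (1 - normal_cdf _ _ _)%:E.
  by rewrite /q; field; rewrite gt_eqF.
rewrite limE.
have E n : test_power (ising th0 (Q n)) (ising (thn n) (Q n)) (S n) alpha =
    (pr (thn n) (Q n) (fun x => critical_value (ising th0 (Q n)) (S n) alpha < S n x))%:E.
  exact: ising_pr.
under eq_cvg do rewrite E.
apply: cvg_EFin; first exact: nearW.
apply/cvgrPdist_le => e e0; have e2 : 0 < e / 2 by rewrite divr_gt0.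
have [dl dl0 dlP] := normal_cdf_near m q s0 e2.
have up0 : 0 < alpha - (1 - normal_cdf 0 s (q + dl)).
  have : normal_cdf 0 s q < normal_cdf 0 s (q + dl) by rewrite normal_cdf_lt// ltrDl.
  by rewrite qE; move: (normal_cdf _ _ _) => ?; lra.
have lo0 : 0 < (1 - normal_cdf 0 s (q - dl)) - alpha.
  have : normal_cdf 0 s (q - dl) < normal_cdf 0 s q by rewrite normal_cdf_lt// gtrBl.
  by rewrite qE; move: (normal_cdf _ _ _) => ?; lra.
have /cvgrPdist_lt/(_ _ up0) c1 := law_gt (x := q + dl) Z0.
have /cvgrPdist_lt/(_ _ lo0) c2 := law_gt (x := q - dl) Z0.
have /cvgrPdist_le/(_ _ e2) c3 := law_gt (x := q + dl) Z1.
have /cvgrPdist_le/(_ _ e2) c4 := law_gt (x := q - dl) Z1.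
near=> n.
have [bn SE] : 0 < b n /\ forall x : config n, S n x = a n + b n * Z n x by near: n.
rewrite /=; set K := critical_value _ _ _.
have [K1 K2] := critical_valueP th0 (Q n) (S n) a01; rewrite -/K in K1 K2.
have hK (t : R) (x : config n) : (a n + b n * t < S n x) = (t < Z n x).
  by rewrite SE ltrD2l ltr_pM2l.
have hK2 (x : config n) : (K < S n x) = ((K - a n) / b n < Z n x).
  by rewrite SE ltr_pdivrMr// ltrBlDl [_ * b n]mulrC.
set L := (K - a n) / b n in hK2.
(* By minimality of the critical value. *)
have Lub : L <= q + dl.
  rewrite ler_pdivrMr// lerBlDl mulrC; apply: K2.
  rewrite (eq_pr _ _ (hK (q + dl))).
  have : `|(1 - normal_cdf 0 s (q + dl)) - pr th0 (Q n) (fun x => q + dl < Z n x)| <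
    alpha - (1 - normal_cdf 0 s (q + dl)) by near: n; exact: c1.
  by move: (normal_cdf _ _ _) (pr _ _ _) => u v; rewrite ltr_norml => /andP[? ?]; lra.
(* By the level constraint. *)
have Llb : q - dl <= L.
  rewrite leNgt; apply/negP => hL.
  have : `|(1 - normal_cdf 0 s (q - dl)) - pr th0 (Q n) (fun x => q - dl < Z n x)| <
    (1 - normal_cdf 0 s (q - dl)) - alpha by near: n; exact: c2.
  have : pr th0 (Q n) (fun x => q - dl < Z n x) <= alpha.
    apply: le_trans K1; apply: pr_le => x; rewrite hK2; exact: lt_trans.
  by move: (normal_cdf _ _ _) (pr _ _ _) => u v; rewrite ltr_norml => ? /andP[? ?]; lra.
rewrite (eq_pr _ _ hK2).
have h3 : `|(1 - normal_cdf m s (q + dl)) - pr (thn n) (Q n) (fun x => q + dl < Z n x)| <= e / 2.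
  by near: n; exact: c3.
have h4 : `|(1 - normal_cdf m s (q - dl)) - pr (thn n) (Q n) (fun x => q - dl < Z n x)| <= e / 2.
  by near: n; exact: c4.
have u1 : pr (thn n) (Q n) (fun x => q + dl < Z n x) <= pr (thn n) (Q n) (fun x => L < Z n x).
  by apply: pr_le => x; exact: le_lt_trans.
have u2 : pr (thn n) (Q n) (fun x => L < Z n x) <= pr (thn n) (Q n) (fun x => q - dl < Z n x).
  by apply: pr_le => x; exact: le_lt_trans.
have g1 : `|normal_cdf m s q - normal_cdf m s (q + dl)| <= e / 2.
  by apply: dlP; rewrite opprD addrA subrr sub0r normrN gtr0_norm.
have g2 : `|normal_cdf m s q - normal_cdf m s (q - dl)| <= e / 2.
  by apply: dlP; rewrite opprB addrCA subrr addr0 gtr0_norm.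
move: h3 h4 u1 u2 g1 g2.
move: (normal_cdf _ _ _) (normal_cdf _ _ _) (normal_cdf _ _ _) => x1 x2 x3.
move: (pr _ _ _) (pr _ _ _) (pr _ _ _) => p1 p2 p3.
by rewrite !ler_norml => /andP[? ?] /andP[? ?] ? ? /andP[? ?] /andP[? ?]; apply/andP; split; lra.
Unshelve. all: by end_near. Qed.

(** * The Gaussian shift experiment *)

Section ae_equal_integrands.
Context d (T : measurableType d) {R : realType} (mu : {measure set T -> \bar R}).
Local Open Scope ereal_scope.
Import HBNNSimple.

Let ge0_ae_le_integral (f g : T -> \bar R) : (forall x, 0 <= f x) -> (forall x, 0 <= g x) ->
  (\forall x \ae mu, f x = g x) -> \int[mu]_x f x <= \int[mu]_x g x.
Proof.
move=> f0 g0 [N [mN N0 fgN]]; have mNc : measurable (~` N) by exact: measurableC.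
rewrite [leLHS]ge0_integralTE//; apply: ge_ereal_sup => _ [h hf <-].
pose k : {nnsfun T >-> R} := mul_nnsfun h (indic_nnsfun R mNc).
have kE x : k x = (h x * \1_(~` N) x)%R by [].
have -> : sintegral mu h = \int[mu]_x (h x)%:E.
  by rewrite integral_nnsfun// patch_setT.
have -> : \int[mu]_x (h x)%:E = \int[mu]_x (k x)%:E.
  apply: ge0_ae_eq_integral => //.
  - exact/measurable_EFinP.
  - exact/measurable_EFinP.
  - by move=> x _; rewrite lee_fin.
  - by move=> x _; rewrite lee_fin.
  exists N; split => // x; apply: contra_notP => xN _.
  by rewrite kE indicE mem_set// mulr1.
rewrite integral_nnsfun// patch_setT [leRHS]ge0_integralTE//.
apply: ereal_sup_ubound; exists k => // x.
rewrite kE indicE; case: (boolP (x \in ~` N)) => [/set_mem xN|_]; last by rewrite mulr0.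
rewrite mulr1 (le_trans (hf x))//.
suff -> : f x = g x by [].
by apply: contrapT => e; apply: xN; exact: fgN.
Qed.

(** A simple function below [f] remains below [g] once it is set to zero on the
    exceptional null set, so the suprema that define the two integrals agree. *)
Lemma ae_eq_integral_any (f g : T -> \bar R) :
  (\forall x \ae mu, f x = g x) -> \int[mu]_x f x = \int[mu]_x g x.
Proof.
move=> fg; rewrite integralE [RHS]integralE.
have fgp : \forall x \ae mu, f^\+ x = g^\+ x.
  by apply: filterS fg => x e; rewrite !funeposE e.
have fgn : \forall x \ae mu, f^\- x = g^\- x.
  by apply: filterS fg => x e; rewrite !funenegE e.
have sym (u v : T -> \bar R) : (\forall x \ae mu, u x = v x) -> \forall x \ae mu, v x = u x.
  by apply: filterS.
by congr (_ - _); apply/eqP; rewrite eq_le !ge0_ae_le_integral//; exact: sym.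
Qed.

End ae_equal_integrands.

Section gibbs_likelihood_ratio.
Context {R : realType} {n : nat} (Q : 'M[R]_n).

Lemma ising_dominates (a b : R) : ising a Q `<< ising b Q.
Proof.
apply/null_content_dominatesP => A mA A0.
suff -> : A = set0 by rewrite measure0.
apply/seteqP; split => // x Ax; exfalso.
have : (ising b Q [set x] <= ising b Q A)%E by apply: le_measure; rewrite ?inE// => y ->.
by rewrite A0 ising_set1 lee_fin leNgt ising_pmf_gt0.
Qed.

(** On a discrete space the Radon-Nikodym density is determined at every atom. *)
Lemma likelihood_ratio_ising (a b : R) (x : config n) :
  likelihood_ratio (ising a Q) (ising b Q) x = ising_pmf a Q x / ising_pmf b Q x.
Proof.
rewrite /likelihood_ratio; set f := Radon_Nikodym _ _.
have ffin : f x \is a fin_num := 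
  @Radon_Nikodym_fin_num _ _ R (charge_of_finite_measure (ising a Q)) (ising b Q) x
    (@ising_dominates a b).
have := @Radon_Nikodym_integral _ _ R (charge_of_finite_measure (ising a Q)) (ising b Q)
  [set x] (@ising_dominates a b) Logic.I.
rewrite -/f (eq_integral (cst (f x))); last by move=> y /set_mem ->.
rewrite integral_cst// -(fineK ffin) => E.
have : (ising_pmf a Q x)%:E = ((fine (f x))%:E * (ising_pmf b Q x)%:E)%E.
  by rewrite -!ising_set1; exact: E.
rewrite -EFinM => -[->] /=.
by rewrite mulfK// gt_eqF// ising_pmf_gt0.
Qed.

End gibbs_likelihood_ratio.

Section normal_likelihood_ratio.
Context {R : realType} (s : R) (s0 : 0 < s).
Notation mu := (@lebesgue_measure R).
Implicit Types m : R.

Let sn : s != 0. Proof. by rewrite gt_eqF. Qed.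

Lemma normal_pdf_gt0 m x : 0 < normal_pdf m s x.
Proof. by rewrite normal_pdfE// mulr_gt0 ?normal_peak_gt0 ?expR_gt0. Qed.

Lemma Radon_Nikodym_normal m :
  ae_eq mu setT (Radon_Nikodym (charge_of_finite_measure (normal_prob m s)) mu)
    (EFin \o normal_pdf m s).
Proof.
have dom := @normal_prob_dominates R m s.
apply: integral_ae_eq => //.
- exact: Radon_Nikodym_integrable.
- by apply/measurable_EFinP; exact: measurable_normal_pdf.
- by move=> E _ mE; rewrite -Radon_Nikodym_integral.
Qed.

Lemma lebesgue_dominated m : mu `<< normal_prob m s.
Proof.
apply/null_content_dominatesP => A mA A0.
have mf : measurable_fun A (EFin \o normal_pdf m s).
  by apply: measurable_funTS; apply/measurable_EFinP; exact: measurable_normal_pdf.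
have : ae_eq mu A (EFin \o normal_pdf m s) (cst 0%E).
  apply/ae_eq_integral_abs => //; rewrite -[RHS]A0; apply: eq_integral => x _.
  by rewrite gee0_abs// lee_fin normal_pdf_ge0.
move=> [N [mN N0 AN]]; apply: (subset_measure0 mA mN _ N0).
move=> x Ax; apply: AN => /= /(_ Ax) [] /eqP.
by rewrite gt_eqF// normal_pdf_gt0.
Qed.

(** The chain rule through Lebesgue measure, where the densities are known. *)
Lemma likelihood_ratio_normal a b :
  \forall y \ae normal_prob b s, likelihood_ratio (normal_prob a s) (normal_prob b s) y =
    expR ((a - b) / s ^+ 2 * y - (a ^+ 2 - b ^+ 2) / (2 * s ^+ 2)).
Proof.
have domb := @normal_prob_dominates R b s.
have domab : normal_prob a s `<< normal_prob b s.
  exact: null_dominates_trans (@normal_prob_dominates R a s) (@lebesgue_dominated b).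
have chain := @Radon_Nikodym_chain_rule _ _ R (charge_of_finite_measure (normal_prob a s)) mu
  (normal_prob b s) domab domb.
have ra := Radon_Nikodym_normal a; have rb := Radon_Nikodym_normal b.
have : \forall y \ae mu, likelihood_ratio (normal_prob a s) (normal_prob b s) y =
    expR ((a - b) / s ^+ 2 * y - (a ^+ 2 - b ^+ 2) / (2 * s ^+ 2)).
  apply: filterS3 chain ra rb => y /(_ Logic.I) + /(_ Logic.I) + /(_ Logic.I).
  rewrite /likelihood_ratio /=; move=> -> /=.
  have := @Radon_Nikodym_fin_num _ _ R (charge_of_finite_measure (normal_prob a s))
    (normal_prob b s) y domab.
  move: (Radon_Nikodym _ _ y) => r /fineK <- + rb'; rewrite rb' /= -EFinM => -[E].
  have pb := gt_eqF (normal_pdf_gt0 b y).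
  apply: (mulIf (negbT pb)); rewrite E !normal_pdfE//.
  rewrite mulrCA; congr (_ * _); rewrite /normal_fun -expRD; congr expR.
  by field; rewrite sn.
move=> [N [mN N0 hN]]; exists N; split => //.
by move/null_content_dominatesP : domb; apply.
Qed.

End normal_likelihood_ratio.

Lemma row_expR_cvg {R : realType} k (T : Type) (G : set_system T) {FG : Filter G}
    (a : T -> 'I_k -> R) (b : 'I_k -> R) :
  (forall i, a x i @[x --> G] --> b i) ->
  \row_i expR (a x i) @[x --> G] --> (\row_i expR (b i) : 'rV[R]_k).
Proof.
move=> ab; apply/cvg_ballP => e e0.
have : \forall x \near G, forall i, `|expR (b i) - expR (a x i)| < e.
  apply: filter_forall => i.
  have := cvg_comp _ _ (ab i) (@continuous_expR R (b i)).
  by move/cvgrPdist_lt/(_ _ e0).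
by apply: filterS => x h; split => // i j; rewrite !mxE; exact: h.
Qed.

Lemma log_ratio_arith {R : realFieldType} (s n th0 ti t0 V m I za zb : R) : s != 0 -> n = s ^+ 2 ->
  I != 0 ->
  (th0 + ti / s) / 2 * V - za - ((th0 + t0 / s) / 2 * V - zb) =
  (ti - t0) * I * (I^-1 * ((V - n * m) / (2 * s))) - (za - zb - (ti - t0) * s * m / 2).
Proof. by move=> s0 -> I0; field; rewrite s0 I0. Qed.

Section gaussian_shift_experiment.
Context {R : realType} (Q : forall n, 'M[R]_n) (K d th0 : R).
Hypotheses (K0 : 0 <= K) (d0 : 0 < d) (th01 : 1 < th0).
Hypothesis Qgood : \forall n \near \oo, coupling K (Q n) /\ spectral_gap d (Q n).
Let I := information th0.
Let I0 : 0 < I := information_gt0 th01.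

(** Both likelihood ratios are exponentials of affine functions, of [T / information] in the
    Gibbs experiment and of the observation in the Gaussian one, and the coefficients
    converge. *)
Lemma experiments_cvg_normal :
  experiments_cvg (fun n (h : R) => ising (local_param th0 h n) (Q n))
    (fun h : R => normal_prob h (Num.sqrt I^-1)).
Proof.
move=> k t h0 _ phi cphi [M phiM].
have si0 : 0 < Num.sqrt I^-1 by rewrite sqrtr_gt0 invr_gt0.
have In : I != 0 by rewrite gt_eqF.
pose cst i := I * (t i ^+ 2 - h0 ^+ 2) / 2.
pose F (u : R) := phi (\row_i expR ((t i - h0) * I * u - cst i)).
have -> : \int[normal_prob h0 (Num.sqrt I^-1)]_y phi (\row_i likelihood_ratio
    (normal_prob (t i) (Num.sqrt I^-1)) (normal_prob h0 (Num.sqrt I^-1)) y) =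
    \int[normal_prob h0 (Num.sqrt I^-1)]_y F y.
  congr fine; apply: ae_eq_integral_any.
  have : \forall y \ae normal_prob h0 (Num.sqrt I^-1), forall i, likelihood_ratio
      (normal_prob (t i) (Num.sqrt I^-1)) (normal_prob h0 (Num.sqrt I^-1)) y =
      expR ((t i - h0) * I * y - cst i).
    apply: filter_forall => i; apply: filterS (likelihood_ratio_normal si0 (t i) h0) => y ->.
    rewrite /cst sqr_sqrtr ?invr_ge0 ?(ltW I0)//; congr expR.
    by move: In; move: I (t i) => J ti J0; field.
  by apply: filterS => y h; congr (phi _)%:E; apply/rowP => i; rewrite !mxE h.
pose z n := log_partition (local_param th0 h0 n) (Q n).
pose c n i := log_partition (local_param th0 (t i) n) (Q n) - z n -
  (t i - h0) * Num.sqrt n%:R * magnetization th0 ^+ 2 / 2.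
have cc i : c n i @[n --> \oo] --> cst i.
  have c1 := log_partition_local K0 d0 th01 Qgood (t := t i).
  have c2 := log_partition_local K0 d0 th01 Qgood (t := h0).
  have : log_partition (local_param th0 (t i) n) (Q n) - log_partition th0 (Q n) -
    t i * Num.sqrt n%:R * magnetization th0 ^+ 2 / 2 -
    (log_partition (local_param th0 h0 n) (Q n) - log_partition th0 (Q n) -
    h0 * Num.sqrt n%:R * magnetization th0 ^+ 2 / 2) @[n --> \oo] -->
    information th0 * t i ^+ 2 / 2 - information th0 * h0 ^+ 2 / 2 by exact: cvgB.
  have -> : information th0 * t i ^+ 2 / 2 - information th0 * h0 ^+ 2 / 2 = cst i.
    by rewrite /cst -/I -mulrBl -mulrBr.
  apply: cvg_trans; apply: near_eq_cvg; apply: nearW => n.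
  rewrite /c /z; move: (log_partition _ _) (log_partition _ _) (log_partition _ _) => ? ? ?.
  by move: (Num.sqrt _) (magnetization _) => *; field.
pose Fn n (u : R) := phi (\row_i expR ((t i - h0) * I * u - c n i)).
pose S n (x : config n) := I^-1 * energy_stat Q th0 x.
have {}law : law_cvg Q (local_param th0 h0) S h0 (Num.sqrt I^-1).
  have := law_scale (a := I^-1) _ _ (energy_stat_law (h := h0) K0 d0 th01 Qgood).
  rewrite sqrtr_gt0 invr_gt0 -/I I0 => /(_ isT isT).
  have -> : I^-1 * (h0 * I) = h0 by rewrite mulrC mulfK.
  suff -> : I^-1 * Num.sqrt I = Num.sqrt I^-1 by [].
  rewrite sqrtrV ?(ltW I0)//.
  have q0 : 0 < Num.sqrt I by rewrite sqrtr_gt0.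
  have E : I = Num.sqrt I * Num.sqrt I by rewrite -expr2 sqr_sqrtr// ltW.
  rewrite {1}E invfM -mulrA mulVf ?mulr1// gt_eqF//.
have cF : continuous F.
  move=> u0.
  have row : \row_i expR ((t i - h0) * I * u - cst i) @[u --> u0] -->
      (\row_i expR ((t i - h0) * I * u0 - cst i) : 'rV[R]_k).
    apply: row_expR_cvg => i; apply: cvgB; last exact: cvg_cst.
    by apply: cvgMr; exact: cvg_id.
  exact: (cvg_comp _ _ row (cphi _)).
have FnF u0 e : 0 < e -> \forall u \near u0 & n \near \oo, `|Fn n u - F u0| <= e.
  move=> e0.
  have row : \row_i expR ((t i - h0) * I * un.1 - c un.2 i) @[un --> filter_prod (nbhs u0) \oo] -->
      (\row_i expR ((t i - h0) * I * u0 - cst i) : 'rV[R]_k).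
    apply: row_expR_cvg => i; apply: cvgB.
      by apply: cvgMr; exact: cvg_fst.
    exact: (cvg_comp _ _ cvg_snd (cc i)).
  have := cvg_comp _ _ row (cphi _).
  move/cvgrPdist_le/(_ _ e0); apply: filterS => -[u n] /=.
  by rewrite distrC.
have lim := law_cvg_integral si0 law cF (fun u => phiM _) (fun n u => phiM _) FnF.
apply: cvg_trans lim; apply: near_eq_cvg; near=> n.
have n0 : (0 < n)%N by near: n; exact: nbhs_infty_gt.
have sn0 := @sqrt_nat_gt0 R n n0.
have sn2 : n%:R = Num.sqrt n%:R ^+ 2 :> R by rewrite sqr_sqrtr.
rewrite integral_gibbs; apply: gibbs_ext => x; congr phi; apply/rowP => i; rewrite !mxE.
rewrite likelihood_ratio_ising -expRB /S /c /z; congr expR.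
exact/esym/(log_ratio_arith _ _ _ _ _ _ _ (lt0r_neq0 sn0) sn2 In).
Unshelve. all: by end_near. Qed.

End gaussian_shift_experiment.

(** * Estimators and tests *)

Lemma law_cvg_in_dist {R : realType} (Q : forall n, 'M[R]_n) (th : nat -> R)
    (S : forall n, config n -> R) (m s : R) : 0 < s -> law_cvg Q th S m s ->
  cvg_in_dist (V := R) (fun n => ising (th n) (Q n)) S (normal_prob m s) id.
Proof.
move=> s0 SL phi cphi [M phiM]; under eq_cvg do rewrite integral_gibbs.
apply: (law_cvg_integral (Fn := fun=> phi) s0 SL cphi phiM (fun=> phiM)) => u0 e e0.
have c : phi un.1 @[un --> filter_prod (nbhs u0) \oo] --> phi u0.
  by apply: (cvg_comp fst phi); [exact: cvg_fst|exact: cphi].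
by move/cvgrPdist_le/(_ _ e0): c; apply: filterS => -[u n] /=; rewrite distrC.
Qed.

Lemma local_param0 {R : realType} (th0 : R) : local_param th0 0 = fun=> th0.
Proof. by apply/funext => n; rewrite /local_param mul0r addr0. Qed.

Section inference_at_local_parameters.
Context {R : realType} (Q : forall n, 'M[R]_n) (K d th0 : R).
Hypotheses (K0 : 0 <= K) (d0 : 0 < d) (th01 : 1 < th0).
Hypothesis Qgood : \forall n \near \oo, coupling K (Q n) /\ spectral_gap d (Q n).
Let I := information th0.
Let I0 : 0 < I := information_gt0 th01.
Let s0 : 0 < Num.sqrt I. Proof. by rewrite sqrtr_gt0. Qed.
Let si0 : 0 < Num.sqrt I^-1. Proof. by rewrite sqrtr_gt0 invr_gt0. Qed.

Section estimators.
Context (mle mple : forall n, config n -> R).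
Hypothesis mleP : forall n, is_estimator (log_lik (Q n)) (@mle n).
Hypothesis mpleP : forall n, is_estimator (log_pseudolik (Q n)) (@mple n).

Lemma mle_law h : law_cvg Q (local_param th0 h)
  (fun n x => Num.sqrt n%:R * (mle x - th0)) h (Num.sqrt I^-1).
Proof.
exact: (estimator_law I0 (fun n x t => is_derive_log_lik (Q n) x t)
  (fun n x a b ha hb => log_lik_strict ha hb) mleP
  (log_lik_score_law h K0 d0 th01 Qgood)).
Qed.

Lemma mle_exists h : ising (local_param th0 h n) (Q n) (estimator_exists (log_lik (Q n)))
  @[n --> \oo] --> 1%E.
Proof.
exact: (estimator_exists_cvg I0 (fun n x t => is_derive_log_lik (Q n) x t)
  (fun n x a b ha hb => log_lik_strict ha hb)
  (log_lik_score_law h K0 d0 th01 Qgood)).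
Qed.

Lemma mple_law h : law_cvg Q (local_param th0 h)
  (fun n x => Num.sqrt n%:R * (mple x - th0)) h (Num.sqrt I^-1).
Proof.
exact: (estimator_law I0 (fun n x t => is_derive_log_pseudolik (Q n) x t)
  (fun n x a b ha hb => score_strict ha hb) mpleP
  (log_pseudolik_score_law h K0 d0 th01 Qgood)).
Qed.

Lemma mple_exists h : ising (local_param th0 h n) (Q n) (estimator_exists (log_pseudolik (Q n)))
  @[n --> \oo] --> 1%E.
Proof.
exact: (estimator_exists_cvg I0 (fun n x t => is_derive_log_pseudolik (Q n) x t)
  (fun n x a b ha hb => score_strict ha hb)
  (log_pseudolik_score_law h K0 d0 th01 Qgood)).
Qed.

End estimators.

Section tests.
Context (h alpha : R) (a01 : 0 < alpha < 1).
Let power (S : forall n, config n -> R) n :=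
  test_power (ising th0 (Q n)) (ising (local_param th0 h n) (Q n)) (S n) alpha.
Let beta := normal_prob 0 1 [set y | normal_quantile (1 - alpha) - h * Num.sqrt I < y].

Let sqrtI : Num.sqrt I * Num.sqrt I = I. Proof. by rewrite -expr2 sqr_sqrtr// ltW. Qed.

(** Both the energy and the squared mean spin are affine in a statistic with limit law
    [N (h * I, I)]. *)
Lemma energy_power (S : forall n, config n -> R) (c : nat -> R) (Z : forall n, config n -> R) :
  law_cvg Q (local_param th0 0) Z (0 * I) (Num.sqrt I) ->
  law_cvg Q (local_param th0 h) Z (h * I) (Num.sqrt I) ->
  (forall n (x : config n), (0 < n)%N -> S n x = c n + 2 * Num.sqrt n%:R * Z n x) ->
  power S n @[n --> \oo] --> beta.
Proof.
rewrite local_param0 mul0r => Z0 Z1 SZ.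
have -> : beta = normal_prob 0 1
    [set y | normal_quantile (1 - alpha) - (h * I) / Num.sqrt I < y].
  suff -> : (h * I) / Num.sqrt I = h * Num.sqrt I by [].
  transitivity (h * (Num.sqrt I * Num.sqrt I) / Num.sqrt I); first by rewrite sqrtI.
  by rewrite mulrA mulfK// gt_eqF.
apply: (power_cvg s0 a01 Z0 Z1 (a := c) (b := fun n => 2 * Num.sqrt n%:R)).
near=> n; have n0 : (0 < n)%N by near: n; exact: nbhs_infty_gt.
by split=> [|x]; [rewrite mulr_gt0// sqrt_nat_gt0|exact: SZ].
Unshelve. all: by end_near. Qed.

Lemma quad_power : power (fun n => quad (Q n)) n @[n --> \oo] --> beta.
Proof.
apply: (energy_power (energy_stat_law (h := 0) K0 d0 th01 Qgood)
  (energy_stat_law (h := h) K0 d0 th01 Qgood) (c := fun n => n%:R * magnetization th0 ^+ 2)) => n x n0.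
have sn0 := @sqrt_nat_gt0 R n n0; rewrite /energy_stat.
move: sn0; move: (Num.sqrt n%:R) (quad _ _) (magnetization _) => sq V m sq0.
by field; rewrite gt_eqF.
Qed.

Lemma mean_power : power (fun n x => n%:R * mean_spin x ^+ 2) n @[n --> \oo] --> beta.
Proof.
apply: (energy_power (mean_stat_law (h := 0) K0 d0 th01 Qgood)
  (mean_stat_law (h := h) K0 d0 th01 Qgood) (c := fun n => n%:R * magnetization th0 ^+ 2)) => n x n0.
have sn2 : n%:R = Num.sqrt n%:R ^+ 2 :> R by rewrite sqr_sqrtr.
rewrite /mean_stat; move: sn2; move: (Num.sqrt n%:R) (mean_spin x) (magnetization _) => sq M m ->.
by field.
Qed.

Lemma mple_power (mple : forall n, config n -> R) :
  (forall n, is_estimator (log_pseudolik (Q n)) (mple n)) ->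
  power mple n @[n --> \oo] --> beta.
Proof.
move=> mpleP; have Z0 := mple_law mpleP (h := 0); have Z1 := mple_law mpleP (h := h).
rewrite local_param0 in Z0.
have -> : beta = normal_prob 0 1
    [set y | normal_quantile (1 - alpha) - h / Num.sqrt I^-1 < y].
  by rewrite sqrtrV ?(ltW I0)// invrK.
apply: (power_cvg si0 a01 Z0 Z1 (a := fun=> th0) (b := fun n => (Num.sqrt n%:R)^-1)).
near=> n; have n0 : (0 < n)%N by near: n; exact: nbhs_infty_gt.
have sn0 := @sqrt_nat_gt0 R n n0.
by split=> [|x]; [rewrite invr_gt0|rewrite mulrA mulVf ?mul1r ?gt_eqF// addrC subrK].
Unshelve. all: by end_near. Qed.

End tests.

End inference_at_local_parameters.

Unset Implicit Arguments.
Theorem theorem2p2 (R : realType) (Q : forall n : nat, 'M[R]_n)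
    (Cw gamma : R) (f : R * R -> R) (lam : nat -> R) (theta0 : R)
    (Q_sym : forall n, (Q n)^T = Q n)
    (Q_ge0 : forall n i j, 0 <= Q n i j)
    (Q_diag : forall n i, Q n i i = 0)
    (Cw_gt0 : 0 < Cw) (gamma_gt0 : 0 < gamma)
    (A1 : forall n, (2 <= n)%N -> forall i, \sum_j Q n i j = 1)
    (A2 : forall n i j, Q n i j < Cw / n%:R)
    (A3 : Num.sqrt (\sum_i \sum_j Q n i j ^+ 2) @[n --> \oo] --> gamma)
    (f_graphon : is_graphon Cw f)
    (A4_cut : delta_cut (step_graphon (n%:R *: Q n)) f @[n --> \oo] --> 0%E)
    (lamP : eigenvalue_list f lam)
    (A4_gap : sup [set lam i | i in [set i : nat | (1 <= i)%N]] < lam 0%N)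
    (theta0_gt1 : 1 < theta0) :
  let Rth := magnetization theta0 ^+ 2 * sigma2 theta0 in
  [/\
    experiments_cvg
      (fun n (h : R) => ising (theta0 + h / Num.sqrt n%:R) (Q n))
      (fun h : R => normal_prob h (Num.sqrt Rth^-1)),
    (forall mle mple : forall n, config n -> R,
      (forall n, is_estimator (log_lik (Q n)) (mle n)) ->
      (forall n, is_estimator (log_pseudolik (Q n)) (mple n)) ->
      [/\ ising theta0 (Q n) (estimator_exists (log_lik (Q n)))
            @[n --> \oo] --> 1%E,
          ising theta0 (Q n) (estimator_exists (log_pseudolik (Q n)))
            @[n --> \oo] --> 1%E,
          cvg_in_dist (V := R) (fun n => ising theta0 (Q n))
            (fun n x => Num.sqrt n%:R * (mle n x - theta0))
            (normal_prob 0 (Num.sqrt Rth^-1)) id &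
          cvg_in_dist (V := R) (fun n => ising theta0 (Q n))
            (fun n x => Num.sqrt n%:R * (mple n x - theta0))
            (normal_prob 0 (Num.sqrt Rth^-1)) id]) &
    (forall (h alpha : R) (mple : forall n, config n -> R),
      0 < h -> 0 < alpha < 1 ->
      (forall n, is_estimator (log_pseudolik (Q n)) (mple n)) ->
      let thetan n := theta0 + h / Num.sqrt n%:R in
      let power (S : forall n, config n -> R) n :=
        test_power (ising theta0 (Q n)) (ising (thetan n) (Q n)) (S n) alpha in
      let beta := normal_prob 0 1
        [set y | normal_quantile (1 - alpha) - h * Num.sqrt Rth < y] in
      [/\ power (fun n x => quad (Q n) x) n @[n --> \oo] --> beta,
          power mple n @[n --> \oo] --> beta &
          power (fun n x => n%:R * mean_spin x ^+ 2) n @[n --> \oo] --> beta])].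
Proof.
move=> Rth.
have Qcoup : \forall n \near \oo, coupling Cw (Q n).
  near=> n; have n2 : (1 < n)%N by near: n; exact: nbhs_infty_gt.
  split => //; first exact: ltnW.
  - by move=> i j; rewrite -[in LHS]Q_sym mxE.
  - exact: A1.
  - by move=> i j; exact: ltW.
have [d d0 Qgood] := spectral_gap_near f_graphon Qcoup A4_cut lamP A4_gap.
have K0 := ltW Cw_gt0.
have si0 : 0 < Num.sqrt Rth^-1 by rewrite sqrtr_gt0 invr_gt0 information_gt0.
split.
- exact: (experiments_cvg_normal K0 d0 theta0_gt1 Qgood).
- move=> mle mple mleP mpleP.
  have law1 := mle_law K0 d0 theta0_gt1 Qgood mleP (h := 0).
  have law2 := mple_law K0 d0 theta0_gt1 Qgood mpleP (h := 0).
  have ex1 := mle_exists K0 d0 theta0_gt1 Qgood 0.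
  have ex2 := mple_exists K0 d0 theta0_gt1 Qgood 0.
  rewrite local_param0 in law1 law2 ex1 ex2.
  split=> //; exact: law_cvg_in_dist.
- move=> h alpha mple _ a01 mpleP thetan power beta; split.
  + exact: (quad_power K0 d0 theta0_gt1 Qgood).
  + exact: (mple_power K0 d0 theta0_gt1 Qgood).
  + exact: (mean_power K0 d0 theta0_gt1 Qgood).
Unshelve. all: by end_near. Qed.
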